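(* Let $m\in\mathbb{N}^+$, $p>2$, and let $\Omega\subset\mathbb{R}^2$ be a bounded open set with $|S(\Omega^c)|=0$, where \[ S(\Omega^c)=\{x\in\Omega^c:\ x=\lim_{k\to\infty}x_k \text{ for some } \{x_k\}_k\subset\Omega^c \text{ such that } x \text{ and } x_k \text{ lie in different connected components of } \Omega^c \text{ for every } k\}. \] Let $u\in W^{m,p}(\mathbb{R}^2;\mathbb{R}^2)$ satisfy $\operatorname{div}u=0$ and $D^ju(x)=0$ for every $x\in\Omega^c$ and every multi-index $j$ with $0\le|j|\le m-1$. Then there exists a sequence $\{u_k\}_k\subset C^\infty_c(\mathbb{R}^2;\mathbb{R}^2)$ with $\operatorname{div}u_k=0$ and $\operatorname{supp}u_k\subset\Omega$ for all $k$, such that $u_k\to u$ in $W^{m,p}(\mathbb{R}^2;\mathbb{R}^2)$.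
   Context: $|A|$ denotes Lebesgue measure. Since $p>2$, by the Morrey–Sobolev embedding all derivatives $D^ju$ with $|j|\le m-1$ have continuous representatives, and the vanishing condition $D^ju=0$ on $\Omega^c$ refers to these continuous representatives (pointwise everywhere on $\Omega^c$). *)

(* Defs.v *)
From HB Require Import structures.
From mathcomp Require Import all_boot all_order all_algebra.
From mathcomp Require Import all_classical all_reals all_analysis.
Set Implicit Arguments. Unset Strict Implicit. Unset Printing Implicit Defensive.
Import Order.TTheory GRing.Theory Num.Theory.
Import numFieldNormedType.Exports.
Local Open Scope classical_set_scope.
Local Open Scope ring_scope.

Section Sobolev.
Variable R : realType.

Definition pt := (R * R)%type.

Definition leb2 := (@lebesgue_measure R \x @lebesgue_measure R)%E.

Definition pd1 (f : pt -> R) : pt -> R :=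
  fun x => derive1 (fun t => f (t, x.2)) x.1.
Definition pd2 (f : pt -> R) : pt -> R :=
  fun x => derive1 (fun t => f (x.1, t)) x.2.

Definition pdw (w : seq bool) (f : pt -> R) : pt -> R :=
  foldr (fun b g => if b then pd1 g else pd2 g) f w.

Definition Dmi (alpha : nat * nat) (f : pt -> R) : pt -> R :=
  pdw (nseq alpha.1 true ++ nseq alpha.2 false) f.

Definition smooth (f : pt -> R) : Prop :=
  forall w : seq bool, continuous (pdw w f) /\
    forall x : pt, derivable (fun t => pdw w f (t, x.2)) x.1 1 /\
                   derivable (fun t => pdw w f (x.1, t)) x.2 1.

Definition supp (f : pt -> R) : set pt := closure [set x | f x != 0].

Definition test_fun (phi : pt -> R) : Prop := smooth phi /\ compact (supp phi).

Definition weak_deriv (alpha : nat * nat) (f g : pt -> R) : Prop :=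
  forall phi, test_fun phi ->
    (\int[leb2]_x (f x * Dmi alpha phi x)%:E =
     \int[leb2]_x ((-1) ^+ (alpha.1 + alpha.2) * (g x * phi x))%:E)%E.

Definition Lp (p : R) (f : pt -> R) : Prop :=
  measurable_fun setT f /\ (Lnorm leb2 p%:E (EFin \o f) < +oo)%E.

Definition sobolev (m : nat) (p : R) (f : pt -> R) : Prop :=
  Lp p f /\ forall alpha : nat * nat, (alpha.1 + alpha.2 <= m)%N ->
    exists g, Lp p g /\ weak_deriv alpha f g.

(* convergence f_k -> f in W^{m,p}(R^2; R), with f_k smooth:
   ||D^alpha f_k - D^alpha f||_p -> 0 for every |alpha| <= m *)
Definition sobolev_cvg (m : nat) (p : R) (fk : nat -> pt -> R) (f : pt -> R) :=
  forall alpha : nat * nat, (alpha.1 + alpha.2 <= m)%N ->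
    forall g, Lp p g -> weak_deriv alpha f g ->
      ((fun k => Lnorm leb2 p%:E (fun x => (Dmi alpha (fk k) x - g x)%:E)) @ \oo
        --> 0%E)%E.

Definition div_free (u1 u2 : pt -> R) : Prop :=
  forall phi, test_fun phi ->
    (\int[leb2]_x (u1 x * pd1 phi x + u2 x * pd2 phi x)%:E = 0)%E.

Definition bounded_set2 (O : set pt) : Prop :=
  exists M : R, forall x, O x -> `|x.1| <= M /\ `|x.2| <= M.

Definition Sing (O : set pt) : set pt :=
  [set x | (~` O) x /\ exists xk : nat -> pt,
      (forall k, (~` O) (xk k)) /\ (xk @ \oo --> x) /\
      (forall k, ~ connected_component (~` O) x (xk k))].

Definition vanish_on (A : set pt) (j : nat * nat) (f : pt -> R) : Prop :=
  exists h : pt -> R, continuous h /\ weak_deriv j f h /\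
    forall x, A x -> h x = 0.

End Sobolev.

(* Main.v *)
Require Import Defs.
From HB Require Import structures.
From mathcomp Require Import all_boot all_order all_algebra.
From mathcomp Require Import all_classical all_reals all_analysis.
From mathcomp Require Import measurable_realfun ring lra.
Set Implicit Arguments. Unset Strict Implicit. Unset Printing Implicit Defensive.
Import Order.TTheory GRing.Theory Num.Theory.
Import numFieldNormedType.Exports.
Local Open Scope classical_set_scope.
Local Open Scope ring_scope.

(* Write [A] for the complement of [Omega] and [d] for the distance to [A].  A
   divergence-free field [u] vanishing outside a bounded set has a stream
   function [psi], and it suffices to modify [psi] so that it
   becomes smooth and locally constant near [A], with small change of the
   gradient in [W^{m,p}].

   - Hardy: since the derivatives of [u] of order less than [m] vanish on [A],
     [|u| / d^m] is in [L^p].  On the Voronoi cell of a point [a] of a finite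
     subset of [A], which is star-shaped about [a], this is the one-dimensional
     inequality along rays; refining the finite subset gives the claim.
   - Sard: [psi] maps [A] onto a null set.  On a square of side [h] meeting [A]
     the same Hardy inequality bounds the oscillation of [psi] on [A] by
     [h^(2-2/p)] times the [L^p] norm of [D^2 psi], and [D^2 psi = 0] a.e. on [A].
   - Let [V] be an open set of small measure containing [psi A], and let
     [h t] be the measure of [V] below [t].  Then [h] is 1-Lipschitz and small,
     while [t - h t] is locally constant on [V], so [psi - h psi] is locally
     constant near [A].
   - [h psi] is mollified at the scale of [d] through dyadic cutoffs.  On the
     shell [d ~ r] its derivatives of order [m + 1] are controlled by
     [r^(-m-1)] times the oscillation of [psi] at scale [r], hence in [L^p] by
     [|u| / d^m], whose integral over [d < r] tends to [0] with [r]. *)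

(** * Change of variables, Jensen and Tonelli *)

(** The obstacle is that [psi] may take many different values on [A], so that no single constant can
    be subtracted before cutting off; composing with [h] handles all the values at once. The price
    is that [h] is only Lipschitz, so higher derivatives of [h psi] are out of reach and every
    estimate relies on the oscillation of [psi] alone. Mollifying at scale [r] loses [r^(-m-1)],
    while the oscillation gains [r |u|]; what remains is [|u| / d^m]. The field [psi] itself is
    mollified at the innermost scale of the correction. Near [A] the difference of the two is then
    the mollification of the locally constant [psi - h psi]. The outermost shell is exceptional:
    there the cutoff multiplies [h psi] and not a difference of two mollifications, which costs the
    size of [h] times a negative power of the outer scale. Therefore the outer scale is fixed first,
    then the measure of [V], then the inner scale. The condition [p > 2] enters through the
    integrability of [t^(-2/p)] at 0 in the inequality along rays. *)

Section affine_change_of_variables.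
Variable R : realType.
Local Notation mu := (@lebesgue_measure R).

Lemma measurable_affine (a c : R) : measurable_fun setT (fun z : R => a + c * z).
Proof. by apply: measurable_funD => //; apply: measurable_funM. Qed.

(** By uniqueness of Lebesgue measure, it suffices to compare the scaled pushforward with it on
    half-open intervals. *)
Lemma lebesgue_measure_affine (a c : R) (A : set R) : 0 < c -> measurable A ->
  (c%:E * mu ((fun z => a + c * z)%R @^-1` A))%E = mu A.
Proof.
move=> c0 mA.
pose c' := NngNum (ltW c0).
have mphi : @measurable_fun _ _ (measurableTypeR R) (measurableTypeR R) setT
  (fun z : R => a + c * z) := measurable_affine a c.
pose phi : {mfun (measurableTypeR R) >-> (measurableTypeR R)} :=
  HB.pack (fun z : R => a + c * z) (isMeasurableFun.Build _ _ _ _ _ mphi).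
pose nu := mscale c' (pushforward mu phi).
rewrite -[LHS]/(nu mphi A); apply/esym/lebesgue_measure_unique => //= _ [[x y] _ <-].
rewrite /nu /mscale /= /pushforward.
have -> : phi @^-1` `]x, y] = `](x - a) / c, (y - a) / c]%classic.
  apply/seteqP; split => z /=; rewrite !in_itv/= ler_pdivlMr// ltr_pdivrMr//;
    by rewrite ltrBlDl lerBrDl ![_ + z * c]addrC (mulrC z) ![c * z + a]addrC.
rewrite !lebesgue_measure_itv/= !lte_fin ltr_pM2r ?invr_gt0// ltrD2r.
case: ifPn => _; last by rewrite mule0.
by rewrite -!EFinB -EFinM; congr (_%:E); field; rewrite gt_eqF.
Qed.

Lemma ge0_integral_affine_pos (a c : R) (f : R -> \bar R) : 0 < c ->
  measurable_fun setT f -> (forall x, 0 <= f x)%E ->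
  (\int[mu]_z f (a + c * z)%R = (c^-1)%:E * \int[mu]_z f z)%E.
Proof.
move=> c0 mf f0.
have mphi : @measurable_fun _ _ (measurableTypeR R) (measurableTypeR R) setT
  (fun z : R => a + c * z) := measurable_affine a c.
pose phi : {mfun (measurableTypeR R) >-> (measurableTypeR R)} :=
  HB.pack (fun z : R => a + c * z) (isMeasurableFun.Build _ _ _ _ _ mphi).
pose c' := NngNum (ltW c0).
have := @ge0_integral_pushforward _ _ (measurableTypeR R) (measurableTypeR R) R phi mphi mu setT f measurableT mf (fun y _ => f0 y).
rewrite preimage_setT => /= <-.
have -> // : (\int[mu]_z f z = \int[mscale c' (pushforward mu phi)]_z f z)%E.
  move=> m; apply: eq_measure_integral => A mA _; rewrite /mscale/=.
  by rewrite -(lebesgue_measure_affine a c0 mA).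
rewrite ge0_integral_mscale//= muleA -EFinM mulVf ?gt_eqF// mul1e.
by [].
Qed.

Lemma ge0_integral_opp (f : R -> \bar R) :
  measurable_fun setT f -> (forall x, 0 <= f x)%E ->
  (\int[mu]_z f (- z)%R = \int[mu]_z f z)%E.
Proof.
move=> mf f0.
have mphi : @measurable_fun _ _ (measurableTypeR R) (measurableTypeR R) setT (-%R : R -> R).
  exact: (measurable_funN (@measurable_id _ _ _)).
have := @ge0_integral_pushforward _ _ (measurableTypeR R) (measurableTypeR R) R -%R mphi mu setT f measurableT mf (fun y _ => f0 y).
rewrite preimage_setT => /= <-.
by apply: eq_measure_integral => A mA _; exact: lebesgue_measureN.
Qed.

(** A negative slope, reduced to a positive one by reflection, occurs in the substitution
    [y = x - s z] inside convolutions. *)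
Lemma ge0_integral_affine (a c : R) (f : R -> \bar R) : c != 0 ->
  measurable_fun setT f -> (forall x, 0 <= f x)%E ->
  (\int[mu]_z f (a + c * z)%R = (`|c|^-1)%:E * \int[mu]_z f z)%E.
Proof.
move=> c0 mf f0; have [cp|] := ltrP 0 c; first by rewrite gtr0_norm// ge0_integral_affine_pos.
rewrite le_eqVlt (negPf c0)/= => cn; rewrite ltr0_norm//.
rewrite -(@ge0_integral_affine_pos a (- c) f) ?oppr_gt0//.
rewrite -[RHS]ge0_integral_opp//.
- by apply: eq_integral => z _; rewrite mulrNN.
- by apply: measurableT_comp => //; exact: measurable_affine.
Qed.

Definition aff (a : pt R) (c : R) (z : pt R) : pt R := (a.1 + c * z.1, a.2 + c * z.2).

Lemma measurable_aff (a : pt R) (c : R) : measurable_fun setT (aff a c).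
Proof.
apply/measurable_fun_pairP; split => /=.
- apply: (measurable_funD (measurable_cst _)); apply: measurable_funM => //.
- apply: (measurable_funD (measurable_cst _)); apply: measurable_funM => //.
Qed.

Lemma ge0_integral_aff (a : pt R) (c : R) (f : pt R -> \bar R) : c != 0 ->
  measurable_fun setT f -> (forall x, 0 <= f x)%E ->
  (\int[@leb2 R]_z f (aff a c z) = ((c ^+ 2)^-1)%:E * \int[@leb2 R]_z f z)%E.
Proof.
move=> c0 mf f0; rewrite /leb2.
have mg : measurable_fun setT (f \o aff a c).
  by apply: measurableT_comp => //; exact: measurable_aff.
have -> := fubini_tonelli1 (m1 := mu) (m2 := mu) _ mg (fun z => f0 _).
have -> := fubini_tonelli1 (m1 := mu) (m2 := mu) _ mf f0.
rewrite /fubini_F/=.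
under eq_integral => x _.
  rewrite (@ge0_integral_affine a.2 c (fun y => f (a.1 + c * x, y)))//; last first.
    exact: measurableT_comp.
  over.
have mF : measurable_fun setT (fun x : R => \int[mu]_y f (x, y))%E.
  exact: (@measurable_fun_fubini_tonelli_F _ _ (measurableTypeR R) (measurableTypeR R) R mu f mf f0).
rewrite ge0_integralZl//; last 2 first.
- exact: (measurableT_comp mF (measurable_affine a.1 c)).
- by move=> x _; exact: integral_ge0.
rewrite (@ge0_integral_affine a.1 c (fun x => \int[mu]_y f (x, y)))%E//; last first.
  by move=> x; exact: integral_ge0.
by rewrite muleA -EFinM -invfM -expr2 real_normK// num_real.
Qed.

End affine_change_of_variables.

Section tonelli_jensen.
Context (R : realType).

Lemma tonelli_in d1 d2 (T1 : measurableType d1) (T2 : measurableType d2)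
  (m1 : {sigma_finite_measure set T1 -> \bar R})
  (m2 : {sigma_finite_measure set T2 -> \bar R})
  (E : set T1) (D : set T2) (F : T1 * T2 -> \bar R) :
  measurable E -> measurable D ->
  measurable_fun setT F -> (forall x, 0 <= F x)%E ->
  (\int[m1]_(x in E) \int[m2]_(z in D) F (x, z) =
   \int[m2]_(z in D) \int[m1]_(x in E) F (x, z))%E.
Proof.
move=> mE mD mF F0.
pose H (y : T1 * T2) := (F y * (\1_(E `*` D) y)%:E)%E.
have mH : measurable_fun setT H.
  apply: emeasurable_funM => //; apply/measurable_EFinP.
  by apply: measurable_indic; exact: measurableX.
have H0 y : (0 <= H y)%E by rewrite mule_ge0// lee_fin.
have := fubini_tonelli (m1 := m1) (m2 := m2) _ mH H0.
rewrite /fubini_F /fubini_G => eqFG.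
transitivity (\int[m1]_x \int[m2]_y H (x, y))%E.
  rewrite [LHS]integral_mkcond; apply: eq_integral => x _.
  rewrite /patch; case: ifPn => xE.
    rewrite integral_mkcond; apply: eq_integral => z _.
    rewrite /patch/H indicE; case: ifPn => zD.
      by rewrite mem_set ?mule1//; split => /=; exact/set_mem.
    by rewrite memNset ?mule0// => -[_ /= /mem_set]; rewrite (negPf zD).
  by rewrite integral0_eq// => z _; rewrite /H indicE memNset ?mule0// => -[/= /mem_set]; rewrite (negPf xE).
rewrite eqFG [RHS]integral_mkcond; apply: eq_integral => z _.
rewrite /patch; case: ifPn => zD.
  rewrite [RHS]integral_mkcond; apply: eq_integral => x _.
  rewrite /patch/H indicE; case: ifPn => xE.
    by rewrite mem_set ?mule1//; split => /=; exact/set_mem.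
  by rewrite memNset ?mule0// => -[/= /mem_set]; rewrite (negPf xE).
by rewrite integral0_eq// => x _; rewrite /H indicE memNset ?mule0// => -[_ /= /mem_set]; rewrite (negPf zD).
Qed.

(** Hölder's inequality for [f w^(1/p)] and [w^(1/q)]. The weight is not normalised; only an upper
    bound [W] of its mass enters, whence the factor [W^(p-1)]. *)
Lemma jensen_weight d (T : measurableType d) (mu : {measure set T -> \bar R})
  (p W : R) (D : set T) (f w : T -> R) : 1 < p -> measurable D ->
  measurable_fun setT f -> measurable_fun setT w ->
  (forall x, 0 <= f x) -> (forall x, 0 <= w x) ->
  (\int[mu]_(x in D) (w x)%:E <= W%:E)%E ->
  ((\int[mu]_(x in D) (f x * w x)%:E) `^ p <=
   (W `^ (p - 1))%:E * \int[mu]_(x in D) (f x `^ p * w x)%:E)%E.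
Proof.
move=> p1 mD mf mw f0 w0 hW.
have p0 : 0 < p by exact: lt_trans p1.
pose q := p / (p - 1).
have pm1 : 0 < p - 1 by rewrite subr_gt0.
have q0 : 0 < q by rewrite divr_gt0.
have pq : p^-1 + q^-1 = 1 by rewrite /q invf_div; field; rewrite gt_eqF.
have W0 : 0 <= W.
  rewrite -lee_fin; apply: le_trans hW; apply: integral_ge0 => x _; rewrite lee_fin//.
pose v x := w x * \1_D x.
have v0 x : 0 <= v x by rewrite mulr_ge0.
have mv : measurable_fun setT v by apply: measurable_funM => //.
have IE (g : T -> R) : (\int[mu]_(x in D) (g x * w x)%:E = \int[mu]_x (g x * v x)%:E)%E.
  rewrite integral_mkcond; apply: eq_integral => x _; rewrite /patch /v indicE.
  by case: ifPn => _; rewrite ?mulr1 ?mulr0.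
have IE1 : (\int[mu]_(x in D) (w x)%:E = \int[mu]_x (v x)%:E)%E.
  rewrite integral_mkcond; apply: eq_integral => x _; rewrite /patch /v indicE.
  by case: ifPn => _; rewrite ?mulr1 ?mulr0.
rewrite !IE; rewrite IE1 in hW.
pose F x := f x * v x `^ p^-1; pose G x := v x `^ q^-1.
have mF : measurable_fun setT F.
  by apply: measurable_funM => //; exact: (measurableT_comp (measurable_powR _)).
have mG : measurable_fun setT G by exact: (measurableT_comp (measurable_powR _)).
have := hoelder mu mF mG p0 q0 pq.
have -> : ('N[mu]_1[EFin \o (F \* G)%R] = \int[mu]_x (f x * v x)%:E)%E.
  rewrite Lnorm1; apply: eq_integral => x _ /=.
  rewrite /F /G -mulrA -powRD; last by rewrite pq oner_eq0.
  by rewrite pq powRr1// ger0_norm// mulr_ge0.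
move=> h.
have {}h := gt0_ler_poweR (ltW p0) _ _ h.
apply: (le_trans (h _ _)).
- by rewrite in_itv/= leey andbT integral_ge0// => x _; rewrite lee_fin mulr_ge0.
- by rewrite in_itv/= leey andbT mule_ge0// Lnorm_ge0.
rewrite (poweRM p (Lnorm_ge0 _ _ _) (Lnorm_ge0 _ _ _)) poweR_Lnorm ?gt_eqF//.
have -> : (\int[mu]_x `|(EFin \o F) x| `^ p = \int[mu]_x (f x `^ p * v x)%:E)%E.
  apply: eq_integral => x _ /=.
  rewrite ger0_norm ?mulr_ge0 ?powR_ge0// /F powRM ?powR_ge0// -powRrM.
  by rewrite mulVf ?gt_eqF// powRr1.
rewrite muleC lee_wpmul2r//.
  by apply: integral_ge0 => x _; rewrite lee_fin mulr_ge0// powR_ge0.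
have -> : p = q * (p - 1) by rewrite /q; field; rewrite gt_eqF.
rewrite poweRrM poweR_Lnorm ?gt_eqF//.
have -> : (\int[mu]_x `|(EFin \o G) x| `^ q = \int[mu]_x (v x)%:E)%E.
  apply: eq_integral => x _ /=.
  by rewrite ger0_norm ?powR_ge0// /G -powRrM mulVf ?gt_eqF// powRr1.
have -> : q * (p - 1) - 1 = p - 1 by rewrite /q; field; rewrite gt_eqF.
rewrite -poweR_EFin; apply: gt0_ler_poweR => //; first exact: ltW.
- by rewrite in_itv/= leey andbT integral_ge0// => x _; rewrite lee_fin.
- by rewrite in_itv/= leey andbT lee_fin.
Qed.

Lemma measurable_int_snd d1 d2 (T1 : measurableType d1) (T2 : measurableType d2)
  (m2 : {sigma_finite_measure set T2 -> \bar R}) (D : set T2) (G : T1 * T2 -> R) :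
  measurable D -> measurable_fun setT G -> (forall y, 0 <= G y) ->
  measurable_fun setT (fun x => \int[m2]_(z in D) (G (x, z))%:E)%E.
Proof.
move=> mD mG G0; under eq_fun do rewrite integral_mkcond.
have -> : (fun x => \int[m2]_z ((fun z => (G (x, z))%:E) \_ D) z)%E =
   fubini_F m2 (fun y => (G y * \1_(setT `*` D) y)%:E).
  apply/funext => x; apply: eq_integral => z _; rewrite /patch indicE.
  case: ifPn => zD; first by rewrite mem_set ?mulr1//; split => //; exact/set_mem.
  by rewrite memNset ?mulr0// => -[_ /= /mem_set]; rewrite (negPf zD).
apply: measurable_fun_fubini_tonelli_F; last by move=> y; rewrite lee_fin mulr_ge0.
apply/measurable_EFinP/measurable_funM => //; apply: measurable_indic.
exact: measurableX.
Qed.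

Lemma measurable_int_fst d1 d2 (T1 : measurableType d1) (T2 : measurableType d2)
  (m1 : {sigma_finite_measure set T1 -> \bar R}) (D : set T1) (G : T1 * T2 -> R) :
  measurable D -> measurable_fun setT G -> (forall y, 0 <= G y) ->
  measurable_fun setT (fun z => \int[m1]_(x in D) (G (x, z))%:E)%E.
Proof.
move=> mD mG G0; under eq_fun do rewrite integral_mkcond.
have -> : (fun z => \int[m1]_x ((fun x => (G (x, z))%:E) \_ D) x)%E =
   fubini_G m1 (fun y => (G y * \1_(D `*` setT) y)%:E).
  apply/funext => z; apply: eq_integral => x _; rewrite /patch indicE.
  case: ifPn => zD; first by rewrite mem_set ?mulr1//; split => //; exact/set_mem.
  by rewrite memNset ?mulr0// => -[/= /mem_set]; rewrite (negPf zD).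
apply: measurable_fun_fubini_tonelli_G; last by move=> y; rewrite lee_fin mulr_ge0.
apply/measurable_EFinP/measurable_funM => //; apply: measurable_indic.
exact: measurableX.
Qed.

(** Jensen in [z] for fixed [x], then exchange of the integrals. Mollifications and averages along
    segments are both bounded in L^p this way. *)
Lemma jensen_tonelli d1 d2 (T1 : measurableType d1) (T2 : measurableType d2)
  (m1 : {sigma_finite_measure set T1 -> \bar R})
  (m2 : {sigma_finite_measure set T2 -> \bar R})
  (p W : R) (E : set T1) (D : set T2) (F : T1 * T2 -> R) (w : T2 -> R) :
  1 < p -> measurable E -> measurable D ->
  measurable_fun setT F -> (forall x, 0 <= F x) ->
  measurable_fun setT w -> (forall x, 0 <= w x) ->
  (\int[m2]_(z in D) (w z)%:E <= W%:E)%E ->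
  (\int[m1]_(x in E) ((\int[m2]_(z in D) (F (x, z) * w z)%:E) `^ p) <=
   (W `^ (p - 1))%:E * \int[m2]_(z in D) ((w z)%:E * \int[m1]_(x in E) (F (x, z) `^ p)%:E))%E.
Proof.
move=> p1 mE mD mF F0 mw w0 hW.
have mw2 : measurable_fun setT (fun y : T1 * T2 => w y.2).
  exact: measurableT_comp.
have mFw : measurable_fun setT (fun y => (F y * w y.2)%:E).
  by apply/measurable_EFinP/measurable_funM.
have mFpw : measurable_fun setT (fun y => (F y `^ p * w y.2)%:E).
  apply/measurable_EFinP/measurable_funM => //.
  exact: (measurableT_comp (measurable_powR _)).
have mFx (x : T1) : measurable_fun setT (fun z => F (x, z)).
  by apply: measurableT_comp => //; exact: measurable_pair1.
have mFz (z : T2) : measurable_fun setT (fun x => F (x, z)).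
  by apply: measurableT_comp => //; exact: measurable_pair2.
apply: (@le_trans _ _ (\int[m1]_(x in E) ((W `^ (p - 1))%:E *
    \int[m2]_(z in D) (F (x, z) `^ p * w z)%:E))%E).
  apply: ge0_le_integral => //.
  - by move=> x _; exact: poweR_ge0.
  - apply: measurable_funTS; apply: (measurableT_comp (measurable_poweR _)).
    apply: (@measurable_int_snd _ _ _ _ m2 D (fun y => F y * w y.2)) => //; first exact/measurable_EFinP.
    by move=> y; rewrite mulr_ge0.
  - apply: measurable_funTS; apply: emeasurable_funM => //.
    apply: (@measurable_int_snd _ _ _ _ m2 D (fun y => F y `^ p * w y.2)) => //; first exact/measurable_EFinP.
    by move=> y; rewrite mulr_ge0// powR_ge0.
  - by move=> x _; exact: jensen_weight.
rewrite ge0_integralZl//; last 3 first.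
- apply: measurable_funTS.
  apply: (@measurable_int_snd _ _ _ _ m2 D (fun y => F y `^ p * w y.2)) => //; first exact/measurable_EFinP.
  by move=> y; rewrite mulr_ge0// powR_ge0.
- by move=> x _; apply: integral_ge0 => z _; rewrite lee_fin mulr_ge0// powR_ge0.
- by rewrite lee_fin powR_ge0.
rewrite lee_wpmul2l ?lee_fin ?powR_ge0//.
rewrite (@tonelli_in _ _ _ _ m1 m2 E D (fun y => (F y `^ p * w y.2)%:E))//; last first.
  by move=> y; rewrite lee_fin mulr_ge0// powR_ge0.
rewrite le_eqVlt; apply/orP; left; apply/eqP; apply: eq_integral => z _ /=.
under eq_integral do rewrite mulrC EFinM.
rewrite ge0_integralZl//.
- apply: measurable_funTS; apply/measurable_EFinP.
  exact: (measurableT_comp (measurable_powR _)).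
- by move=> x _; rewrite lee_fin powR_ge0.
- by rewrite lee_fin.
Qed.

End tonelli_jensen.

(** The [p]-th power of the norm is kept without the root: it is additive over disjoint domains, and
    the triangle inequality then costs a factor [2^p]. *)
HB.lock Definition Np (R : realType) (p : R) (D : set (pt R)) (f : pt R -> R) : \bar R :=
  (\int[@leb2 R]_(x in D) (`|f x| `^ p)%:E)%E.

(** * The plane with the maximum norm, and p-th powers of L^p norms *)

Section plane.
Variable R : realType.
Local Notation pt := (pt R).
Local Notation leb2 := (@leb2 R).
Implicit Types (p r c : R) (f g : pt -> R) (D E : set pt) (x a : pt).

Lemma pt_ltnorm (x : pt) r : (`|x| < r) = (`|x.1| < r) && (`|x.2| < r).
Proof. by rewrite prod_normE/= gt_max. Qed.

Lemma pt_lenorm (x : pt) r : (`|x| <= r) = (`|x.1| <= r) && (`|x.2| <= r).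
Proof. by rewrite prod_normE/= ge_max. Qed.

Lemma pt_norm1 (x : pt) : `|x.1| <= `|x|.
Proof. by have := lexx `|x|; rewrite {1}pt_lenorm => /andP[]. Qed.

Lemma pt_norm2 (x : pt) : `|x.2| <= `|x|.
Proof. by have := lexx `|x|; rewrite {1}pt_lenorm => /andP[]. Qed.

Definition box (a : pt) (r : R) : set pt := [set x | `|x - a| <= r].

Lemma boxE (a : pt) r : box a r = `[a.1 - r, a.1 + r] `*` `[a.2 - r, a.2 + r].
Proof.
apply/seteqP; split => x; rewrite /box/= pt_lenorm/= !in_itv/= !ler_norml.
  by move=> /andP[/andP[? ?] /andP[? ?]]; split; lra.
by move=> [/andP[? ?] /andP[? ?]]; apply/andP; split; lra.
Qed.

Lemma measurable_box a r : measurable (box a r).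
Proof. by rewrite boxE; apply: measurableX; exact: measurable_itv. Qed.

Lemma leb2_box a r : 0 <= r -> leb2 (box a r) = ((2 * r) ^+ 2)%:E.
Proof.
move=> r0; rewrite boxE /leb2 product_measure1E; [|exact: measurable_itv..].
rewrite /= !lebesgue_measure_itv/= !lte_fin.
have [r1|r1] := ltrP 0 r.
  by rewrite !ifT; [|lra..]; rewrite -!EFinB -EFinM; congr (_%:E); ring.
have -> : r = 0 by lra.
by rewrite !ifF ?mule0 ?mulr0 ?expr0n//; apply/negbTE; rewrite -leNgt; lra.
Qed.

(** The sigma-algebra of the plane is the product one, so an open set has to be written as a
    countable union of squares with rational centres. *)
Lemma open_measurable2 (U : set pt) : open U -> measurable U.
Proof.
move=> oU.
pose bx (q1 q2 : rat) (n : nat) : set pt := [set x | `|x.1 - ratr q1| < n.+1%:R^-1] `&`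
   [set x | `|x.2 - ratr q2| < n.+1%:R^-1].
have mbx q1 q2 n : measurable (bx q1 q2 n).
  have -> : bx q1 q2 n = (ball (ratr q1 : R) n.+1%:R^-1) `*` (ball (ratr q2 : R) n.+1%:R^-1).
    by apply/seteqP; split => x /=; rewrite /bx/ball/= (distrC x.1) (distrC x.2).
  by apply: measurableX; exact: measurable_ball.
have -> : U = \bigcup_q1 \bigcup_q2 \bigcup_n
   (if `[< bx q1 q2 n `<=` U >] then bx q1 q2 n else set0).
  apply/seteqP; split => [x Ux|x [q1 _ [q2 _ [n _]]]]; last first.
    by case: ifPn => // /asboolP + h; exact.
  have [e /= e0 eU] : \forall e \near 0^'+, ball x e `<=` U.
    by have := open_nbhs_nbhs (conj oU Ux); rewrite -nbhs_ballE => -[e /= e0 eU];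
      exists e => //= r /=; rewrite sub0r normrN => re r0;
      apply: subset_trans eU; apply: le_ball; rewrite (le_trans (ler_norm _))// ltW.
  have {}eU : ball x (e / 2) `<=` U.
    by apply: eU => /=; rewrite ?divr_gt0// sub0r normrN gtr0_norm ?divr_gt0//; lra.
  have [n ne] : exists n, n.+1%:R^-1 < e / 4 :> R.
    have e4 : 0 < e / 4 by rewrite divr_gt0.
    by have [n _ /(_ n (leqnn n))] := near_infty_natSinv_lt (PosNum e4); exists n.
  have n0 : 0 < n.+1%:R^-1 :> R by rewrite invr_gt0.
  have [q1 q1x] : exists q : rat, ratr q \in `]x.1, x.1 + n.+1%:R^-1[.
    by apply: rat_in_itvoo; rewrite ltrDl.
  have [q2 q2x] : exists q : rat, ratr q \in `]x.2, x.2 + n.+1%:R^-1[.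
    by apply: rat_in_itvoo; rewrite ltrDl.
  move: q1x q2x n0 ne; rewrite !in_itv/=; set t := n.+1%:R^-1 => /andP[? ?] /andP[? ?] n0 ne.
  exists q1 => //; exists q2 => //; exists n => //; case: asboolP => [_|].
    by split; rewrite /= -/t ltr_norml; clearbody t; lra.
  move=> []; apply: subset_trans eU => y []; rewrite /= -/t !ltr_norml => /andP[? ?] /andP[? ?].
  by split; rewrite /ball/= ltr_norml; clearbody t; lra.
apply: bigcupT_measurable_rat => q1; apply: bigcupT_measurable_rat => q2.
by apply: bigcupT_measurable => n; case: ifPn.
Qed.

Lemma closed_measurable2 (U : set pt) : closed U -> measurable U.
Proof.
by move=> cU; rewrite -(setCK U); apply: measurableC; apply: open_measurable2; exact: closed_openC.
Qed.

Lemma continuous_measurable2 (f : pt -> R) : continuous f -> measurable_fun setT f.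
Proof.
move=> cf; apply: (measurability _ (RGenOpens.measurableE R)) => //.
move=> _ [_ [a [b ->] <-]]; rewrite setTI; apply: open_measurable2.
by apply: open_comp; [move=> x _; exact: cf|exact: interval_open].
Qed.

Lemma measurable_addpt_scale (a : pt) (c : R) :
  measurable_fun setT (fun z : pt => a + c *: z).
Proof. exact: measurable_aff. Qed.

Lemma NpE p D f : Np p D f = (\int[leb2]_(x in D) (`|f x| `^ p)%:E)%E.
Proof. by rewrite unlock. Qed.

Lemma Np_ge0 p D f : (0 <= Np p D f)%E.
Proof. by rewrite NpE; apply: integral_ge0 => x _; rewrite lee_fin powR_ge0. Qed.

Lemma measurable_norm_powR (f : pt -> R) p D : measurable_fun setT f ->
  measurable_fun D (fun x => (`|f x| `^ p)%:E).
Proof.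
move=> mf; apply: measurable_funTS; apply/measurable_EFinP.
apply: (measurableT_comp (measurable_powR _)); exact: measurableT_comp.
Qed.

Lemma eq_Np p D f g : (forall x, D x -> f x = g x) -> Np p D f = Np p D g.
Proof. by move=> fg; rewrite !NpE; apply: eq_integral => x /set_mem Dx; rewrite fg. Qed.

Lemma eq_Np_norm p D f g : (forall x, D x -> `|f x| = `|g x|) -> Np p D f = Np p D g.
Proof. by move=> fg; rewrite !NpE; apply: eq_integral => x /set_mem Dx; rewrite fg. Qed.

Lemma le_Np p D f g : 0 <= p -> measurable D -> measurable_fun setT f -> measurable_fun setT g ->
  (forall x, D x -> `|f x| <= `|g x|) -> (Np p D f <= Np p D g)%E.
Proof.
move=> p0 mD mf mg fg; rewrite !NpE; apply: ge0_le_integral => //.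
- exact: measurable_norm_powR.
- exact: measurable_norm_powR.
- by move=> x Dx; rewrite lee_fin ge0_ler_powR// ?nnegrE// fg.
Qed.

Lemma subset_Np p (D E : set pt) f : measurable D -> measurable E -> measurable_fun setT f ->
  D `<=` E -> (Np p D f <= Np p E f)%E.
Proof.
move=> mD mE mf DE; rewrite !NpE; apply: ge0_subset_integral => //.
exact: measurable_norm_powR.
Qed.

Lemma powR_add_le (p a b : R) : 0 <= p -> 0 <= a -> 0 <= b ->
  (a + b) `^ p <= 2 `^ p * (a `^ p + b `^ p).
Proof.
move=> p0 a0 b0.
wlog ab : a b a0 b0 / a <= b.
  move=> h; have [|/ltW] := leP a b; first exact: h.
  by rewrite addrC [X in _ * X]addrC; exact: h.
apply: (@le_trans _ _ ((2 * b) `^ p)).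
  by rewrite ge0_ler_powR// ?nnegrE; lra.
by rewrite powRM// ler_wpM2l ?powR_ge0// lerDr powR_ge0.
Qed.

Lemma Np_add p D f g : 0 <= p -> measurable D -> measurable_fun setT f -> measurable_fun setT g ->
  (Np p D (fun x => f x + g x)%R <= (2 `^ p)%:E * (Np p D f + Np p D g))%E.
Proof.
move=> p0 mD mf mg; rewrite !NpE -ge0_integralD//; [|exact: measurable_norm_powR..].
rewrite -ge0_integralZl//; last 2 first.
- by apply: emeasurable_funD; exact: measurable_norm_powR.
- by move=> x _; rewrite adde_ge0 ?lee_fin ?powR_ge0.
apply: ge0_le_integral => //.
- by apply: measurable_norm_powR; exact: measurable_funD.
- apply: emeasurable_funM => //.
  by apply: emeasurable_funD; exact: measurable_norm_powR.
- move=> x _; rewrite -EFinD -EFinM lee_fin; apply: le_trans; last exact: powR_add_le.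
  by rewrite ge0_ler_powR ?nnegrE ?addr_ge0// ler_normD.
Qed.

Lemma Np_scale p D f c : measurable D -> measurable_fun setT f ->
  (Np p D (fun x => c * f x)%R = (`|c| `^ p)%:E * Np p D f)%E.
Proof.
move=> mD mf; rewrite !NpE -ge0_integralZl//; last exact: measurable_norm_powR.
by apply: eq_integral => x _; rewrite normrM powRM// EFinM.
Qed.

Lemma Np_opp p D f : Np p D (fun x => - f x) = Np p D f.
Proof. by apply: eq_Np_norm => x _; rewrite normrN. Qed.

Lemma Np_cst p D c : measurable D -> (Np p D (cst c) = (`|c| `^ p)%:E * leb2 D)%E.
Proof. by move=> mD; rewrite !NpE /= integral_cst. Qed.

Lemma Np_setU p D E f : measurable D -> measurable E -> measurable_fun setT f ->
  (Np p (D `|` E) f <= Np p D f + Np p E f)%E.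
Proof.
move=> mD mE mf; have -> : D `|` E = (D `\` E) `|` E by rewrite setUDl setDv setD0.
rewrite !NpE ge0_integral_setU//; last 3 first.
- exact: measurableD.
- exact: measurable_norm_powR.
- by apply/disj_setPS => x [[_ +]] //.
by rewrite leeD2r// -!NpE; apply: subset_Np => //; exact: measurableD.
Qed.

(** Stated as an inequality so that [E'] can be any measurable set containing the image of [E]; no
    image has to be computed. *)
Lemma Np_aff p (E E' : set pt) (a : pt) (c : R) (f : pt -> R) : c != 0 ->
  measurable E -> measurable E' -> measurable_fun setT f ->
  (forall x, E x -> E' (a + c *: x)) ->
  (Np p E (fun x => f (a + c *: x)%R) <= ((c ^+ 2)^-1)%:E * Np p E' f)%E.
Proof.
move=> c0 mE mE' mf EE'.
pose h x := ((`|f x| `^ p) * \1_E' x)%:E.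
have mh : measurable_fun setT h.
  apply/measurable_EFinP; apply: measurable_funM => //.
  by apply/measurable_EFinP; exact: measurable_norm_powR.
have h0 x : (0 <= h x)%E by rewrite lee_fin mulr_ge0// powR_ge0.
have -> : (Np p E' f = \int[leb2]_x h x)%E.
  rewrite !NpE integral_mkcond; apply: eq_integral => x _; rewrite /patch /h indicE.
  by case: ifPn => _; rewrite ?mulr1 ?mulr0.
rewrite -(@ge0_integral_aff R a c h c0 mh h0) NpE integral_mkcond.
apply: ge0_le_integral => //.
- by move=> x _; rewrite /patch; case: ifPn => // _; rewrite lee_fin powR_ge0.
- apply/(measurable_restrictT _ _).1 => //; apply: (measurable_norm_powR (f := fun x => f (a + c *: x))).
  by apply: measurableT_comp => //; exact: measurable_aff.
- by apply: measurableT_comp => //; exact: measurable_aff.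
- move=> x _; rewrite /patch; case: ifPn => // /set_mem /EE' xE.
  by rewrite /h -[aff a c x]/(a + c *: x) indicE mem_set// mulr1.
Qed.

Lemma Np_indic p D E f : 0 < p -> measurable D -> measurable E -> measurable_fun setT f ->
  Np p D (fun x => f x * \1_E x) = Np p (D `&` E) f.
Proof.
move=> p0 mD mE mf; rewrite !NpE setIC integral_mkcondl.
apply: eq_integral => x _; rewrite /patch indicE.
by case: ifPn => _; rewrite ?mulr1// mulr0 normr0 powR0// gt_eqF.
Qed.

Lemma Np_shift p (E E' : set pt) (v : pt) (f : pt -> R) :
  measurable E -> measurable E' -> measurable_fun setT f ->
  (forall x, E x -> E' (x + v)) ->
  (Np p E (fun x => f (x + v)%R) <= Np p E' f)%E.
Proof.
move=> mE mE' mf EE'.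
have := @Np_aff p E E' v 1 f (oner_neq0 _) mE mE' mf.
rewrite expr1n invr1 mul1e => h; apply: le_trans (h _); last first.
  by move=> x /EE'; rewrite scale1r addrC.
by rewrite le_eqVlt; apply/orP; left; apply/eqP; apply: eq_Np => x _; rewrite scale1r addrC.
Qed.

End plane.

(** * Continuity of translations in L^p *)

Section translation_continuity.
Variable R : realType.
Local Notation pt := (pt R).
Local Notation leb2 := (@leb2 R).
Implicit Types (p r c : R) (f g : pt -> R) (D E : set pt) (x a v : pt).

Lemma cvge0_small (u : nat -> \bar R) : u @ \oo --> 0%E -> forall e : R, 0 < e ->
  exists N, forall n, (N <= n)%N -> (u n <= e%:E)%E.
Proof.
move=> /fine_cvgP[[N1 _ uf] /cvgrPdist_le u0] e e0.
have [N2 _ uN] := u0 _ e0; exists (maxn N1 N2) => n; rewrite geq_max => /andP[n1 n2].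
rewrite -(fineK (uf _ n1)) lee_fin; have := uN _ n2.
by rewrite /= sub0r normrN => /(le_trans (ler_norm _)).
Qed.

Lemma small_cvge0 (u : nat -> \bar R) : (forall n, 0 <= u n)%E ->
  (forall e : R, 0 < e -> exists N, forall n, (N <= n)%N -> (u n <= e%:E)%E) ->
  u @ \oo --> 0%E.
Proof.
move=> u0 h; apply/fine_cvgP; split.
  have [N hN] := h 1 ltr01; exists N => // n /= Nn.
  by rewrite ge0_fin_numE// (le_lt_trans (hN _ Nn))// ltry.
apply/cvgrPdist_le => e e0; have [N hN] := h e e0; exists N => // n /= Nn.
rewrite sub0r normrN ger0_norm ?fine_ge0// -lee_fin fineK ?hN//.
by rewrite ge0_fin_numE// (le_lt_trans (hN _ Nn))// ltry.
Qed.

Lemma Np_dominated p D (f_ : nat -> pt -> R) f g : 0 < p -> measurable D ->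
  (forall n, measurable_fun setT (f_ n)) -> measurable_fun setT f -> measurable_fun setT g ->
  (forall x, D x -> f_ ^~ x @ \oo --> f x) ->
  (forall n x, D x -> `|f_ n x - f x| <= `|g x|) -> (Np p D g < +oo)%E ->
  forall e : R, 0 < e -> exists N, forall n, (N <= n)%N ->
    (Np p D (fun x => f_ n x - f x)%R <= e%:E)%E.
Proof.
move=> p0 mD mf_ mf mg ff fg gp; apply: cvge0_small.
have mB n : measurable_fun setT (fun x => f_ n x - f x) by exact: measurable_funB.
rewrite (_ : 0%E = \int[leb2]_(x in D) (cst 0%E) x)%E; last by rewrite integral0.
under eq_fun do rewrite NpE.
apply: (@dominated_cvg _ _ _ leb2 D mD (fun n x => (`|f_ n x - f x| `^ p)%:E) (cst 0%E)
   (fun x => (`|g x| `^ p)%:E)) => //.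
- by move=> n; exact: measurable_norm_powR.
- move=> x Dx; rewrite /cst; apply: cvg_EFin; first by apply: nearW => n.
  apply/cvgrPdist_le => e e0.
  have /cvgrPdist_le/(_ (e `^ p^-1)) := ff x Dx.
  case; first by rewrite powR_gt0.
  move=> N _ hN; exists N => // n /= /hN; rewrite sub0r normrN [in X in _ -> X]ger0_norm ?powR_ge0// distrC => h.
  rewrite -[leRHS](powRr1 (ltW e0)) -(mulVf (lt0r_neq0 p0)) powRrM.
  by rewrite ge0_ler_powR ?nnegrE ?powR_ge0 ?(ltW p0).
- apply/integrableP; split; first exact: measurable_norm_powR.
  by rewrite (_ : \int[_]_(x in _) _ = Np p D g)%E// NpE; apply: eq_integral => x _; rewrite /= ger0_norm// powR_ge0.
- by move=> n x Dx; rewrite /= ger0_norm ?powR_ge0// lee_fin ge0_ler_powR ?nnegrE ?(ltW p0)// fg.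
Qed.

(** Dominated convergence for [f] times the indicator of [E_ n]. *)
Lemma Np_vanish p D (E_ : nat -> set pt) f : 0 < p -> measurable D ->
  (forall n, measurable (E_ n)) -> measurable_fun setT f ->
  (forall x, D x -> exists N, forall n, (N <= n)%N -> ~ E_ n x) -> (Np p D f < +oo)%E ->
  forall e : R, 0 < e -> exists N, forall n, (N <= n)%N ->
    (Np p (D `&` E_ n) f <= e%:E)%E.
Proof.
move=> p0 mD mE mf DE fp e e0.
have mfE n : measurable_fun setT (fun x => f x * \1_(E_ n) x) by apply: measurable_funM.
have [||N hN] := @Np_dominated p D (fun n x => f x * \1_(E_ n) x) (cst 0) f p0 mD mfE (measurable_cst _) mf _ _ fp e e0.
- move=> x Dx; have [N hN] := DE x Dx; apply/cvgrPdist_le => d d0.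
  exists N => // n /= /hN xE; rewrite indicE memNset// mulr0 subrr normr0; exact: ltW.
- move=> n x Dx; rewrite subr0 normrM indicE.
  by case: (x \in E_ n); rewrite ?normr1 ?normr0 ?mulr1 ?mulr0.
exists N => n /hN; rewrite -Np_indic//.
by under [X in (X <= _)%E -> _]eq_Np do rewrite subr0.
Qed.

(** Continuity of translations for an indicator, tested on boxes only: the generating strips are
    unbounded, and countable unions need tails of small measure. *)
Definition tgood p E := measurable E /\ forall r e : R, 0 <= r -> 0 < e ->
  exists2 d : R, 0 < d & forall v : pt, `|v| <= d ->
    (Np p (box (0 : pt)%R r) (fun x => \1_E (x + v)%R - \1_E x)%R <= e%:E)%E.

Lemma measurable_addv v : measurable_fun setT (fun x : pt => x + v).
Proof.
rewrite (_ : (fun x => x + v) = (fun x : pt => v + 1 *: x)).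
  exact: measurable_addpt_scale.
by apply/funext => x; rewrite scale1r addrC.
Qed.

Lemma measurable_indic_shift E v : measurable E -> measurable_fun setT (fun x => \1_E (x + v) : R).
Proof. by move=> mE; apply: (measurableT_comp (measurable_indic _)) => //; exact: measurable_addv. Qed.

Lemma indicD_le E F (x y : pt) :
  `|\1_(E `|` F) y - \1_(E `|` F) x| <= `|(\1_E y - \1_E x) : R| + `|(\1_F y - \1_F x) : R|.
Proof.
rewrite !indicE !in_setU.
by case: (y \in E); case: (x \in E); case: (y \in F); case: (x \in F) => /=;
  rewrite ?(subrr, subr0, sub0r, normrN, normr0, normr1, addr0, add0r) ?lexx ?ler01 ?ler0n// ler_wpDl.
Qed.

Lemma tgoodU p E F : 0 < p -> tgood p E -> tgood p F -> tgood p (E `|` F).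
Proof.
move=> p0 [mE hE] [mF hF]; split; first exact: measurableU.
move=> r e r0 e0; pose e' := e / 2 / (2 `^ p).
have e'0 : 0 < e' by rewrite !divr_gt0// powR_gt0.
have [d1 d10 h1] := hE r e' r0 e'0; have [d2 d20 h2] := hF r e' r0 e'0.
exists (Num.min d1 d2); first by rewrite lt_min d10.
move=> v; rewrite le_min => /andP[v1 v2].
have m1 G : measurable G -> measurable_fun setT (fun x => \1_G (x + v) - \1_G x : R).
  by move=> mG; apply: measurable_funB => //; exact: measurable_indic_shift.
have mb := measurable_box (0 : pt) r.
apply: (@le_trans _ _ (Np p (box 0 r) (fun x => `|\1_E (x + v) - \1_E x| + `|\1_F (x + v)- \1_F x|)%R)).
  apply: le_Np => //.
  - exact: ltW.
  - by apply: m1; exact: measurableU.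
  - by apply: measurable_funD; apply: measurableT_comp => //; exact: m1.
  - by move=> x _; rewrite [X in _ <= X]ger0_norm ?addr_ge0// indicD_le.
apply: (le_trans (Np_add (ltW p0) mb _ _)); [by apply: measurableT_comp => //; exact: m1..|].
have nn G : Np p (box 0 r) (fun x => `|\1_G (x + v) - \1_G x : R|) = Np p (box 0 r) (fun x => \1_G (x + v) - \1_G x).
  by apply: eq_Np_norm => x _; rewrite normr_id.
rewrite !nn; apply: (@le_trans _ _ ((2 `^ p)%:E * (e'%:E + e'%:E))%E).
  by rewrite lee_wpmul2l ?lee_fin ?powR_ge0// leeD// ?h1 ?h2.
rewrite -EFinD -EFinM lee_fin /e' le_eqVlt; apply/orP; left; apply/eqP.
by field; rewrite gt_eqF// powR_gt0.
Qed.

Lemma tgoodC p E : tgood p E -> tgood p (~` E).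
Proof.
move=> [mE hE]; split; first exact: measurableC.
move=> r e r0 e0; have [d d0 hd] := hE r e r0 e0; exists d => // v /hd; apply: le_trans.
rewrite le_eqVlt; apply/orP; left; apply/eqP; apply: eq_Np_norm => x _.
rewrite !indicE !in_setC; case: (_ \in _); case: (_ \in _) => /=;
  by rewrite ?(subrr, subr0, sub0r, normrN).
Qed.

Lemma tgood0 p : 0 < p -> tgood p set0.
Proof.
move=> p0; split => // r e r0 e0; exists 1 => // v _.
rewrite (@eq_Np _ _ _ _ (cst 0)); last by move=> x _; rewrite !indicE !in_set0 subrr.
by rewrite Np_cst ?normr0 ?powR0 ?gt_eqF// ?mul0e ?lee_fin ?ltW//; exact: measurable_box.
Qed.

(** On a box, the union exceeds a finite subunion [G N] by a set [X] of small measure, whose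
    indicator is small before and after translation. *)
Lemma tgood_bigcup p (F : nat -> set pt) : 0 < p -> (forall n, tgood p (F n)) ->
  tgood p (\bigcup_n F n).
Proof.
move=> p0 gF; have mF n : measurable (F n) by have [] := gF n.
have mU : measurable (\bigcup_n F n) by exact: bigcupT_measurable.
split=> // r e r0 e0.
pose G n := \big[setU/set0]_(i < n) F i.
have gG n : tgood p (G n).
  rewrite /G; elim: n => [|n IH]; first by rewrite big_ord0; exact: tgood0.
  by rewrite big_ord_recr; exact: tgoodU.
have mG n : measurable (G n) by have [] := gG n.
have GU n : G n `<=` \bigcup_n F n.
  by move=> x; rewrite /G -bigcup_mkord => -[i _ Fx]; exists i.
(* Three error terms and two nested uses of [Np_add]. *)
pose e' := e / (3 * (2 `^ p * 2 `^ p)).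
have p2 : 0 < 2 `^ p :> R by rewrite powR_gt0.
have e'0 : 0 < e' by rewrite divr_gt0// !mulr_gt0.
have mD n : measurable (\bigcup_n F n `\` G n) by exact: measurableD.
(* The radius [r + 1] leaves room for translations of length at most 1. *)
have [||N hN] := @Np_vanish p (box 0 (r + 1)) (fun n => \bigcup_n F n `\` G n) (cst 1) p0
   (measurable_box _ _) mD (measurable_cst _) _ _ e' e'0.
- move=> x _; have [[i _ Fx]|nU] := pselect ((\bigcup_n F n) x).
    exists i.+1 => n ni [_]; apply; rewrite /G -bigcup_mkord; by exists i.
  by exists 0%N => n _ [].
- by rewrite Np_cst ?leb2_box ?lte_mul_pinfty ?ltry//; [lra|exact: measurable_box].
have {}hN := hN N (leqnn N).
have [d d0 hd] := (gG N).2 r e' r0 e'0.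
exists (Num.min d 1); first by rewrite lt_min d0/=.
move=> v; rewrite le_min => /andP[vd v1].
pose X := \bigcup_n F n `\` G N.
have XE y : \1_(\bigcup_n F n) y = \1_X y + \1_(G N) y :> R.
  rewrite !indicE in_setD; have [yG|yG] := boolP (y \in G N).
    by rewrite andbF add0r mem_set//; apply: (GU N); exact/set_mem.
  by rewrite andbT addr0.
have mX : measurable X := mD N.
have Xsmall : (Np p (box (0 : pt)%R (r + 1)) (\1_X : pt -> R) <= e'%:E)%E.
  rewrite (@eq_Np _ _ _ _ (fun x => cst 1 x * \1_X x)); last by move=> x _; rewrite mul1r.
  by rewrite Np_indic//; exact: measurable_box.
have mb := measurable_box (0 : pt).
have s1 : (Np p (box (0 : pt)%R r) (fun x => \1_X (x + v)%R : R) <= e'%:E)%E.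
  apply: le_trans Xsmall; apply: Np_shift => // x; rewrite /box/= !subr0 => xr.
  by apply: le_trans (ler_normD _ _) _; lra.
have s2 : (Np p (box (0 : pt)%R r) (\1_X : pt -> R) <= e'%:E)%E.
  apply: le_trans Xsmall; apply: subset_Np => // x; rewrite /box/= !subr0 => xr; lra.
rewrite (@eq_Np _ _ _ _ (fun x => (\1_X (x + v) + (- \1_X x)) + (\1_(G N) (x + v) - \1_(G N) x))); last first.
  by move=> x _; rewrite !XE; ring.
have mXv : measurable_fun setT (fun x => \1_X (x + v) : R) by exact: measurable_indic_shift.
have mXn : measurable_fun setT (fun x => - \1_X x : R) by exact: measurableT_comp.
apply: (le_trans (Np_add (ltW p0) (mb r) _ _)).
- exact: measurable_funD.
- by apply: measurable_funB => //; exact: measurable_indic_shift.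
apply: (@le_trans _ _ ((2 `^ p)%:E * ((2 `^ p)%:E * (e'%:E + e'%:E) + e'%:E))%E).
  rewrite lee_wpmul2l ?lee_fin ?powR_ge0// leeD ?hd//.
  apply: (le_trans (Np_add (ltW p0) (mb r) mXv mXn)).
  by rewrite lee_wpmul2l ?lee_fin ?powR_ge0// leeD// Np_opp.
rewrite -[leLHS]/((2 `^ p * (2 `^ p * (e' + e') + e'))%:E) lee_fin.
have p21 : 1 <= 2 `^ p :> R by rewrite -{1}(powRr0 2) ler_powR// ?ltW//; lra.
have -> : e = e' * (3 * (2 `^ p * 2 `^ p)) by rewrite /e'; field; rewrite gt_eqF.
move: (2 `^ p) p21 => t t1.
have h : e' * t <= e' * t * t by rewrite ler_peMr// mulr_ge0 ?(ltW e'0)//; lra.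
lra.
Qed.

(** The indicator of the strip and its translate differ only at points whose coordinate [pi] is
    within [|v|] of [a] or [b]. Both coordinates are treated at once, [rect] being the rectangle
    around such a line. *)
Lemma tgood_preimage_itv p (pi : pt -> R) (rect : R -> R -> R -> set pt) (a b : R) : 0 < p ->
  measurable_fun setT pi -> (forall x v, pi (x + v) = pi x + pi v) ->
  (forall x, `|pi x| <= `|x|) ->
  (forall c d r, measurable (rect c d r)) ->
  (forall c d r, 0 < d -> 0 <= r -> leb2 (rect c d r) = ((2 * d) * (2 * r))%:E) ->
  (forall c d r x, box 0 r x -> `|pi x - c| <= d -> rect c d r x) ->
  tgood p (pi @^-1` `]a, b[).
Proof.
move=> p0 mpi piD pi1 mrect lrect inrect.
have mab : measurable (`]a, b[%classic : set R) by exact: measurable_itv.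
set E := pi @^-1` _.
have mE : measurable E by rewrite -[E]setTI; exact: mpi.
split=> // r e r0 e0.
have r1 : 0 < 8 * (r + 1) by lra.
(* The two rectangles have total measure [8 d r], at most [e]. *)
pose d := e / (8 * (r + 1)).
have d0 : 0 < d by rewrite divr_gt0.
exists d => // v vd.
pose S := rect a d r `|` rect b d r.
have mS : measurable S by exact: measurableU.
have mb := measurable_box (0 : pt) r.
have md : measurable_fun setT (fun x => \1_E (x + v) - \1_E x : R).
  by apply: measurable_funB => //; exact: measurable_indic_shift.
have mS1 : measurable_fun setT (fun x => cst 1 x * \1_S x : R) by apply: measurable_funM.
apply: (@le_trans _ _ (Np p (box 0%R r) (fun x => cst 1 x * \1_S x)%R)).
  apply: le_Np => //; first exact: ltW.
  move=> x bx; rewrite mul1r [X in _ <= X]ger0_norm//.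
  have [xS|xS] := pselect (S x).
    rewrite [X in _ <= X]indicE mem_set//; rewrite !indicE.
    by case: (_ \in _); case: (_ \in _); rewrite ?(subrr, subr0, sub0r, normrN, normr0, normr1).
  rewrite [X in _ <= X]indicE memNset//.
  have ha : d < `|pi x - a|.
    by rewrite ltNge; apply/negP => h; apply: xS; left; exact: inrect.
  have hb : d < `|pi x - b|.
    by rewrite ltNge; apply/negP => h; apply: xS; right; exact: inrect.
  have := le_trans (pi1 v) vd; move: ha hb.
  rewrite !ltr_normr ler_norml => /orP ha /orP hb /andP[h1 h2].
  suff -> : \1_E (x + v) = \1_E x :> R by rewrite subrr normr0.
  rewrite !indicE; congr (_%:R); congr nat_of_bool.
  by apply/idP/idP => /set_mem; rewrite /E/= !in_itv/= ?piD => /andP[? ?]; apply/mem_set;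
    rewrite /E/= in_itv/= ?piD; apply/andP; split; case: ha => ?; case: hb => ?; lra.
rewrite Np_indic//; apply: (@le_trans _ _ (Np p S (cst 1%R))).
  by apply: subset_Np => //; exact: measurableI.
apply: (le_trans (Np_setU _ _ _ _)) => //.
rewrite !Np_cst// normr1 powR1 !mul1e !lrect// -EFinD lee_fin.
have -> : 2 * d * (2 * r) + 2 * d * (2 * r) = d * (8 * r) by ring.
by rewrite /d mulrAC ler_pdivrMr// ler_pM2l//; lra.
Qed.

Lemma tgood_fst p (a b : R) : 0 < p -> tgood p (fst @^-1` `]a, b[).
Proof.
move=> p0; apply: (@tgood_preimage_itv p fst (fun c d r => `[c - d, c + d] `*` `[- r, r])) => //.
- exact: pt_norm1.
- by move=> c d r; apply: measurableX; exact: measurable_itv.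
- move=> c d r d0 r0; rewrite /leb2 product_measure1E; [|exact: measurable_itv..].
  rewrite /= !lebesgue_measure_itv/= !lte_fin ifT; last by lra.
  have [?|?] := ltrP (- r) r; first by rewrite -!EFinB -EFinM; congr (_%:E); ring.
  have -> : r = 0 by lra.
  by rewrite mule0 !mulr0.
- move=> c d r x; rewrite /box/= subr0 pt_lenorm !ler_norml => /andP[/andP[? ?] /andP[? ?]] /andP[? ?].
  by split; rewrite /= in_itv/=; apply/andP; split => //; lra.
Qed.

Lemma tgood_snd p (a b : R) : 0 < p -> tgood p (snd @^-1` `]a, b[).
Proof.
move=> p0; apply: (@tgood_preimage_itv p snd (fun c d r => `[- r, r] `*` `[c - d, c + d])) => //.
- exact: pt_norm2.
- by move=> c d r; apply: measurableX; exact: measurable_itv.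
- move=> c d r d0 r0; rewrite /leb2 product_measure1E; [|exact: measurable_itv..].
  rewrite /= !lebesgue_measure_itv/= !lte_fin [in X in (_ * X)%E]ifT; last by lra.
  have [?|?] := ltrP (- r) r; first by rewrite -!EFinB -EFinM; congr (_%:E); ring.
  have -> : r = 0 by lra.
  by rewrite mul0e !mulr0.
- move=> c d r x; rewrite /box/= subr0 pt_lenorm !ler_norml => /andP[/andP[? ?] /andP[? ?]] /andP[? ?].
  by split; rewrite /= in_itv/=; apply/andP; split => //; lra.
Qed.

(* The sets satisfying [tgood] form a sigma-algebra containing the open strips, hence all Borel sets. *)
Lemma tgood_measurable p E : 0 < p -> measurable E -> tgood p E.
Proof.
move=> p0.
have sig (pi : pt -> R) : (forall a b : R, tgood p (pi @^-1` `]a, b[)) ->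
    forall A : set R, measurable A -> tgood p (pi @^-1` A).
  move=> hpi A; rewrite -[measurable A]/((R.-ocitv.-measurable).-sigma.-measurable A) RGenOpens.measurableE.
  move: A; apply: smallest_sub.
    split=> [|A gA|F gF].
    - by rewrite preimage_set0; exact: tgood0.
    - by rewrite setTD preimage_setC; exact: tgoodC.
    - by rewrite preimage_bigcup; exact: tgood_bigcup.
  by move=> _ [a [b ->]]; exact: hpi.
move: E; apply: smallest_sub.
  split=> [|A gA|F gF]; first exact: tgood0.
  - by rewrite setTD; exact: tgoodC.
  - exact: tgood_bigcup.
move=> A [[B mB <-]|[B mB <-]]; rewrite setTI.
- by apply: (sig fst) => // a b; exact: tgood_fst.
- by apply: (sig snd) => // a b; exact: tgood_snd.
Qed.

Definition tcont p f := measurable_fun setT f /\ forall e : R, 0 < e ->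
  exists2 d : R, 0 < d & forall v : pt, `|v| <= d ->
    (Np p setT (fun x => f (x + v)%R - f x)%R <= e%:E)%E.

Lemma measurable_shift f v : measurable_fun setT f -> measurable_fun setT (fun x => f (x + v)).
Proof. by move=> mf; apply: measurableT_comp => //; exact: measurable_addv. Qed.

Lemma tcont_indic p E (r : R) : 0 < p -> 0 <= r -> measurable E -> E `<=` box 0 r -> tcont p \1_E.
Proof.
move=> p0 r0 mE Er; split => // e e0.
have [_ /(_ (r + 1) e)] := tgood_measurable p0 mE.
case=> //; first by lra.
move=> d d0 hd; exists (Num.min d 1); first by rewrite lt_min d0/=.
move=> v; rewrite le_min => /andP[/hd hv v1]; apply: le_trans hv.
have mb := measurable_box (0 : pt) (r + 1).
have md : measurable_fun setT (fun x => \1_E (x + v) - \1_E x : R).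
  by apply: measurable_funB => //; exact: measurable_indic_shift.
rewrite -[X in (_ <= Np _ X _)%E]setTI -Np_indic// le_eqVlt; apply/orP; left; apply/eqP.
apply: eq_Np => x _; rewrite [X in _ * X]indicE.
have [xb|xb] := boolP (x \in box _ _); first by rewrite mulr1.
have xr : ~ (`|x| <= r + 1) by move=> h; move/negP: xb; apply; rewrite inE /box/= subr0.
have xE : ~ E x by move=> /Er; rewrite /box/= subr0 => h; apply: xr; lra.
have xvE : ~ E (x + v).
  move=> /Er; rewrite /box/= subr0 => h; apply: xr.
  rewrite -[x](addrK v); apply: le_trans (ler_normB _ _) _; lra.
by rewrite mulr0 !indicE !memNset// subrr.
Qed.

Lemma tcontD p f g : 0 < p -> tcont p f -> tcont p g -> tcont p (fun x => f x + g x).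
Proof.
move=> p0 [mf hf] [mg hg]; split; first exact: measurable_funD.
move=> e e0; pose e' := e / 2 / (2 `^ p).
have p2 : 0 < 2 `^ p :> R by rewrite powR_gt0.
have e'0 : 0 < e' by rewrite !divr_gt0.
have [d1 d10 h1] := hf e' e'0; have [d2 d20 h2] := hg e' e'0.
exists (Num.min d1 d2); first by rewrite lt_min d10.
move=> v; rewrite le_min => /andP[/h1{}h1 /h2{}h2].
rewrite (@eq_Np _ _ _ _ (fun x => (f (x + v) - f x) + (g (x + v) - g x))); last by move=> x _; ring.
apply: (le_trans (Np_add (ltW p0) measurableT _ _)).
- by apply: measurable_funB => //; exact: measurable_shift.
- by apply: measurable_funB => //; exact: measurable_shift.
apply: (@le_trans _ _ ((2 `^ p)%:E * (e'%:E + e'%:E))%E).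
  by apply: lee_wpmul2l; [rewrite lee_fin ltW|exact: leeD].
rewrite -EFinD -EFinM lee_fin /e' le_eqVlt; apply/orP; left; apply/eqP.
by field; rewrite gt_eqF.
Qed.

Lemma tcontZ p c f : 0 < p -> tcont p f -> tcont p (fun x => c * f x).
Proof.
move=> p0 [mf hf]; split; first exact: measurable_funM.
move=> e e0; pose e' := e / (`|c| `^ p + 1).
have p2 : 0 < `|c| `^ p + 1 :> R by rewrite ltr_wpDl// powR_ge0.
have e'0 : 0 < e' by rewrite !divr_gt0.
have [d d0 h] := hf e' e'0; exists d => // v /h{}h.
rewrite (@eq_Np _ _ _ _ (fun x => c * (f (x + v) - f x))); last by move=> x _; ring.
rewrite Np_scale//; last by apply: measurable_funB => //; exact: measurable_shift.
apply: (@le_trans _ _ ((`|c| `^ p)%:E * e'%:E)%E).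
  by apply: lee_wpmul2l; rewrite ?lee_fin ?powR_ge0.
rewrite -EFinM lee_fin /e' mulrC mulrAC ler_pdivrMr// ler_pM2l//; lra.
Qed.

Lemma tcont0 p : 0 < p -> tcont p (cst 0).
Proof.
move=> p0; split => // e e0; exists 1 => // v _.
rewrite (@eq_Np _ _ _ _ (cst 0)); last by move=> x _; rewrite subrr.
by rewrite Np_cst// normr0 powR0 ?gt_eqF// mul0e lee_fin ltW.
Qed.

Lemma tcont_sum p n (F : 'I_n -> pt -> R) : 0 < p -> (forall i, tcont p (F i)) ->
  tcont p (fun x => \sum_(i < n) F i x).
Proof.
move=> p0; elim: n F => [|n IH] F hF.
  by under eq_fun do rewrite big_ord0; exact: tcont0.
under eq_fun do rewrite big_ord_recr.
by apply: tcontD => //; exact: IH.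
Qed.

(** A three-term argument: by invariance of the measure, the translated error [f - g] is as small as
    the error itself. *)
Lemma tcont_approx p f : 0 < p -> measurable_fun setT f ->
  (forall e : R, 0 < e -> exists2 g, tcont p g & (Np p setT (fun x => f x - g x)%R <= e%:E)%E) ->
  tcont p f.
Proof.
move=> p0 mf hf; split => // e e0.
pose e' := e / (3 * (2 `^ p * 2 `^ p)).
have p2 : 0 < 2 `^ p :> R by rewrite powR_gt0.
have e'0 : 0 < e' by rewrite divr_gt0// !mulr_gt0.
have [g [mg hg] fg] := hf e' e'0; have [d d0 hd] := hg e' e'0; exists d => // v /hd hv.
pose k x := f x - g x.
have mk : measurable_fun setT k by exact: measurable_funB.
have mkv := measurable_shift v mk.
have mkn : measurable_fun setT (fun x => - k x) by exact: measurableT_comp.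
rewrite (@eq_Np _ _ _ _ (fun x => (k (x + v) + - k x) + (g (x + v) - g x))); last first.
  by move=> x _; rewrite /k; ring.
apply: (le_trans (Np_add (ltW p0) measurableT _ _)).
- exact: measurable_funD.
- by apply: measurable_funB => //; exact: measurable_shift.
apply: (@le_trans _ _ ((2 `^ p)%:E * ((2 `^ p)%:E * (e'%:E + e'%:E) + e'%:E))%E).
  apply: lee_wpmul2l; first by rewrite lee_fin ltW.
  apply: leeD => //; apply: (le_trans (Np_add (ltW p0) measurableT mkv mkn)).
  apply: lee_wpmul2l; first by rewrite lee_fin ltW.
  by apply: leeD; [apply: le_trans fg; apply: Np_shift|rewrite Np_opp].
rewrite -[leLHS]/((2 `^ p * (2 `^ p * (e' + e') + e'))%:E) lee_fin.
have p21 : 1 <= 2 `^ p :> R by rewrite -{1}(powRr0 2) ler_powR// ?ltW//; lra.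
have -> : e = e' * (3 * (2 `^ p * 2 `^ p)) by rewrite /e'; field; rewrite gt_eqF.
move: (2 `^ p) p21 => t t1.
have h : e' * t <= e' * t * t by rewrite ler_peMr// mulr_ge0 ?(ltW e'0)//; lra.
lra.
Qed.

Import HBNNSimple.

Lemma tcont_ge0 p f (r : R) : 0 < p -> 0 <= r -> measurable_fun setT f -> (forall x, 0 <= f x) ->
  (forall x, f x != 0 -> box 0 r x) -> (Np p setT f < +oo)%E -> tcont p f.
Proof.
move=> p0 r0 mf f0 fr fp; apply: tcont_approx => // e e0.
have mf' : measurable_fun setT (EFin \o f) by exact/measurable_EFinP.
pose s := nnsfun_approx measurableT mf'.
have s_cvg x : (fun n => s n x) @ \oo --> f x.
  have := @cvg_nnsfun_approx _ _ _ _ measurableT _ mf' (fun x _ => f0 x) x I.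
  by move=> /fine_cvg.
have s_le n x : s n x <= f x.
  have := @nd_nnsfun_approx _ _ _ _ measurableT _ mf'; move=> nd.
  have nds : nondecreasing_seq (fun n => s n x) by move=> i j /nd/lefP; exact.
  have := nondecreasing_cvgn_le nds; rewrite (cvg_lim _ (s_cvg x))// => h.
  exact: h (s_cvg x) n.
have ms n : measurable_fun setT (s n) by [].
have [||N hN] := @Np_dominated p setT (fun n => s n) f f p0 measurableT ms mf mf _ _ fp e e0.
- by [].
- move=> n x _; rewrite ler0_norm ?subr_le0// opprB ger0_norm//.
  by rewrite lerBlDr lerDl.
exists (s N).
  have -> : (s N : pt -> R) = _ := funext (fimfunEord (s N)).
  apply: tcont_sum => // i; set y := _`_i.
  (* The level set of the value 0 is unbounded, hence outside the scope of [tcont_indic], but it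
     contributes nothing. *)
  have [->|y0] := eqVneq y 0; first by under eq_fun do rewrite mul0r; exact: tcont0.
  apply: tcontZ => //; apply: (@tcont_indic _ _ r) => // x /= sy.
  apply: fr; apply: contra_neq y0 => fx0; rewrite -sy; apply/eqP.
  by rewrite eq_le -{1}fx0 s_le/=.
rewrite (@eq_Np_norm _ _ _ _ (fun x => s N x - f x)); last by move=> x _; rewrite distrC.
exact: hN.
Qed.

(** Approximation by simple functions needs bounded level sets and a sign; hence the truncation to
    large boxes and the splitting into positive and negative parts. *)
Theorem translation_continuous p g : 0 < p -> measurable_fun setT g -> (Np p setT g < +oo)%E ->
  tcont p g.
Proof.
move=> p0 mg gp.
have bounded_ge0 (h : pt -> R) (r : R) : 0 <= r -> measurable_fun setT h ->
    (forall x, h x != 0 -> box 0 r x) -> (Np p setT h < +oo)%E -> tcont p h.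
  move=> r0 mh hr height.
  have mpos : measurable_fun setT (fun x => Num.max (h x) 0) by exact: measurable_maxr.
  have mneg : measurable_fun setT (fun x => Num.max (- h x) 0).
    by apply: measurable_maxr => //; exact: measurableT_comp.
  rewrite (_ : h = fun x => Num.max (h x) 0 + (-1) * Num.max (- h x) 0); last first.
    by apply/funext => x; rewrite !maxEle; case: ifPn; case: ifPn => *; lra.
  apply: tcontD => //; last apply: tcontZ => //.
  - apply: (@tcont_ge0 _ _ r) => //.
    + by move=> x; rewrite le_max lexx orbT.
    + by move=> x; rewrite maxEle; case: ifPn => [|_]; [rewrite eqxx|exact: hr].
    + apply: le_lt_trans height; apply: le_Np => //; first exact: ltW.
      move=> x _; rewrite ger0_norm; last by rewrite le_max lexx orbT.
      by rewrite ge_max ler_norm normr_ge0.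
  - apply: (@tcont_ge0 _ _ r) => //.
    + by move=> x; rewrite le_max lexx orbT.
    + move=> x; rewrite maxEle; case: ifPn => [|_]; first by rewrite eqxx.
      by rewrite oppr_eq0; exact: hr.
    + apply: le_lt_trans height; apply: le_Np => //; first exact: ltW.
      move=> x _; rewrite ger0_norm; last by rewrite le_max lexx orbT.
      by rewrite ge_max -normrN ler_norm normr_ge0.
apply: tcont_approx => // e e0.
have mb n := measurable_box (0 : pt) n%:R.
have [||N hN] := @Np_vanish p setT (fun n => ~` box 0 n%:R) g p0 measurableT _ mg _ gp e e0.
- by move=> n; exact: measurableC.
- move=> x _; exists (Num.bound `|x|) => n xn; apply; rewrite /box/= subr0 ltW//.
  apply: lt_le_trans (archi_boundP (normr_ge0 x)) _; by rewrite ler_nat.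
exists (fun x => g x * \1_(box 0 N%:R) x).
  apply: (bounded_ge0 _ N%:R) => //.
  - by apply: measurable_funM.
  - by move=> x; rewrite indicE; case: (boolP (x \in _)) => [/set_mem//|]; rewrite mulr0 eqxx.
  - rewrite Np_indic//; apply: le_lt_trans gp; apply: subset_Np => //; exact: measurableI.
apply: le_trans (hN N (leqnn N)); rewrite -Np_indic//; last exact: measurableC.
rewrite le_eqVlt; apply/orP; left; apply/eqP; apply: eq_Np => x _.
by rewrite !indicE in_setC; case: (x \in _); rewrite /= ?mulr1 ?mulr0 ?subrr ?subr0.
Qed.

End translation_continuity.

(** * Mollification *)

Section bump.
Variable R : realType.
Implicit Types (f g : R -> R) (x : R).

(** The rules of differentiation for functions given as explicit abstractions; [isd_eq] normalises
    the value of the derivative afterwards. *)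
Lemma isd_eq f x a b : is_derive x 1 f a -> a = b -> is_derive x 1 f b.
Proof. by move=> h <-. Qed.

Lemma isd_add f g x a b : is_derive x 1 f a -> is_derive x 1 g b ->
  is_derive x 1 (fun y => f y + g y) (a + b).
Proof. exact: is_deriveD. Qed.

Lemma isd_opp f x a : is_derive x 1 f a -> is_derive x 1 (fun y => - f y) (- a).
Proof. exact: is_deriveN. Qed.

Lemma isd_mul f g x a b : is_derive x 1 f a -> is_derive x 1 g b ->
  is_derive x 1 (fun y => f y * g y) (f x * b + g x * a).
Proof. exact: is_deriveM. Qed.

Lemma isd_scale (c : R) f x a : is_derive x 1 f a -> is_derive x 1 (fun y => c * f y) (c * a).
Proof. exact: is_deriveZ. Qed.

Lemma isd_comp f g x a b : is_derive (g x) 1 f a -> is_derive x 1 g b ->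
  is_derive x 1 (fun y => f (g y)) (b * a).
Proof.
move=> df dg; rewrite mulrC; exact: (@is_derive1_comp _ f g x a b df dg).
Qed.

Lemma isd_cst (c x : R) : is_derive x 1 (fun _ : R => c) 0.
Proof. exact: is_derive_cst. Qed.

Lemma isd_near f g x a : (\near x, f x = g x) -> is_derive x 1 f a -> is_derive x 1 g a.
Proof. exact: near_eq_is_derive. Qed.

Lemma isd_affine (c d x : R) : is_derive x 1 (fun y => c + d * y) d.
Proof.
have := isd_add (is_derive_cst c x 1) (isd_scale d (is_derive_id x 1)).
by rewrite add0r mulr1.
Qed.

Lemma isd_inv x : x != 0 -> is_derive x 1 (fun y => y^-1) (- (x^-1 * x^-1)).
Proof.
move=> x0; apply: DeriveDef; first by apply: derivableV => //; exact: derivable_id.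
by rewrite deriveV//= derive_id /GRing.scale/= mulr1 expr2 invfM.
Qed.

Lemma isd_exp f n x a : is_derive x 1 f a -> is_derive x 1 (fun y => f y ^+ n) (n%:R * f x ^+ n.-1 * a).
Proof.
move=> df; rewrite (_ : (fun y => f y ^+ n) = f ^+ n); first exact: is_deriveX.
by apply/funext => y; elim: n => [|n IH]; rewrite ?expr0// !exprS IH.
Qed.

Lemma isd_derive1 f x a : is_derive x 1 f a -> derive1 f x = a.
Proof. by move=> [_ <-]; rewrite derive1E. Qed.

Lemma derivable_isd f x : derivable f x 1 -> is_derive x 1 f (derive1 f x).
Proof. by move=> d; apply: DeriveDef => //; rewrite derive1E. Qed.

(** The powers of [1/x] in front of [exp(-1/x)] make the linear span of the family stable under
    differentiation. *)
Definition flat (n : nat) : R -> R :=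
  fun x => if 0 < x then x^-1 ^+ n * expR (- x^-1) else 0.

Lemma flat_le n x : 0 < x -> flat n x <= n.+1`!%:R * x.
Proof.
move=> x0; rewrite /flat x0 expRN.
have y0 : 0 < x^-1 by rewrite invr_gt0.
rewrite ler_pdivrMr ?expR_gt0//.
have h := expR_ge1Dxn n (ltW y0).
apply: (@le_trans _ _ (n.+1`!%:R * x * (x^-1 ^+ n.+1 / n.+1`!%:R))); last first.
  rewrite ler_wpM2l ?mulr_ge0 ?(ltW x0)//; apply: le_trans h; by rewrite lerDr.
rewrite exprS le_eqVlt; apply/orP; left; apply/eqP; field.
by rewrite (gt_eqF x0) andbT pnatr_eq0 -lt0n fact_gt0.
Qed.

Lemma flat_ge0 n x : 0 <= flat n x.
Proof.
rewrite /flat; case: ifPn => // x0.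
by rewrite mulr_ge0 ?expR_ge0// exprn_ge0// invr_ge0 ltW.
Qed.

Lemma is_derive_flat n x :
  is_derive x 1 (flat n) (- n%:R * flat n.+1 x + flat n.+2 x).
Proof.
have [x0|x0|->] := ltgtP x 0.
- rewrite /flat !ifF; [|by apply/negbTE; rewrite -leNgt ltW..].
  rewrite mulr0 addr0; apply: isd_near (isd_cst 0 x).
  near=> y; rewrite ifF//; apply/negbTE; rewrite -leNgt ltW//.
  by near: y; exact: lt_nbhsl.
- rewrite /flat !ifT//.
  apply: (@isd_near (fun y => y^-1 ^+ n * expR (- y^-1))).
    by near=> y; rewrite ifT//; near: y; exact: lt_nbhsr.
  have xn0 : x != 0 by rewrite gt_eqF.
  have dV := isd_inv xn0.
  apply: (isd_eq (isd_mul (isd_exp n dV) (@isd_comp _ (fun y => - y^-1) _ _ _ (is_derive_expR (- x^-1)) (isd_opp dV)))).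
  case: n => [|n]; first by rewrite !mul0r mulr0 addr0 expr0 oppr0 mul0r add0r exprS expr1; ring.
  by rewrite /= !exprS; ring.
- have fl0 m : flat m 0 = 0 by rewrite /flat ltxx.
  rewrite !fl0 mulr0 addr0.
  have lim0 : h^-1 *: (flat n (h + 0) - flat n 0) @[h --> (0:R)^'] --> (0:R).
    apply/cvgrPdist_le => e e0; near=> h.
    rewrite sub0r normrN addr0 fl0 subr0 /GRing.scale/= normrM normfV (ger0_norm (flat_ge0 _ _)).
    have [h0|h0] := ltrP 0 h; last by rewrite /flat ifF ?mulr0 ?(ltW e0)//; apply/negbTE; rewrite -leNgt.
    (* The difference quotient at 0 from the right is again a member of the family, so [flat_le]
       makes it tend to 0. *)
    have -> : `|h|^-1 * flat n h = flat n.+1 h.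
      by rewrite /flat h0 exprS gtr0_norm// mulrA.
    apply: (le_trans (flat_le _ h0)).
    rewrite mulrC -ler_pdivlMr ?ltr0n ?fact_gt0//.
    apply: le_trans (ler_norm _) _.
    near: h; apply: dnbhs0_le; by rewrite divr_gt0// ltr0n fact_gt0.
  split.
    by apply/cvg_ex; exists 0; rewrite /=; under eq_fun do rewrite scaler1; exact: lim0.
  by rewrite /derive; under eq_fun do rewrite scaler1; apply/cvg_lim.
Unshelve. all: end_near. Qed.

(** An algebra closed under differentiation: smoothness of its members follows by induction, without
    formulas for their derivatives. *)
Inductive flatalg : (R -> R) -> Prop :=
| flatalg_flat n (a : R) : flatalg (fun x => flat n (1 + a * x))
| flatalg_add f g : flatalg f -> flatalg g -> flatalg (fun x => f x + g x)
| flatalg_scale (c : R) f : flatalg f -> flatalg (fun x => c * f x)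
| flatalg_mul f g : flatalg f -> flatalg g -> flatalg (fun x => f x * g x).

Lemma flatalg_derive f : flatalg f ->
  exists2 g, flatalg g & forall x, is_derive x 1 f (g x).
Proof.
elim=> {f} [n a|f g _ [f' af df] _ [g' ag dg]|c f _ [f' af df]|f g bf [f' af df] bg [g' ag dg]].
- exists (fun x => a * (- n%:R * flat n.+1 (1 + a * x) + flat n.+2 (1 + a * x))).
    apply: flatalg_scale; apply: flatalg_add; last exact: flatalg_flat.
    by apply: flatalg_scale; exact: flatalg_flat.
  by move=> x; apply: isd_comp; [exact: is_derive_flat|exact: isd_affine].
- by exists (fun x => f' x + g' x); [exact: flatalg_add|move=> x; exact: isd_add].
- by exists (fun x => c * f' x); [exact: flatalg_scale|move=> x; exact: isd_scale].
- exists (fun x => f x * g' x + g x * f' x).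
    by apply: flatalg_add; exact: flatalg_mul.
  by move=> x; exact: isd_mul.
Qed.

Definition smooth1 f := forall n x, derivable (derive1n n f) x 1.

Lemma flatalg_smooth1 f : flatalg f -> smooth1 f.
Proof.
move=> af n x; have [g ag] : exists2 g, flatalg g & derive1n n f = g.
  elim: n => [|n [g ag IH]]; first by exists f.
  have [g' ag' dg] := flatalg_derive ag; exists g' => //.
  by rewrite derive1nS IH; apply/funext => y; rewrite derive1E; apply: derive_val.
by move=> ->; have [g' _ dg] := flatalg_derive ag; have [] := dg x.
Qed.

Definition bump1 : R -> R := fun x => flat 0 (1 + 1 * x) * flat 0 (1 + (-1) * x).

Lemma smooth1_bump1 : smooth1 bump1.
Proof. by apply: flatalg_smooth1; apply: flatalg_mul; exact: flatalg_flat. Qed.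

Lemma bump1_ge0 x : 0 <= bump1 x.
Proof. by rewrite mulr_ge0// flat_ge0. Qed.

Lemma bump1_eq0 x : 1 <= `|x| -> bump1 x = 0.
Proof.
rewrite ler_normr => /orP[x1|x1]; rewrite /bump1 /flat.
  by rewrite [X in _ * X]ifF ?mulr0//; apply/negbTE; rewrite -leNgt; lra.
by rewrite ifF ?mul0r//; apply/negbTE; rewrite -leNgt; lra.
Qed.

End bump.

HB.lock Definition cvl (R : realType) (f k : pt R -> R) (x : pt R) : R :=
  \int[@leb2 R]_y (f y * k (x - y)).

(** * Partial derivatives in the plane *)

Section plane_calculus.
Variable R : realType.
Local Notation pt := (pt R).
Local Notation leb2 := (@leb2 R).
Implicit Types (p r c t : R) (f g k : pt -> R) (D E : set pt) (x y a v z : pt) (b : bool) (w : seq bool).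

(** Both coordinates are treated at once, indexed by a Boolean. The line [axl b x] runs through [x]
    parallel to the axis [b] and is parametrised by that coordinate. *)
Definition crd b x : R := if b then x.1 else x.2.
Definition axl b x t : pt := if b then (t, x.2) else (x.1, t).
Definition pdd b f : pt -> R := fun x => derive1 (fun t => f (axl b x t)) (crd b x).

Lemma pdw_cons b w f : pdw (b :: w) f = pdd b (pdw w f).
Proof. by case: b. Qed.

Lemma pdw_rcons b w f : pdw (rcons w b) f = pdw w (pdd b f).
Proof. by rewrite /pdw foldr_rcons; case: b. Qed.

Lemma smoothP f : smooth f <-> forall w, continuous (pdw w f) /\
  forall b x, derivable (fun t => pdw w f (axl b x t)) (crd b x) 1.
Proof.
split=> h w; have [cf df] := h w; split=> //.
  by move=> b x; have [d1 d2] := df x; case: b; [exact: d1|exact: d2].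
by move=> x; split; [exact: (df true)|exact: (df false)].
Qed.

Lemma smooth_pdd b f : smooth f -> smooth (pdd b f).
Proof. by move=> sf w; rewrite -pdw_rcons; exact: sf. Qed.

Lemma smooth_continuous f : smooth f -> continuous f.
Proof. by move=> /(_ [::])[]. Qed.

Lemma smooth_isd f b x : smooth f ->
  is_derive (crd b x) 1 (fun t => f (axl b x t)) (pdd b f x).
Proof. by move=> /smoothP/(_ [::])[_ /(_ b x)] /derivable_isd. Qed.

Lemma axl_crd b x : axl b x (crd b x) = x.
Proof. by case: b; case: x. Qed.

Lemma axl_sub b x y t : axl b x t - y = axl b (x - y) (t - crd b y).
Proof. by case: b. Qed.

Lemma crd_sub b x y : crd b (x - y) = crd b x - crd b y.
Proof. by case: b. Qed.

Lemma compact_box a r : compact (box a r).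
Proof. by rewrite boxE; apply: compact_setX; exact: segment_compact. Qed.

Lemma continuous_box_bounded f a r : continuous f ->
  exists2 C, 0 <= C & forall x, box a r x -> `|f x| <= C.
Proof.
move=> cf; have : compact (f @` box a r).
  by apply: continuous_compact; [exact: continuous_subspaceT|exact: compact_box].
move=> /compact_bounded[M [_ hM]]; exists (`|M| + 1); first by rewrite addr_ge0.
move=> x bx; apply: hM; last by exists x.
by rewrite (le_lt_trans (ler_norm M))// ltrDl.
Qed.

Lemma derive_bounded_lipschitz (f f' : R -> R) (s t C : R) :
  (forall u : R, is_derive u 1 f (f' u)) ->
  (forall u : R, Num.min s t <= u <= Num.max s t -> `|f' u| <= C) ->
  `|f s - f t| <= C * `|s - t|.
Proof.
move=> df; wlog st : s t / t <= s.
  move=> h hC; have [st|/ltW st] := leP t s; first exact: h.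
  by rewrite distrC (distrC s); apply: h => //; move=> u; rewrite minC maxC; exact: hC.
move=> hC.
have cf : {within `[t, s], continuous f}.
  by apply: continuous_subspaceT => u; apply/differentiable_continuous/derivable1_diffP; have [] := df u.
have [c cts ->] := @MVT_segment _ f f' t s st (fun u _ => df u) cf.
rewrite normrM ler_wpM2r//; apply: hC.
by move: cts; rewrite in_itv/= (min_idPr st) (max_idPl st).
Qed.

Lemma isd_line f b z (u : R) : (forall b x, derivable (fun t => f (axl b x t)) (crd b x) 1) ->
  is_derive u 1 (fun t => f (axl b z t)) (pdd b f (axl b z u)).
Proof. by move=> df; have := derivable_isd (df b (axl b z u)); case: b. Qed.

(** The path from [x] to [y] through the corner [(x.1, y.2)] stays in the box, and the mean value
    theorem applies to each leg. *)
Lemma partial_bounded_lipschitz f a r C :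
  (forall b x, derivable (fun t => f (axl b x t)) (crd b x) 1) ->
  (forall b x, box a r x -> `|pdd b f x| <= C) ->
  forall x y, box a r x -> box a r y -> `|f x - f y| <= (C + C) * `|x - y|.
Proof.
move=> df hC x y bx byy.
have isd b z (u : R) : is_derive u 1 (fun t => f (axl b z t)) (pdd b f (axl b z u)).
  exact: isd_line.
have C0 : 0 <= C := le_trans (normr_ge0 _) (hC true x bx).
have bw : box a r (x.1, y.2).
  move: bx byy; rewrite /box/= !pt_lenorm/= => /andP[? _] /andP[_ ?]; exact/andP.
have itvb (u s t c : R) : Num.min s t <= u <= Num.max s t -> `|s - c| <= r -> `|t - c| <= r -> `|u - c| <= r.
  rewrite ge_min le_max !ler_norml => /andP[/orP h1 /orP h2] /andP[? ?] /andP[? ?].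
  by apply/andP; split; case: h1 => ?; case: h2 => ?; lra.
have h1 : `|f (x.1, y.2) - f y| <= C * `|x.1 - y.1|.
  have := @derive_bounded_lipschitz (fun t => f (axl true y t)) (fun u => pdd true f (axl true y u)) x.1 y.1 C (isd true y).
  rewrite /axl; case: y bw byy {isd} => y1 y2 /= bw byy; apply.
  move=> u uxy; apply: hC; move: bw byy; rewrite /box/= !pt_lenorm/= => /andP[h1 ->] /andP[h2 _].
  by rewrite andbT; exact: itvb uxy h1 h2.
have h2 : `|f x - f (x.1, y.2)| <= C * `|x.2 - y.2|.
  have := @derive_bounded_lipschitz (fun t => f (axl false x t)) (fun u => pdd false f (axl false x u)) x.2 y.2 C (isd false x).
  rewrite /axl; case: x bw bx {isd h1} => x1 x2 /= bw bx; apply.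
  move=> u uxy; apply: hC; move: bw bx; rewrite /box/= !pt_lenorm/= => /andP[-> h2] /andP[_ h3].
  by exact: itvb uxy h3 h2.
rewrite -(subrKA (f (x.1, y.2))); apply: (le_trans (ler_normD _ _)).
rewrite mulrDl lerD//.
  by apply: (le_trans h2); rewrite ler_wpM2l//; exact: (pt_norm2 (x - y)).
by apply: (le_trans h1); rewrite ler_wpM2l//; exact: (pt_norm1 (x - y)).
Qed.

Lemma lipschitz_continuous f : (forall a, exists C, forall x y, box a 1 x -> box a 1 y ->
   `|f x - f y| <= C * `|x - y|) -> continuous f.
Proof.
move=> h x; have [C hC] := h x; apply/cvgrPdist_le => e e0.
have C0 : 0 < `|C| + 1 by rewrite ltr_wpDl.
near=> y.
apply: (le_trans (hC _ _ _ _)).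
- by rewrite /box/= subrr normr0.
- rewrite /box/= distrC; near: y; exact: cvgr_dist_le.
apply: (@le_trans _ _ ((`|C| + 1) * `|x - y|)).
  by rewrite ler_wpM2r// (le_trans (ler_norm _))// lerDl.
rewrite mulrC -ler_pdivlMr//; near: y; apply: cvgr_dist_le => //.
by rewrite divr_gt0.
Unshelve. all: end_near. Qed.

(** A form without quotient and with [h = 0] allowed, suited to adding increments in two
    variables. *)
Lemma isd_epsP (g : R -> R) (t l : R) : is_derive t 1 g l <->
  (forall e, 0 < e -> exists2 d, 0 < d & forall h, `|h| < d ->
     `|g (t + h) - g t - h * l| <= e * `|h|).
Proof.
split.
- move=> [/cvg_ex[l' hl] lE]; have {lE} l'E : l' = l.
    by rewrite -lE; apply/esym; apply: cvg_lim hl.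
  rewrite {}l'E in hl; move=> e e0.
  have /cvgrPdist_le/(_ e e0) [d /= d0 hd] := hl.
  exists d => // h hdd; have [->|h0] := eqVneq h 0.
    by rewrite addr0 subrr mul0r subr0 normr0 mulr0.
  have := hd h; rewrite /= sub0r normrN => /(_ hdd h0).
  rewrite [h *: 1]mulr1 (addrC h t) -[_ *: _]/(_ * _) distrC => mol_height.
  have -> : g (t + h) - g t - h * l = h * (h^-1 * (g (t + h) - g t) - l) by field.
  by rewrite normrM mulrC ler_wpM2r.
- move=> H; have lim0 : h^-1 *: (g (h *: 1 + t) - g t) @[h --> (0:R)^'] --> l.
    apply/cvgrPdist_le => e e0; have [d d0 hd] := H e e0.
    exists d => //= h; rewrite /= sub0r normrN => hdd h0.
    rewrite [h *: 1]mulr1 (addrC h t) -[_ *: _]/(_ * _).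
    have -> : l - h^-1 * (g (t + h) - g t) = - (h^-1 * (g (t + h) - g t - h * l)) by field.
    rewrite normrN normrM normfV mulrC ler_pdivrMr ?normr_gt0//; exact: hd.
  split; first by apply/cvg_ex; exists l.
  by rewrite /derive; apply: cvg_lim.
Qed.

(** The increment is split at a corner. The vertical leg starts at the point [y] itself, where the
    second partial derivative suffices; the horizontal leg does not pass through [y], and there the
    mean value theorem is combined with the continuity of the first partial derivative. *)
Lemma is_derive_segment f x v (t : R) :
  (forall b x, derivable (fun t => f (axl b x t)) (crd b x) 1) ->
  (forall b, continuous (pdd b f)) ->
  is_derive t 1 (fun u => f (x + u *: v)) (v.1 * pdd true f (x + t *: v) + v.2 * pdd false f (x + t *: v)).
Proof.
move=> df cf; have [y yd] : {y : pt | y = x + t *: v} by exists (x + t *: v).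
apply/isd_epsP => e e0; rewrite -yd.
have isd b z (u : R) : is_derive u 1 (fun t => f (axl b z t)) (pdd b f (axl b z u)).
  exact: isd_line.
have V0 : 0 < 2 * (`|v| + 1) by rewrite mulr_gt0// ltr_wpDl.
pose e' := e / (2 * (`|v| + 1)).
have e'0 : 0 < e' by rewrite divr_gt0.
have [d1 d10 hd1] : exists2 d, 0 < d & forall z, `|y - z| < d -> `|pdd true f y - pdd true f z| <= e'.
  have /cvgrPdist_le/(_ e' e'0) := cf true y.
  rewrite -nbhs_ballE => -[d /= d0 hd]; exists d => // z yz; apply: hd.
  by move: yz; rewrite pt_ltnorm => /andP[? ?]; split.
have [d2 d20 hd2] := (isd_epsP _ _ _).1 (isd false y y.2) e' e'0.
have v1 : 0 < `|v| + 1 by rewrite ltr_wpDl.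
exists (Num.min (d1 / (`|v| + 1)) (d2 / (`|v| + 1))); first by rewrite lt_min !divr_gt0.
move=> h; rewrite lt_min !ltr_pdivlMr// => /andP[h1 h2].
have hv (c : R) : `|c| <= `|v| -> `|h * c| <= `|h| * (`|v| + 1).
  by move=> cv; rewrite normrM ler_wpM2l// (le_trans cv)// lerDl.
have yE : x + (t + h) *: v = (y.1 + h * v.1, y.2 + h * v.2).
  by rewrite scalerDl addrA -yd.
rewrite yE.
have -> : f (y.1 + h * v.1, y.2 + h * v.2) - f y - h * (v.1 * pdd true f y + v.2 * pdd false f y) =
  (f (y.1 + h * v.1, y.2 + h * v.2) - f (y.1, y.2 + h * v.2) - h * v.1 * pdd true f y) +
  (f (y.1, y.2 + h * v.2) - f (y.1, y.2) - h * v.2 * pdd false f y).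
  by rewrite -surjective_pairing; ring.
apply: (le_trans (ler_normD _ _)).
have b2 : `|f (y.1, y.2 + h * v.2) - f (y.1, y.2) - h * v.2 * pdd false f y| <= e' * `|h * v.2|.
  have := hd2 (h * v.2) (le_lt_trans (hv _ (pt_norm2 v)) h2).
  by rewrite [axl false y y.2](axl_crd false y) -[(y.1, y.2)]surjective_pairing.
have b1 : `|f (y.1 + h * v.1, y.2 + h * v.2) - f (y.1, y.2 + h * v.2) - h * v.1 * pdd true f y| <= e' * `|h * v.1|.
  pose z : pt := (y.1, y.2 + h * v.2).
  have dd (u : R) : is_derive u 1 (fun s => f (axl true z s) + - pdd true f y * s) (pdd true f (axl true z u) + - pdd true f y).
    by have := isd_add (isd true z u) (isd_scale (- pdd true f y) (is_derive_id u 1)); rewrite mulr1.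
  have := derive_bounded_lipschitz (s := y.1 + h * v.1) (t := y.1) (C := e') dd.
  rewrite /axl/=.
  have -> : f (y.1 + h * v.1, y.2 + h * v.2) + - pdd true f y * (y.1 + h * v.1) - (f (y.1, y.2 + h * v.2) + - pdd true f y * y.1) =
     f (y.1 + h * v.1, y.2 + h * v.2) - f (y.1, y.2 + h * v.2) - h * v.1 * pdd true f y by ring.
  have -> : y.1 + h * v.1 - y.1 = h * v.1 by ring.
  apply => u; rewrite ge_min le_max => uu; rewrite distrC; apply: hd1.
  have k1 := le_lt_trans (hv _ (pt_norm1 v)) h1; have k2 := le_lt_trans (hv _ (pt_norm2 v)) h1.
  rewrite pt_ltnorm/=; apply/andP; split; last by rewrite opprD addrA subrr sub0r normrN.
  move: k1; rewrite !ltr_norml => /andP[? ?].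
  by move: uu => /andP[/orP[?|?] /orP[?|?]]; apply/andP; split; lra.
apply: (le_trans (lerD b1 b2)); rewrite -mulrDr.
apply: (@le_trans _ _ (e' * (`|h| * (`|v| + 1) + `|h| * (`|v| + 1)))).
  by rewrite ler_pM2l// lerD// hv ?pt_norm1 ?pt_norm2.
rewrite /e' le_eqVlt; apply/orP; left; apply/eqP; field.
by rewrite gt_eqF.
Qed.

End plane_calculus.

(** * Convolution with smooth kernels of bounded support *)

Section convolution.
Variable R : realType.
Local Notation pt := (pt R).
Local Notation leb2 := (@leb2 R).
Implicit Types (p r c s t : R) (f g k : pt -> R) (D E : set pt) (x y a v z : pt) (b : bool) (w : seq bool).

Definition ker r k := smooth k /\ forall z, r < `|z| -> k z = 0.

Definition locint f := measurable_fun setT f /\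
  forall r, leb2.-integrable (box 0 r) (EFin \o f).

Lemma ker_pdd b r k : ker r k -> ker r (pdd b k).
Proof.
move=> [sk k0]; split; first exact: smooth_pdd.
move=> z rz; rewrite /pdd.
have d0 : is_derive (crd b z) 1 (fun t => k (axl b z t)) 0.
  apply: isd_near (isd_cst 0 _).
  have lt : \forall y \near z, r < `|y|.
    by near=> y; near: y; apply: (@norm_continuous _ _ z [set u | r < u]); exact: lt_nbhsr.
  near=> t; rewrite k0//; near: t.
  have : axl b z t @[t --> crd b z] --> z.
    apply/cvgrPdist_lt => e e0; exists e => //= t zt.
    rewrite pt_ltnorm; move: zt; rewrite /axl /crd; case: b => /=; rewrite !subrr normr0 e0 ?andbT//.
  by move=> h; exact: (h [set y | r < `|y|] lt).
by rewrite (isd_derive1 d0).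
Unshelve. all: end_near. Qed.

Lemma ker_pdw w r k : ker r k -> ker r (pdw w k).
Proof. by elim: w => // b w IH kk; rewrite pdw_cons; apply: ker_pdd; exact: IH. Qed.

Lemma ker_bounded r k : ker r k -> exists2 C, 0 <= C & forall z, `|k z| <= C.
Proof.
move=> [sk k0]; have [C C0 hC] := continuous_box_bounded 0 r (smooth_continuous sk).
exists C => // z; have [zr|zr] := leP `|z| r; first by apply: hC; rewrite /box/= subr0.
by rewrite k0// normr0.
Qed.

Lemma measurable_subpt x : measurable_fun setT (fun y : pt => x - y).
Proof.
rewrite (_ : (fun y => x - y) = (fun y : pt => x + (-1) *: y)).
  exact: measurable_addpt_scale.
by apply/funext => y; rewrite scaleN1r.
Qed.

Lemma locint_box f r c : locint f -> leb2.-integrable setT (fun y => (c * (`|f y| * \1_(box 0 r) y))%:E).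
Proof.
move=> [mf hf]; have mb := measurable_box (0 : pt) r.
have h : leb2.-integrable setT ((EFin \o f) \_ (box 0 r)).
  by apply: (iffLR (integrable_mkcond _ _)); [exact: mb|exact: hf].
have m1 : measurable_fun setT (fun y => (c * (`|f y| * \1_(box 0 r) y))%:E).
  apply/measurable_EFinP; apply: measurable_funM => //; apply: measurable_funM => //.
  exact: measurableT_comp.
apply: le_integrable (integrableZl measurableT `|c| h) => //.
move=> y _; rewrite /= /patch indicE; case: ifPn => yb.
  by rewrite mulr1 -EFinM lee_fin !normrM !normr_id.
by rewrite !mulr0 normr0 mule0 abse0.
Qed.

Lemma ker_le f r k C x y r' : (forall z, r < `|z| -> k z = 0) -> (forall z, `|k z| <= C) -> `|x| + r <= r' ->
  `|f y * k (x - y)| <= C * (`|f y| * \1_(box 0 r') y).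
Proof.
move=> k0 hC xr; have [yr|yr] := leP `|y| r'.
  rewrite indicE mem_set ?mulr1; last by rewrite /box/= subr0.
  by rewrite normrM mulrC ler_wpM2r.
rewrite k0 ?mulr0 ?normr0; first by rewrite mulr_ge0 ?mulr_ge0// (le_trans (normr_ge0 (k 0))).
rewrite -(ltrD2l `|x|); apply: (le_lt_trans xr); apply: (lt_le_trans yr).
by rewrite -{1}(subKr x y); apply: (le_trans (ler_normB _ _)).
Qed.

Lemma measurable_cvl f k x : measurable_fun setT f -> measurable_fun setT k ->
  measurable_fun setT (fun y => f y * k (x - y)).
Proof.
move=> mf mk; apply: measurable_funM => //; apply: measurableT_comp => //.
exact: measurable_subpt.
Qed.

Lemma cvl_integrable f r k x : locint f -> ker r k ->
  leb2.-integrable setT (EFin \o (fun y => f y * k (x - y))).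
Proof.
move=> lf kk; have [C C0 hC] := ker_bounded kk; have [sk k0] := kk.
have mk := continuous_measurable2 (smooth_continuous sk).
apply: le_integrable (locint_box (`|x| + r) C lf) => //.
  by apply/measurable_EFinP; apply: measurable_cvl => //; case: lf.
move=> y _; rewrite /= lee_fin [X in _ <= X]ger0_norm; last by rewrite !mulr_ge0.
exact: ker_le hC (lexx _).
Qed.

Lemma cvlE f k x : cvl f k x = \int[leb2]_y (f y * k (x - y)).
Proof. by rewrite cvl.unlock. Qed.

Lemma norm_axl_le b x t : crd b x - 1 < t -> t < crd b x + 1 -> `|axl b x t| <= `|x| + 1.
Proof.
rewrite pt_lenorm; have := pt_norm1 x; have := pt_norm2 x.
rewrite /axl /crd; case: b => /=; rewrite !ler_norml => /andP[? ?] /andP[? ?] ? ?;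
  by apply/andP; split; apply/andP; split; lra.
Qed.

(** Differentiation under the integral sign. As long as the coordinate moves by less than 1, the
    integrand lives in the box of radius [|x| + 1 + r], which provides one dominating function. *)
Lemma cvl_isd f r k b x : locint f -> ker r k ->
  is_derive (crd b x) 1 (fun t => cvl f k (axl b x t)) (cvl f (pdd b k) x).
Proof.
move=> lf kk; have kk' := ker_pdd b kk; have [C C0 hC] := ker_bounded kk'; have [sk k0] := kk.
pose F (t : R) (y : pt) := f y * k (axl b x t - y).
have isdF (t : R) y : is_derive t 1 (F ^~ y) (f y * pdd b k (axl b x t - y)).
  apply: isd_scale; rewrite axl_sub.
  have -> : (fun t => k (axl b x t - y)) = (fun t => k (axl b (x - y) (- crd b y + 1 * t))).
    by apply/funext => u; rewrite axl_sub mul1r [- _ + u]addrC.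
  have dk : is_derive (- crd b y + 1 * t) 1 (fun t => k (axl b (x - y) t)) (pdd b k (axl b (x - y) (t - crd b y))).
    rewrite mul1r addrC; apply: isd_line => b' x'.
    by have [] := smooth_isd b' x' sk.
  by have := @isd_comp _ _ (fun u => - crd b y + 1 * u) _ _ _ dk (isd_affine (- crd b y) 1 t); rewrite mul1r.
have -> : (fun t => cvl f k (axl b x t)) = (fun t => \int[leb2]_(y in setT) F t y).
  by apply/funext => t; rewrite cvlE.
have intF t : leb2.-integrable setT (EFin \o F t) by exact: cvl_integrable kk.
have dF t y : derivable (F^~ y) t 1 by have [] := isdF t y.
pose G y := C * (`|f y| * \1_(box 0 (`|x| + 1 + r)) y).
have G0 y : 0 <= G y by rewrite !mulr_ge0.
have intG : leb2.-integrable setT (EFin \o G) by exact: locint_box.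
have Ia : `]crd b x - 1, crd b x + 1[%classic (crd b x) by rewrite /= in_itv/=; apply/andP; split; lra.
have Gub t y : `]crd b x - 1, crd b x + 1[%classic t -> setT y -> `|partial1of2 F t y| <= G y.
  rewrite /= in_itv/= => /andP[t1 t2] _.
  rewrite /partial1of2 (isd_derive1 (isdF t y)); have [_ k0'] := kk'; apply: (@ker_le f r (pdd b k) C _ y _ k0' hC).
  by rewrite lerD2r; exact: norm_axl_le.
apply: DeriveDef.
  by apply: (@derivable_under_integral _ _ _ leb2 F setT measurableT _ _ _ Ia) intG _ => //.
rewrite -derive1E (@differentiation_under_integral _ _ _ leb2 F setT measurableT _ _ _ Ia _ _ G G0 intG)//.
rewrite cvlE; apply: eq_Rintegral => y _; rewrite /partial1of2 (isd_derive1 (isdF _ y)).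
by rewrite axl_crd.
Qed.

Lemma cvl_bound f r k C x r' : locint f -> ker r k -> (forall z, `|k z| <= C) -> `|x| + r <= r' ->
  `|cvl f k x| <= C * \int[leb2]_(y in box 0 r') `|f y|.
Proof.
move=> lf kk hC xr; have mb := measurable_box (0 : pt) r'.
have C0 : 0 <= C := le_trans (normr_ge0 _) (hC 0).
rewrite cvlE; apply: (@le_trans _ _ (\int[leb2]_y `|f y * k (x - y)|)).
  by apply: le_normr_Rintegral => //; exact: cvl_integrable kk.
have -> : C * \int[leb2]_(y in box 0 r') `|f y| = \int[leb2]_y (C * (`|f y| * \1_(box 0 r') y)).
  rewrite RintegralZl//; last first.
    have := locint_box r' 1 lf; congr (_.-integrable _ _).
    by apply/funext => y; rewrite mul1r.
  congr (_ * _); rewrite Rintegral_mkcond; apply: eq_Rintegral => y _.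
  by rewrite /patch indicE; case: ifPn => _; rewrite ?mulr1 ?mulr0.
have [_ k0] := kk.
apply: le_Rintegral => //.
- have := cvl_integrable x lf kk => /integrableP[m i]; apply/integrableP; split.
    by apply: measurableT_comp => //; apply: measurableT_comp => //; exact/measurable_EFinP.
  by under eq_integral do rewrite /= normr_id.
- exact: locint_box.
- by move=> y _; exact: ker_le k0 hC xr.
Qed.

Lemma cvl_pdd f r k b : locint f -> ker r k -> pdd b (cvl f k) = cvl f (pdd b k).
Proof. by move=> lf kk; apply/funext => x; exact/isd_derive1/(cvl_isd _ _ lf kk). Qed.

Lemma cvl_pdw f r k w : locint f -> ker r k -> pdw w (cvl f k) = cvl f (pdw w k).
Proof.
move=> lf kk; elim: w => // b w IH; rewrite !pdw_cons IH.
by apply: cvl_pdd => //; exact: ker_pdw kk.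
Qed.

(** The partial derivatives are convolutions with [pdd b k], hence locally bounded, so the
    convolution is locally Lipschitz. *)
Lemma cvl_continuous f r k : locint f -> ker r k -> continuous (cvl f k).
Proof.
move=> lf kk; apply: lipschitz_continuous => a.
pose I := \int[leb2]_(y in box 0 (`|a| + 1 + r)) `|f y|.
have [C1 C10 hC1] := ker_bounded (ker_pdd true kk).
have [C2 C20 hC2] := ker_bounded (ker_pdd false kk).
exists ((C1 * I + C2 * I) + (C1 * I + C2 * I)).
have I0 : 0 <= I by apply: Rintegral_ge0.
apply: partial_bounded_lipschitz; first by move=> b x; have [] := cvl_isd b x lf kk.
move=> b x bx.
have xr : `|x| + r <= `|a| + 1 + r.
  rewrite lerD2r -[x](subrK a) addrC; apply: (le_trans (ler_normD _ _)).
  by rewrite lerD2l.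
rewrite (cvl_pdd _ lf kk); case: b.
  apply: (le_trans (cvl_bound lf (ker_pdd true kk) hC1 xr)); by rewrite lerDl mulr_ge0.
apply: (le_trans (cvl_bound lf (ker_pdd false kk) hC2 xr)); by rewrite lerDr mulr_ge0.
Qed.

Lemma cvl_smooth f r k : locint f -> ker r k -> smooth (cvl f k).
Proof.
move=> lf kk; apply/smoothP => w; have kw := ker_pdw w kk.
rewrite (cvl_pdw _ lf kk); split; first exact: cvl_continuous kw.
by move=> b x; have [] := cvl_isd b x lf kw.
Qed.

End convolution.

(** * The standard mollifier *)

Section mollifier.
Variable R : realType.
Local Notation pt := (pt R).
Local Notation leb2 := (@leb2 R).
Implicit Types (p r c s t : R) (f g k : pt -> R) (D E : set pt) (x y a v z : pt) (b : bool) (w : seq bool).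

Lemma pdw_prod (f g : R -> R) c w : smooth1 f -> smooth1 g ->
  pdw w (fun x : pt => c * (f x.1 * g x.2)) =
  (fun x => c * (derive1n (count id w) f x.1 * derive1n (count negb w) g x.2)).
Proof.
move=> sf sg; elim: w => // b w IH; rewrite pdw_cons IH; apply/funext => x.
apply: isd_derive1; rewrite /axl /crd; case: b => /=.
- rewrite !add0n; apply: isd_scale.
  have := isd_mul (derivable_isd (sf (count id w) x.1)) (isd_cst (derive1n (count negb w) g x.2) x.1).
  by rewrite mulr0 add0r mulrC.
- rewrite !add0n; apply: isd_scale.
  have := isd_mul (isd_cst (derive1n (count id w) f x.1) x.2) (derivable_isd (sg (count negb w) x.2)).
  by rewrite mulr0 addr0.
Qed.

Lemma smooth1_continuous (f : R -> R) n : smooth1 f -> continuous (derive1n n f).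
Proof. by move=> sf x; apply/differentiable_continuous/derivable1_diffP; exact: sf. Qed.

Lemma smooth_prod (f g : R -> R) c : smooth1 f -> smooth1 g ->
  smooth (fun x : pt => c * (f x.1 * g x.2)).
Proof.
move=> sf sg; apply/smoothP => w; rewrite pdw_prod//; split.
  move=> x; apply: cvgM; first exact: cvg_cst.
  apply: cvgM.
  - apply: (@continuous_comp _ _ _ (fst : pt -> R) (derive1n (count id w) f)); first exact: cvg_fst.
    exact: smooth1_continuous.
  - apply: (@continuous_comp _ _ _ (snd : pt -> R) (derive1n (count negb w) g)); first exact: cvg_snd.
    exact: smooth1_continuous.
move=> b x; have sfx := derivable_isd (sf (count id w) x.1); have sgx := derivable_isd (sg (count negb w) x.2).
rewrite /axl /crd; case: b => /=.
- by have [] := isd_scale c (isd_mul sfx (isd_cst (derive1n (count negb w) g x.2) x.1)).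
- by have [] := isd_scale c (isd_mul (isd_cst (derive1n (count id w) f x.1) x.2) sgx).
Qed.

Lemma derive1n_dilate (f : R -> R) c n : smooth1 f ->
  derive1n n (fun t => f (c * t)) = (fun t => c ^+ n * derive1n n f (c * t)).
Proof.
move=> sf; elim: n => [|n IH]; first by apply/funext => t; rewrite expr0 mul1r.
rewrite derive1nS IH; apply/funext => t; apply: isd_derive1.
have := @isd_comp _ (derive1n n f) (fun u => 0 + c * u) t _ _ _ (isd_affine 0 c t).
rewrite add0r => /(_ _ (derivable_isd (sf n _))) /(isd_scale (c ^+ n)).
rewrite exprSr -mulrA derive1nS; under eq_fun do rewrite add0r; exact.
Qed.

Lemma smooth1_dilate (f : R -> R) c : smooth1 f -> smooth1 (fun t => f (c * t)).
Proof.
move=> sf n x; rewrite derive1n_dilate//.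
have := @isd_comp _ (derive1n n f) (fun u => 0 + c * u) x _ _ _ (isd_affine 0 c x).
rewrite add0r => /(_ _ (derivable_isd (sf n _))) /(isd_scale (c ^+ n)) [].
by under eq_fun do rewrite add0r.
Qed.

(** Not yet normalised; the factor 1 gives it the shape of [smooth_prod]. *)
Definition rho0 : pt -> R := fun x => 1 * (bump1 x.1 * bump1 x.2).

Lemma ker_rho0 : ker 1 rho0.
Proof.
split; first by apply: smooth_prod; exact: smooth1_bump1.
move=> z; rewrite prod_normE lt_max /rho0 => /orP[/ltW/bump1_eq0->|/ltW/bump1_eq0->];
  by rewrite ?(mul0r, mulr0).
Qed.

Lemma rho0_ge0 x : 0 <= rho0 x.
Proof. by rewrite /rho0 mul1r mulr_ge0// bump1_ge0. Qed.

Lemma rho0_gt0 : exists2 e, 0 < e & forall x, `|x| <= 2^-1 -> e <= rho0 x.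
Proof.
(* For [|t| <= 1/2] both [1 + t] and [1 - t] are at least [1/2], so each of the four [flat] factors
   is at least [exp(-2)]. *)
exists (expR (-2) * expR (-2) * (expR (-2) * expR (-2))); first by rewrite !mulr_gt0// expR_gt0.
have hb (t : R) : `|t| <= 2^-1 -> expR (-2) * expR (-2) <= bump1 t.
  rewrite ler_norml => /andP[t1 t2]; rewrite /bump1 /flat !ifT; [|lra..].
  rewrite !expr0 !mul1r; apply: ler_pM; rewrite ?expR_ge0// ler_expR lerN2.
  - rewrite -[leRHS]invrK lef_pV2 ?posrE; lra.
  - rewrite -[leRHS]invrK lef_pV2 ?posrE; lra.
move=> x; rewrite pt_lenorm => /andP[x1 x2]; rewrite /rho0 mul1r.
by apply: ler_pM; rewrite ?mulr_ge0 ?expR_ge0// hb.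
Qed.

Lemma integral_cst_box a r c : 0 <= r ->
  (\int[leb2]_(z in box a r) c%:E = (c * (2 * r) ^+ 2)%:E)%E.
Proof.
move=> r0; rewrite integral_cst; last exact: measurable_box.
by rewrite -[X in (_ * X)%E]/(leb2 (box a r)) leb2_box.
Qed.

Definition irho : R := fine (\int[leb2]_z (rho0 z)%:E)%E.

Lemma measurable_ker r k : ker r k -> measurable_fun setT k.
Proof. by move=> [sk _]; apply: continuous_measurable2; exact: smooth_continuous. Qed.

Lemma int_rho0 : 0 < irho /\ (\int[leb2]_z (rho0 z)%:E = irho%:E)%E.
Proof.
have mr := measurable_ker ker_rho0.
have [C C0 hC] := ker_bounded ker_rho0.
have fin : (\int[leb2]_z (rho0 z)%:E < +oo)%E.
  have fin1 : (\int[leb2]_(z in box (0 : pt)%R 1%R) C%:E < +oo)%E.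
    by rewrite integral_cst_box// ltry.
  apply: le_lt_trans fin1.
  rewrite [leRHS]integral_mkcond; apply: ge0_le_integral => //.
  - by move=> z _; rewrite lee_fin rho0_ge0.
  - exact/measurable_EFinP.
  - apply: (measurable_restrictT _ _).1 => //; exact: measurable_box.
  - move=> z _; rewrite /patch; case: ifPn => zB; rewrite lee_fin.
      exact: le_trans (ler_norm _) (hC z).
    have [_ ->//] := ker_rho0; rewrite ltNge; apply/negP => h; move/negP: zB; apply.
    by rewrite inE /box/= subr0.
have [e e0 he] := rho0_gt0.
have pos : (0 < \int[leb2]_z (rho0 z)%:E)%E.
  have pos1 : (0 < \int[leb2]_(z in box (0 : pt)%R 2^-1%R) e%:E)%E.
    by rewrite integral_cst_box// lte_fin mulr_gt0// exprn_gt0// mulr_gt0.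
  apply: (lt_le_trans pos1).
  rewrite integral_mkcond; apply: ge0_le_integral => //.
  - by move=> z _; rewrite /patch; case: ifPn => // _; rewrite lee_fin ltW.
  - apply: (measurable_restrictT _ _).1 => //; exact: measurable_box.
  - exact/measurable_EFinP.
  - move=> z _; rewrite /patch; case: ifPn => [/set_mem|_]; rewrite lee_fin ?rho0_ge0//.
    by rewrite /box/= subr0 => /he.
split; first by rewrite /irho fine_gt0// pos.
by rewrite /irho fineK// ge0_fin_numE// ltW.
Qed.

(** A tensor product rather than a rescaling of [rho], so that [pdw_prod] computes its
    derivatives. *)
Definition rhos s : pt -> R :=
  fun x => (s^-1 ^+ 2 * irho^-1) * (bump1 (s^-1 * x.1) * bump1 (s^-1 * x.2)).

Definition rho : pt -> R := fun x => irho^-1 * (bump1 x.1 * bump1 x.2).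

Lemma rho1 : ker 1 rho.
Proof.
split; first by apply: smooth_prod; exact: smooth1_bump1.
move=> z; rewrite prod_normE lt_max /rho => /orP[/ltW/bump1_eq0->|/ltW/bump1_eq0->];
  by rewrite ?(mul0r, mulr0).
Qed.

Lemma rhosE s x : rhos s x = s^-1 ^+ 2 * rho (s^-1 *: x).
Proof. by rewrite /rhos /rho mulrA. Qed.

Lemma smooth1_bump1_dilate s : smooth1 (fun t => bump1 (s^-1 * t)).
Proof. by apply: smooth1_dilate; exact: smooth1_bump1. Qed.

Lemma pdw_rhosE s w x : pdw w (rhos s) x = (s^-1 ^+ 2 * irho^-1) *
  (derive1n (count id w) (fun t => bump1 (s^-1 * t)) x.1 *
   derive1n (count negb w) (fun t => bump1 (s^-1 * t)) x.2).
Proof.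
have sb := @smooth1_bump1_dilate s.
exact: (congr1 (@^~ x) (@pdw_prod _ _ (s^-1 ^+ 2 * irho^-1) w sb sb)).
Qed.

Lemma pdw_rhos s w x : pdw w (rhos s) x = s^-1 ^+ 2 * (s^-1 ^+ size w * pdw w rho (s^-1 *: x)).
Proof.
have sb := @smooth1_bump1 R.
rewrite pdw_rhosE /rho pdw_prod//.
rewrite !derive1n_dilate//=.
have -> : size w = (count id w + count negb w)%N by rewrite -(count_predC id w).
by rewrite exprD -![s^-1 *: _]/(s^-1 * _); ring.
Qed.

(** Symmetry of mixed derivatives for the kernel, from which it passes to all mollifications. *)
Lemma pdw_rhos_count s w w' : count id w = count id w' -> count negb w = count negb w' ->
  pdw w (rhos s) = pdw w' (rhos s).
Proof. by move=> h1 h2; apply/funext => x; rewrite !pdw_rhosE h1 h2. Qed.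

Lemma ker_rhos s : 0 < s -> ker s (rhos s).
Proof.
move=> s0; split; first exact: (@smooth_prod _ _ _ (@smooth1_bump1_dilate s) (@smooth1_bump1_dilate s)).
move=> z sz; rewrite rhosE; have [_ ->] := rho1; first by rewrite mulr0.
by rewrite normrZ gtr0_norm ?invr_gt0// mulrC ltr_pdivlMr// mul1r.
Qed.

Lemma rho_ge0 x : 0 <= rho x.
Proof. by rewrite mulr_ge0 ?invr_ge0 ?(ltW int_rho0.1)// mulr_ge0// bump1_ge0. Qed.

Lemma int_rho : (\int[leb2]_z (rho z)%:E = 1)%E.
Proof.
have [i0 iE] := int_rho0.
transitivity (\int[leb2]_z ((irho^-1)%:E * (rho0 z)%:E))%E.
  by apply: eq_integral => z _; rewrite -EFinM /rho0 mul1r.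
rewrite ge0_integralZl//.
- by rewrite iE -EFinM mulVf// gt_eqF.
- by apply/measurable_EFinP; exact: measurable_ker ker_rho0.
- by move=> z _; rewrite lee_fin rho0_ge0.
- by rewrite lee_fin invr_ge0 ltW.
Qed.

Definition rhoC w : R := sval (cid2 (ker_bounded (ker_pdw w rho1))).

Lemma rhoC_ge0 w : 0 <= rhoC w.
Proof. by rewrite /rhoC; case: cid2. Qed.

Lemma rhoC_le w z : `|pdw w rho z| <= rhoC w.
Proof. by rewrite /rhoC; case: cid2 => /= C _ h; exact: h. Qed.

End mollifier.

(** * Bounds and convergence of mollifications *)

Section mollification.
Variable R : realType.
Local Notation pt := (pt R).
Local Notation leb2 := (@leb2 R).
Implicit Types (p r c s t : R) (f g k : pt -> R) (D E : set pt) (x y a v z : pt) (b : bool) (w : seq bool).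

Lemma leb2_sigma_finite : sigma_finite setT leb2.
Proof.
exists (fun n => box 0 n%:R).
  apply/esym/seteqP; split => // x _; exists (Num.bound `|x|) => //.
  by rewrite /box/= subr0 ltW// archi_boundP.
by move=> n; split; [exact: measurable_box|rewrite leb2_box// ltry].
Qed.

(** The measure [leb2] packaged as sigma-finite, so that the plane can be a factor in Tonelli's
    theorem. *)
Definition sleb2 : {sigma_finite_measure set (measurableTypeR R * measurableTypeR R)%type -> \bar R} :=
  HB.pack (@lebesgue_measure R \x @lebesgue_measure R)%E
    (Measure_isSigmaFinite.Build _ _ _ (@lebesgue_measure R \x @lebesgue_measure R)%E leb2_sigma_finite).

Definition mol s f := cvl f (rhos s).

Lemma locint_bounded f : measurable_fun setT f ->
  (forall r, exists C, forall x, box 0 r x -> `|f x| <= C) -> locint f.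
Proof.
move=> mf hf; split => // r; have [C hC] := hf r.
apply: measurable_bounded_integrable.
- exact: measurable_box.
- have [r0|r0] := leP 0 r; first by rewrite -[X in (X < _)%E]/(leb2 (box 0 r)) leb2_box// ltry.
  rewrite (_ : box 0 r = set0) ?measure0//; apply/seteqP; split => // x.
  by rewrite /box/= subr0 => /(le_trans (normr_ge0 _)); rewrite leNgt r0.
- exact: measurable_funTS.
- exists C; split; first exact: num_real.
  by move=> M CM x bx; apply: (le_trans (hC x bx)); exact: ltW.
Qed.

Lemma locint_continuous f : continuous f -> locint f.
Proof.
move=> cf; apply: locint_bounded; first exact: continuous_measurable2.
by move=> r; have [C _ hC] := continuous_box_bounded 0 r cf; exists C.
Qed.

Lemma locint_Lp p f : 1 < p -> measurable_fun setT f -> (Np p setT f < +oo)%E -> locint f.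
Proof.
move=> p1 mf fp; split => // r; apply/integrableP; split; first exact/measurable_EFinP/measurable_funTS.
have mb := measurable_box (0 : pt) r.
have p0 : 0 < p by exact: lt_trans p1.
have [r0|r0] := leP 0 r; last first.
  rewrite (_ : box 0 r = set0) ?integral_set0//; apply/seteqP; split => // x.
  by rewrite /box/= subr0 => /(le_trans (normr_ge0 _)); rewrite leNgt r0.
have mnf : measurable_fun setT (fun x => `|f x|) by exact: measurableT_comp.
have W : (\int[leb2]_(z in box (0 : pt)%R r) (cst 1%R z)%:E <= (1 * (2 * r) ^+ 2)%:E)%E.
  by rewrite -(integral_cst_box (0 : pt) 1 r0).
have := @jensen_weight R _ _ leb2 p _ (box 0 r) (fun x => `|f x|) (cst 1) p1 mb mnf
  (measurable_cst _) (fun=> normr_ge0 _) (fun=> ler01) W.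
under eq_integral do rewrite mulr1.
under [X in (_ <= _ * X)%E -> _]eq_integral do rewrite mulr1.
rewrite -NpE => h.
apply: (@lty_poweRy _ _ p); first by rewrite gt_eqF.
apply: (le_lt_trans h); rewrite lte_mul_pinfty ?lee_fin ?powR_ge0//.
by apply: le_lt_trans fp; apply: subset_Np.
Qed.

Lemma locint_add f g : locint f -> locint g -> locint (fun x => f x + g x).
Proof.
move=> [mf hf] [mg hg]; split; first exact: measurable_funD.
move=> r; apply: (@eq_integrable _ _ _ leb2 _ (measurable_box _ _) ((EFin \o f) \+ (EFin \o g))%E) => //.
by apply: integrableD; [exact: measurable_box|exact: hf|exact: hg].
Qed.

Lemma locint_opp f : locint f -> locint (fun x => - f x).
Proof.
move=> [mf hf]; split; first exact: measurableT_comp.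
move=> r; apply: (@eq_integrable _ _ _ leb2 _ (measurable_box _ _) (\- (EFin \o f))%E) => //.
by apply: integrableN; exact: hf.
Qed.

Lemma locint_cst c : locint (fun _ => c).
Proof. by apply: locint_continuous => x; exact: cvg_cst. Qed.

Lemma cvl_sub f g r k x : locint f -> locint g -> ker r k ->
  cvl (fun y => f y - g y) k x = cvl f k x - cvl g k x.
Proof.
move=> lf lg kk; rewrite !cvlE -RintegralB//; last 2 first.
- exact: cvl_integrable kk.
- exact: cvl_integrable kk.
by apply: eq_Rintegral => y _; rewrite mulrBl.
Qed.

(** Substitution [y = x - s z]: the Jacobian [s^2] cancels the normalisation of [rhos s], and each
    derivative leaves a factor [1/s]. *)
Lemma int_abs_kernel f s w x : 0 < s -> measurable_fun setT f ->
  (\int[leb2]_y (`|f y * pdw w (rhos s) (x - y)|)%:E =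
   \int[leb2]_z (`|f (x + (- s) *: z)| * (s^-1 ^+ size w * `|pdw w (@rho R) z|))%:E)%E.
Proof.
move=> s0 mf; have kk := ker_pdw w (ker_rhos s0).
pose h y := (`|f y * pdw w (rhos s) (x - y)|)%:E.
have mh : measurable_fun setT h.
  apply/measurable_EFinP; apply: measurableT_comp => //; apply: measurable_cvl => //.
  exact: measurable_ker kk.
have sn0 : - s != 0 by rewrite oppr_eq0 gt_eqF.
have h0 y : (0 <= h y)%E by rewrite lee_fin.
have := @ge0_integral_aff R x (- s) h sn0 mh h0.
have i2 : 0 < (- s) ^+ 2 by rewrite sqrrN exprn_gt0.
move=> /(congr1 (fun X => ((- s) ^+ 2)%:E * X)%E).
rewrite muleA -EFinM mulfV ?gt_eqF// mul1e => <-.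
rewrite -ge0_integralZl//; last 2 first.
- by apply: measurableT_comp => //; exact: measurable_aff.
- by rewrite lee_fin ltW.
apply: eq_integral => z _; rewrite /h -EFinM; congr (_%:E).
rewrite -[aff x (- s) z]/(x + (- s) *: z) opprD addrA subrr sub0r -scaleNr opprK.
rewrite pdw_rhos scalerA mulVf ?gt_eqF// scale1r sqrrN.
rewrite !normrM (ger0_norm (exprn_ge0 _ _)) ?invr_ge0 ?(ltW s0)//.
rewrite (ger0_norm (_ : 0 <= s^-1)) ?invr_ge0 ?(ltW s0)//.
by field; rewrite gt_eqF.
Qed.

Lemma cvl_rhos_bound f s w x : 0 < s -> locint f ->
  ((`|cvl f (pdw w (rhos s)) x|)%:E <= (rhoC R w * s^-1 ^+ size w)%:E *
     \int[leb2]_(z in box (0 : pt)%R 1%R) (`|f (x + (- s) *: z)|)%:E)%E.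
Proof.
move=> s0 lf; have [mf _] := lf; have kk := ker_pdw w (ker_rhos s0).
have si0 : 0 <= s^-1 ^+ size w by rewrite exprn_ge0// invr_ge0 ltW.
have mb := measurable_box (0 : pt) 1.
have mfs : measurable_fun setT (fun z => f (x + (- s) *: z)).
  by apply: measurableT_comp => //; exact: measurable_addpt_scale.
have mr : measurable_fun setT (pdw w (@rho R)) := measurable_ker (ker_pdw w (rho1 R)).
apply: (@le_trans _ _ (\int[leb2]_y (`|f y * pdw w (rhos s) (x - y)|)%:E)%E).
  have i := cvl_integrable x lf kk.
  rewrite cvlE EFin_normr_Rintegral//.
  by apply: (le_trans (le_abse_integral _ _ _)) => //; exact: measurable_int i.
rewrite int_abs_kernel// -ge0_integralZl//; last 2 first.
- by apply: measurable_funTS; apply/measurable_EFinP; exact: measurableT_comp.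
- by rewrite lee_fin mulr_ge0// rhoC_ge0.
rewrite [leRHS]integral_mkcond; apply: ge0_le_integral => //.
- by move=> z _; rewrite lee_fin !mulr_ge0.
- apply/measurable_EFinP; apply: measurable_funM; first exact: measurableT_comp.
  by apply: measurable_funM => //; exact: measurableT_comp.
- apply: (measurable_restrictT _ _).1 => //; apply: measurable_funTS.
  apply: emeasurable_funM => //; apply/measurable_EFinP; exact: measurableT_comp.
- move=> z _; rewrite /patch; case: ifPn => zb.
    rewrite -EFinM lee_fin mulrC [rhoC _ _ * _]mulrC -!mulrA.
    rewrite ler_wpM2l// ler_wpM2r//; exact: rhoC_le.
  have [_ ->] := ker_pdw w (rho1 R); first by rewrite normr0 !mulr0.
  rewrite ltNge; apply/negP => h; move/negP: zb; apply.
  by rewrite inE /box/= subr0.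
Qed.

Lemma cvl_cst c s x : 0 < s -> cvl (fun _ => c) (rhos s) x = c.
Proof.
move=> s0.
have i : leb2.-integrable setT (EFin \o (fun y => rhos s (x - y))).
  have := cvl_integrable x (locint_cst 1) (ker_rhos s0).
  by congr (_.-integrable _ _); apply/funext => y; rewrite /= mul1r.
rewrite cvlE RintegralZl// (_ : Rintegral _ _ _ = 1) ?mulr1//.
have := @int_abs_kernel (fun=> 1) s [::] x s0 (measurable_cst _).
under eq_integral => y _.
  rewrite mul1r /= ger0_norm; last first.
    by rewrite rhosE mulr_ge0// ?rho_ge0// sqr_ge0.
  over.
under [X in _ = X -> _]eq_integral => z _.
  rewrite normr1 mul1r expr0 mul1r ger0_norm; last exact: rho_ge0.
  over.
by rewrite int_rho /Rintegral => ->.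
Qed.

Lemma pdw_cst w c : pdw w (fun _ : pt => c) = fun _ => if w is [::] then c else 0.
Proof.
elim: w => // b w IH; rewrite pdw_cons IH; apply/funext => x.
by apply: isd_derive1; exact: isd_cst.
Qed.

Lemma pdw_mol s f w : 0 < s -> locint f -> pdw w (mol s f) = cvl f (pdw w (rhos s)).
Proof. by move=> s0 lf; rewrite (cvl_pdw _ lf (ker_rhos s0)). Qed.

Lemma smooth_mol s f : 0 < s -> locint f -> smooth (mol s f).
Proof. by move=> s0 lf; exact: cvl_smooth (ker_rhos s0). Qed.

(** Subtracting a constant from [f] changes the value of the mollification by that constant and no
    derivative. Taking [c = f x] bounds derivatives of every order by the mean oscillation of [f]
    around [x]. *)
Lemma mol_bound f s w x c : 0 < s -> locint f ->
  ((`|pdw w (mol s f) x - (if w is [::] then c else 0)|)%:E <= (rhoC R w * s^-1 ^+ size w)%:E *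
     \int[leb2]_(z in box (0 : pt)%R 1%R) (`|f (x + (- s) *: z)%R - c|)%:E)%E.
Proof.
move=> s0 lf; have lc := locint_cst c.
have lfc : locint (fun y => f y - c) by apply: (@locint_add f (fun=> - c)) => //; exact: locint_cst.
apply: le_trans (cvl_rhos_bound w x s0 lfc); rewrite lee_fin.
rewrite (cvl_sub _ lf lc (ker_pdw w (ker_rhos s0))).
rewrite -(pdw_mol w s0 lf) -(cvl_pdw w lc (ker_rhos s0)).
have -> : cvl (fun=> c) (rhos s) = (fun=> c) by apply/funext => y; exact: cvl_cst.
by rewrite pdw_cst.
Qed.

Lemma Np_avg_weight d (T : measurableType d) (m : {sigma_finite_measure set T -> \bar R})
  p (E : set pt) (A : set T) (h : pt -> R) (F : pt * T -> R) (w : T -> R) (C W : R) :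
  1 < p -> measurable E -> measurable A -> 0 <= C ->
  measurable_fun setT h -> measurable_fun setT F -> measurable_fun setT w -> (forall z : T, 0 <= w z) ->
  (\int[m]_(t in A) (w t)%:E <= W%:E)%E ->
  (forall x, E x -> ((`|h x|)%:E <= C%:E * \int[m]_(t in A) (`|F (x, t)| * w t)%:E)%E) ->
  (Np p E h <= (C `^ p * W `^ (p - 1))%:E *
     \int[m]_(t in A) ((w t)%:E * Np p E (fun x => F (x, t))))%E.
Proof.
move=> p1 mE mA C0 mh mF mw w0 hW hF; have p0 : 0 < p by exact: lt_trans p1.
have mnF : measurable_fun setT (fun q : pt * T => `|F q|) by exact: measurableT_comp.
have mFw : measurable_fun setT (fun q : pt * T => `|F q| * w q.2).
  by apply: measurable_funM => //; exact: measurableT_comp.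
have J : (\int[leb2]_(x in E) ((\int[m]_(t in A) (`|F (x, t)| * w t)%R%:E) `^ p) <=
   (W `^ (p - 1))%:E * \int[m]_(t in A) ((w t)%:E * \int[leb2]_(x in E) (`|F (x, t)| `^ p)%:E))%E.
  by apply: (@jensen_tonelli R _ _ _ _ sleb2 m p W E A (fun q : pt * T => `|F q|) w) => //.
have Imeas : measurable_fun setT (fun x => \int[m]_(t in A) (`|F (x, t)| * w t)%:E)%E.
  apply: (measurable_int_snd m (G := fun q : pt * T => `|F q| * w q.2)) => //.
  by move=> q; rewrite mulr_ge0.
apply: (@le_trans _ _ ((C `^ p)%:E * \int[leb2]_(x in E)
    ((\int[m]_(t in A) (`|F (x, t)| * w t)%R%:E) `^ p))%E).
  rewrite NpE -ge0_integralZl//; last 3 first.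
  - by apply: measurable_funTS; apply: (measurableT_comp (measurable_poweR _)).
  - by move=> x _; exact: poweR_ge0.
  - by rewrite lee_fin powR_ge0.
  apply: ge0_le_integral => //.
  - by apply: measurable_norm_powR.
  - by apply: measurable_funTS; apply: emeasurable_funM => //; apply: (measurableT_comp (measurable_poweR _)).
  - move=> x Ex; rewrite -!poweR_EFin -poweRM//; last first.
      by apply: integral_ge0 => z _; rewrite lee_fin mulr_ge0.
    apply: gt0_ler_poweR; first exact: ltW.
    + by rewrite in_itv/= leey andbT lee_fin.
    + rewrite in_itv/= leey andbT mule_ge0//.
      by apply: integral_ge0 => z _; rewrite lee_fin mulr_ge0.
    + exact: hF.
rewrite [in X in (_ <= X)%E]EFinM -muleA; apply: lee_wpmul2l; first by rewrite lee_fin powR_ge0.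
apply: (le_trans J); rewrite le_eqVlt; apply/orP; left; apply/eqP; congr (_ * _)%E.
by apply: eq_integral => z _; rewrite NpE.
Qed.

Lemma measurable_Np_snd d (T : measurableType d) p E (F : pt * T -> R) :
  measurable E -> measurable_fun setT F -> measurable_fun setT (fun t : T => Np p E (fun x => F (x, t))).
Proof.
move=> mE mF; under eq_fun do rewrite NpE.
apply: (measurable_int_fst sleb2 (G := fun q : pt * T => `|F q| `^ p)) => //.
apply: (measurableT_comp (measurable_powR _)); exact: measurableT_comp.
Qed.

(** Constant weight on [box 0 1], whose area is the 4 in the constant. *)
Lemma Np_avg p E (h : pt -> R) (F : pt * pt -> R) C (K : \bar R) : 1 < p -> measurable E -> 0 <= C ->
  measurable_fun setT h -> measurable_fun setT F ->
  (forall x, E x -> ((`|h x|)%:E <= C%:E *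
     \int[leb2]_(z in box (0 : pt)%R 1%R) (`|F (x, z)|)%:E)%E) ->
  (forall z, box 0 1 z -> (Np p E (fun x => F (x, z)) <= K)%E) ->
  (Np p E h <= ((4 * C) `^ p)%:E * K)%E.
Proof.
move=> p1 mE C0 mh mF hF hK; have p0 : 0 < p by exact: lt_trans p1.
have mb := measurable_box (0 : pt) 1.
have W : (\int[leb2]_(z in box (0 : pt)%R 1%R) (cst 1%R z)%:E <= 4%:E)%E.
  by rewrite (integral_cst_box (0 : pt) 1 ler01) lee_fin; lra.
have K0 : (0 <= K)%E.
  by apply: le_trans (hK 0 _); [exact: Np_ge0|rewrite /box/= subrr normr0].
apply: (@le_trans _ _ ((C `^ p * 4 `^ (p - 1))%:E *
     \int[leb2]_(z in box (0 : pt)%R 1%R) ((cst 1%R z)%:E * Np p E (fun x => F (x, z))))%E).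
  apply: (@Np_avg_weight _ _ sleb2) => //.
  by move=> x Ex; under eq_integral do rewrite mulr1; exact: hF.
apply: (@le_trans _ _ ((C `^ p * 4 `^ (p - 1))%:E * (K * 4%:E))%E).
  apply: lee_wpmul2l; first by rewrite lee_fin mulr_ge0// powR_ge0.
  apply: (@le_trans _ _ (\int[leb2]_(z in box (0 : pt)%R 1%R) (cst K z))%E).
    apply: ge0_le_integral => //.
    - by move=> z _; rewrite mul1e; exact: Np_ge0.
    - apply: measurable_funTS; under eq_fun do rewrite mul1e.
      exact: measurable_Np_snd.
    - by move=> z bz; rewrite mul1e; exact: hK.
  rewrite integral_cst// -[X in (_ * X)%E]/(leb2 (box 0 1)) leb2_box//.
  by apply: lee_wpmul2l => //; rewrite lee_fin; lra.
rewrite le_eqVlt; apply/orP; left; apply/eqP.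
rewrite powRM// muleC -muleA -EFinM muleC; congr (_%:E * _)%E.
have -> : (4 : R) `^ p = 4 `^ (p - 1) * 4.
  rewrite -{3}(powRr1 (_ : 0 <= 4)) ?ler0n// -powRD ?subrK// (negbTE (lt0r_neq0 p0))//.
ring.
Qed.

Lemma measurable_addpair c : measurable_fun setT (fun y : pt * pt => y.1 + c *: y.2).
Proof.
have m1 : measurable_fun setT (fun q : pt * pt => q.1.1 + c * q.2.1).
  by apply: measurable_funD; [|apply: measurable_funM => //]; apply: measurableT_comp.
have m2 : measurable_fun setT (fun q : pt * pt => q.1.2 + c * q.2.2).
  by apply: measurable_funD; [|apply: measurable_funM => //]; apply: measurableT_comp.
by apply/measurable_fun_pairP; split; [exact: m1|exact: m2].
Qed.

Lemma measurable_mol s f : 0 < s -> locint f -> measurable_fun setT (mol s f).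
Proof. by move=> s0 lf; apply: continuous_measurable2; apply: smooth_continuous; exact: smooth_mol. Qed.

Lemma Np_mol p s E E' f : 1 < p -> 0 < s -> measurable E -> measurable E' -> locint f ->
  (forall x z, E x -> `|z| <= s -> E' (x + z)) ->
  (Np p E (mol s f) <= ((4 * rhoC R [::]) `^ p)%:E * Np p E' f)%E.
Proof.
move=> p1 s0 mE mE' lf EE'; have [mf _] := lf.
apply: (@Np_avg _ _ _ (fun q : pt * pt => f (q.1 + (- s) *: q.2))) => //.
- exact: rhoC_ge0.
- exact: measurable_mol.
- by apply: measurableT_comp => //; exact: measurable_addpair.
- by move=> x _; have := cvl_rhos_bound [::] x s0 lf; rewrite /= expr0 mulr1.
- move=> z bz; apply: (@Np_shift _ _ _ _ ((- s) *: z)) => // x Ex; apply: EE' => //.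
  move: bz; rewrite /box/= subr0 normrZ normrN gtr0_norm// => bz.
  by rewrite -[leRHS]mulr1 ler_pM2l.
Qed.

(** The error at [x] is at most a multiple of the integral of [|f(x - s z) - f x|] over [z] in the
    unit box, so continuity of translations in L^p applies. *)
Lemma mol_cvg p f : 1 < p -> measurable_fun setT f -> (Np p setT f < +oo)%E ->
  forall e : R, 0 < e -> exists2 d : R, 0 < d & forall s, 0 < s -> s <= d ->
    (Np p setT (fun x => mol s f x - f x)%R <= e%:E)%E.
Proof.
move=> p1 mf fp e e0; have p0 : 0 < p by exact: lt_trans p1.
have lf := locint_Lp p1 mf fp.
pose C := (4 * rhoC R [::]) `^ p + 1.
have C0 : 0 < C by rewrite ltr_wpDl// powR_ge0.
have [_ /(_ (e / C))] := translation_continuous p0 mf fp.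
case=> [|d d0 hd]; first by rewrite divr_gt0.
exists d => // s s0 sd.
apply: (@le_trans _ _ (((4 * rhoC R [::]) `^ p)%:E * (e / C)%:E)%E); last first.
  by rewrite -EFinM lee_fin mulrA ler_pdivrMr// mulrC ler_pM2l// /C lerDl.
apply: (@Np_avg _ _ _ (fun q : pt * pt => f (q.1 + (- s) *: q.2) - f q.1)) => //.
- exact: rhoC_ge0.
- by apply: measurable_funB => //; exact: measurable_mol.
- apply: measurable_funB; last exact: measurableT_comp.
  by apply: measurableT_comp => //; exact: measurable_addpair.
- by move=> x _; have := @mol_bound f s [::] x (f x) s0 lf; rewrite /= expr0 mulr1.
- move=> z bz; apply: (hd ((- s) *: z)).
  move: bz; rewrite /box/= subr0 normrZ normrN gtr0_norm// => bz.
  by apply: le_trans sd; rewrite -[leRHS]mulr1 ler_pM2l.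
Qed.

(** Both functions are L^p limits of the same mollifications; this yields the uniqueness of weak
    derivatives. *)
Lemma Np_mol_sub_cvg p f g (s : nat -> R) : 1 < p -> (forall n, 0 < s n) -> s @ \oo --> (0 : R) ->
  measurable_fun setT f -> measurable_fun setT g -> (Np p setT f < +oo)%E -> (Np p setT g < +oo)%E ->
  (forall n, mol (s n) f = mol (s n) g) -> Np p setT (fun x => f x - g x) = 0%E.
Proof.
move=> p1 s0 scv mf mg fp gp fg; have p0 : 0 < p by exact: lt_trans p1.
apply/eqP; rewrite eq_le Np_ge0 andbT; apply/lee_addgt0Pr => e e0; rewrite add0e.
pose e' := e / 2 / (2 `^ p).
have p2 : 0 < 2 `^ p :> R by rewrite powR_gt0.
have e'0 : 0 < e' by rewrite !divr_gt0.
have [d1 d10 h1] := mol_cvg p1 mf fp e'0; have [d2 d20 h2] := mol_cvg p1 mg gp e'0.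
have d0 : 0 < Num.min d1 d2 by rewrite lt_min d10.
have /cvgrPdist_le/(_ _ d0)[N _ /(_ N (leqnn N))] := scv.
rewrite sub0r normrN gtr0_norm// le_min => /andP[sd1 sd2].
have lf := locint_Lp p1 mf fp; have lg := locint_Lp p1 mg gp.
have mm1 := measurable_mol (s0 N) lf; have mm2 := measurable_mol (s0 N) lg.
rewrite (@eq_Np _ _ _ _ (fun x => - (mol (s N) f x - f x) + (mol (s N) g x - g x))); last first.
  by move=> x _; rewrite fg; ring.
apply: (le_trans (Np_add (ltW p0) measurableT _ _)).
- by apply: measurableT_comp => //; exact: measurable_funB.
- exact: measurable_funB.
apply: (@le_trans _ _ ((2 `^ p)%:E * (e'%:E + e'%:E))%E).
  by apply: lee_wpmul2l; [rewrite lee_fin ltW|apply: leeD; rewrite ?Np_opp; [exact: h1|exact: h2]].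
rewrite -EFinD -EFinM lee_fin /e' le_eqVlt; apply/orP; left; apply/eqP.
by field; rewrite gt_eqF.
Qed.

Lemma mol_cvg_pt f x : continuous f -> forall e : R, 0 < e -> exists2 d : R, 0 < d &
  forall s, 0 < s -> s <= d -> `|mol s f x - f x| <= e.
Proof.
move=> cf e e0; have lf := locint_continuous cf.
pose C := rhoC R [::] * 4 + 1.
have C0 : 0 < C by rewrite ltr_wpDl// mulr_ge0// rhoC_ge0.
have eC : 0 < e / C by rewrite divr_gt0.
have /cvgrPdist_le/(_ _ eC) := cf x; rewrite -nbhs_ballE => -[d /= d0 hd].
exists (d / 2); first by rewrite divr_gt0.
move=> s s0 sd.
rewrite -lee_fin; have := @mol_bound f s [::] x (f x) s0 lf; rewrite /= expr0 mulr1 => h.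
apply: (le_trans h).
apply: (@le_trans _ _ ((rhoC R [::])%:E * \int[leb2]_(z in box (0 : pt)%R 1%R) (e / C)%R%:E)%E).
  apply: lee_wpmul2l; first by rewrite lee_fin rhoC_ge0.
  apply: ge0_le_integral => //.
  - exact: measurable_box.
  - apply: measurable_funTS; apply/measurable_EFinP; apply: measurableT_comp => //.
    apply: measurable_funB => //; apply: measurableT_comp; first exact: continuous_measurable2.
    exact: measurable_addpt_scale.
  - move=> z; rewrite /box/= subr0 => z1; rewrite lee_fin distrC; apply: hd.
    have : `|x - (x + - s *: z)| < d.
      rewrite opprD addrA subrr sub0r normrN normrZ normrN gtr0_norm//.
      apply: (@le_lt_trans _ _ s); first by rewrite -[leRHS]mulr1 ler_pM2l.
      lra.
    by rewrite pt_ltnorm => /andP[? ?]; split.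
rewrite integral_cst_box// -EFinM lee_fin.
have -> : rhoC R [::] * (e / C * (2 * 1) ^+ 2) = (rhoC R [::] * 4 * e) / C by ring.
by rewrite ler_pdivrMr// [e * C]mulrC ler_pM2r// /C lerDl.
Qed.

Lemma norm_FTC_le (u u' : R -> R) : (forall t : R, is_derive t 1 u (u' t)) -> continuous u' ->
  ((`|u 1%R - u 0%R|)%:E <= \int[@lebesgue_measure R]_(t in `[0%R, 1%R]) (`|u' t|)%:E)%E.
Proof.
move=> du cu'.
have cu : continuous u by move=> t; apply: differentiable_continuous; apply/derivable1_diffP; exact: (@ex_derive _ _ _ _ _ _ _ (du t)).
have := @continuous_FTC2 R u' u 0 1 ltr01 (continuous_subspaceT cu').
move=> FTC; rewrite -abse_EFin EFinB -FTC.
- apply: (le_trans (le_abse_integral _ _ _)) => //.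
  by apply/measurable_EFinP; apply: measurable_funTS; exact: continuous_measurable_fun.
- split => //.
  + by apply: cvg_at_right_filter; exact: cu.
  + by apply: cvg_at_left_filter; exact: cu.
- by move=> t _; exact: isd_derive1.
Qed.

Lemma smooth_segment_le f x v : smooth f ->
  ((`|f (x + v)%R - f x|)%:E <= (`|v|)%:E * \int[@lebesgue_measure R]_(t in `[0%R, 1%R])
    (`|pdd true f (x + t *: v)%R| + `|pdd false f (x + t *: v)%R|)%:E)%E.
Proof.
move=> sf.
have df b y : derivable (fun t => f (axl b y t)) (crd b y) 1 by have [_] := (smoothP f).1 sf [::]; exact.
have cf b : continuous (pdd b f) by apply: smooth_continuous; exact: smooth_pdd.
have cl : continuous (fun t : R => x + t *: v).
  move=> t; apply: cvgD; first exact: cvg_cst.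
  by apply: cvgZr_tmp; exact: cvg_id.
have cfl b : continuous (fun t : R => pdd b f (x + t *: v)).
  by move=> t; apply: continuous_comp; [exact: cl|exact: cf].
have cs : continuous (fun t : R => v.1 * pdd true f (x + t *: v) + v.2 * pdd false f (x + t *: v)).
  by move=> t; apply: cvgD; apply: cvgM; try exact: cvg_cst; exact: cfl.
have := norm_FTC_le (fun t => is_derive_segment x v t df cf) cs.
rewrite scale1r scale0r addr0 => h; apply: (le_trans h).
have mn b : measurable_fun setT (fun t : R => `|pdd b f (x + t *: v)|).
  by apply: measurableT_comp => //; exact: continuous_measurable_fun.
rewrite -ge0_integralZl//; last first.
  by apply: measurable_funTS; apply/measurable_EFinP; apply: measurable_funD; exact: mn.
apply: ge0_le_integral => //.
- by apply: measurable_funTS; apply/measurable_EFinP; apply: measurableT_comp => //; exact: continuous_measurable_fun.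
- by apply: measurable_funTS; apply: emeasurable_funM => //; apply/measurable_EFinP; apply: measurable_funD; exact: mn.
- move=> t _; rewrite -EFinM lee_fin mulrDr; apply: (le_trans (ler_normD _ _)).
  by apply: lerD; rewrite normrM ler_wpM2r//; [exact: pt_norm1|exact: pt_norm2].
Qed.

End mollification.

(** * Functions with p-integrable gradient along segments *)

Section segments.
Variable R : realType.
Local Notation pt := (pt R).
Local Notation leb2 := (@leb2 R).
Local Notation mu := (@lebesgue_measure R).
Implicit Types (p r c s : R) (f k : pt -> R) (D E : set pt) (x y a v z : pt) (b : bool) (w : seq bool).

(* [g] is the weak partial derivative of [f] in the direction [b] ([true] for the
   first variable); stating it on mollifications makes it available pointwise. *)
Definition wpd b f g := forall s, 0 < s -> pdd b (mol s f) = mol s g.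

Lemma limn_einf0_small (u : nat -> \bar R) : limn_einf u = 0%E -> forall (e : R) n, 0 < e ->
  exists2 j, (n <= j)%N & (u j < e%:E)%E.
Proof.
move=> u0 e n e0; apply: contrapT => h.
have : (e%:E <= einfs u n)%E.
  apply: le_ereal_inf_tmp => _ [j /= nj <-]; rewrite leNgt; apply/negP => uj.
  by apply: h; exists j.
have : (einfs u n <= limn_einf u)%E.
  rewrite limn_einf_lim (cvg_lim _ (@cvg_einfs_sup _ u))//.
  by apply: ereal_sup_ubound; exists n.
by rewrite u0 => /[swap] /le_trans /[apply]; rewrite lee_fin leNgt e0.
Qed.

Lemma limn_einf_ge0 (u : nat -> \bar R) : (forall n, 0 <= u n)%E -> (0 <= limn_einf u)%E.
Proof.
move=> u0; rewrite limn_einf_lim; apply: lime_ge; first exact: is_cvg_einfs.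
by apply: nearW => n; apply: le_ereal_inf_tmp => _ [j _ <-].
Qed.

Lemma cvg0_limn_einf (u : nat -> \bar R) : u @ \oo --> 0%E -> limn_einf u = 0%E.
Proof. by move=> cu; rewrite is_cvg_limn_einfE; [exact/cvg_lim|apply/cvg_ex; exists 0%E]. Qed.

Lemma measurable_pairpt d (T : measurableType d) (P : T -> pt) :
  measurable_fun setT (fun t : T => (P t).1) -> measurable_fun setT (fun t : T => (P t).2) -> measurable_fun setT P.
Proof. by move=> m1 m2; apply/measurable_fun_pairP; split. Qed.

Lemma measurable_segment (P Q : pt -> pt) : measurable_fun setT P -> measurable_fun setT Q ->
  measurable_fun setT (fun q : pt * R => P q.1 + q.2 *: (Q q.1 - P q.1)).
Proof.
move=> mP mQ.
have m11 : measurable_fun setT (fun q : pt * R => (P q.1).1) by do 2 apply: measurableT_comp => //.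
have m12 : measurable_fun setT (fun q : pt * R => (P q.1).2) by do 2 apply: measurableT_comp => //.
have m21 : measurable_fun setT (fun q : pt * R => (Q q.1).1) by do 2 apply: measurableT_comp => //.
have m22 : measurable_fun setT (fun q : pt * R => (Q q.1).2) by do 2 apply: measurableT_comp => //.
apply: measurable_pairpt => /=.
- by apply: measurable_funD => //; apply: measurable_funM => //; apply: measurable_funB.
- by apply: measurable_funD => //; apply: measurable_funM => //; apply: measurable_funB.
Qed.

(** The parameter 0 is excluded because the weights [t^(-al)] used below are singular there. *)
Definition segavg (g : pt -> R) a x : \bar R := (\int[mu]_(t in `]0%R, 1%R]) (`|g (a + t *: (x - a))%R|)%:E)%E.

Lemma measurable_segavg (g : pt -> R) (P Q : pt -> pt) : measurable_fun setT g ->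
  measurable_fun setT P -> measurable_fun setT Q ->
  measurable_fun setT (fun x => segavg g (P x) (Q x)).
Proof.
move=> mg mP mQ; rewrite /segavg.
apply: (measurable_int_snd mu (G := fun q : pt * R => `|g (P q.1 + q.2 *: (Q q.1 - P q.1))|)) => //.
by apply: measurableT_comp => //; apply: measurableT_comp => //; exact: measurable_segment.
Qed.

Lemma segavg_ge0 g a x : (0 <= segavg g a x)%E.
Proof. exact: integral_ge0. Qed.

Lemma measurable_line (g : pt -> R) a v : measurable_fun setT g -> measurable_fun setT (fun t : R => g (a + t *: v)).
Proof.
move=> mg; apply: measurableT_comp => //.
apply: measurable_pairpt => /=; by apply: measurable_funD => //; apply: measurable_funM.
Qed.

Lemma segavg_le_add (g h k : pt -> R) a x : measurable_fun setT g -> measurable_fun setT h -> measurable_fun setT k ->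
  (forall y, `|g y| <= `|h y| + `|k y|) -> (segavg g a x <= segavg h a x + segavg k a x)%E.
Proof.
move=> mg mh mk ghk; rewrite /segavg.
have ml (l : pt -> R) : measurable_fun setT l -> measurable_fun (`]0, 1]%classic : set R) (fun t : R => (`|l (a + t *: (x - a))|)%:E).
  move=> ml; apply: measurable_funTS; apply/measurable_EFinP; apply: measurableT_comp => //.
  exact: measurable_line.
rewrite -ge0_integralD//; try exact: ml.
apply: ge0_le_integral => //; first exact: ml.
- by apply: emeasurable_funD; exact: ml.
- by move=> t _; rewrite -EFinD lee_fin.
Qed.

Lemma smooth_segavg_le f a x : smooth f ->
  ((`|f x - f a|)%:E <= (`|x - a|)%:E * segavg (fun y => `|pdd true f y| + `|pdd false f y|)%R a x)%E.
Proof.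
move=> sf; have := smooth_segment_le a (x - a) sf.
rewrite addrCA subrr addr0 => h; apply: (le_trans h).
have mg b := continuous_measurable2 (smooth_continuous (smooth_pdd b sf)).
apply: lee_wpmul2l; first by rewrite lee_fin.
rewrite /segavg integral_itv_obnd_cbnd; last first.
  apply: measurable_funTS; apply/measurable_EFinP; apply: measurableT_comp => //.
  apply: (@measurable_line (fun y => `|pdd true f y| + `|pdd false f y|)).
  by apply: measurable_funD; apply: measurableT_comp.
apply: ge0_le_integral => //.
- apply: measurable_funTS; apply/measurable_EFinP.
  apply: (@measurable_line (fun y => `|pdd true f y| + `|pdd false f y|)).
  by apply: measurable_funD; apply: measurableT_comp.
- apply: measurable_funTS; apply/measurable_EFinP; apply: measurableT_comp => //.
  apply: (@measurable_line (fun y => `|pdd true f y| + `|pdd false f y|)).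
  by apply: measurable_funD; apply: measurableT_comp.
- by move=> t _; rewrite lee_fin ler_norm.
Qed.

Definition grnorm (g : bool -> pt -> R) : pt -> R := fun x => `|g true x| + `|g false x|.

Lemma grnorm_ge0 g x : 0 <= grnorm g x. Proof. by rewrite addr_ge0. Qed.

Lemma measurable_grnorm (g : bool -> pt -> R) : (forall b, measurable_fun setT (g b)) -> measurable_fun setT (grnorm g).
Proof. by move=> mg; apply: measurable_funD; apply: measurableT_comp. Qed.

Lemma Np_grnorm p D g : 0 <= p -> measurable D -> (forall b, measurable_fun setT (g b)) ->
  (Np p D (grnorm g) <= (2 `^ p)%:E * (Np p D (g true) + Np p D (g false)))%E.
Proof.
move=> p0 mD mg; apply: (le_trans (@Np_add _ p D (fun x => `|g true x|) (fun x => `|g false x|) _ _ _ _)) => //.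
- exact: measurableT_comp.
- exact: measurableT_comp.
by rewrite (@eq_Np_norm _ _ _ _ (g true)) ?(@eq_Np_norm _ _ _ (fun x => `|g false x|) (g false)) // => x _; rewrite normr_id.
Qed.

(* The inequality holds for the mollifications; their gradients converge in L^p along
   almost every segment by Fatou's lemma. *)
Lemma segment_ae p E (P Q : pt -> pt) (C : R) f (g : bool -> pt -> R) : 1 < p -> measurable E ->
  measurable_fun setT P -> measurable_fun setT Q -> continuous f ->
  (forall b, measurable_fun setT (g b)) -> (forall b, Np p setT (g b) < +oo)%E ->
  (forall b, wpd b f (g b)) -> 0 <= C ->
  (forall k, measurable_fun setT k ->
     (\int[leb2]_(x in E) (segavg k (P x) (Q x) `^ p) <= C%:E * Np p setT k)%E) ->
  exists Z, [/\ measurable Z, leb2 Z = 0%E & forall x, E x -> ~ Z x ->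
    ((`|f (Q x) - f (P x)|)%:E <= (`|Q x - P x|)%:E * segavg (grnorm g) (P x) (Q x))%E].
Proof.
move=> p1 mE mP mQ cf mg gp wf C0 hC; have p0 : 0 < p by exact: lt_trans p1.
have lf := locint_continuous cf; have lg b := locint_Lp p1 (mg b) (gp b).
(* Scales along which both components of the gradient converge with error at most [1/(n+1)]. *)
have s_ex n : exists s, [/\ 0 < s, s <= n.+1%:R^-1 &
    forall b, (Np p setT (fun x => mol s (g b) x - g b x)%R <= (n.+1%:R^-1)%:E)%E].
  have n0 : 0 < n.+1%:R^-1 :> R by rewrite invr_gt0.
  have [d1 d10 h1] := mol_cvg p1 (mg true) (gp true) n0.
  have [d2 d20 h2] := mol_cvg p1 (mg false) (gp false) n0.
  exists (Num.min n.+1%:R^-1 (Num.min d1 d2)); split.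
  - by rewrite !lt_min n0 d10 d20.
  - by rewrite ge_min lexx.
  - by case; [apply: h1|apply: h2]; rewrite ?lt_min ?n0 ?d10 ?d20// !ge_min lexx ?orbT.
pose s n := sval (cid (s_ex n)).
have s0 n : 0 < s n by rewrite /s; case: cid => ? [].
have sn n : s n <= n.+1%:R^-1 by rewrite /s; case: cid => ? [].
have sg n b : (Np p setT (fun x => mol (s n) (g b) x - g b x)%R <= (n.+1%:R^-1)%:E)%E.
  by rewrite /s; case: cid => ? [].
pose dl n b x := mol (s n) (g b) x - g b x.
have mdl n b : measurable_fun setT (dl n b) by apply: measurable_funB => //; exact: measurable_mol.
pose u n x := (segavg (grnorm (dl n)) (P x) (Q x) `^ p)%E.
have mu_ n : measurable_fun E (u n).
  apply: measurable_funTS; apply: (measurableT_comp (measurable_poweR _)).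
  by apply: measurable_segavg => //; exact: measurable_grnorm.
have u0 n x : E x -> (0 <= u n x)%E by move=> _; exact: poweR_ge0.
(* The hypothesis on [C] carries the convergence of the gradients over to their averages along the
   segments. *)
have iu : (fun n => \int[leb2]_(x in E) u n x)%E @ \oo --> 0%E.
  apply: small_cvge0; first by move=> n; apply: integral_ge0 => x /u0.
  move=> e e0; have p2 : 0 < 2 `^ p :> R by rewrite powR_gt0.
  exists (Num.bound (C * (2 `^ p * 2) / e)) => n Nn.
  apply: (le_trans (hC _ (measurable_grnorm (mdl n)))).
  apply: (@le_trans _ _ (C%:E * ((2 `^ p)%:E * ((n.+1%:R^-1)%:E + (n.+1%:R^-1)%:E)))%E).
    apply: lee_wpmul2l; first by rewrite lee_fin.
    apply: (le_trans (Np_grnorm (ltW p0) _ (mdl n))) => //.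
    by apply: lee_wpmul2l; [rewrite lee_fin ltW|apply: leeD; exact: sg].
  rewrite -EFinD -!EFinM lee_fin.
  have -> : C * (2 `^ p * (n.+1%:R^-1 + n.+1%:R^-1)) = C * (2 `^ p * 2) / n.+1%:R by ring.
  rewrite ler_pdivrMr// [e * _]mulrC -ler_pdivrMr//.
  apply: (@le_trans _ _ (Num.bound (C * (2 `^ p * 2) / e))%:R); last by rewrite ler_nat ltnW.
  by rewrite ltW// archi_boundP// divr_ge0// ?mulr_ge0// ltW.
have mlim : measurable_fun E (fun x => limn_einf (u ^~ x)) .
  apply: (emeasurable_fun_cvg (fun n x => einfs (u ^~ x) n)); first exact: measurable_fun_einfs.
  by move=> x _; rewrite limn_einf_lim; exact: is_cvg_einfs.
(* By Fatou's lemma the lower limit has integral 0, hence vanishes outside a null set; no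
   subsequence has to be extracted. *)
have lim0 : (\int[leb2]_(x in E) limn_einf (u ^~ x))%E = 0%E.
  apply/eqP; rewrite eq_le; apply/andP; split.
    rewrite -(cvg0_limn_einf iu).
    exact: (fatou leb2 mE mu_ u0).
  by apply: integral_ge0 => x Ex; apply: limn_einf_ge0 => n; exact: u0.
have limge0 x : E x -> (0 <= limn_einf (u ^~ x))%E.
  by move=> Ex; apply: limn_einf_ge0 => n; exact: u0.
have /(ae_eq_integral_abs leb2 mE mlim)[Z [mZ Z0 hZ]] :
    (\int[leb2]_(x in E) `|limn_einf (u ^~ x)|)%E = 0%E.
  rewrite -[RHS]lim0; apply: eq_integral => x; rewrite inE => Ex.
  by rewrite gee0_abs// limge0.
exists Z; split => // x Ex nZx.
have lx : limn_einf (u ^~ x) = 0%E.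
  by apply: contrapT => h; apply: nZx; apply: hZ => /=; apply/not_implyP; split.
set N := `|Q x - P x|; set I := segavg (grnorm g) (P x) (Q x).
have I0 : (0 <= I)%E by exact: segavg_ge0.
have [N0|N0] := eqVneq N 0.
  have /eqP : Q x = P x by apply/eqP; rewrite -subr_eq0 -normr_eq0 -/N N0.
  by rewrite N0 mul0e lee_fin => /eqP ->; rewrite subrr normr0.
have Ngt0 : 0 < N by rewrite lt_neqAle eq_sym N0 normr_ge0.
have [Iy|Ify] := eqVneq I +oo%E; first by rewrite Iy gt0_muley ?leey// lte_fin.
have Ifin : I \is a fin_num by rewrite ge0_fin_numE// ltey.
rewrite -(fineK Ifin) -EFinM lee_fin; apply/ler_addgt0Pr => e e0.
(* The final error is [e'] at each endpoint plus [N e'] from the gradient. *)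
pose e' := e / (2 + N).
have e'0 : 0 < e' by rewrite divr_gt0// addr_gt0.
have [d1 d10 h1] := mol_cvg_pt (P x) cf e'0.
have [d2 d20 h2] := mol_cvg_pt (Q x) cf e'0.
have ep0 : 0 < e' `^ p by rewrite powR_gt0.
have dm : 0 < Num.min d1 d2 by rewrite lt_min d10.
(* A lower limit 0 gives a small gradient error at indices beyond any bound, here one past which
   both endpoint values are approximated. *)
have [j nj uj] := limn_einf0_small lx (Num.bound (Num.min d1 d2)^-1) ep0.
have sj : s j <= Num.min d1 d2.
  apply: (le_trans (sn j)); rewrite -[leRHS]invrK lef_pV2 ?posrE// ?invr_gt0//.
  apply: (@le_trans _ _ (Num.bound (Num.min d1 d2)^-1)%:R); last by rewrite ler_nat ltnW.
  by rewrite ltW// archi_boundP// invr_ge0 ltW.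
move: sj; rewrite le_min => /andP[sj1 sj2].
have {}h1 := h1 _ (s0 j) sj1; have {}h2 := h2 _ (s0 j) sj2.
set A := segavg (grnorm (dl j)) (P x) (Q x) in uj *.
have A0 : (0 <= A)%E by exact: segavg_ge0.
have Ae : (A <= e'%:E)%E.
  rewrite leNgt; apply/negP => eA; move: uj; rewrite /u -/A ltNge => /negP; apply.
  rewrite -poweR_EFin; apply: gt0_ler_poweR; rewrite ?in_itv/= ?leey ?andbT//; [exact: ltW|by rewrite lee_fin ltW|exact: ltW].
have key : ((`|mol (s j) f (Q x) - mol (s j) f (P x)|)%:E <= N%:E * (I + e'%:E))%E.
  apply: (le_trans (smooth_segavg_le _ _ (smooth_mol (s0 j) lf))).
  apply: lee_wpmul2l; first by rewrite lee_fin ltW.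
  apply: (@le_trans _ _ (I + A)%E); last by rewrite leeD2l.
  apply: segavg_le_add.
  - rewrite !wf//; apply: measurable_funD; apply: measurableT_comp => //; exact: measurable_mol.
  - exact: measurable_grnorm.
  - exact: measurable_grnorm.
  - move=> y; rewrite !wf// (ger0_norm (addr_ge0 _ _))// !(ger0_norm (grnorm_ge0 _ _)) /grnorm /dl addrACA.
    have tri (c d : R) : `|c| <= `|d| + `|c - d| by rewrite -{1}(subrK d c) addrC ler_normD.
    by apply: lerD.
move: key; rewrite -(fineK Ifin) -EFinD -EFinM lee_fin => key.
have -> : f (Q x) - f (P x) = - (mol (s j) f (Q x) - f (Q x)) + (mol (s j) f (P x) - f (P x)) +
   (mol (s j) f (Q x) - mol (s j) f (P x)) by ring.
apply: (le_trans (ler_normD _ _)); apply: (@le_trans _ _ ((e' + e') + N * (fine I + e'))).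
  by apply: lerD => //; apply: (le_trans (ler_normD _ _)); rewrite normrN lerD.
have -> : e = e' * (2 + N) by rewrite divfK// gt_eqF// addr_gt0.
rewrite le_eqVlt; apply/orP; left; apply/eqP; ring.
Qed.

Lemma int_powR_lt1 (a : R) : 0 < a -> a < 1 ->
  (\int[mu]_(t in `]0%R, 1%R]) (t `^ (- a))%:E <= ((1 - a)^-1)%:E)%E.
Proof.
(* With [n + 2] the left endpoint is strictly less than 1 for all [n], as the fundamental theorem
   requires. *)
move=> a0 a1; pose F (n : nat) : set R := `[n.+2%:R^-1, 1]%classic.
have a1' : 0 < 1 - a by rewrite subr_gt0.
have UF : \bigcup_n F n = `]0, 1]%classic.
  apply/seteqP; split => t /=.
    by move=> [n _]; rewrite /F/= !in_itv/= => /andP[h ->]; rewrite (lt_le_trans _ h)// invr_gt0.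
  rewrite in_itv/= => /andP[t0 t1]; exists (Num.bound t^-1) => //.
  rewrite /F/= in_itv/= t1 andbT -[leRHS]invrK lef_pV2 ?posrE ?invr_gt0//.
  apply: (@le_trans _ _ (Num.bound t^-1)%:R); last by rewrite ler_nat -addn2 leq_addr.
  by rewrite ltW// archi_boundP// invr_ge0 ltW.
have mp : measurable_fun setT (fun t : R => (t `^ (- a))%:E) by apply/measurable_EFinP; exact: measurable_powR.
have cv : (fun n => \int[mu]_(t in F n) (t `^ (- a))%:E)%E @ \oo --> (\int[mu]_(t in \bigcup_n F n) (t `^ (- a))%:E)%E.
  apply: ge0_nondecreasing_set_cvg_integral.
  - move=> n k nk; apply/subsetPset => t; rewrite /F/= !in_itv/= => /andP[h ->]; rewrite andbT.
    by apply: le_trans h; rewrite lef_pV2 ?posrE// ler_nat.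
  - by move=> n; exact: measurable_itv.
  - by move=> n; exact: measurable_funTS.
  - by move=> n t _; rewrite lee_fin powR_ge0.
rewrite -UF -(cvg_lim _ cv)//; apply: lime_le; first by apply/cvg_ex; eexists; exact: cv.
apply: nearW => n.
have k0 : 0 < n.+2%:R^-1 :> R by rewrite invr_gt0.
have k1 : n.+2%:R^-1 < 1 :> R by rewrite invf_lt1// ltr1n.
pose G (t : R) := (1 - a)^-1 * t `^ (1 - a).
have dG (t : R) : 0 < t -> is_derive t 1 G (t `^ (- a)).
  move=> t0; have it : t \in `]0, +oo[ by rewrite in_itv/= t0.
  have := derivable_isd (@derivable_powR _ 1 (1 - a) _ it); rewrite powR_derive1// => h.
  apply: (isd_eq (isd_scale (1 - a)^-1 h)); rewrite mulrA mulVf ?gt_eqF// mul1r.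
  by congr (_ `^ _); ring.
have cG (t : R) : 0 < t -> {for t, continuous G}.
  by move=> t0; apply: differentiable_continuous; apply/derivable1_diffP; have [] := dG t t0.
have cp : {within `[n.+2%:R^-1, 1], continuous (fun t : R => t `^ (- a))}.
  apply: continuous_in_subspaceT => t; rewrite inE/= in_itv/= => /andP[t0 _].
  have {}t0 : 0 < t by exact: lt_le_trans t0.
  apply: differentiable_continuous; apply/derivable1_diffP; apply: derivable_powR.
  by rewrite in_itv/= t0.
rewrite (@continuous_FTC2 _ (fun t : R => t `^ (- a)) G _ _ k1 cp).
- rewrite -EFinB lee_fin /G powR1 mulr1 lerBlDr lerDl mulr_ge0 ?powR_ge0// invr_ge0 ltW//.
- split.
  + move=> t; rewrite in_itv/= => /andP[t0 _]; have [] // := dG t _; exact: lt_trans t0.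
  + by apply: cvg_at_right_filter; exact: cG.
  + by apply: cvg_at_left_filter; exact: cG.
- move=> t; rewrite in_itv/= => /andP[t0 _]; apply: isd_derive1; apply: dG; exact: lt_trans t0.
Qed.

End segments.

(** * Hardy inequality on star-shaped sets *)

Section hardy.
Variable R : realType.
Local Notation pt := (pt R).
Local Notation leb2 := (@leb2 R).
Local Notation mu := (@lebesgue_measure R).
Implicit Types (p r c s : R) (f k : pt -> R) (D E : set pt) (x y a v z : pt) (b : bool) (w : seq bool).

Lemma Np_null p Z f : measurable Z -> leb2 Z = 0%E -> measurable_fun setT f -> Np p Z f = 0%E.
Proof.
move=> mZ Z0 mf; rewrite NpE; apply/eqP; rewrite eq_le integral_ge0 ?andbT//.
rewrite (_ : 0%E = \int[leb2]_(x in Z) `| (cst 0%E x : \bar R) |)%E; last first.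
  by rewrite (eq_integral (cst 0%E)) ?integral0// => x _; rewrite abse0.
rewrite le_eqVlt; apply/orP; left; apply/eqP.
transitivity (\int[leb2]_(x in Z) `|(`|f x| `^ p)%:E|)%E.
  by apply: eq_integral => x _; rewrite gee0_abs// lee_fin powR_ge0.
rewrite (_ : (\int[leb2]_(x in Z) `|(cst 0%E x : \bar R)|)%E = 0%E); last first.
  by rewrite (eq_integral (cst 0%E)) ?integral0// => x _; rewrite abse0.
apply/ae_eq_integral_abs => //; first exact: measurable_norm_powR.
by exists Z; split => // x /= /not_implyP[].
Qed.

Lemma Np_setDnull p D Z f : measurable D -> measurable Z -> leb2 Z = 0%E -> measurable_fun setT f ->
  (Np p D f <= Np p (D `\` Z) f)%E.
Proof.
move=> mD mZ Z0 mf; have mDZ := measurableD mD mZ.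
apply: (@le_trans _ _ (Np p ((D `\` Z) `|` Z) f)).
  apply: subset_Np => //; first exact: measurableU.
  by move=> x Dx; have [Zx|nZx] := pselect (Z x); [right|left].
by apply: (le_trans (Np_setU _ _ _ _)) => //; rewrite (Np_null _ mZ)// adde0.
Qed.

Lemma Np_le_int p E c (h : pt -> R) (A : pt -> \bar R) : 0 < p -> 0 <= c -> measurable E ->
  measurable_fun setT h -> measurable_fun setT A -> (forall x, 0 <= A x)%E ->
  (forall x, E x -> ((`|h x|)%:E <= c%:E * A x)%E) ->
  (Np p E h <= (c `^ p)%:E * \int[leb2]_(x in E) (A x `^ p))%E.
Proof.
move=> p0 c0 mE mh mA A0 hA.
rewrite NpE -ge0_integralZl//; last 3 first.
- by apply: measurable_funTS; apply: (measurableT_comp (measurable_poweR _)).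
- by move=> x _; exact: poweR_ge0.
- by rewrite lee_fin powR_ge0.
apply: ge0_le_integral => //.
- by apply: measurable_norm_powR.
- by apply: measurable_funTS; apply: emeasurable_funM => //; apply: (measurableT_comp (measurable_poweR _)).
- move=> x Ex; rewrite -!poweR_EFin -poweRM//.
  apply: gt0_ler_poweR; first exact: ltW.
  + by rewrite in_itv/= leey andbT lee_fin.
  + by rewrite in_itv/= leey andbT mule_ge0.
  + exact: hA.
Qed.

(** Multiply and divide the integrand by [t^al]. Jensen for the weight [t^(-al)] produces the factor
    [t^(al p)], which compensates the growth [t^(-al p)] allowed in the hypothesis. *)
Lemma int_segavg_weight p E (P Q : pt -> pt) k (K : \bar R) (al W : R) : 1 < p -> measurable E ->
  measurable_fun setT P -> measurable_fun setT Q -> measurable_fun setT k ->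
  (\int[mu]_(t in `]0%R, 1%R]) (t `^ (- al))%:E <= W%:E)%E ->
  (forall t : R, 0 < t <= 1 ->
    (Np p E (fun x => k (P x + t *: (Q x - P x))%R) <= (t `^ (- (al * p)))%:E * K)%E) ->
  (0 <= K)%E ->
  (\int[leb2]_(x in E) (segavg k (P x) (Q x) `^ p) <= (W `^ p)%:E * K)%E.
Proof.
move=> p1 mE mP mQ mk hW hK K0; have p0 : 0 < p by exact: lt_trans p1.
have mS := measurable_segment mP mQ.
have mw (c : R) : measurable_fun setT (fun t : R => t `^ c) by exact: measurable_powR.
pose F (q : pt * R) := `|k (P q.1 + q.2 *: (Q q.1 - P q.1))| * q.2 `^ al.
have mF : measurable_fun setT F.
  apply: measurable_funM; first by do 2 apply: measurableT_comp => //.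
  by apply: (measurableT_comp (mw al)).
have F0 q : 0 <= F q by rewrite mulr_ge0// powR_ge0.
have := @jensen_tonelli R _ _ _ _ (@sleb2 R) mu p W E `]0, 1]%classic F (fun t => t `^ (- al)) p1 mE.
move=> /(_ (measurable_itv _) mF F0 (mw _) (fun t => powR_ge0 _ _) hW) J.
rewrite (_ : (\int[leb2]_(x in E) _)%E = (\int[leb2]_(x in E) ((\int[mu]_(t in `]0%R, 1%R])
   (F (x, t) * t `^ (- al))%:E) `^ p))%E); last first.
  apply: eq_integral => x _; rewrite /segavg; congr (_ `^ _)%E; apply: eq_integral => t.
  rewrite inE/= in_itv/= => /andP[t0 _]; rewrite /F/= -mulrA -powRD ?subrr ?powRr0 ?mulr1//.
  by apply/implyP => _; rewrite gt_eqF.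
apply: (le_trans J).
have W0 : 0 <= W.
  by rewrite -lee_fin; apply: le_trans hW; apply: integral_ge0 => t _; rewrite lee_fin powR_ge0.
have -> : W `^ p = W `^ (p - 1) * W.
  by rewrite -{3}(powRr1 W0) -powRD ?subrK// (negbTE (lt0r_neq0 p0)).
rewrite EFinM -muleA; apply: lee_wpmul2l; first by rewrite lee_fin powR_ge0.
apply: (@le_trans _ _ (K * \int[mu]_(t in `]0%R, 1%R]) (t `^ (- al))%:E)%E); last first.
  by rewrite muleC; apply: lee_wpmul2r.
rewrite -ge0_integralZl//; last 2 first.
- by apply: measurable_funTS; apply/measurable_EFinP.
- by move=> t _; rewrite lee_fin powR_ge0.
apply: ge0_le_integral => //.
- move=> t _; rewrite mule_ge0 ?lee_fin ?powR_ge0//; apply: integral_ge0 => x _.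
  by rewrite lee_fin powR_ge0.
- apply: measurable_funTS; apply: emeasurable_funM; first exact/measurable_EFinP.
  apply: (measurable_int_fst (@sleb2 R) (G := fun q : pt * R => F q `^ p)) => //.
    by apply: (measurableT_comp (measurable_powR _)).
  by move=> q; exact: powR_ge0.
- by apply: measurable_funTS; apply: emeasurable_funM => //; exact/measurable_EFinP.
- move=> t; rewrite /= in_itv/= => /andP[t0 t1]; rewrite muleC; apply: lee_wpmul2r.
    by rewrite lee_fin powR_ge0.
  have -> : (\int[sleb2 R]_(x in E) (F (x, t) `^ p)%:E =
     (t `^ (al * p))%:E * Np p E (fun x => k (P x + t *: (Q x - P x))%R))%E.
    rewrite NpE -ge0_integralZl//; last 2 first.
    - apply: measurable_norm_powR; apply: measurableT_comp => //.
      exact: (measurableT_comp mS (measurable_pair2 t)).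
    - by rewrite lee_fin powR_ge0.
    apply: eq_integral => x _; rewrite -EFinM; congr (_%:E).
    by rewrite /F/= powRM ?powR_ge0// -powRrM mulrC.
  have t01 : 0 < t <= 1 by rewrite t0 t1.
  apply: (@le_trans _ _ ((t `^ (al * p))%:E * ((t `^ (- (al * p)))%:E * K))%E).
    by apply: lee_wpmul2l; [rewrite lee_fin powR_ge0|exact: hK].
  rewrite muleA -EFinM -powRD ?subrr ?powRr0 ?mul1e//.
  by apply/implyP => _; rewrite gt_eqF.
Qed.

(** Translations preserve the measure, so the exponent 0 does. *)
Lemma segavg_shift p E E' k v : 1 < p -> measurable E -> measurable E' -> measurable_fun setT k ->
  (forall x (t : R), E x -> 0 < t <= 1 -> E' (x + t *: v)) ->
  (\int[leb2]_(x in E) (segavg k x (x + v)%R `^ p) <= Np p E' k)%E.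
Proof.
move=> p1 mE mE' mk EE'.
have W : (\int[mu]_(t in `]0%R, 1%R]) (t `^ (- 0))%:E <= 1%:E :> \bar R)%E.
  rewrite (eq_integral (cst 1%:E)); last by move=> t _; rewrite oppr0 powRr0.
  by rewrite integral_cst//= lebesgue_measure_itv/= lte_fin ltr01 oppr0 adde0 mule1.
have -> : Np p E' k = ((1 `^ p)%R%:E * Np p E' k)%E by rewrite powR1 mul1e.
apply: (@int_segavg_weight p E id (fun x => x + v) k _ 0) => //.
- exact: measurable_addv.
- move=> t t01; rewrite mul0r oppr0 powRr0 mul1e.
  rewrite (@eq_Np _ _ _ _ (fun x => k (x + t *: v))); last by move=> x _; rewrite [x + v]addrC addrK.
  by apply: (@Np_shift _ _ _ _ (t *: v)) => // x Ex; exact: EE'.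
- exact: Np_ge0.
Qed.

(** With [t > 0] the centre itself need not belong to [E]. *)
Definition star a E := forall x (t : R), E x -> 0 < t <= 1 -> E (a + t *: (x - a)).

(** The mass [1 / (1 - 2/p)] of the weight [t^(-2/p)] on []0, 1]], raised to the power [p]. *)
Definition hardyC p : R := (1 - 2 / p)^-1 `^ p.

(* The weight [t^(-2/p)] balances Jensen's constant with the Jacobian [t^2] of the dilation. *)
Lemma segavg_star p a E k : 2 < p -> measurable E -> measurable_fun setT k -> star a E ->
  (\int[leb2]_(x in E) (segavg k a x `^ p) <= (hardyC p)%:E * Np p E k)%E.
Proof.
move=> p2 mE mk sE; have p0 : 0 < p by exact: lt_trans p2.
have p1 : 1 < p by apply: lt_trans p2; rewrite ltr1n.
apply: (@int_segavg_weight p E (cst a) id k _ (2 / p)) => //.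
- by apply: int_powR_lt1; rewrite ?divr_gt0// ltr_pdivrMr// mul1r.
- move=> t /andP[t0 t1]; rewrite divfK ?gt_eqF//.
  rewrite powRN powR_mulrn ?(ltW t0)//.
  rewrite (@eq_Np _ _ _ _ (fun x => k ((a - t *: a) + t *: x))); last first.
    by move=> x _; rewrite /= scalerBr addrA addrAC.
  apply: (@Np_aff _ p E E _ t) => //; first by rewrite gt_eqF.
  by move=> x Ex; rewrite -addrA [- _ + _]addrC -scalerBr; apply: sE => //; rewrite t0 t1.
- exact: Np_ge0.
Qed.

(* Equal to [0] at [x = a]. *)
Definition wgt a x : R := `|x - a|^-1.

Lemma wgt_ge0 a x : 0 <= wgt a x. Proof. by rewrite invr_ge0. Qed.

Lemma measurable_norm_sub a : measurable_fun setT (fun x : pt => `|x - a|).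
Proof.
by apply: continuous_measurable2 => x; apply: cvg_norm; apply: cvgB; [exact: cvg_id|exact: cvg_cst].
Qed.

Lemma measurable_wgt a n : measurable_fun setT (fun x => wgt a x ^+ n).
Proof.
apply: measurable_funX; rewrite (_ : wgt a = fun x => `|x - a| `^ (-1)); last first.
  by apply/funext => x; rewrite powR_inv1.
by apply: (measurableT_comp (measurable_powR _)); exact: measurable_norm_sub.
Qed.

(** As [f a = 0], the value at [x] is at most [|x - a|] times the average of the gradient on the
    segment from [a]. One power of [wgt a x] cancels [|x - a|]; the others move under the integral,
    because the points of the segment are closer to [a] than [x] is and their weight is larger. *)
Lemma hardy_step p a E f (g : bool -> pt -> R) n : 2 < p -> measurable E -> star a E ->
  continuous f -> f a = 0 -> (forall b, measurable_fun setT (g b)) ->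
  (forall b, Np p setT (g b) < +oo)%E -> (forall b, wpd b f (g b)) ->
  (Np p E (fun x => f x * wgt a x ^+ n.+1)%R <= (hardyC p * 2 `^ p)%:E *
    (Np p E (fun x => g true x * wgt a x ^+ n)%R + Np p E (fun x => g false x * wgt a x ^+ n)%R))%E.
Proof.
move=> p2 mE sE cf fa mg gp wf; have p0 : 0 < p by exact: lt_trans p2.
have p1 : 1 < p by apply: lt_trans p2; rewrite ltr1n.
have mf := continuous_measurable2 cf.
have C0 : 0 <= hardyC p by exact: powR_ge0.
have [|Z [mZ Z0 hZ]] := @segment_ae R p E (cst a) id (hardyC p) f g p1 mE (measurable_cst _)
    (@measurable_id _ _ setT) cf mg gp wf C0.
  move=> k mk; apply: (le_trans (segavg_star p2 mE mk sE)).
  by apply: lee_wpmul2l; [rewrite lee_fin|exact: subset_Np].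
pose g' b x := g b x * wgt a x ^+ n.
have mg' b : measurable_fun setT (g' b) by apply: measurable_funM => //; exact: measurable_wgt.
have mg'n := measurable_grnorm mg'.
have mfw : measurable_fun setT (fun x => f x * wgt a x ^+ n.+1).
  by apply: measurable_funM => //; exact: measurable_wgt.
have mEZ := measurableD mE mZ.
apply: (le_trans (Np_setDnull _ mE mZ Z0 mfw)).
apply: (@le_trans _ _ ((1 `^ p)%R%:E * \int[leb2]_(x in E `\` Z) (segavg (grnorm g') a x `^ p))%E).
  apply: Np_le_int => //; first by apply: measurable_segavg => //; exact: measurable_id.
    by move=> x; exact: segavg_ge0.
  move=> x [Ex nZx]; rewrite mul1e; have := hZ x Ex nZx; rewrite /= fa subr0 => h.
  have [xa|xa] := eqVneq x a.
    by rewrite xa fa mul0r normr0; exact: segavg_ge0.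
  have N0 : 0 < `|x - a| by rewrite normr_gt0 subr_eq0.
  rewrite normrM (ger0_norm (exprn_ge0 _ (wgt_ge0 _ _))) EFinM.
  apply: (@le_trans _ _ ((`|x - a|)%:E * segavg (grnorm g) a x * (wgt a x ^+ n.+1)%:E)%E).
    by apply: lee_wpmul2r => //; rewrite lee_fin exprn_ge0// wgt_ge0.
  rewrite -muleA [(_ * (wgt _ _ ^+ _)%:E)%E]muleC muleA -EFinM exprS mulrA divff ?gt_eqF// mul1r.
  rewrite /segavg -ge0_integralZl//; last 2 first.
  - apply: measurable_funTS; apply/measurable_EFinP; apply: measurableT_comp => //.
    by apply: (@measurable_line _ (grnorm g)); exact: measurable_grnorm.
  - by rewrite lee_fin exprn_ge0// wgt_ge0.
  apply: ge0_le_integral => //.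
  - by move=> t _; rewrite mule_ge0// lee_fin ?exprn_ge0 ?wgt_ge0.
  - apply: measurable_funTS; apply: emeasurable_funM => //; apply/measurable_EFinP; apply: measurableT_comp => //.
    by apply: (@measurable_line _ (grnorm g)); exact: measurable_grnorm.
  - apply: measurable_funTS; apply/measurable_EFinP; apply: measurableT_comp => //.
    exact: (@measurable_line _ (grnorm g')).
  - move=> t; rewrite /= in_itv/= => /andP[t0 t1]; rewrite -EFinM lee_fin.
    rewrite !ger0_norm ?grnorm_ge0// /grnorm /g'; set y := a + _.
    rewrite !normrM -mulrDl mulrC (ger0_norm (exprn_ge0 _ (wgt_ge0 _ _))).
    apply: ler_wpM2l; first by rewrite addr_ge0.
    apply: lerXn2r; rewrite ?nnegrE ?wgt_ge0// /wgt lef_pV2 ?posrE//.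
    + by rewrite /y addrC addKr normrZ gtr0_norm// ler_piMl.
    + by rewrite /y addrC addKr normrZ gtr0_norm// mulr_gt0.
rewrite powR1 mul1e; apply: (@le_trans _ _ ((hardyC p)%:E * Np p E (grnorm g'))%E).
  apply: (le_trans _ (segavg_star p2 mE mg'n sE)); apply: ge0_subset_integral => //.
  + apply: measurable_funTS; apply: (measurableT_comp (measurable_poweR _)).
    by apply: measurable_segavg => //; exact: measurable_id.
  + by move=> x _; exact: poweR_ge0.
rewrite EFinM -muleA; apply: lee_wpmul2l; first by rewrite lee_fin.
by apply: Np_grnorm => //; exact: ltW.
Qed.

(** The sum of [F] over all words obtained from [w] by prefixing [n] letters. *)
Fixpoint wsum (F : seq bool -> \bar R) n w : \bar R :=
  if n is n'.+1 then (wsum F n' (true :: w) + wsum F n' (false :: w))%E else F w.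

Lemma wsum_ge0 F n w : (forall w, 0 <= F w)%E -> (0 <= wsum F n w)%E.
Proof. by move=> F0; elim: n w => [|n IH] w //=; rewrite adde_ge0. Qed.

Lemma wsum_lty F n w : (forall w', size w' = (size w + n)%N -> F w' < +oo)%E -> (wsum F n w < +oo)%E.
Proof.
elim: n w => [|n IH] w /= hF; first by apply: hF; rewrite addn0.
by apply: lte_add_pinfty; apply: IH => w' sw; apply: hF; rewrite sw/= addnS.
Qed.

Lemma le_wsum F F' n w : (forall w', size w' = (size w + n)%N -> F w' <= F' w')%E ->
  (wsum F n w <= wsum F' n w)%E.
Proof.
elim: n w => [|n IH] w /= hF; first by apply: hF; rewrite addn0.
by apply: leeD; apply: IH => w' sw; apply: hF; rewrite sw/= addnS.
Qed.

Lemma wsum_sum (I : Type) (l : seq I) (F : I -> seq bool -> \bar R) n w :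
  (\sum_(i <- l) wsum (F i) n w = wsum (fun w => \sum_(i <- l) F i w) n w)%E.
Proof. by elim: n w => [|n IH] w //=; rewrite big_split/= !IH. Qed.

Lemma hardy p n a E (G : seq bool -> pt -> R) : 2 < p -> measurable E -> star a E ->
  (forall w, (size w < n)%N -> continuous (G w) /\ G w a = 0) ->
  (forall b w, (size w < n)%N -> measurable_fun setT (G (b :: w)) /\ (Np p setT (G (b :: w)) < +oo)%E) ->
  (forall b w, (size w < n)%N -> wpd b (G w) (G (b :: w))) ->
  (Np p E (fun x => G [::] x * wgt a x ^+ n)%R <=
    ((hardyC p * 2 `^ p) ^+ n)%:E * wsum (fun w => Np p E (G w)) n [::])%E.
Proof.
move=> p2 mE sE cG LG wG; set C := hardyC p * _.
have C0 : 0 <= C by rewrite mulr_ge0// powR_ge0.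
suff main j w : (size w + j)%N = n -> (Np p E (fun x => G w x * wgt a x ^+ j)%R <=
    (C ^+ j)%:E * wsum (fun w => Np p E (G w)) j w)%E by exact: main.
elim: j w => [|j IH] w wn.
  by rewrite expr0 mul1e /= (@eq_Np _ _ _ _ (G w))// => x _; rewrite expr0 mulr1.
have wn' : (size w < n)%N by rewrite -wn addnS ltnS leq_addr.
have [cf fa] := cG w wn'.
apply: (le_trans (@hardy_step p a E (G w) (fun b => G (b :: w)) j p2 mE sE cf fa _ _ _)).
- by move=> b; have [] := LG b w wn'.
- by move=> b; have [] := LG b w wn'.
- by move=> b; exact: wG.
rewrite [C ^+ j.+1]exprS [(C * _)%:E]EFinM -muleA; apply: lee_wpmul2l; first by rewrite lee_fin.
rewrite /= ge0_muleDr; try by apply: wsum_ge0 => ?; exact: Np_ge0.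
by apply: leeD; apply: IH; rewrite /= -wn addnS.
Qed.

End hardy.

(** * Difference quotients, and weak derivatives on a zero set *)

Section vanishing.
Variable R : realType.
Local Notation pt := (pt R).
Local Notation leb2 := (@leb2 R).
Local Notation mu := (@lebesgue_measure R).
Implicit Types (p r c s : R) (f k : pt -> R) (D E : set pt) (x y a v z : pt) (b : bool) (w : seq bool).

Lemma Np_difference p E E' f (g : bool -> pt -> R) v : 1 < p -> measurable E -> measurable E' ->
  continuous f -> (forall b, measurable_fun setT (g b)) ->
  (forall b, Np p setT (g b) < +oo)%E -> (forall b, wpd b f (g b)) ->
  (forall x (t : R), E x -> 0 < t <= 1 -> E' (x + t *: v)) ->
  (Np p E (fun x => f (x + v)%R - f x)%R <= (`|v| `^ p)%:E * Np p E' (grnorm g))%E.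
Proof.
move=> p1 mE mE' cf mg gp wf EE'; have p0 : 0 < p by exact: lt_trans p1.
have mf := continuous_measurable2 cf; have mgn := measurable_grnorm mg.
have mv := @measurable_addv R v.
have [|Z [mZ Z0 hZ]] := @segment_ae R p E id (fun x => x + v) 1 f g p1 mE
    (@measurable_id _ _ setT) mv cf mg gp wf ler01.
  by move=> k mk; rewrite mul1e; apply: segavg_shift.
have mEZ := measurableD mE mZ.
have mh : measurable_fun setT (fun x => f (x + v) - f x) by apply: measurable_funB => //; exact: measurable_shift.
apply: (le_trans (Np_setDnull _ mE mZ Z0 mh)).
apply: (@le_trans _ _ ((`|v| `^ p)%:E * \int[leb2]_(x in E `\` Z) (segavg (grnorm g) x (x + v)%R `^ p))%E).
  apply: Np_le_int => //; first by apply: measurable_segavg => //; exact: measurable_id.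
    by move=> x; exact: segavg_ge0.
  by move=> x [Ex nZx]; have := hZ x Ex nZx; rewrite /= [x + v - x]addrAC subrr add0r.
apply: lee_wpmul2l; first by rewrite lee_fin powR_ge0.
apply: (le_trans _ (segavg_shift p1 mE mE' mgn EE')).
apply: ge0_subset_integral => //.
+ apply: measurable_funTS; apply: (measurableT_comp (measurable_poweR _)).
  by apply: measurable_segavg => //; exact: measurable_id.
+ by move=> x _; exact: poweR_ge0.
Qed.

Lemma Np_add_le p D f g (A B : \bar R) : 0 <= p -> measurable D -> measurable_fun setT f -> measurable_fun setT g ->
  (Np p D f <= A)%E -> (Np p D g <= B)%E ->
  (Np p D (fun x => f x + g x)%R <= (2 `^ p)%:E * (A + B))%E.
Proof.
move=> p0 mD mf mg fA gB; apply: (le_trans (Np_add p0 mD mf mg)).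
by apply: lee_wpmul2l; [rewrite lee_fin powR_ge0|exact: leeD].
Qed.

(** The fundamental theorem for [l -> f (x + l *: v) - l * (t * pdd b f x)]: it compares the
    derivative at [x] with the increment of [f], up to the oscillation of the derivative along the
    segment. *)
Lemma ftc_axis f b x (t : R) v : smooth f -> v = t *: axl b 0 1 ->
  ((`|t * pdd b f x|)%:E <= \int[mu]_(l in `[0%R, 1%R])
    (`|f (x + v)%R - f x| + `|t| * `|pdd b f (x + l *: v)%R - pdd b f x|)%:E)%E.
Proof.
move=> sf vE.
have df b' y : derivable (fun t => f (axl b' y t)) (crd b' y) 1 by have [_] := (smoothP f).1 sf [::]; exact.
have cf b' : continuous (pdd b' f) by apply: smooth_continuous; exact: smooth_pdd.
pose u (l : R) := f (x + l *: v) - l * (t * pdd b f x).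
pose u' (l : R) := t * (pdd b f (x + l *: v) - pdd b f x).
have du (l : R) : is_derive l 1 u (u' l).
  have h1 := is_derive_segment x v l df cf.
  have h2 := isd_opp (isd_mul (is_derive_id l 1) (isd_cst (t * pdd b f x) l)).
  apply: (isd_eq (isd_add h1 h2)); rewrite /u'.
  have -> : v.1 * pdd true f (x + l *: v) + v.2 * pdd false f (x + l *: v) = t * pdd b f (x + l *: v).
    by move: (x + l *: v) => y; rewrite vE; case: (b); rewrite /= /GRing.scale/=; ring.
  ring.
have cl : continuous (fun l : R => x + l *: v).
  move=> l; apply: cvgD; first exact: cvg_cst.
  by apply: cvgZr_tmp; exact: cvg_id.
have cu' : continuous u'.
  move=> l; apply: cvgM; first exact: cvg_cst.
  apply: cvgB; last exact: cvg_cst.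
  by apply: continuous_comp; [exact: cl|exact: cf].
have FTC := norm_FTC_le du cu'.
have mu' : measurable_fun setT (fun l : R => `|u' l|).
  by apply: measurableT_comp => //; exact: continuous_measurable_fun.
apply: (@le_trans _ _ ((`|f (x + v)%R - f x|)%:E + (`|u 1%R - u 0%R|)%:E)%E).
  rewrite -EFinD lee_fin /u scale1r scale0r addr0 mul1r mul0r subr0.
  rewrite {1}(_ : t * pdd b f x = (f (x + v) - f x) - (f (x + v) - t * pdd b f x - f x)); last by ring.
  exact: ler_normB.
apply: (@le_trans _ _ ((`|f (x + v)%R - f x|)%:E + \int[mu]_(l in `[0%R, 1%R]) (`|u' l|)%:E)%E).
  by apply: leeD.
rewrite (_ : (`|f (x + v) - f x|)%:E = (\int[mu]_(l in `[0%R, 1%R]) (cst (`|f (x + v) - f x|)%:E l))%E); last first.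
  by rewrite integral_cst//= lebesgue_measure_itv/= lte_fin ltr01 oppr0 adde0 mule1.
rewrite -ge0_integralD//; last 2 first.
- by move=> l _; rewrite lee_fin.
- by apply: measurable_funTS; exact/measurable_EFinP.
rewrite le_eqVlt; apply/orP; left; apply/eqP; apply: eq_integral => l _.
by rewrite -EFinD /u' normrM.
Qed.

(* Difference quotients of [f] vanish where both endpoints are in [A], which is most of [A]
   for short translations. *)
Lemma wpd_vanish p b f (g : pt -> R) A : 1 < p -> measurable A -> continuous f ->
  measurable_fun setT g -> (Np p setT f < +oo)%E -> (Np p setT g < +oo)%E -> wpd b f g ->
  (forall x, A x -> f x = 0) -> Np p A g = 0%E.
Proof.
move=> p1 mA cf mg fp gp wf fA; have p0 : 0 < p by exact: lt_trans p1.
have p0' := ltW p0.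
have mf := continuous_measurable2 cf; have lf := locint_continuous cf; have lg := locint_Lp p1 mg gp.
apply/eqP; rewrite eq_le Np_ge0 andbT; apply/lee_addgt0Pr => e e0; rewrite add0e.
pose K : R := 2 `^ p; have K0 : 0 < K by rewrite powR_gt0.
(* Mirrors the nesting of the triangle inequalities below, so that the total error is exactly
   [dt * M = e]. *)
pose M := 1 + K * (1 + K * ((K * (1 + 1)) + K * ((K * (1 + 1)) + 1))).
have M0 : 0 < M by rewrite !(mulr_gt0, addr_gt0).
pose dt := e / M; have dt0 : 0 < dt by rewrite divr_gt0.
pose q x := g x * \1_A x.
have mq : measurable_fun setT q by apply: measurable_funM => //; exact: measurable_indic.
have qp : (Np p setT q < +oo)%E.
  rewrite Np_indic//; apply: le_lt_trans gp; apply: subset_Np => //; exact: measurableI.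
have [_ /(_ _ dt0)[d1 d10 h1]] := translation_continuous p0 mq qp.
have [_ /(_ _ dt0)[d2 d20 h2]] := translation_continuous p0 mg gp.
pose t := Num.min d1 d2; have t0 : 0 < t by rewrite lt_min d10.
pose v := t *: axl b (0 : pt) 1.
have vt : `|v| <= t.
  rewrite /v normrZ gtr0_norm// ler_piMr ?(ltW t0)//.
  by rewrite pt_lenorm; case: (b); rewrite /= normr0 normr1 lexx ler01.
(* The increment of [f] gets divided by [t], so its mollification error must be small relative to
   [t^p]. *)
pose s1 := t `^ p * dt.
have s10 : 0 < s1 by rewrite mulr_gt0// powR_gt0.
have [c1 c10 k1] := mol_cvg p1 mf fp s10; have [c2 c20 k2] := mol_cvg p1 mg gp dt0.
pose s := Num.min c1 c2; have s0 : 0 < s by rewrite lt_min c10.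
have {}k1 : (Np p setT (fun x => mol s f x - f x)%R <= s1%:E)%E by apply: k1 => //; rewrite ge_min lexx.
have {}k2 : (Np p setT (fun x => mol s g x - g x)%R <= dt%:E)%E by apply: k2 => //; rewrite ge_min lexx orbT.
have {}h1 : (Np p setT (fun x => q (x + v) - q x)%R <= dt%:E)%E.
  by apply: h1; apply: (le_trans vt); rewrite ge_min lexx.
have {}h2 (l : R) : 0 <= l <= 1 -> (Np p setT (fun x => g (x + l *: v) - g x)%R <= dt%:E)%E.
  move=> /andP[l0 l1]; apply: h2; rewrite normrZ ger0_norm//.
  by apply: (@le_trans _ _ t); [rewrite -[t]mul1r ler_pM|rewrite ge_min lexx orbT].
have mfs := measurable_mol s0 lf; have mgs := measurable_mol s0 lg.
have mdf : measurable_fun setT (fun x => mol s f x - f x) by exact: measurable_funB.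
have mdg : measurable_fun setT (fun x => mol s g x - g x) by exact: measurable_funB.
pose E := A `&` [set x | A (x + v)].
have mE : measurable E.
  apply: measurableI => //; rewrite -[X in measurable X]setTI.
  exact: (@measurable_addv R v measurableT).
(* On [A] minus [E] the translate of [q] vanishes and [q = g], so the translation error of [q]
   equals [|g|] there. *)
have step1 : (Np p A g <= Np p E g + dt%:E)%E.
  have mAE := measurableD mA mE.
  apply: (@le_trans _ _ (Np p (E `|` (A `\` E)) g)).
    apply: subset_Np => //; first exact: measurableU.
    by move=> x Ax; have [Ex|nEx] := pselect (E x); [left|right].
  apply: (le_trans (Np_setU _ _ _ _)) => //; apply: leeD => //.
  apply: le_trans h1.
  apply: (@le_trans _ _ (Np p (A `\` E) (fun x => q (x + v) - q x)%R)).
    apply: le_Np => //; first by apply: measurable_funB => //; exact: measurable_shift.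
    move=> x [Ax nE]; rewrite /q !indicE (mem_set Ax) memNset ?mulr0 ?mulr1 ?sub0r ?normrN//.
    by move=> Av; apply: nE.
  by apply: subset_Np => //; apply: measurable_funB => //; exact: measurable_shift.
(* On [E] both endpoints lie in [A], where [f] vanishes; only mollification errors remain. *)
have diffs : (Np p E (fun x => mol s f (x + v) - mol s f x)%R <= (K * (s1 + s1))%:E)%E.
  rewrite (@eq_Np _ _ _ _ (fun x => (mol s f (x + v) - f (x + v)) + - (mol s f x - f x))); last first.
    by move=> x [Ax Av]; rewrite (fA _ Ax) (fA _ Av); ring.
  rewrite EFinM EFinD; apply: Np_add_le => //.
  - exact: (@measurable_shift _ (fun x => mol s f x - f x)).
  - exact: measurableT_comp.
  - by apply: le_trans k1; apply: (@Np_shift _ _ _ _ v (fun x => mol s f x - f x)).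
  - by rewrite Np_opp; apply: le_trans k1; exact: subset_Np.
have diffg (l : R) : 0 <= l <= 1 ->
    (Np p E (fun x => mol s g (x + l *: v) - mol s g x)%R <= (K * (K * (dt + dt) + dt))%:E)%E.
  move=> l01.
  rewrite (@eq_Np _ _ _ _ (fun x => ((mol s g (x + l *: v) - g (x + l *: v)) + - (mol s g x - g x)) +
     (g (x + l *: v) - g x))); last by move=> x _; ring.
  have ms1 := @measurable_shift _ (fun x => mol s g x - g x) (l *: v) mdg.
  have ms2 : measurable_fun setT (fun x => - (mol s g x - g x)) by exact: measurableT_comp.
  have ms3 : measurable_fun setT (fun x => g (x + l *: v) - g x).
    by apply: measurable_funB => //; exact: measurable_shift.
  rewrite EFinM EFinD; apply: Np_add_le => //; first exact: measurable_funD.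
    rewrite EFinM EFinD; apply: Np_add_le => //.
    - by apply: le_trans k2; apply: (@Np_shift _ _ _ _ (l *: v) (fun x => mol s g x - g x)).
    - by rewrite Np_opp; apply: le_trans k2; exact: subset_Np.
  by apply: le_trans (h2 _ l01); exact: subset_Np.
have step2 : (Np p E (mol s g) <= (K * (K * (dt + dt) + K * (K * (dt + dt) + dt)))%:E)%E.
  pose F (xl : pt * R) := t^-1 * `|mol s f (xl.1 + v) - mol s f xl.1| + `|mol s g (xl.1 + xl.2 *: v) - mol s g xl.1|.
  have mF1 : measurable_fun setT (fun xl : pt * R => mol s f (xl.1 + v) - mol s f xl.1).
    apply: (measurableT_comp (_ : measurable_fun setT (fun x => mol s f (x + v) - mol s f x)) measurable_fst).
    by apply: measurable_funB => //; exact: measurable_shift.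
  have mF2 : measurable_fun setT (fun xl : pt * R => mol s g (xl.1 + xl.2 *: v) - mol s g xl.1).
    apply: measurable_funB; last exact: measurableT_comp.
    have := @measurable_segment R id (fun x => x + v) (@measurable_id _ _ setT) (@measurable_addv R v).
    move=> mS; apply: (eq_measurable_fun (fun xl : pt * R => mol s g (xl.1 + xl.2 *: (xl.1 + v - xl.1)))).
      by move=> xl _; rewrite [xl.1 + v]addrC addrK.
    exact: measurableT_comp mS.
  have mF : measurable_fun setT F.
    by apply: measurable_funD; [apply: measurable_funM => //|]; apply: measurableT_comp.
  have W : (\int[mu]_(l in `[0%R, 1%R]) (cst 1%R l)%:E <= 1%:E :> \bar R)%E.
    rewrite (eq_integral (cst 1%:E))// integral_cst//= lebesgue_measure_itv/= lte_fin ltr01.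
    by rewrite oppr0 adde0 mule1.
  have m1 : measurable_fun setT (cst 1 : R -> R) by [].
  have := @Np_avg_weight R _ _ mu p E `[0, 1]%classic (mol s g) F (cst 1) 1 1 p1 mE
    (measurable_itv _) ler01 mgs mF m1 (fun=> ler01) W.
  rewrite powR1 mul1r mul1e.
  move=> avg; apply: (le_trans (avg _)).
    move=> x Ex; rewrite mul1e.
    have := @ftc_axis (mol s f) b x t v (smooth_mol s0 lf) erefl; rewrite wf// => hx.
     rewrite -(@lee_pmul2l _ t%:E) ?lte_fin//.
    rewrite -EFinM -{1}(gtr0_norm t0) -normrM; apply: (le_trans hx).
    rewrite -ge0_integralZl//; last 3 first.
    - apply: measurable_funTS; apply/measurable_EFinP; under eq_fun do rewrite mulr1.
      by apply: measurableT_comp => //; exact: (measurableT_comp mF (measurable_pair1 x)).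
    - by move=> l _; rewrite lee_fin mulr1.
    - by rewrite lee_fin ltW.
    rewrite le_eqVlt; apply/orP; left; apply/eqP; apply: eq_integral => l _.
    rewrite -EFinM mulr1 [`|F _|]ger0_norm; last by rewrite addr_ge0// mulr_ge0// invr_ge0 ltW.
    by rewrite mulrDr mulrA mulfV ?gt_eqF// mul1r (gtr0_norm t0).
  apply: (@le_trans _ _ (\int[mu]_(l in `[0%R, 1%R]) (cst (K * (K * (dt + dt) + K * (K * (dt + dt) + dt)))%:E l))%E).
    apply: ge0_le_integral => //.
    - by move=> l _; rewrite mul1e Np_ge0.
    - by apply: measurable_funTS; under eq_fun do rewrite mul1e; exact: measurable_Np_snd.
    - move=> l; rewrite /= in_itv/= => l01; rewrite mul1e EFinM EFinD.
      apply: (@Np_add_le _ _ (fun x => t^-1 * `|mol s f (x + v) - mol s f x|)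
        (fun x => `|mol s g (x + l *: v) - mol s g x|)) => //.
      + apply: measurable_funM => //; apply: measurableT_comp => //.
        by apply: measurable_funB => //; exact: measurable_shift.
      + apply: measurableT_comp => //; apply: measurable_funB => //; exact: measurable_shift.
      + rewrite Np_scale//; last first.
          apply: measurableT_comp => //; apply: measurable_funB => //; exact: measurable_shift.
        rewrite (@eq_Np_norm _ _ _ _ (fun x => mol s f (x + v) - mol s f x)); last by move=> x _; rewrite normr_id.
        apply: (@le_trans _ _ ((`|t^-1| `^ p)%:E * (K * (s1 + s1))%:E)%E).
          by apply: lee_wpmul2l => //; rewrite lee_fin powR_ge0.
        rewrite -EFinM lee_fin gtr0_norm ?invr_gt0// /s1.
        have tt1 : t^-1 `^ p * t `^ p = 1 by rewrite -powRM ?invr_ge0 ?(ltW t0)// mulVf ?gt_eqF// powR1.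
        have -> : t^-1 `^ p * (K * (t `^ p * dt + t `^ p * dt)) = (t^-1 `^ p * t `^ p) * (K * (dt + dt)) by ring.
        by rewrite tt1 mul1r.
      + by rewrite (@eq_Np_norm _ _ _ _ (fun x => mol s g (x + l *: v) - mol s g x)) ?diffg// => x _; rewrite normr_id.
  by rewrite integral_cst//= lebesgue_measure_itv/= lte_fin ltr01 oppr0 adde0 mule1.
apply: (le_trans step1).
apply: (@le_trans _ _ ((K * (dt + K * (K * (dt + dt) + K * (K * (dt + dt) + dt))))%:E + dt%:E)%E).
  apply: leeD => //.
  rewrite (@eq_Np _ _ _ _ (fun x => - (mol s g x - g x) + mol s g x)); last by move=> x _; ring.
  rewrite EFinM EFinD; apply: Np_add_le => //; first exact: measurableT_comp.
  by rewrite Np_opp; apply: le_trans k2; exact: subset_Np.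
rewrite -EFinD lee_fin le_eqVlt; apply/orP; left; apply/eqP.
have -> : e = dt * M by rewrite /dt divfK// gt_eqF.
rewrite /M; ring.
Qed.

End vanishing.

(** * Weak derivatives and the stream function *)

Section weak_derivatives.
Variable R : realType.
Local Notation pt := (pt R).
Local Notation leb2 := (@leb2 R).
Local Notation mu := (@lebesgue_measure R).
Implicit Types (p r c s : R) (f k u : pt -> R) (D E : set pt) (x y a v z : pt) (b : bool) (w : seq bool).

Lemma sub_axl b x y (t : R) : x - axl b y t = axl b (x - y) (crd b x - t).
Proof. by case: b. Qed.

Lemma pdd_reflect b f x y c : smooth f ->
  is_derive (crd b y) 1 (fun t => c * f (x - axl b y t)) (- c * pdd b f (x - y)).
Proof.
move=> sf.
have h := smooth_isd b (x - y) sf.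
have ha : is_derive (crd b y) 1 (fun t : R => crd b x + (-1) * t) (-1) by exact: isd_affine.
have -> : (fun t => c * f (x - axl b y t)) =
    (fun t => c * (fun l => f (axl b (x - y) l)) (crd b x + (-1) * t)).
  by apply/funext => t; rewrite sub_axl mulN1r.
have h' : is_derive (crd b x + (-1) * crd b y) 1 (fun l => f (axl b (x - y) l)) (pdd b f (x - y)).
  by rewrite mulN1r -crd_sub.
have hc := @isd_comp R (fun l => f (axl b (x - y) l)) (fun t => crd b x + -1 * t) (crd b y) _ _ h' ha.
by apply: (isd_eq (isd_scale c hc)); ring.
Qed.

Lemma pdw_reflect w f x : smooth f ->
  pdw w (fun y => f (x - y)) = (fun y => (-1) ^+ size w * pdw w f (x - y)).
Proof.
move=> sf; elim: w => [|b w IH]; first by apply/funext => y; rewrite /= expr0 mul1r.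
have sw : smooth (pdw w f).
  by move=> w'; have := sf (w' ++ w); rewrite /pdw foldr_cat.
rewrite !pdw_cons IH; apply/funext => y; rewrite exprS mulN1r.
by apply: isd_derive1; exact: pdd_reflect.
Qed.

Lemma smooth_reflect f x : smooth f -> smooth (fun y => f (x - y)).
Proof.
move=> sf; apply/smoothP => w; rewrite pdw_reflect//.
have sw : smooth (pdw w f).
  by move=> w'; have := sf (w' ++ w); rewrite /pdw foldr_cat.
split.
  move=> y; apply: cvgM; first exact: cvg_cst.
  apply: (@continuous_comp _ _ _ (fun y => x - y)); last exact: smooth_continuous.
  by apply: cvgB; [exact: cvg_cst|exact: cvg_id].
by move=> b y; have [] := pdd_reflect b x y ((-1) ^+ size w) sw.
Qed.

Lemma closed_box a r : closed (box a r).
Proof. by apply: compact_closed; [exact: norm_hausdorff|exact: compact_box]. Qed.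

Lemma compact_supp f a r : (forall x, r < `|x - a| -> f x = 0) -> compact (supp f) /\ supp f `<=` box a r.
Proof.
move=> hf; have sb : supp f `<=` box a r.
  rewrite ((closure_id (box a r)).1 (@closed_box a r)).
  apply: closure_subset => x /= /eqP fx; rewrite /box/= leNgt; apply/negP => h; apply: fx; exact: hf.
split => //; apply: subclosed_compact sb; [exact: closed_closure|exact: compact_box].
Qed.

Lemma test_ker r k x : ker r k -> test_fun (fun y => k (x - y)).
Proof.
move=> [sk hk]; split; first exact: smooth_reflect.
have [] // := @compact_supp (fun y => k (x - y)) x r.
by move=> y h; apply: hk; rewrite distrC.
Qed.

(** Test with [y -> k (x - y)]: the sign [(-1)^|al|] from the reflection cancels the one in the
    definition of the weak derivative. *)
Lemma weak_cvl al u g r k x : locint u -> locint g -> weak_deriv al u g -> ker r k ->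
  cvl g k x = cvl u (Dmi al k) x.
Proof.
move=> lu lg wd kk; have [sk _] := kk.
have kD : ker r (Dmi al k) by exact: ker_pdw.
have sz : size (nseq al.1 true ++ nseq al.2 false) = (al.1 + al.2)%N by rewrite size_cat !size_nseq.
have := wd _ (test_ker x kk); rewrite /Dmi pdw_reflect// sz -/(Dmi al k); set e := (-1) ^+ _ => h.
have ee : e * e = 1 by rewrite /e -exprD addnn -mul2n exprM sqrrN expr1n expr1n.
have i1 := cvl_integrable x lu kD; have i2 := cvl_integrable x lg kk.
have h1 : e * cvl u (Dmi al k) x = e * cvl g k x.
  rewrite !cvlE -!RintegralZl//.
  rewrite /Rintegral -h; congr (fine _); apply: eq_integral => y _; congr (_%:E); ring.
by rewrite -[LHS]mul1r -[RHS]mul1r -ee -!mulrA h1.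
Qed.

Lemma LpP p f : 0 < p -> Lp p f -> measurable_fun setT f /\ (Np p setT f < +oo)%E.
Proof.
move=> p0 [mf hf]; split => //.
have := @poweR_Lnorm _ _ _ leb2 (EFin \o f) p (lt0r_neq0 p0).
rewrite NpE (_ : (\int[leb2]_x (`|f x| `^ p)%:E)%E = (\int[leb2]_x (`|(EFin \o f) x| `^ p))%E); last first.
  by apply: eq_integral => x _; rewrite /= -poweR_EFin.
move=> <-; apply: poweR_lty => //.
Qed.

Lemma Lnorm_Np p f : 0 < p -> (Lnorm leb2 p%:E (EFin \o f) = (Np p setT f) `^ p^-1)%E.
Proof.
move=> p0; rewrite unlock NpE; congr (_ `^ _)%E.
Qed.

Definition cnt w : nat * nat := (count id w, count negb w).

Lemma cnt_size w : ((cnt w).1 + (cnt w).2)%N = size w.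
Proof. by rewrite /cnt/=; elim: w => //= -[] w /= <-; rewrite ?addnS ?addSn ?add0n ?add1n. Qed.

(** The new derivative reaches the kernel at the other end of the word; the order is immaterial by
    [pdw_rhos_count], which is why a family indexed by multi-indices suffices. *)
Lemma weak_wpd m u (G : nat * nat -> pt -> R) : locint u ->
  (forall al, (al.1 + al.2 <= m)%N -> locint (G al) /\ weak_deriv al u (G al)) ->
  forall b w, (size w < m)%N -> wpd b (G (cnt w)) (G (cnt (b :: w))).
Proof.
move=> lu hG b w wm s s0; apply/funext => x.
have [l1 w1] : locint (G (cnt w)) /\ weak_deriv (cnt w) u (G (cnt w)).
  by apply: hG; rewrite cnt_size ltnW.
have [l2 w2] : locint (G (cnt (b :: w))) /\ weak_deriv (cnt (b :: w)) u (G (cnt (b :: w))).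
  by apply: hG; rewrite cnt_size.
have kk := @ker_rhos R s s0.
rewrite (cvl_pdd b l1 kk) (weak_cvl x lu l1 w1 (ker_pdd b kk)) /mol (weak_cvl x lu l2 w2 kk).
congr (cvl _ _ _); rewrite /Dmi -pdw_rcons; apply: pdw_rhos_count.
- by rewrite -cats1 !count_cat !count_nseq /=; case: (b); rewrite /= ?mul1n ?mul0n ?addn0 ?add0n ?add1n ?addn1.
- by rewrite -cats1 !count_cat !count_nseq /=; case: (b); rewrite /= ?mul1n ?mul0n ?addn0 ?add0n ?add1n ?addn1.
Qed.

Lemma wpd_pdw n (G : seq bool -> pt -> R) s : 0 < s ->
  (forall b w, (size w < n)%N -> wpd b (G w) (G (b :: w))) ->
  forall w, (size w <= n)%N -> pdw w (mol s (G [::])) = mol s (G w).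
Proof.
by move=> s0 hG; elim=> // b w IH bw; rewrite pdw_cons IH; [exact: hG|exact: ltnW].
Qed.

Lemma Np_compact_lty p f M : 0 < p -> continuous f -> (forall x, M < `|x| -> f x = 0) -> (Np p setT f < +oo)%E.
Proof.
move=> p0 cf fM; have [C C0 hC] := continuous_box_bounded 0 M cf.
have mf := continuous_measurable2 cf; have mb := measurable_box (0 : pt) M.
have -> : f = (fun x => f x * \1_(box 0 M) x).
  apply/funext => x; rewrite indicE; have [h|h] := leP `|x| M.
    by rewrite mem_set ?mulr1// /box/= subr0.
  by rewrite fM ?mul0r.
rewrite Np_indic// setTI; apply: (@le_lt_trans _ _ (Np p (box 0 M) (cst C))).
  by apply: le_Np => //; [exact: ltW|move=> x bx; rewrite (ger0_norm C0); exact: hC].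
rewrite Np_cst// lte_mul_pinfty ?lee_fin ?powR_ge0//.
have [M0|M0] := leP 0 M; first by rewrite leb2_box// ltry.
have -> : box 0 M = set0.
  apply/seteqP; split => // x.
  by rewrite /box/= subr0 => /(le_trans (normr_ge0 _)); rewrite leNgt M0.
by rewrite /leb2 measure0.
Qed.

(** Below order [m] the continuous representatives of the vanishing condition are taken; they are in
    L^p since they vanish outside a bounded set. At order [m] the Sobolev condition provides the
    derivative. *)
Lemma sobolev_family m p u A M : 1 < p -> (0 < m)%N -> sobolev m p u ->
  (forall x, M < `|x| -> A x) ->
  (forall j : nat * nat, (j.1 + j.2 <= m.-1)%N -> vanish_on A j u) ->
  exists G : nat * nat -> pt -> R,
   (forall al, (al.1 + al.2 <= m)%N ->
     [/\ measurable_fun setT (G al), (Np p setT (G al) < +oo)%E & weak_deriv al u (G al)]) /\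
   (forall al, (al.1 + al.2 < m)%N -> continuous (G al) /\ forall x, A x -> G al x = 0).
Proof.
move=> p1 m0 [_ su] AM hv; have p0 : 0 < p by exact: lt_trans p1.
have ex al : exists g : pt -> R, ((al.1 + al.2 <= m)%N ->
     [/\ measurable_fun setT g, (Np p setT g < +oo)%E & weak_deriv al u g]) /\
   ((al.1 + al.2 < m)%N -> continuous g /\ forall x, A x -> g x = 0).
  have [lm|lm] := ltnP (al.1 + al.2)%N m.
    have [|h [ch [wh hA]]] := hv al; first by rewrite -ltnS prednK.
    exists h; split => // _; split => //; first exact: continuous_measurable2.
    by apply: (@Np_compact_lty _ _ M) => // x /AM /hA.
  have [em|em] := eqVneq (al.1 + al.2)%N m.
    have [|g [/LpP-/(_ p0)[mg gp] wg]] := su al; first by rewrite em.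
    by exists g; split.
  (* A default value at orders above [m]. *)
  by exists (cst 0); split; [move=> h; move: em; rewrite eqn_leq h lm|].
exists (fun al => sval (cid (ex al))); split => al hal.
- by case: cid => g [] /= h1 _; exact: h1.
- by case: cid => g [] /= _ h1; exact: h1.
Qed.

Lemma div_mol u1 u2 s x : 0 < s -> locint u1 -> locint u2 -> div_free u1 u2 ->
  cvl u1 (pdd true (rhos s)) x + cvl u2 (pdd false (rhos s)) x = 0.
Proof.
move=> s0 l1 l2 df; have kk := @ker_rhos R s s0; have [sk _] := kk.
have := df _ (test_ker x kk).
rewrite -[pd1 _]/(pdw [:: true] _) -[pd2 _]/(pdw [:: false] _) !pdw_reflect// => h.
have i1 := cvl_integrable x l1 (ker_pdd true kk); have i2 := cvl_integrable x l2 (ker_pdd false kk).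
have iD : leb2.-integrable setT (EFin \o (fun y => u1 y * pdd true (rhos s) (x - y) + u2 y * pdd false (rhos s) (x - y))).
  by have := integrableD measurableT i1 i2; apply: eq_integrable.
apply: oppr_inj; rewrite !cvlE -(RintegralD measurableT i1 i2) oppr0 -mulN1r -(RintegralZl _ measurableT iD).
rewrite /Rintegral -[RHS]/(fine 0%E) -h; congr (fine _); apply: eq_integral => y _; congr (_%:E).
rewrite -[pdw [:: true] _]/(pdd true (rhos s)) -[pdw [:: false] _]/(pdd false (rhos s)) [size _]/= [size _]/= !expr1.
move: (pdd true _ _) (pdd false _ _) => c d; ring.
Qed.

End weak_derivatives.

(** * The stream function of a divergence-free field *)

Section stream_function.
Variable R : realType.
Local Notation pt := (pt R).
Local Notation leb2 := (@leb2 R).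
Local Notation mu := (@lebesgue_measure R).
Implicit Types (p r c s M : R) (f k : pt -> R) (D E : set pt) (x y a v z : pt) (b : bool) (w : seq bool).

Lemma compact_support_uniform f M : continuous f -> (forall x, M < `|x| -> f x = 0) ->
  forall e : R, 0 < e -> exists2 d : R, 0 < d & forall x y, `|x - y| <= d -> `|f x - f y| <= e.
Proof.
move=> cf fM e e0.
have nc := (compact_near_coveringP (box (0 : pt) (M + 1))).1 (@compact_box R 0 (M + 1)).
pose P (d : R) x := forall y, `|x - y| <= d -> `|f x - f y| <= e.
have : \forall d \near (0 : R)^'+, box 0 (M + 1) `<=` P d.
  apply: nc => x _.
  have /cvgrPdist_le/(_ (e / 2)) := cf x; rewrite divr_gt0// => /(_ isT).
  rewrite -nbhs_ballE => -[d /= d0 hd].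
  have hd' y : `|x - y| < d -> `|f x - f y| <= e / 2.
    by move=> xy; apply: hd; move: xy; rewrite pt_ltnorm => /andP[? ?]; split.
  exists (ball x (d / 2), [set i | i < d / 2]).
    split; first by apply: nbhsx_ballx; rewrite divr_gt0.
    by apply: nbhs_right_lt; rewrite divr_gt0.
  move=> [x' i] /= [bx' id] y yx'.
  have xx' : `|x - x'| < d / 2.
    by move: bx'; rewrite /ball/= /prod_ball/= => -[b1 b2]; rewrite pt_ltnorm b1 b2.
  have h1 : `|f x - f x'| <= e / 2 by apply: hd'; lra.
  have h2 : `|f x - f y| <= e / 2.
    apply: hd'; rewrite -[x - y](subrKA x'); apply: (le_lt_trans (ler_normD _ _)).
    lra.
  rewrite -[f x' - f y](subrKA (f x)); apply: (le_trans (ler_normD _ _)).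
  rewrite distrC; lra.
move=> h.
have H : \forall d \near (0 : R)^'+, (box 0 (M + 1) `<=` P d /\ 0 < d) /\ d < 1.
  apply: filterI; last by apply: nbhs_right_lt.
  by apply: filterI => //; exact: nbhs_right_gt.
have [d [[hd d0] d1]] := @filter_ex _ _ (at_right_proper_filter (0 : R)) _ H.
exists d => // x y xy; have [bx|bx] := leP `|x| (M + 1).
  by apply: hd => //; rewrite /box/= subr0.
have yM : M < `|y|.
  have : `|x| <= `|x - y| + `|y| by rewrite -{1}(subrK y x) ler_normD.
  lra.
by rewrite !fM ?subrr ?normr0 ?ltW//; lra.
Qed.

Lemma bounded_Rintegral (h : R -> R) (C T : R) : 0 <= T -> measurable_fun setT h ->
  (forall t, `|h t| <= C * \1_(`[0, T]%classic : set R) t) ->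
  [/\ mu.-integrable setT (EFin \o h), `|\int[mu]_t h t| <= C * T &
    (\int[mu]_t (`|h t|)%:E <= (C * T)%:E)%E].
Proof.
move=> T0 mh hC.
have m1 : measurable_fun setT (fun t : R => (C * \1_(`[0, T]%classic : set R) t)%:E).
  apply/measurable_EFinP; apply: measurable_funM => //; exact: measurable_indic.
have i1 : (\int[mu]_t (C * \1_(`[0%R, T]%classic : set R) t)%:E = (C * T)%:E)%E.
  transitivity (\int[mu]_(t in `[0%R, T]) (cst C%:E t))%E.
    rewrite [RHS]integral_mkcond; apply: eq_integral => t _; rewrite /patch indicE.
    by case: ifPn => _; rewrite ?mulr1 ?mulr0.
  rewrite integral_cst//= lebesgue_measure_itv/= lte_fin.
  case: ltP => [_|T0']; first by rewrite oppr0 adde0.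
  by have -> : T = 0 by [apply/eqP; rewrite eq_le T0 T0']; rewrite mulr0 mule0.
have le1 : (\int[mu]_t (`|h t|)%:E <= (C * T)%:E)%E.
  rewrite -i1; apply: ge0_le_integral => //.
  - by apply/measurable_EFinP; exact: measurableT_comp.
  - by move=> t _; rewrite lee_fin.
have ih : mu.-integrable setT (EFin \o h).
  apply/integrableP; split; first exact/measurable_EFinP.
  exact: (le_lt_trans le1 (ltry _)).
split => //; rewrite -lee_fin EFin_normr_Rintegral//.
apply: le_trans le1; apply: (le_trans (le_abse_integral _ _ _)) => //.
exact/measurable_EFinP.
Qed.

Definition downward : pt := (0, -1).
(* Primitive of [V] from below: the stream function when [V] is the first component
   of a divergence-free field. *)
Definition down_integral (V : pt -> R) x : R := \int[mu]_t (\1_(`[0, +oo[%classic : set R) t * V (x + t *: downward)).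

Lemma downward_le x (t : R) : t - `|x| <= `|x + t *: downward|.
Proof.
apply: le_trans (pt_norm2 _); rewrite /= /GRing.scale/= mulrN1.
have := pt_norm2 x; have := ler_norm (t - x.2); rewrite distrC.
have := ler_norm x.2; lra.
Qed.

Lemma down_integral_integrable (V : pt -> R) M x c : continuous V -> (forall x, M < `|x| -> V x = 0) ->
  (forall z, `|V z| <= c) -> 0 <= M ->
  mu.-integrable setT (EFin \o (fun t => \1_(`[0, +oo[%classic : set R) t * V (x + t *: downward))).
Proof.
move=> cV VM Vc M0; have c0 : 0 <= c by apply: le_trans (Vc 0).
have [] // := @bounded_Rintegral (fun t => \1_(`[0, +oo[%classic : set R) t * V (x + t *: downward)) c (`|x| + M).
- by rewrite addr_ge0.
- apply: measurable_funM; first exact: measurable_indic.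
  by apply: measurable_line; exact: continuous_measurable2.
- move=> t; rewrite !indicE normrM.
  have [tT|tT] := leP t (`|x| + M); last first.
    rewrite VM ?normr0 ?mulr0 ?mulr_ge0//; apply: lt_le_trans (downward_le x t); lra.
  have [t0|t0] := leP 0 t.
    by rewrite !mem_set/= ?in_itv/= ?t0//= ?normr1 ?mul1r ?mulr1.
  by rewrite memNset ?normr0 ?mul0r ?mulr_ge0//= in_itv/= leNgt t0.
Qed.

Lemma compact_support_bounded f M : continuous f -> (forall x, M < `|x| -> f x = 0) ->
  exists2 c, 0 <= c & forall z, `|f z| <= c.
Proof.
move=> cf fM; have [C C0 hC] := continuous_box_bounded 0 M cf; exists C => // z.
have [h|h] := leP `|z| M; first by apply: hC; rewrite /box/= subr0.
by rewrite fM// normr0.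
Qed.

(** Uniform continuity of [V], integrated over rays that leave its support within a length [T]
    common to all points near [x]. *)
Lemma continuous_down_integral (V : pt -> R) M : continuous V -> (forall x, M < `|x| -> V x = 0) -> 0 <= M ->
  continuous (down_integral V).
Proof.
move=> cV VM M0 x; have mV := continuous_measurable2 cV.
have [c c0 Vc] := compact_support_bounded cV VM.
apply/cvgrPdist_le => e e0; pose T := `|x| + 1 + M.
have T0 : 0 < T by rewrite /T; have := normr_ge0 x; lra.
have [d d0 hd] := compact_support_uniform cV VM (divr_gt0 e0 T0).
have m0 : 0 < Num.min d 1 by rewrite lt_min d0 ltr01.
apply: (filterS _ (nbhsx_ballx x _ m0)) => y [b1 b2].
have : `|x - y| < Num.min d 1 by rewrite pt_ltnorm b1 b2.
rewrite lt_min => /andP[xyd xy1].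
rewrite /down_integral -RintegralB//; last 2 first.
- exact: down_integral_integrable VM Vc M0.
- exact: down_integral_integrable VM Vc M0.
have -> : e = e / T * T by rewrite divfK// gt_eqF.
pose h (t : R) := \1_(`[0, +oo[%classic : set R) t * V (x + t *: downward) - \1_(`[0, +oo[%classic : set R) t * V (y + t *: downward).
have [] // := @bounded_Rintegral h (e / T) T (ltW T0).
- apply: measurable_funB; apply: measurable_funM; try exact: measurable_indic; exact: measurable_line.
- move=> t; rewrite /h -mulrBr normrM !indicE.
  have eT : 0 <= e / T by rewrite divr_ge0// ltW.
  have [tT|tT] := leP t T; last first.
    have yx : `|y| <= `|x| + 1 by rewrite -(subKr x y); apply: (le_trans (ler_normB _ _)); lra.
    have V1 : V (x + t *: downward) = 0 by apply: VM; apply: lt_le_trans (downward_le x t); rewrite /T in tT *; lra.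
    have V2 : V (y + t *: downward) = 0 by apply: VM; apply: lt_le_trans (downward_le y t); rewrite /T in tT *; lra.
    by rewrite V1 V2 subrr normr0 mulr0 mulr_ge0.
  have [t0|t0] := leP 0 t.
    rewrite !mem_set/= ?in_itv/= ?t0//= ?normr1 ?mul1r ?mulr1//.
    by apply: hd; rewrite opprD addrACA subrr addr0 ltW.
  have -> : (t \in `[0, +oo[%classic) = false by apply/negbTE/negP; rewrite inE/= in_itv/= leNgt t0.
  by rewrite normr0 mul0r mulr_ge0.
Qed.

Lemma integral_shift (f : pt -> R) v : measurable_fun setT f ->
  (\int[leb2]_y (f (y + v)%R)%:E = \int[leb2]_y (f y)%:E)%E.
Proof.
move=> mf.
have key (h : pt -> \bar R) : measurable_fun setT h -> (forall y, 0 <= h y)%E ->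
    (\int[leb2]_y h (y + v)%R = \int[leb2]_y h y)%E.
  move=> mh h0; have := @ge0_integral_aff R v 1 h (oner_neq0 _) mh h0.
  rewrite expr1n invr1 mul1e => <-; apply: eq_integral => y _; congr h.
  by rewrite /aff; apply/pair_equal_spec; rewrite /= !mul1r ![v.1 + _]addrC ![v.2 + _]addrC.
pose g y := (f y)%:E; have mg : measurable_fun setT g by exact/measurable_EFinP.
rewrite integralE [RHS]integralE; congr (_ - _)%E.
- by apply: (etrans _ (key g^\+%E (measurable_funepos mg) (funepos_ge0 _))); apply: eq_integral => y _; rewrite !funeposE.
- by apply: (etrans _ (key g^\-%E (measurable_funeneg mg) (funeneg_ge0 _))); apply: eq_integral => y _; rewrite !funenegE.
Qed.

Lemma integrable_mulr d (T : measurableType d) (m : {measure set T -> \bar R}) (h : T -> R) c :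
  m.-integrable setT (EFin \o h) -> m.-integrable setT (EFin \o (fun t => h t * c)).
Proof.
move=> ih; have := integrableZl measurableT c ih.
by apply: eq_integrable => // t _; rewrite /= -EFinM mulrC.
Qed.

(** Fubini and translation invariance: mollification commutes with shifting along the ray. The
    integrand is bounded and of bounded support in both variables, hence integrable on the
    product. *)
Lemma cvl_down_integral (V : pt -> R) M r k x : continuous V -> (forall x, M < `|x| -> V x = 0) -> 0 <= M -> 0 <= r -> ker r k ->
  cvl (down_integral V) k x = \int[mu]_t (\1_(`[0, +oo[%classic : set R) t * cvl V k (x + t *: downward)).
Proof.
move=> cV VM M0 r0 kk; have mV := continuous_measurable2 cV; have mk := measurable_ker kk.
have lV := locint_continuous cV; have cP := continuous_down_integral cV VM M0; have lP := locint_continuous cP.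
have [c c0 Vc] := compact_support_bounded cV VM.
have [d d0 kd] := ker_bounded kk; have [_ kr] := kk.
pose T := `|x| + r + M; have T0 : 0 <= T by rewrite !addr_ge0.
pose H (t : R) : R := \1_(`[0, +oo[%classic : set R) t.
have mH : measurable_fun setT H by exact: measurable_indic.
pose F (q : pt * R) := H q.2 * V (q.1 + q.2 *: downward) * k (x - q.1).
have mVd : measurable_fun setT (fun q : pt * R => V (q.1 + q.2 *: downward)).
  apply: measurableT_comp => //; apply: measurable_pairpt => /=.
  - by apply: measurable_funD; [exact: measurableT_comp|apply: measurable_funM].
  - by apply: measurable_funD; [exact: measurableT_comp|apply: measurable_funM].
have mkx : measurable_fun setT (fun q : pt * R => k (x - q.1)).
  apply: measurableT_comp => //.
  exact: (measurableT_comp (measurable_subpt x) measurable_fst).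
have mF : measurable_fun setT F.
  apply: measurable_funM => //; apply: measurable_funM => //; exact: measurableT_comp.
have Fle y t : `|F (y, t)| <= (c * d) * (\1_(box x r) y * \1_(`[0, T]%classic : set R) t).
  rewrite /F/= /H !normrM !indicE.
  have cd0 : 0 <= c * d by rewrite mulr_ge0.
  have [yx|yx] := leP `|x - y| r; last by rewrite (kr _ yx) normr0 mulr0 !mulr_ge0.
  rewrite [y \in _]mem_set ?mul1r; last by rewrite /box/= distrC.
  have [tT|tT] := leP t T; last first.
    rewrite VM ?normr0 ?mulr0 ?mul0r ?mulr_ge0//; apply: lt_le_trans (downward_le y t).
    have : `|y| <= `|x| + r by rewrite -(subKr x y); apply: (le_trans (ler_normB _ _)); lra.
    rewrite /T in tT *; lra.
  have [t0|t0] := leP 0 t.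
    by rewrite !mem_set/= ?in_itv/= ?t0//= ?normr1 ?mul1r ?mulr1; exact: ler_pM.
  by rewrite memNset ?normr0 ?mul0r ?mulr_ge0//= in_itv/= leNgt t0.
have iF : (sleb2 R \x mu)%E.-integrable setT (EFin \o F).
  apply/integrable12ltyP; first exact/measurable_EFinP.
  apply: (@le_lt_trans _ _ (\int[leb2]_(y in box x r) (c * d * T)%:E)%E); last first.
    by rewrite integral_cst_box// ltry.
  rewrite [leRHS]integral_mkcond; apply: ge0_le_integral => //.
  - by move=> y _; apply: integral_ge0.
  - apply: (measurable_int_snd mu (D := setT) (G := fun q => `|F q|)) => //; exact: measurableT_comp.
  - apply: (measurable_restrictT _ _).1 => //; exact: measurable_box.
  - move=> y _; rewrite /patch; case: ifPn => [yb|yb].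
      have mFy : measurable_fun setT (fun t => F (y, t)) by exact: (measurableT_comp mF (measurable_pair1 y)).
      have [] // := @bounded_Rintegral (fun t => F (y, t)) (c * d) T T0 mFy.
      by move=> t; apply: (le_trans (Fle y t)); rewrite [\1_(box x r) y]indicE yb mul1r.
    rewrite integral0_eq// => t _; congr (_%:E); apply/eqP; rewrite normr_eq0 -normr_le0.
    by apply: (le_trans (Fle y t)); rewrite [\1_(box x r) y]indicE (negbTE yb) mul0r mulr0.
have := Fubini iF => /= FB.
rewrite cvlE /Rintegral; congr fine.
transitivity (\int[leb2]_y \int[mu]_t (F (y, t))%:E)%E.
  apply: eq_integral => y _; rewrite /down_integral.
  have i1 := down_integral_integrable y cV VM Vc M0.
  rewrite -RintegralZr// /Rintegral fineK//; apply: integrable_fin_num => //.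
  exact: integrable_mulr.
rewrite FB; apply: eq_integral => t _.
have iV := cvl_integrable (x + t *: downward) lV kk.
rewrite mulrC cvlE -(RintegralZr _ measurableT iV) /Rintegral fineK; last first.
  by apply: integrable_fin_num => //; exact: integrable_mulr.
rewrite -(@integral_shift (fun y => V y * k (x + t *: downward - y) * H t) (t *: downward)); last first.
  by apply: measurable_funM => //; exact: measurable_cvl.
apply: eq_integral => y _; congr (_%:E); rewrite /F/= -mulrA mulrC; congr (_ * k _ * _).
by rewrite opprD addrACA subrr addr0.
Qed.

Lemma ker_mol (V : pt -> R) M s : 0 < s -> locint V -> (forall x, M < `|x| -> V x = 0) -> ker (M + s) (mol s V).
Proof.
move=> s0 lV VM; split; first exact: smooth_mol.
move=> x xM; rewrite /mol cvlE; have [_ ks] := @ker_rhos R s s0.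
rewrite (_ : (fun y => _) = (fun=> 0)) ?Rintegral_cst ?mul0r//; apply/funext => y.
have [yM|yM] := leP `|y| M; last by rewrite VM// mul0r.
rewrite ks ?mulr0//; have : `|x| <= `|x - y| + `|y| by rewrite -{1}(subrK y x) ler_normD.
lra.
Qed.

(** The ray leaves the support of [W], so that only the value at its starting point remains. *)
Lemma down_integral_pdd W r x : 0 <= r -> ker r W ->
  \int[mu]_t (\1_(`[0, +oo[%classic : set R) t * pdd false W (x + t *: downward)) = W x.
Proof.
move=> r0 kW; have [sW Wr] := kW; have [sW' Wr'] := ker_pdd false kW.
pose T := `|x| + r + 1; have T0 : 0 < T by rewrite ltr_wpDl// addr_ge0.
have df b' y : derivable (fun t => W (axl b' y t)) (crd b' y) 1 by have [_] := (smoothP W).1 sW [::]; exact.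
have cf b' : continuous (pdd b' W) by apply: smooth_continuous; exact: smooth_pdd.
have cl : continuous (fun t : R => x + t *: downward).
  move=> t; apply: cvgD; first exact: cvg_cst.
  by apply: cvgZr_tmp; exact: cvg_id.
pose u (t : R) := - W (x + t *: downward); pose u' (t : R) := pdd false W (x + t *: downward).
have du (t : R) : is_derive t 1 u (u' t).
  apply: (isd_eq (isd_opp (is_derive_segment x downward t df cf))); rewrite /u' /=; ring.
have cu : continuous u.
  by move=> t; apply: cvgN; apply: continuous_comp; [exact: cl|exact: smooth_continuous].
have cu' : continuous u' by move=> t; apply: continuous_comp; [exact: cl|exact: cf].
have FTC := @continuous_FTC2 R u' u 0 T T0 (continuous_subspaceT cu').
transitivity (fine (\int[mu]_(t in `[0%R, T]) (u' t)%:E)%E).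
  rewrite /Rintegral; congr fine; rewrite [RHS]integral_mkcond; apply: eq_integral => t _.
  rewrite /patch indicE; case: ifPn => tT.
    by rewrite mem_set ?mul1r//; move: tT; rewrite inE/= !in_itv/= andbT => /andP[].
  have [t0|t0] := leP 0 t; last by rewrite memNset ?mul0r//= in_itv/= leNgt t0.
  rewrite Wr' ?mulr0//; apply: lt_le_trans (downward_le x t).
  have : T < t by rewrite ltNge; apply/negP => tT'; move/negP: tT; apply; rewrite inE/= in_itv/= t0.
  rewrite /T; lra.
rewrite FTC.
- rewrite -EFinB /= /u scale0r addr0 Wr ?oppr0 ?sub0r ?opprK//.
  by apply: lt_le_trans (downward_le x T); rewrite /T; lra.
- split => //.
  + by apply: cvg_at_right_filter; exact: cu.
  + by apply: cvg_at_left_filter; exact: cu.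
- by move=> t _; exact: isd_derive1.
Qed.

Lemma mol_opp s f : 0 < s -> locint f -> mol s (fun x => - f x) = (fun x => - mol s f x).
Proof.
move=> s0 lf; apply/funext => x; rewrite /mol !cvlE -mulN1r.
have i := cvl_integrable x lf (ker_rhos s0).
rewrite -(RintegralZl _ measurableT i).
by apply: eq_Rintegral => y _; rewrite mulN1r mulNr.
Qed.

(** After mollification, the vertical derivative comes from the fundamental theorem along the ray.
    For the horizontal one, the divergence condition replaces the horizontal derivative of [U1] by
    minus the vertical derivative of [U2], and the same theorem applies. *)
Lemma stream_function (U1 U2 : pt -> R) M : continuous U1 -> continuous U2 -> 0 <= M ->
  (forall x, M < `|x| -> U1 x = 0) -> (forall x, M < `|x| -> U2 x = 0) ->
  (forall s x, 0 < s -> cvl U1 (pdd true (rhos s)) x + cvl U2 (pdd false (rhos s)) x = 0) ->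
  exists psi, [/\ continuous psi, wpd false psi U1 & wpd true psi (fun x => - U2 x)].
Proof.
move=> c1 c2 M0 U1M U2M dv; exists (down_integral U1); have cP := continuous_down_integral c1 U1M M0.
have l1 := locint_continuous c1; have l2 := locint_continuous c2; have lP := locint_continuous cP.
split => // s s0; apply/funext => x; have kk := @ker_rhos R s s0; have s0' := ltW s0.
- rewrite (cvl_pdd false lP kk) (cvl_down_integral x c1 U1M M0 s0' (ker_pdd false kk)).
  rewrite -(cvl_pdd false l1 kk); apply: (@down_integral_pdd _ (M + s)); first by rewrite addr_ge0.
  exact: ker_mol.
- rewrite (cvl_pdd true lP kk) (cvl_down_integral x c1 U1M M0 s0' (ker_pdd true kk)).
  rewrite mol_opp//.
  have Ms : 0 <= M + s by rewrite addr_ge0.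
  have k2 := ker_mol s0 l2 U2M.
  rewrite -(down_integral_pdd x Ms k2) -mulN1r.
  have k3 := ker_pdd false k2; have cW : continuous (pdd false (mol s U2)) by apply: smooth_continuous; case: k3.
  have [d _ hd] := ker_bounded k3; have [_ W0] := k3.
  have i1 := down_integral_integrable x cW W0 hd Ms.
  rewrite -(RintegralZl _ measurableT i1); apply: eq_Rintegral => t _.
  have := dv s (x + t *: downward) s0; rewrite -(cvl_pdd false l2 kk) => /eqP; rewrite addr_eq0 => /eqP ->.
  by rewrite mulN1r mulrN.
Qed.

End stream_function.

(** * Hardy inequality relative to a closed set *)

Section distance.
Variable R : realType.
Local Notation pt := (pt R).
Local Notation leb2 := (@leb2 R).
Local Notation mu := (@lebesgue_measure R).
Implicit Types (p r c s M : R) (f k : pt -> R) (A D E : set pt) (x y a v z : pt) (b : bool) (w : seq bool).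

Lemma measurable_lt_set (f g : pt -> R) : measurable_fun setT f -> measurable_fun setT g ->
  measurable [set x | f x < g x].
Proof.
move=> mf mg; rewrite (_ : [set x | f x < g x] = ~` [set x | g x <= f x]).
  by apply: measurableC; rewrite -[X in measurable X]setTI; apply: measurable_fun_le.
by apply/seteqP; split => x /=; [rewrite ltNge => /negP|move=> /negP; rewrite -ltNge].
Qed.

Definition dist A x : R := inf [set `|x - a| | a in A].

Lemma dist_has_inf A x : A !=set0 -> has_inf [set `|x - a| | a in A].
Proof.
move=> [a Aa]; split; first by exists `|x - a|; exists a.
by exists 0 => _ [y _ <-].
Qed.

Lemma dist_ge0 A x : A !=set0 -> 0 <= dist A x.
Proof.
move=> A0; apply: lb_le_inf; first by have [] := dist_has_inf x A0.
by move=> _ [y _ <-].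
Qed.

Lemma dist_le A x a : A a -> dist A x <= `|x - a|.
Proof. by move=> Aa; apply: ge_inf; [exists 0 => _ [y _ <-]|exists a]. Qed.

Lemma dist_adherent A x (e : R) : A !=set0 -> 0 < e -> exists2 a, A a & `|x - a| < dist A x + e.
Proof. by move=> A0 e0; have [_ [a Aa <-] h] := inf_adherent e0 (dist_has_inf x A0); exists a. Qed.

Lemma dist_lip A x y : A !=set0 -> dist A x <= dist A y + `|x - y|.
Proof.
move=> A0; apply/ler_addgt0Pr => e e0; have [a Aa h] := dist_adherent y A0 e0.
apply: (le_trans (dist_le x Aa)); rewrite -(subrKA y); apply: (le_trans (ler_normD _ _)).
rewrite /= in h *; lra.
Qed.

Lemma dist_continuous A : A !=set0 -> continuous (dist A).
Proof.
move=> A0; apply: lipschitz_continuous => a; exists 1 => x y _ _; rewrite mul1r.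
have := dist_lip x y A0; have := dist_lip y x A0; rewrite [`|y - x|]distrC => h1 h2.
by rewrite ler_norml; apply/andP; split; lra.
Qed.

Lemma dist_eq0 A x : A x -> dist A x = 0.
Proof.
move=> Ax; apply/eqP; rewrite eq_le dist_ge0 ?andbT; last by exists x.
by apply: (le_trans (dist_le x Ax)); rewrite subrr normr0.
Qed.

Lemma dist_gt0 A x : closed A -> A !=set0 -> ~ A x -> 0 < dist A x.
Proof.
move=> cA A0 nAx; rewrite lt_neqAle dist_ge0// andbT; apply/negP => /eqP d0; apply: nAx.
apply: cA => U; rewrite -nbhs_ballE => -[e /= e0 eU].
have [a Aa h] := dist_adherent x A0 e0; exists a; split => //; apply: eU.
by move: h; rewrite -d0 add0r pt_ltnorm => /andP[? ?]; split.
Qed.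

(** For each rational point and each radius [1/(n+1)], a point of [A] within that radius is selected
    if there is one; [pickle] enumerates the selections. *)
Lemma dense_sequence A : A !=set0 -> exists a_ : nat -> pt, (forall i, A (a_ i)) /\
  forall x e, 0 < e -> exists i, `|x - a_ i| < dist A x + e.
Proof.
move=> [a0 Aa0]; have A0 : A !=set0 by exists a0.
pose q (t : rat * rat * nat) : pt := (ratr t.1.1, ratr t.1.2).
have ex (t : rat * rat * nat) : exists a, A a /\ ((exists2 b, A b & `|b - q t| < t.2.+1%:R^-1) -> `|a - q t| < t.2.+1%:R^-1).
  have [[b Ab hb]|h] := pselect (exists2 b, A b & `|b - q t| < t.2.+1%:R^-1); first by exists b.
  by exists a0; split.
pose s t := sval (cid (ex t)).
have As t : A (s t) by rewrite /s; case: cid => ? [].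
have hs t : (exists2 b, A b & `|b - q t| < t.2.+1%:R^-1) -> `|s t - q t| < t.2.+1%:R^-1.
  by rewrite /s; case: cid => ? [].
exists (fun i => if unpickle i is Some t then s t else a0); split.
  by move=> i; case: unpickle.
move=> x e e0.
have e4 : 0 < e / 4 by rewrite divr_gt0.
have [b Ab hb] := dist_adherent x A0 e4.
pose n := Num.bound (e / 4)^-1.
have n4 : n.+1%:R^-1 <= e / 4.
  rewrite -[leRHS]invrK lef_pV2 ?posrE// ?invr_gt0//.
  apply: (@le_trans _ _ n%:R); last by rewrite ler_nat.
  by rewrite ltW// archi_boundP// invr_ge0 ltW.
have n0 : 0 < n.+1%:R^-1 :> R by rewrite invr_gt0.
have rq (y d : R) : 0 < d -> exists r : rat, `|y - ratr r| < d.
  move=> d0; have /rat_in_itvoo[r] : y - d < y + d by lra.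
  by rewrite in_itv/= => /andP[h1 h2]; exists r; rewrite ltr_norml; apply/andP; split; lra.
have [r1 h1] := rq b.1 _ n0; have [r2 h2] := rq b.2 _ n0.
pose t : rat * rat * nat := (r1, r2, n).
have ht : `|b - q t| < n.+1%:R^-1 by rewrite pt_ltnorm h1 h2.
have ht' : `|s t - q t| < n.+1%:R^-1 by apply: (hs t); exists b.
exists (pickle t); rewrite pickleK.
have -> : x - s t = (x - b) + ((b - q t) - (s t - q t)).
  by rewrite opprB [b - q t + _]addrA subrK addrA subrK.
apply: (le_lt_trans (ler_normD _ _)).
apply: (@lt_le_trans _ _ ((dist A x + e / 4) + (e / 4 + e / 4))); last by lra.
apply: ltrD => //; apply: (le_lt_trans (ler_normB _ _)).
by apply: ltrD; [exact: lt_le_trans ht n4|exact: lt_le_trans ht' n4].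
Qed.

End distance.

(** * Voronoi cells of finite sets *)

Section voronoi.
Variable R : realType.
Local Notation pt := (pt R).
Local Notation leb2 := (@leb2 R).
Variables (a_ : nat -> pt).
Implicit Types (p r c s M : R) (f k : pt -> R) (A D E : set pt) (x y a v z : pt) (b : bool) (w : seq bool).

(* Voronoi cell of [a_ i] among [a_ 0, ..., a_ n], ties being given to the smallest index. *)
Definition cell n i : set pt := [set x | forall j, (j <= n)%N ->
  `|x - a_ i| <= `|x - a_ j| /\ ((j < i)%N -> `|x - a_ i| < `|x - a_ j|)].

Lemma measurable_cell n i : measurable (cell n i).
Proof.
have m1 j : measurable [set x | `|x - a_ i| <= `|x - a_ j|].
  rewrite -[X in measurable X]setTI; apply: measurable_fun_le => //; exact: measurable_norm_sub.
have m2 j : measurable [set x | `|x - a_ i| < `|x - a_ j|].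
  by apply: measurable_lt_set; exact: measurable_norm_sub.
rewrite (_ : cell n i = \bigcap_j (if (j <= n)%N then [set x | `|x - a_ i| <= `|x - a_ j|] `&`
    (if (j < i)%N then [set x | `|x - a_ i| < `|x - a_ j|] else setT) else setT)).
  apply: bigcap_measurable => // j _; case: ifP => // _; apply: measurableI => //.
  by case: ifP.
apply/seteqP; split => x /=.
  move=> h j _; case: ifPn => // jn; have [h1 h2] := h j jn; split => //.
  by case: ifPn => // ji; exact: h2.
move=> h j jn; have := h j I; rewrite jn => -[h1 h2]; split => // ji; move: h2.
by rewrite ji.
Qed.

(** For [y] on the segment from [a_ i] to [x], the ball about [y] through [a_ i] lies in the ball
    about [x] through [a_ i], so no other centre is closer to [y]. *)
Lemma star_cell n i : (i <= n)%N -> star (a_ i) (cell n i).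
Proof.
move=> le_in x t hx /andP[t0 t1] j jn; have [h1 h2] := hx j jn.
set y := a_ i + t *: (x - a_ i).
have e1 : `|y - a_ i| = t * `|x - a_ i| by rewrite /y addrC addKr normrZ gtr0_norm.
have e2 : `|x - y| = (1 - t) * `|x - a_ i|.
  have -> : x - y = (1 - t) *: (x - a_ i) by rewrite /y opprD addrA scalerBl scale1r.
  by rewrite normrZ ger0_norm// subr_ge0.
have e3 : `|x - a_ j| <= `|x - y| + `|y - a_ j| by rewrite -{1}(subrKA y x); exact: ler_normD.
split; first by rewrite e1; lra.
by move=> /h2 h3; rewrite e1; lra.
Qed.

(** Of the indices that minimise the distance, the least is taken, as the rule for ties demands. *)
Lemma cell_cover n x : exists2 i, (i <= n)%N & cell n i x.
Proof.
pose P i := (i <= n)%N && [forall j : 'I_n.+1, `|x - a_ i| <= `|x - a_ j|].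
have exP : exists i, P i.
  pose i0 := [arg min_(i < (ord0 : 'I_n.+1)) `|x - a_ i|]%O.
  exists i0; rewrite /P -ltnS ltn_ord /=; apply/forallP => j; rewrite /i0.
  by case: arg_minP => //= i _; apply.
case: (ex_minnP exP) => i /andP[le_in /forallP hi] mini.
exists i => // j jn; have hj : `|x - a_ i| <= `|x - a_ j| by have := hi (Ordinal (jn : (j < n.+1)%N)).
split => // ji; rewrite ltNge; apply/negP => hij.
have : P j by rewrite /P jn; apply/forallP => l; exact: le_trans hij (hi l).
by move=> /mini; rewrite leqNgt ji.
Qed.

Lemma cell_disj n i i' x : (i <= n)%N -> (i' <= n)%N -> cell n i x -> cell n i' x -> i = i'.
Proof.
move=> in_ in' c c'; have [ii|ii|//] := ltngtP i i'.
- have [_ /(_ ii)] := c' i in_; have [+ _] := c i' in'; by rewrite leNgt => /negbTE ->.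
- have [_ /(_ ii)] := c i' in'; have [+ _] := c' i in_; by rewrite leNgt => /negbTE ->.
Qed.

Lemma Np_bigU p (F : nat -> set pt) n f : (forall i, measurable (F i)) -> trivIset `I_n F ->
  measurable_fun setT f ->
  (Np p (\big[setU/set0]_(i < n) F i) f = \sum_(i < n) Np p (F i) f)%E.
Proof.
move=> mF tF mf; rewrite NpE -(big_mkord xpredT F) /index_iota subn0.
rewrite ge0_integral_bigsetU//.
- by rewrite -(big_mkord xpredT (fun i => Np p (F i) f)) /index_iota subn0; apply: eq_bigr => i _; rewrite NpE.
- exact: iota_uniq.
- by apply: sub_trivIset tF => i /=; rewrite mem_iota add0n.
- exact: measurable_norm_powR.
Qed.

End voronoi.

(** * Summation of the Hardy inequality over the cells *)

Section global_hardy.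
Variable R : realType.
Local Notation pt := (pt R).
Local Notation leb2 := (@leb2 R).
Implicit Types (p r c s M : R) (f k : pt -> R) (A D E : set pt) (x y a v z : pt) (b : bool) (w : seq bool).

Lemma measurable_dist A : A !=set0 -> measurable_fun setT (dist A).
Proof. by move=> A0; apply: continuous_measurable2; exact: dist_continuous. Qed.

Lemma measurable_invdist A n : A !=set0 -> measurable_fun setT (fun x => (dist A x)^-1 ^+ n).
Proof.
move=> A0; apply: measurable_funX; rewrite (_ : (fun x => _) = fun x => dist A x `^ (-1)); last first.
  by apply/funext => x; rewrite powR_inv1// dist_ge0.
by apply: (measurableT_comp (measurable_powR _)); exact: measurable_dist.
Qed.

(** On each cell the weight at the centre dominates that of [dist A] up to a power of 2. The cells
    are disjoint, so the right-hand sides add up to a bound independent of [N], and monotone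
    convergence applies. *)
Lemma hardy_global p n A (G : seq bool -> pt -> R) : 2 < p -> A !=set0 ->
  (forall w, (size w < n)%N -> continuous (G w) /\ forall x, A x -> G w x = 0) ->
  (forall w, (size w <= n)%N -> measurable_fun setT (G w) /\ (Np p setT (G w) < +oo)%E) ->
  (forall b w, (size w < n)%N -> wpd b (G w) (G (b :: w))) ->
  (Np p [set x | 0 < dist A x]%R (fun x => G [::] x * (dist A x)^-1 ^+ n)%R < +oo)%E.
Proof.
move=> p2 A0 cG LG wG; have p0 : 0 < p by exact: lt_trans p2.
have [a_ [Aa da]] := dense_sequence A0.
have [mG0 _] := LG [::] (leq0n n).
pose F x := G [::] x * (dist A x)^-1 ^+ n.
have mF : measurable_fun setT F by apply: measurable_funM => //; exact: measurable_invdist.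
(* Where the first [N + 1] points realise the distance to [A] up to a factor 2, the source of
   [2 ^+ n] in the bound. *)
pose S N : set pt := [set x | 0 < dist A x /\ exists2 j, (j <= N)%N & `|x - a_ j| <= 2 * dist A x].
have md := measurable_dist A0.
have mD : measurable [set x | 0 < dist A x].
  exact: (@measurable_lt_set _ (cst 0) (dist A)).
have mS N : measurable (S N).
  rewrite (_ : S N = [set x | 0 < dist A x] `&` \bigcup_(j in `I_N.+1) [set x | `|x - a_ j| <= 2 * dist A x]).
    apply: measurableI => //; apply: bigcup_measurable => j _.
    rewrite -[X in measurable X]setTI; apply: measurable_fun_le => //; first exact: measurable_norm_sub.
    exact: measurable_funM.
  apply/seteqP; split => x /=.
    by move=> [d0 [j jN h]]; split => //; exists j.
  by move=> [d0 [j jN h]]; split => //; exists j.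
set C := (hardyC p * 2 `^ p) ^+ n.
have C0 : 0 <= C by rewrite exprn_ge0// mulr_ge0// powR_ge0.
pose B := (((2 ^+ n) `^ p)%:E * (C%:E * wsum (fun w => Np p setT (G w)) n [::]))%E.
have Bfin : (B < +oo)%E.
  rewrite /B lte_mul_pinfty ?lee_fin ?powR_ge0// lte_mul_pinfty//.
  by apply: wsum_lty => w; rewrite add0n => wn; have [] := LG w _; rewrite ?wn.
apply: le_lt_trans Bfin.
have bound N : (Np p (S N) F <= B)%E.
  pose T i := S N `&` cell a_ N i.
  have mT i : measurable (T i) by apply: measurableI => //; exact: measurable_cell.
  have mc i := measurable_cell a_ N i.
  have tc : trivIset `I_N.+1 (cell a_ N).
    by move=> i j /= iN jN [x [ci cj]]; apply: cell_disj ci cj.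
  have tT : trivIset `I_N.+1 T.
    by move=> i j /= iN jN [x [[_ ci] [_ cj]]]; apply: cell_disj ci cj.
  apply: (@le_trans _ _ (Np p (\big[setU/set0]_(i < N.+1) T i) F)).
    apply: subset_Np => //; first exact: bigsetU_measurable.
    move=> x Sx; rewrite -bigcup_mkord; have [i iN ci] := cell_cover a_ N x.
    by exists i.
  rewrite Np_bigU//.
  apply: (@le_trans _ _ (\sum_(i < N.+1) (((2 ^+ n) `^ p)%:E * (C%:E * wsum (fun w => Np p (cell a_ N i) (G w)) n [::])))%E).
    apply: lee_sum => i _.
    have hst : star (a_ i) (cell a_ N i) by apply: star_cell; rewrite -ltnS.
    have H := @hardy R p n (a_ i) (cell a_ N i) G p2 (mc i) hst.
    apply: (@le_trans _ _ (((2 ^+ n) `^ p)%:E * Np p (cell a_ N i) (fun x => G [::] x * wgt (a_ i) x ^+ n)%R)%E); last first.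
      apply: lee_wpmul2l; first by rewrite lee_fin powR_ge0.
      apply: H => //; first by move=> w wn; have [? h] := cG w wn; split => //; exact: h.
      by move=> b w wn; exact: LG.
    have mw : measurable_fun setT (fun x => G [::] x * wgt (a_ i) x ^+ n).
      by apply: measurable_funM => //; exact: measurable_wgt.
    have -> : (2 ^+ n) `^ p = `|2 ^+ n : R| `^ p by rewrite ger0_norm ?exprn_ge0.
    rewrite -Np_scale//.
    apply: (@le_trans _ _ (Np p (T i) (fun x => 2 ^+ n * (G [::] x * wgt (a_ i) x ^+ n))%R)); last first.
      by apply: subset_Np => //; [exact: measurable_funM|move=> x []].
    apply: le_Np => //; [exact: ltW|exact: measurable_funM|].
    move=> x [[d0 [j jN hj]] ci]; rewrite /F mulrCA !normrM; apply: ler_wpM2l => //.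
    have xi : `|x - a_ i| <= 2 * dist A x by have [h _] := ci j jN; exact: le_trans hj.
    have x0 : 0 < `|x - a_ i| by apply: lt_le_trans (dist_le x (Aa i)).
    rewrite -normrM -exprMn !ger0_norm ?exprn_ge0 ?mulr_ge0 ?invr_ge0 ?(ltW d0) ?wgt_ge0//.
    apply: lerXn2r; rewrite ?nnegrE ?mulr_ge0 ?invr_ge0 ?(ltW d0)//.
    rewrite /wgt -[leLHS]mul1r ler_pdivrMr// mulrAC ler_pdivlMr// mul1r.
    exact: xi.
  rewrite -ge0_sume_distrr; last first.
    move=> i _; rewrite mule_ge0 ?lee_fin//; apply: wsum_ge0 => w; exact: Np_ge0.
  rewrite -ge0_sume_distrr; last by move=> i _; apply: wsum_ge0 => w; exact: Np_ge0.
  apply: lee_wpmul2l; first by rewrite lee_fin powR_ge0.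
  apply: lee_wpmul2l; first by rewrite lee_fin.
  rewrite (wsum_sum _ (fun i : 'I_N.+1 => fun w => Np p (cell a_ N i) (G w))).
  apply: le_wsum => w; rewrite add0n => wn; have wn' : (size w <= n)%N by rewrite wn.
  have [mw _] := LG w wn'.
  rewrite -Np_bigU//; apply: subset_Np => //; exact: bigsetU_measurable.
have UD : \bigcup_N S N = [set x | 0 < dist A x].
  apply/seteqP; split => x /=; first by move=> [N _ []].
  (* Density with tolerance [dist A x] itself gives the factor 2. *)
  move=> d0; have [i hi] := da x _ d0; exists i => //; split => //; exists i => //.
  by rewrite mulr_natl mulr2n ltW.
have cv : (fun N => \int[leb2]_(x in S N) (`|F x| `^ p)%:E)%E @ \oo --> (\int[leb2]_(x in \bigcup_N S N) (`|F x| `^ p)%:E)%E.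
  apply: ge0_nondecreasing_set_cvg_integral.
  - move=> N N' NN'; apply/subsetPset => x [d0 [j jN h]]; split => //; exists j => //; exact: leq_trans NN'.
  - exact: mS.
  - by move=> N; exact: measurable_norm_powR.
  - by move=> N x _; rewrite lee_fin powR_ge0.
rewrite NpE -UD -(cvg_lim _ cv)//; apply: lime_le; first by apply/cvg_ex; eexists; exact: cv.
by apply: nearW => N; rewrite -NpE; exact: bound.
Qed.

End global_hardy.

(** * Sard property of the stream function *)

Section sard.
Variable R : realType.
Local Notation pt := (pt R).
Local Notation leb2 := (@leb2 R).
Local Notation mu := (@lebesgue_measure R).
Implicit Types (p r c s M h : R) (f psi : pt -> R) (A D E Q : set pt) (x y a b v z : pt) (w : seq bool).

Lemma wpd_subc (b : bool) f (g : pt -> R) c : locint f -> wpd b f g -> wpd b (fun x => f x - c) g.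
Proof.
move=> lf wf s s0; rewrite -wf//.
have -> : mol s (fun x => f x - c) = (fun x => mol s f x - c).
  by apply/funext => x; rewrite /mol (cvl_sub _ lf (locint_cst c) (ker_rhos s0)) cvl_cst.
apply/funext => x; apply: isd_derive1.
have h := smooth_isd b x (smooth_mol s0 lf).
by apply: (isd_eq (isd_add h (isd_cst (- c) _))); rewrite addr0.
Qed.

(** One Hardy constant for each of two derivatives, and [2^p * 2] for comparing two base points. *)
Definition sardC p : R := 2 `^ p * 2 * (hardyC p * 2 `^ p) ^+ 2.

Lemma sardC_ge0 p : 0 <= sardC p.
Proof. by rewrite !mulr_ge0 ?powR_ge0. Qed.

(** At a point where the gradient vanishes, [psi] minus its value there vanishes to second order, so
    Hardy with exponent 2 bounds it on [Q] by [h^2] times the second derivatives. Subtracting the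
    bounds for [a] and [b] leaves the constant [psi a - psi b], integrated over [Q]. *)
Lemma sard_square p Q h psi (G : seq bool -> pt -> R) a b : 2 < p -> measurable Q ->
  leb2 Q = (h ^+ 2)%:E -> 0 < h -> (forall x y, Q x -> Q y -> `|x - y| <= h) ->
  (forall x, Q x -> star x Q) -> continuous psi ->
  (forall i, continuous (G [:: i])) ->
  (forall w, (0 < size w <= 2)%N -> measurable_fun setT (G w) /\ (Np p setT (G w) < +oo)%E) ->
  (forall i, wpd i psi (G [:: i])) -> (forall i j, wpd j (G [:: i]) (G [:: j; i])) ->
  Q a -> Q b -> (forall i, G [:: i] a = 0) -> (forall i, G [:: i] b = 0) ->
  ((`|psi a - psi b| `^ p)%:E <= (sardC p * h `^ (2 * (p - 1)))%:E * wsum (fun w => Np p Q (G w)) 2 [::])%E.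
Proof.
move=> p2 mQ lQ h0 dQ sQ cpsi cG LG w1 w2 Qa Qb Ga Gb; have p0 : 0 < p by exact: lt_trans p2.
set X := wsum _ _ _; have lpsi := locint_continuous cpsi.
have mpsi := continuous_measurable2 cpsi.
have X0 : (0 <= X)%E by apply: wsum_ge0 => w; exact: Np_ge0.
set C := (hardyC p * 2 `^ p) ^+ 2.
have C0 : 0 <= C by rewrite exprn_ge0// mulr_ge0// powR_ge0.
have key (c0 : pt) : Q c0 -> (forall i, G [:: i] c0 = 0) ->
    (Np p Q (fun x => psi x - psi c0)%R <= (h `^ (2 * p))%:E * (C%:E * X))%E.
  move=> Qc Gc; pose G' w := if w is [::] then (fun x => psi x - psi c0) else G w.
  have cG' w : (size w < 2)%N -> continuous (G' w) /\ G' w c0 = 0.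
    case: w => [_|i [_|//]] /=; last by split.
    by split; [move=> x; apply: cvgB; [exact: cpsi|exact: cvg_cst]|rewrite subrr].
  have H := @hardy R p 2 c0 Q G' p2 mQ (sQ _ Qc) cG'.
  have {}H : (Np p Q (fun x => G' [::] x * wgt c0 x ^+ 2)%R <= C%:E * X)%E.
    apply: H.
    - by move=> i w hw; apply: LG.
    - move=> j [_|i [_|//]]; [exact: wpd_subc|exact: w2].
  have mp' : measurable_fun setT (fun x => psi x - psi c0) by exact: measurable_funB.
  have mw : measurable_fun setT (fun x => G' [::] x * wgt c0 x ^+ 2).
    by apply: measurable_funM => //; exact: measurable_wgt.
  apply: (@le_trans _ _ ((h `^ (2 * p))%:E * Np p Q (fun x => G' [::] x * wgt c0 x ^+ 2)%R)%E); last first.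
    by apply: lee_wpmul2l => //; rewrite lee_fin powR_ge0.
  have -> : h `^ (2 * p) = `|h ^+ 2| `^ p.
    by rewrite ger0_norm ?exprn_ge0 ?(ltW h0)// -powR_mulrn ?(ltW h0)// -powRrM.
  rewrite -Np_scale//; apply: le_Np => //; [exact: ltW|exact: measurable_funM|].
  move=> x Qx; rewrite /G'; have [->|xc] := eqVneq x c0; first by rewrite subrr normr0.
  have N0 : 0 < `|x - c0| by rewrite normr_gt0 subr_eq0.
  rewrite mulrCA normrM; apply: ler_peMr => //; rewrite /wgt -exprMn ger0_norm; last first.
    by rewrite exprn_ge0// divr_ge0// ltW.
  by rewrite exprn_ege1// ler_pdivlMr// mul1r; exact: dQ.
have mpa c : measurable_fun setT (fun x => psi x - c) by exact: measurable_funB.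
have sum2 : (Np p Q (cst (psi a - psi b))%R <= (2 `^ p)%:E * ((h `^ (2 * p))%:E * (C%:E * X) + (h `^ (2 * p))%:E * (C%:E * X)))%E.
  rewrite (@eq_Np _ _ _ _ (fun x => - (psi x - psi a) + (psi x - psi b))); last by move=> x _ /=; ring.
  apply: Np_add_le => //; [exact: ltW|exact: measurableT_comp|by rewrite Np_opp; exact: key|exact: key].
move: sum2; rewrite Np_cst// lQ => sum2.
have h2 : 0 < h ^+ 2 by rewrite exprn_gt0.
(* The area [h^2] of [Q] on the left lowers the exponent [2 p] to [2 (p - 1)]. *)
rewrite -(@lee_pmul2r _ (h ^+ 2)%:E) ?lte_fin//; apply: (le_trans sum2).
rewrite -ge0_muleDl ?mule_ge0 ?lee_fin ?powR_ge0//.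
rewrite -EFinD !muleA -!EFinM [leRHS]muleAC -EFinM.
rewrite le_eqVlt; apply/orP; left; apply/eqP; congr (_%:E * _)%E.
have -> : h `^ (2 * p) = h `^ (2 * (p - 1)) * h ^+ 2.
  rewrite -(powR_mulrn 2 (ltW h0)) -powRD; last by apply/implyP => _; rewrite gt_eqF.
  by congr (_ `^ _); rewrite mulrBr mulr1 subrK.
rewrite /sardC -/C; ring.
Qed.

(* Either [l <= eta h^2], or dividing [l^p] by [l^(p-1) > (eta h^2)^(p-1)] bounds [l] by the second term. *)
Lemma sard_young p (l h eta X C : R) : 1 < p -> 0 <= l -> 0 < h -> 0 < eta -> 0 <= X -> 0 <= C ->
  l `^ p <= C * h `^ (2 * (p - 1)) * X -> l <= eta * h ^+ 2 + C * (eta `^ (p - 1))^-1 * X.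
Proof.
move=> p1 l0 h0 e0 X0 C0 hl.
have ep : 0 < eta `^ (p - 1) by rewrite powR_gt0.
have eh : 0 < eta * h ^+ 2 by rewrite mulr_gt0// exprn_gt0.
have r0 : 0 <= C * (eta `^ (p - 1))^-1 * X by rewrite !mulr_ge0// invr_ge0 ltW.
have [le1|lt1] := leP l (eta * h ^+ 2); first by apply: (le_trans le1); rewrite lerDl.
have lp : 0 < l by exact: lt_trans lt1.
apply: (@le_trans _ _ (C * (eta `^ (p - 1))^-1 * X)); last by rewrite lerDr ltW.
have lq : 0 < l `^ (p - 1) by rewrite powR_gt0.
have hq : h `^ (2 * (p - 1)) = (h ^+ 2) `^ (p - 1) by rewrite -powR_mulrn ?(ltW h0)// -powRrM.
have : l * l `^ (p - 1) <= C * h `^ (2 * (p - 1)) * X.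
  by rewrite -{1}(powRr1 l0) -powRD ?[1 + _]addrC ?subrK// gt_eqF ?implybT// (lt_trans _ p1).
move=> {}hl; rewrite -(ler_pM2r lq); apply: (le_trans hl).
have -> : C * (eta `^ (p - 1))^-1 * X * l `^ (p - 1) = C * X * (l `^ (p - 1) / eta `^ (p - 1)) by ring.
have -> : C * h `^ (2 * (p - 1)) * X = C * X * h `^ (2 * (p - 1)) by ring.
apply: ler_wpM2l; first by rewrite mulr_ge0.
rewrite ler_pdivlMr// hq -powRM ?exprn_ge0 ?(ltW h0) ?(ltW e0)//; apply: ge0_ler_powR.
- by rewrite subr_ge0 ltW.
- by rewrite nnegrE mulr_ge0 ?exprn_ge0 ?(ltW h0) ?(ltW e0).
- by rewrite nnegrE.
- by rewrite mulrC ltW.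
Qed.

(** The index encodes a pair of coordinates by [k %/ n] and [k %% n]; half-open sides make the
    squares disjoint. *)
Definition grid_square (L h : R) (n k : nat) : set pt :=
  `[(k %/ n)%:R * h - L, (k %/ n).+1%:R * h - L[%classic `*` `[(k %% n)%:R * h - L, (k %% n).+1%:R * h - L[%classic.

Lemma measurable_grid_square L h n k : measurable (grid_square L h n k).
Proof. by apply: measurableX; exact: measurable_itv. Qed.

Lemma leb2_grid_square L h n k : 0 < h -> leb2 (grid_square L h n k) = (h ^+ 2)%:E.
Proof.
move=> h0; rewrite /grid_square /leb2 product_measure1E; [|exact: measurable_itv..].
rewrite /= !lebesgue_measure_itv/= !lte_fin -![_.+1%:R]natr1 !mulrDl !mul1r.
by rewrite !ifT; [|lra..]; rewrite -!EFinB -EFinM; congr (_%:E); ring.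
Qed.

Lemma grid_square_diam L h n k x y : grid_square L h n k x -> grid_square L h n k y -> `|x - y| <= h.
Proof.
rewrite /grid_square/= !in_itv/= -![_.+1%:R]natr1 !mulrDl !mul1r.
move=> [/andP[a1 a2] /andP[a3 a4]] [/andP[b1 b2] /andP[b3 b4]].
by rewrite pt_lenorm/= !ler_norml; apply/andP; split; apply/andP; split; lra.
Qed.

Lemma itv_convex (a b x y t : R) : a <= x < b -> a <= y < b -> 0 < t <= 1 -> a <= x + t * (y - x) < b.
Proof.
move=> /andP[a1 a2] /andP[b1 b2] /andP[t0 t1]; apply/andP; split.
- have -> : x + t * (y - x) = (1 - t) * x + t * y by ring.
  have -> : a = (1 - t) * a + t * a by ring.
  by apply: lerD; apply: ler_wpM2l => //; rewrite ?subr_ge0// ltW.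
- have -> : x + t * (y - x) = (1 - t) * x + t * y by ring.
  have -> : b = (1 - t) * b + t * b by ring.
  by apply: ler_ltD; [apply: ler_wpM2l; rewrite ?subr_ge0// ltW|rewrite ltr_pM2l].
Qed.

Lemma grid_square_star L h n k a : grid_square L h n k a -> star a (grid_square L h n k).
Proof.
rewrite /grid_square => -[/= a1 a2] x t [/= x1 x2] t01; rewrite !in_itv/= in a1 a2 x1 x2 *.
by split; exact: itv_convex.
Qed.

Lemma grid_square_cover L h n x : 0 < h -> n%:R * h = 2 * L -> `|x| < L ->
  exists2 k, (k < n * n)%N & grid_square L h n k x.
Proof.
move=> h0 nh; rewrite pt_ltnorm => /andP[]; rewrite !ltr_norml => /andP[x1 x2] /andP[x3 x4].
have one (y : R) : - L < y -> y < L -> exists2 i, (i < n)%N & i%:R * h - L <= y < i.+1%:R * h - L.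
  move=> y1 y2; have y0 : 0 <= (y + L) / h by rewrite divr_ge0// ?ltW//; lra.
  have /andP[t1 t2] := Num.Theory.truncn_itv y0.
  exists (Num.truncn ((y + L) / h)).
    rewrite -(ltr_nat R); apply: (le_lt_trans t1); rewrite ltr_pdivrMr// nh; lra.
  rewrite lerBlDr ltrBrDr -ler_pdivlMr// -ltr_pdivrMr// t1 t2//.
have [i i1 i2] := one _ x1 x2; have [j j1 j2] := one _ x3 x4.
have n0 : (0 < n)%N by apply: leq_ltn_trans i1.
exists (i * n + j)%N.
  by apply: (@leq_trans (i.+1 * n)); [rewrite mulSn addnC ltn_add2r|rewrite leq_mul2r i1 orbT].
by rewrite /grid_square divnMDl// divn_small// addn0 modnMDl modn_small//; split; rewrite /= in_itv.
Qed.

Lemma grid_square_disj L h n k k' x : 0 < h -> grid_square L h n k x -> grid_square L h n k' x -> k = k'.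
Proof.
move=> h0; rewrite /grid_square => -[/= a1 a2] [/= b1 b2]; rewrite !in_itv/= in a1 a2 b1 b2.
have one (i j : nat) (y : R) : i%:R * h - L <= y < i.+1%:R * h - L -> j%:R * h - L <= y < j.+1%:R * h - L -> i = j.
  have aux i' j' : i'%:R * h - L <= y < i'.+1%:R * h - L -> j'%:R * h - L <= y < j'.+1%:R * h - L -> (i' <= j')%N.
    move=> /andP[c1 c2] /andP[d1 d2]; rewrite -ltnS -(ltr_nat R) -(ltr_pM2r h0); lra.
  by move=> c d; apply/eqP; rewrite eqn_leq !aux.
by rewrite (divn_eq k n) (divn_eq k' n) (one _ _ _ a1 b1) (one _ _ _ a2 b2).
Qed.

(** The part of the neighbourhoods outside [A] shrinks to the empty set because [A] is closed. The
    radius has the form that fits the mesh of the grid in [sard]. *)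
Lemma near_small p A L (g : pt -> R) : 0 < p -> closed A -> A !=set0 -> 0 < L -> measurable_fun setT g ->
  (Np p setT g < +oo)%E -> Np p A g = 0%E -> forall e : R, 0 < e -> exists N, forall n, (N <= n)%N ->
    (Np p [set x | dist A x < 4 * L / n.+1%:R]%R g <= e%:E)%E.
Proof.
move=> p0 cA A0 L0 mg gp gA e e0.
have md := measurable_dist A0; have mA := closed_measurable2 cA.
pose E_ n : set pt := [set x | 0 < dist A x] `&` [set x | dist A x < 4 * L / n.+1%:R].
have mE n : measurable (E_ n).
  by apply: measurableI; [exact: (@measurable_lt_set _ (cst 0))|exact: (@measurable_lt_set _ _ (cst _))].
have [|N hN] := Np_vanish p0 measurableT mE mg _ gp e0.
  move=> x _; have [d0|d0] := leP (dist A x) 0.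
    by exists 0%N => n _ [/= h _]; move: h; rewrite ltNge d0.
  exists (Num.bound (4 * L / dist A x)) => n Nn [_ /=]; apply/negP; rewrite -leNgt.
  rewrite ler_pdivrMr// [dist A x * _]mulrC -ler_pdivrMr//.
  apply: (@le_trans _ _ (Num.bound (4 * L / dist A x))%:R); last by rewrite ler_nat ltnW.
  by rewrite ltW// archi_boundP// divr_ge0 ?mulr_ge0// ltW.
exists N => n Nn; apply: (@le_trans _ _ (Np p (A `|` (setT `&` E_ n)) g)).
  apply: subset_Np => //; first exact: (@measurable_lt_set _ _ (cst _)).
    by apply: measurableU => //; exact: measurableI.
  move=> x /= hx; have [Ax|nAx] := pselect (A x); first by left.
  by right; split => //; split => //=; exact: dist_gt0.
by apply: (le_trans (Np_setU _ _ _ _)) => //; [exact: measurableI|rewrite gA add0e; exact: hN].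
Qed.

(** By [sard_young], the values on [A] in one square spread over at most [e1 h^2] plus a multiple of
    the integral [X k] of the second derivatives. The first terms add up to a multiple of the total
    area, the second to a multiple of an integral near [A], which is small as the second derivatives
    vanish a.e. on [A]. *)
Lemma sard p A L psi (G : seq bool -> pt -> R) : 2 < p -> closed A -> A !=set0 -> 0 < L -> continuous psi ->
  (forall i, continuous (G [:: i])) ->
  (forall w, (0 < size w <= 2)%N -> measurable_fun setT (G w) /\ (Np p setT (G w) < +oo)%E) ->
  (forall i, wpd i psi (G [:: i])) -> (forall i j, wpd j (G [:: i]) (G [:: j; i])) ->
  (forall i x, A x -> G [:: i] x = 0) -> (forall i j, Np p A (G [:: j; i]) = 0%E) ->
  forall eta : R, 0 < eta -> exists U : set R, [/\ open U,
    (forall x, A x -> `|x| < L -> U (psi x)) & (mu U <= eta%:E)%E].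
Proof.
move=> p2 cA A0 L0 cpsi cG LG w1 w2 GA GA2 eta eta0; have p0 : 0 < p by exact: lt_trans p2.
have p1 : 1 < p by apply: lt_trans p2; rewrite ltr1n.
(* The terms [4 e1 h^2] over [n^2] squares with [n h = 2 L] sum to [16 e1 L^2 = eta / 2]. *)
pose e1 := eta / (32 * L ^+ 2); have e10 : 0 < e1 by rewrite divr_gt0// mulr_gt0// exprn_gt0.
pose C := sardC p * (e1 `^ (p - 1))^-1.
have C0 : 0 <= C by rewrite mulr_ge0 ?sardC_ge0// invr_ge0 powR_ge0.
(* Makes the remaining contribution [2 C (4 e2)] at most [eta / 2]. *)
pose e2 := eta / (4 * (C + 1)) / 4.
have e20 : 0 < e2 by rewrite !divr_gt0// mulr_gt0// ltr_wpDl.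
have near2 i j : exists N, forall n, (N <= n)%N ->
    (Np p [set x | dist A x < 4 * L / n.+1%:R]%R (G [:: j; i]) <= e2%:E)%E.
  by have [m l] := LG [:: j; i] isT; apply: near_small.
have [N1 h1] := near2 true true; have [N2 h2] := near2 true false.
have [N3 h3] := near2 false true; have [N4 h4] := near2 false false.
pose n' := maxn (maxn N1 N2) (maxn N3 N4); pose n := n'.+1.
have {}h1 := h1 n' (leq_trans (leq_maxl _ _) (leq_maxl _ _)).
have {}h2 := h2 n' (leq_trans (leq_maxr _ _) (leq_maxl _ _)).
have {}h3 := h3 n' (leq_trans (leq_maxl _ _) (leq_maxr _ _)).
have {}h4 := h4 n' (leq_trans (leq_maxr _ _) (leq_maxr _ _)).
pose h := 2 * L / n%:R; have n0 : 0 < n%:R :> R by rewrite ltr0n.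
have h0 : 0 < h by rewrite !divr_gt0// mulr_gt0.
have nh : n%:R * h = 2 * L by rewrite mulrC divfK// gt_eqF.
pose meets k := exists2 a, A a & grid_square L h n k a.
pose T k : set pt := if pselect (meets k) then grid_square L h n k else set0.
have mT k : measurable (T k) by rewrite /T; case: pselect => ?; [exact: measurable_grid_square|exact: measurable0].
have tT : trivIset `I_(n * n) T.
  move=> k k' _ _ [x []]; rewrite /T; case: pselect => // m; case: pselect => // m' hx hx'.
  exact: grid_square_disj hx hx'.
pose X k := wsum (fun w => Np p (T k) (G w)) 2 [::].
have X0 k : (0 <= X k)%E by apply: wsum_ge0 => w; exact: Np_ge0.
have Xfin k : X k \is a fin_num.
  rewrite ge0_fin_numE//; apply: wsum_lty => w sw; have w12 : (0 < size w <= 2)%N by rewrite sw.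
  have [mw lw] := LG w w12.
  exact: le_lt_trans (subset_Np _ (mT k) measurableT mw _) lw.
have sumX : (\sum_(k < n * n) X k <= (4 * e2)%:E)%E.
  rewrite (wsum_sum _ (fun k : 'I_(n * n) => fun w => Np p (T k) (G w))).
  pose V := [set x | dist A x < 4 * L / n%:R].
  have mV : measurable V by apply: (@measurable_lt_set _ _ (cst _)) => //; exact: measurable_dist.
  apply: (@le_trans _ _ (wsum (fun w => Np p V (G w)) 2 [::])).
    apply: le_wsum => w sw; have w12 : (0 < size w <= 2)%N by rewrite sw.
    have [mw lw] := LG w w12.
    rewrite -Np_bigU//; apply: subset_Np => //; first exact: bigsetU_measurable.
    rewrite -bigcup_mkord => x [k _]; rewrite /T; case: pselect => // -[a Aa ha] hx.
    rewrite /V/=; apply: (le_lt_trans (dist_le x Aa)).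
    apply: (le_lt_trans (grid_square_diam hx ha)); rewrite /h ltr_pM2r ?invr_gt0// ltr_pM2r// ltr_nat//.
  rewrite /=; have -> : (4 * e2)%:E = (e2%:E + e2%:E + (e2%:E + e2%:E))%E.
    by rewrite -!EFinD; congr (_%:E); ring.
  by apply: leeD; apply: leeD.
pose ct k := if pselect (meets k) is left m then psi (sval (cid2 m)) else 0.
pose l k := e1 * h ^+ 2 + C * fine (X k).
(* The extra margin [e1 h^2] lets an open interval contain all values taken on [A] in the square. *)
pose I k : set R := if pselect (meets k) then `]ct k - (l k + e1 * h ^+ 2), ct k + (l k + e1 * h ^+ 2)[%classic else set0.
have eh0 : 0 < e1 * h ^+ 2 by rewrite mulr_gt0// exprn_gt0.
have l0 k : 0 <= l k by rewrite addr_ge0 ?(ltW eh0)// mulr_ge0// fine_ge0.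
have mI k : measurable (I k) by rewrite /I; case: pselect => ?; [exact: measurable_itv|exact: measurable0].
exists (\big[setU/set0]_(k < n * n) I k); split.
- rewrite -bigcup_mkord; apply: bigcup_open => k _; rewrite /I; case: pselect => ?; [exact: itv_open|exact: open0].
- move=> x Ax xL; have [k kn hx] := grid_square_cover h0 nh xL; rewrite -bigcup_mkord; exists k => //.
  rewrite /I /ct; case: pselect => [m|nm]; last by exfalso; apply: nm; exists x.
  case: cid2 => a Aa ha /=.
  have Tk : T k = grid_square L h n k by rewrite /T; case: pselect.
  have := @sard_square p (grid_square L h n k) h psi G a x p2 (@measurable_grid_square _ _ _ _) (@leb2_grid_square _ _ _ _ h0) h0
    (@grid_square_diam _ _ _ _) (@grid_square_star _ _ _ _) cpsi cG LG w1 w2 ha hx (fun i => GA i _ Aa) (fun i => GA i _ Ax).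
  rewrite -Tk -/(X k) -(fineK (Xfin k)) -EFinM lee_fin => hl.
  have := sard_young p1 (normr_ge0 _) h0 e10 (fine_ge0 (X0 k)) (sardC_ge0 p) hl.
  rewrite -/C -/(l k) => hd.
  have : `|psi a - psi x| < l k + e1 * h ^+ 2 by apply: (le_lt_trans hd); rewrite ltrDl.
  rewrite ltr_norml in_itv/= => /andP[q1 q2]; apply/andP; split; lra.
- have Bo : (mu (\big[setU/set0]_(k < n * n) I k) <= \sum_(k < n * n) mu (I k))%E.
    by apply: Boole_inequality => k _; exact: mI.
  apply: (le_trans Bo).
  apply: (@le_trans _ _ (\sum_(k < n * n) ((4 * (e1 * h ^+ 2))%:E + (2 * C)%:E * X k))%E).
    apply: lee_sum => k _; rewrite -(fineK (Xfin k)) -EFinM -EFinD /I; case: pselect => ?; last first.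
      rewrite /= measure0 lee_fin; apply: addr_ge0; first by rewrite mulr_ge0// ltW.
      by rewrite mulr_ge0 ?fine_ge0// mulr_ge0.
    rewrite /= lebesgue_measure_itv/= lte_fin ifT; last first.
      by have := l0 k; lra.
    by rewrite -EFinB lee_fin /l; lra.
  rewrite big_split/= -ge0_sume_distrr// sumEFin sumr_const card_ord.
  apply: (@le_trans _ _ ((4 * (e1 * h ^+ 2) *+ (n * n))%:E + (2 * C)%:E * (4 * e2)%:E)%E).
    by apply: leeD => //; apply: lee_wpmul2l => //; rewrite lee_fin mulr_ge0.
  rewrite -EFinM -EFinD lee_fin.
  have -> : 4 * (e1 * h ^+ 2) *+ (n * n) = eta / 2.
    rewrite -mulr_natr natrM (_ : _ * _ = 4 * e1 * (n%:R * h) ^+ 2); last by ring.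
    by rewrite nh /e1; field; rewrite gt_eqF.
  have -> : 4 * e2 = eta / (4 * (C + 1)) by rewrite /e2 mulrC divfK.
  have -> : 2 * C * (eta / (4 * (C + 1))) = eta / 2 * (C / (C + 1)).
    by field; rewrite gt_eqF// ltr_wpDl.
  have : C / (C + 1) <= 1 by rewrite ler_pdivrMr ?ltr_wpDl// mul1r lerDl.
  have : 0 < eta / 2 by rewrite divr_gt0.
  move: (C / (C + 1)) (eta / 2) (splitr eta) => c d dE d0 c1.
  have : d * c <= d by rewrite ler_piMr// ltW.
  lra.
Qed.

Lemma height_function (U : set R) (eta : R) : open U -> (mu U <= eta%:E)%E ->
  exists ht : R -> R, [/\ forall t, 0 <= ht t <= eta, forall s t, `|ht s - ht t| <= `|s - t| &
    forall s t, s <= t -> (forall r, s <= r <= t -> U r) -> ht t - ht s = t - s].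
Proof.
move=> oU mUe; have mU : measurable U by exact: open_measurable.
have mI t : measurable (U `&` `]-oo, t]) by apply: measurableI => //; exact: measurable_itv.
have mJ s t : measurable (U `&` `]s, t]) by apply: measurableI => //; exact: measurable_itv.
have Ile t : (mu (U `&` `]-oo, t]) <= eta%:E)%E.
  apply: le_trans mUe; apply: le_measure; [apply: mem_set; exact: mI|exact: mem_set|].
  by move=> r [].
have Ifin t : mu (U `&` `]-oo, t]) \is a fin_num by rewrite ge0_fin_numE//; exact: le_lt_trans (Ile t) (ltry _).
have Jle s t : s <= t -> (mu (U `&` `]s, t]) <= (t - s)%:E)%E.
  move=> st; apply: (@le_trans _ _ (mu `]s, t])).
    apply: le_measure; [apply: mem_set; exact: mJ|apply: mem_set; exact: measurable_itv|].
    by move=> r [].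
  rewrite lebesgue_measure_itv/= lte_fin; case: ltP => [_|ts]; first by rewrite -EFinB.
  by rewrite lee_fin subr_ge0.
have Jfin s t : s <= t -> mu (U `&` `]s, t]) \is a fin_num.
  by move=> st; rewrite ge0_fin_numE//; exact: le_lt_trans (Jle _ _ st) (ltry _).
pose ht t := fine (mu (U `&` `]-oo, t])).
have inc s t : s <= t -> ht t = ht s + fine (mu (U `&` `]s, t])).
  move=> st; have disj : (U `&` `]-oo, s]) `&` (U `&` `]s, t]) = set0.
    apply/seteqP; split => // r [[_ /=]]; rewrite in_itv/= => rs [_ /=]; rewrite in_itv/= => /andP[sr _].
    by move: sr; rewrite ltNge rs.
  have mUE := measureU mu (mI s) (mJ s t) disj.
  rewrite /ht -fineD ?Ifin ?Jfin// -mUE.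
  congr (fine (mu _)); rewrite -setIUr; congr (_ `&` _).
  apply/seteqP; split => r /=; rewrite !in_itv/=.
    by move=> rt; case: (leP r s) => rs; [left|right].
  by move=> [rs|/andP[]//]; exact: le_trans rs st.
exists ht; split.
- by move=> t; rewrite /ht fine_ge0//= -lee_fin fineK.
- have aux s t : s <= t -> `|ht s - ht t| <= `|s - t|.
    move=> st; rewrite (inc _ _ st) opprD addrA subrr sub0r normrN ger0_norm ?fine_ge0//.
    by rewrite distrC ger0_norm ?subr_ge0// -lee_fin fineK ?Jfin//; exact: Jle.
  move=> s t; have [st|/ltW ts] := leP s t; first exact: aux.
  by rewrite distrC [leRHS]distrC; exact: aux.
- move=> s t st hU; rewrite (inc _ _ st) addrAC subrr add0r.
  have -> : U `&` `]s, t] = `]s, t]%classic.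
    apply/setIidPr => r /=; rewrite in_itv/= => /andP[sr rt]; apply: hU; by rewrite (ltW sr) rt.
  rewrite lebesgue_measure_itv/= lte_fin; case: ltP => [_|ts]; first by rewrite -EFinB.
  by rewrite /=; apply/esym/eqP; rewrite subr_eq0 eq_le ts st.
Qed.

End sard.

(** * Smooth functions *)

Section smooth_algebra.
Variable R : realType.
Local Notation pt := (pt R).
Implicit Types (r c : R) (f g h : pt -> R) (x y : pt) (b : bool) (w : seq bool).

Lemma smooth_pdw w f : smooth f -> smooth (pdw w f).
Proof. by move=> sf w'; have := sf (w' ++ w); rewrite /pdw foldr_cat. Qed.

Lemma pdd2E b b' f : pdd b (pdd b' f) = pdw [:: b; b'] f. Proof. by rewrite !pdw_cons. Qed.

Local Opaque smooth pdw.

(** Sums of products of smooth functions are stable under partial differentiation by the Leibniz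
    rule, which gives smoothness of products by induction. *)
Inductive prodalg : (pt -> R) -> Prop :=
| prodalg_prod f g : smooth f -> smooth g -> prodalg (fun x => f x * g x)
| prodalg_add f g : prodalg f -> prodalg g -> prodalg (fun x => f x + g x).

Lemma prodalg_pdd b f : prodalg f -> continuous f /\ exists2 g, prodalg g &
  forall x, is_derive (crd b x) 1 (fun t => f (axl b x t)) (g x).
Proof.
elim=> [{}f g sf sg|{}f g _ [cf [f' pf df]] _ [cg [g' pg dg]]].
- split; first by move=> x; apply: cvgM; exact: smooth_continuous.
  exists (fun x => f x * pdd b g x + g x * pdd b f x).
    by apply: prodalg_add; [exact: (prodalg_prod sf (smooth_pdd b sg))|exact: (prodalg_prod sg (smooth_pdd b sf))].
  move=> x; have h1 := smooth_isd b x sf; have h2 := smooth_isd b x sg.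
  by apply: (isd_eq (isd_mul h1 h2)); rewrite !axl_crd.
- split; first by move=> x; apply: cvgD; [exact: cf|exact: cg].
  exists (fun x => f' x + g' x); first exact: prodalg_add.
  by move=> x; exact: isd_add.
Qed.

Lemma prodalg_smooth f : prodalg f -> smooth f.
Proof.
move=> pf; apply/smoothP => w.
have pw : prodalg (pdw w f).
  elim: w => // b w IH; rewrite pdw_cons; have [_ [g pg dg]] := prodalg_pdd b IH.
  by rewrite (_ : pdd b _ = g)//; apply/funext => x; exact: isd_derive1.
split; first by have [] := prodalg_pdd true pw.
by move=> b x; have [_ [g _ /(_ x)[]]] := prodalg_pdd b pw.
Qed.

Lemma smooth_mul f g : smooth f -> smooth g -> smooth (fun x => f x * g x).
Proof. by move=> sf sg; apply: prodalg_smooth; exact: prodalg_prod. Qed.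

Lemma smooth_cst c : smooth (fun _ : pt => c).
Proof.
apply/smoothP => w; rewrite pdw_cst; split; first by move=> x; exact: cvg_cst.
by move=> b x; exact: derivable_cst.
Qed.

Lemma smooth_add f g : smooth f -> smooth g -> smooth (fun x => f x + g x).
Proof.
move=> sf sg; rewrite (_ : (fun x => _) = (fun x => f x * 1 + g x * 1)); last by apply/funext => x; rewrite !mulr1.
by apply: prodalg_smooth; apply: prodalg_add; [exact: (prodalg_prod sf (smooth_cst 1))|exact: (prodalg_prod sg (smooth_cst 1))].
Qed.

Lemma smooth_opp f : smooth f -> smooth (fun x => - f x).
Proof.
move=> sf; rewrite (_ : (fun x => _) = (fun x => (-1) * f x)); last by apply/funext => x; rewrite mulN1r.
exact: (smooth_mul (smooth_cst (-1)) sf).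
Qed.

Lemma smooth_sub f g : smooth f -> smooth g -> smooth (fun x => f x - g x).
Proof. by move=> sf sg; exact: (@smooth_add f (fun x => - g x) sf (smooth_opp sg)). Qed.

Lemma pdd_add b f g : smooth f -> smooth g -> pdd b (fun x => f x + g x) = (fun x => pdd b f x + pdd b g x).
Proof.
by move=> sf sg; apply/funext => x; apply: isd_derive1; apply: isd_add; exact: smooth_isd.
Qed.

Lemma pdd_opp b f : smooth f -> pdd b (fun x => - f x) = (fun x => - pdd b f x).
Proof. by move=> sf; apply/funext => x; apply: isd_derive1; apply: isd_opp; exact: smooth_isd. Qed.

Lemma pdd_mul b f g : smooth f -> smooth g ->
  pdd b (fun x => f x * g x) = (fun x => f x * pdd b g x + g x * pdd b f x).
Proof.
move=> sf sg; apply/funext => x; apply: isd_derive1.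
by apply: (isd_eq (isd_mul (smooth_isd b x sf) (smooth_isd b x sg))); rewrite !axl_crd.
Qed.

Lemma pdw_add w f g : smooth f -> smooth g -> pdw w (fun x => f x + g x) = (fun x => pdw w f x + pdw w g x).
Proof.
move=> sf sg; elim: w => // b w IH.
by rewrite !pdw_cons IH (pdd_add b (smooth_pdw w sf) (smooth_pdw w sg)).
Qed.

Lemma pdw_opp w f : smooth f -> pdw w (fun x => - f x) = (fun x => - pdw w f x).
Proof. by move=> sf; elim: w => // b w IH; rewrite !pdw_cons IH (pdd_opp b (smooth_pdw w sf)). Qed.

Lemma pdw_sub w f g : smooth f -> smooth g -> pdw w (fun x => f x - g x) = (fun x => pdw w f x - pdw w g x).
Proof. by move=> sf sg; rewrite (@pdw_add w f (fun x => - g x) sf (smooth_opp sg)) (pdw_opp w sg). Qed.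

Lemma pdw_subc w f c : smooth f -> w <> [::] -> pdw w (fun x => f x - c) = pdw w f.
Proof.
move=> sf w0; rewrite (@pdw_sub w f (fun=> c) sf (smooth_cst c)).
by apply/funext => x; rewrite pdw_cst; case: w w0 => // b w _; rewrite subr0.
Qed.

(** Letters are removed at the right end, where [pdw] differentiates first, so that the induction
    applies to [f * pdd b g] and [g * pdd b f]. These two products account for the factor 2 per
    letter, and [q] plays the role of an inverse length. *)
Lemma pdw_mul_bound n f g x (F G q : R) : smooth f -> smooth g -> 0 <= F -> 0 <= G -> 0 <= q ->
  (forall w, (size w <= n)%N -> `|pdw w f x| <= F * q ^+ size w) ->
  (forall w, (size w <= n)%N -> `|pdw w g x| <= G * q ^+ size w) ->
  forall w, (size w <= n)%N -> `|pdw w (fun x => f x * g x) x| <= 2 ^+ size w * (F * G) * q ^+ size w.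
Proof.
move=> + + + + q0; elim: n f g F G => [|n IH] f g F G sf sg F0 G0 hF hG w.
  case: w => // _; rewrite /= !expr0 mul1r !mulr1 normrM.
  by have := hF [::] isT; have := hG [::] isT; rewrite /= expr0 !mulr1 => h1 h2; exact: ler_pM.
case/lastP: w => [_|w b].
  rewrite /= !expr0 mul1r !mulr1 normrM.
  by have := hF [::] isT; have := hG [::] isT; rewrite /= expr0 !mulr1 => h1 h2; exact: ler_pM.
rewrite size_rcons ltnS => wn; rewrite pdw_rcons (pdd_mul b sf sg).
rewrite (pdw_add w (smooth_mul sf (smooth_pdd b sg)) (smooth_mul sg (smooth_pdd b sf))).
have hF1 w' : (size w' <= n)%N -> `|pdw w' f x| <= F * q ^+ size w' by move=> h; apply: hF; rewrite leqW.
have hG1 w' : (size w' <= n)%N -> `|pdw w' g x| <= G * q ^+ size w' by move=> h; apply: hG; rewrite leqW.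
have hF2 w' : (size w' <= n)%N -> `|pdw w' (pdd b f) x| <= (F * q) * q ^+ size w'.
  by move=> h; have := hF (rcons w' b); rewrite size_rcons pdw_rcons exprS mulrA; apply.
have hG2 w' : (size w' <= n)%N -> `|pdw w' (pdd b g) x| <= (G * q) * q ^+ size w'.
  by move=> h; have := hG (rcons w' b); rewrite size_rcons pdw_rcons exprS mulrA; apply.
have h1 := IH f (pdd b g) F (G * q) sf (smooth_pdd b sg) F0 (mulr_ge0 G0 q0) hF1 hG2 w wn.
have h2 := IH g (pdd b f) G (F * q) sg (smooth_pdd b sf) G0 (mulr_ge0 F0 q0) hG1 hF2 w wn.
apply: (le_trans (ler_normD _ _)); apply: (le_trans (lerD h1 h2)).
rewrite le_eqVlt; apply/orP; left; apply/eqP; rewrite !exprS; ring.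
Qed.

(** Carried as a property of its own: it holds for mollifications by the form of the kernel, passes
    to sums and products, and makes a rotated gradient divergence free. *)
Definition pdcomm f := forall x, pdd true (pdd false f) x = pdd false (pdd true f) x.

Lemma pdcomm_mol s f : 0 < s -> locint f -> pdcomm (mol s f).
Proof.
move=> s0 lf x; rewrite !pdd2E !(pdw_mol _ s0 lf).
by rewrite (@pdw_rhos_count R s [:: true; false] [:: false; true] erefl erefl).
Qed.

Lemma pdcomm_add f g : smooth f -> smooth g -> pdcomm f -> pdcomm g -> pdcomm (fun x => f x + g x).
Proof.
move=> sf sg cf cg x.
have s1 b := smooth_pdd b sf; have s2 b := smooth_pdd b sg.
by rewrite !(pdd_add _ sf sg) !(pdd_add _ (s1 _) (s2 _)) cf cg.
Qed.

Lemma pdcomm_opp f : smooth f -> pdcomm f -> pdcomm (fun x => - f x).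
Proof.
move=> sf cf x; have s1 b := smooth_pdd b sf.
by rewrite !(pdd_opp _ sf) !(pdd_opp _ (s1 _)) cf.
Qed.

Lemma pdcomm_mul f g : smooth f -> smooth g -> pdcomm f -> pdcomm g -> pdcomm (fun x => f x * g x).
Proof.
move=> sf sg cf cg x.
have s1 b := smooth_pdd b sf; have s2 b := smooth_pdd b sg.
have m1 b := smooth_mul sf (s2 b); have m2 b := smooth_mul sg (s1 b).
rewrite !(pdd_mul _ sf sg) !(pdd_add _ (m1 _) (m2 _)) !(pdd_mul _ sf (s2 _)) !(pdd_mul _ sg (s1 _)) cf cg.
move: (f x) (g x) (pdd false g x) (pdd true g x) (pdd false f x) (pdd true f x) (pdd false (pdd true g) x) (pdd false (pdd true f) x) => *; ring.
Qed.

Lemma pdd_local b f g (V : set pt) x : open V -> (forall y, V y -> f y = g y) -> V x -> pdd b f x = pdd b g x.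
Proof.
move=> oV fg Vx; rewrite /pdd !derive1E; apply: near_eq_derive.
have nV : nbhs x V by exact: open_nbhs_nbhs.
move: nV; rewrite -nbhs_ballE => -[e /= e0 eV]; exists e => //= t ht; apply: fg; apply: eV.
by case: b ht => ht; split => //=; exact: ballxx.
Qed.

Lemma pdw_local w f g (V : set pt) x : open V -> (forall y, V y -> f y = g y) -> V x -> pdw w f x = pdw w g x.
Proof.
move=> oV fg; elim: w x => [|b w IH] x Vx; first exact: fg.
by rewrite !pdw_cons; apply: (pdd_local b oV) => // y Vy; exact: IH.
Qed.

Lemma words_bound (F : seq bool -> R) n : exists2 K : R, 1 <= K & forall w, (size w <= n)%N -> F w <= K.
Proof.
elim: n F => [|n IH] F.
  by exists (Num.max 1 (F [::])) => [|[]// _]; rewrite le_max lexx ?orbT.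
have [K1 K10 h1] := IH (fun w => F (true :: w)); have [K2 K20 h2] := IH (fun w => F (false :: w)).
exists (Num.max K1 (Num.max K2 (F [::]))); first by rewrite le_max K10.
move=> [_|[] w wn]; first by rewrite !le_max lexx !orbT.
- by apply: (le_trans (h1 w wn)); rewrite le_max lexx.
- by apply: (le_trans (h2 w wn)); rewrite !le_max lexx ?orbT.
Qed.

(** The oscillation around [c] in [mol_bound] is zero. *)
Lemma mol_const s f c x w : 0 < s -> locint f -> (forall z, `|z - x| <= s -> f z = c) ->
  pdw w (mol s f) x = if w is [::] then c else 0.
Proof.
move=> s0 lf hf; have := @mol_bound R f s w x c s0 lf.
rewrite (_ : (\int[@leb2 R]_(z in _) _)%E = 0%E); last first.
  rewrite (eq_integral (cst 0%E)) ?integral0// => z; rewrite inE /box/= subr0 => z1.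
  rewrite hf ?subrr ?normr0// addrC addKr normrZ normrN gtr0_norm//.
  by rewrite -[leRHS]mulr1 ler_pM2l.
by rewrite mule0 lee_fin normr_le0 subr_eq0 => /eqP.
Qed.

End smooth_algebra.

(** * Correction of the stream function near the closed set *)

Section construction.
Variable R : realType.
Local Notation pt := (pt R).
Local Notation leb2 := (@leb2 R).
Implicit Types (x y z : pt) (b : bool) (w : seq bool) (k j N n : nat).

Definition radius k : R := 2^-1 ^+ k.

Lemma radius_gt0 k : 0 < radius k. Proof. by rewrite exprn_gt0// invr_gt0. Qed.

Lemma radiusS k : radius k.+1 = radius k / 2. Proof. by rewrite /radius exprSr. Qed.

Lemma radius_le1 k : radius k <= 1. Proof. by rewrite exprn_ile1// ?invr_ge0// invf_le1// ler1n. Qed.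

Lemma radius_mono k j : (k <= j)%N -> radius j <= radius k.
Proof. by move=> kj; apply: ler_wiXn2l => //; rewrite ?invr_ge0// invf_le1// ler1n. Qed.

Lemma radius_small (e : R) : 0 < e -> exists N, forall n, (N <= n)%N -> radius n <= e.
Proof.
move=> e0; exists (Num.bound e^-1) => n Nn; apply: (le_trans (radius_mono Nn)).
set N := Num.bound _; rewrite /radius exprVn -[leRHS]invrK lef_pV2 ?posrE ?invr_gt0 ?exprn_gt0//.
apply: (@le_trans _ _ N%:R); first by rewrite ltW// archi_boundP// invr_ge0 ltW.
by rewrite -natrX ler_nat ltnW// ltn_expl.
Qed.

Variables (A : set pt) (psi : pt -> R) (ht : R -> R).
Hypotheses (A0 : A !=set0) (cpsi : continuous psi) (ht_lip : forall s t, `|ht s - ht t| <= `|s - t|).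

Local Notation d := (dist A).

Definition height x := ht (psi x).
(** Threshold 3 and mollification radius [radius k / 2] make [cutoff k] equal to 1 where
    [d < 5/2 radius k] and to 0 where [d > 7/2 radius k]. *)
Definition near_indic k : pt -> R := \1_[set x | d x < 3 * radius k].
Definition cutoff k := mol (radius k / 2) (near_indic k).
Definition mol_height k := mol (radius k / 4) height.

(* Telescoped form of [mol_height k] on the shell where [d] is about [radius k], for
   [K0 <= k <= K0 + N]. *)
Fixpoint corrector K0 N : pt -> R := if N is N'.+1 then
  fun x => corrector K0 N' x + cutoff (K0 + N) x * (mol_height (K0 + N) x - mol_height (K0 + N') x)
  else fun x => cutoff K0 x * mol_height K0 x.

Lemma continuous_height : continuous height.
Proof.
move=> x; apply/cvgrPdist_le => e e0.
have /cvgrPdist_le/(_ _ e0) := cpsi (x := x); apply: filterS => y; exact: le_trans (ht_lip _ _).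
Qed.

Lemma locint_height : locint height. Proof. exact: locint_continuous continuous_height. Qed.

Lemma measurable_near_indic k : measurable_fun setT (near_indic k).
Proof.
apply: measurable_indic; apply: measurable_lt_set; last exact: measurable_cst.
exact: measurable_dist.
Qed.

Lemma near_indic_le1 k x : `|near_indic k x| <= 1.
Proof. by rewrite /near_indic indicE; case: (_ \in _); rewrite ?normr1 ?normr0. Qed.

Lemma locint_near_indic k : locint (near_indic k).
Proof.
by apply: locint_bounded; [exact: measurable_near_indic|move=> r; exists 1 => x _; exact: near_indic_le1].
Qed.

Lemma radius2_gt0 k : 0 < radius k / 2. Proof. by rewrite divr_gt0// radius_gt0. Qed.
Lemma radius4_gt0 k : 0 < radius k / 4. Proof. by rewrite divr_gt0// radius_gt0. Qed.

Lemma smooth_cutoff k : smooth (cutoff k). Proof. exact: smooth_mol (radius2_gt0 k) (locint_near_indic k). Qed.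
Lemma smooth_mol_height k : smooth (mol_height k). Proof. exact: smooth_mol (radius4_gt0 k) locint_height. Qed.

Local Opaque smooth pdw.

Lemma cutoff_eq1 k x : d x < 5 / 2 * radius k -> cutoff k x = 1.
Proof.
move=> dx; have := @mol_const R (radius k / 2) (near_indic k) 1 x [::] (radius2_gt0 k) (locint_near_indic k); apply => z zx.
have := dist_lip z x A0; have := radius_gt0 k => r0 dz.
by rewrite /near_indic indicE mem_set//=; lra.
Qed.

Lemma cutoff_eq0 k x : 7 / 2 * radius k < d x -> cutoff k x = 0.
Proof.
move=> dx; have := @mol_const R (radius k / 2) (near_indic k) 0 x [::] (radius2_gt0 k) (locint_near_indic k); apply => z zx.
have := dist_lip x z A0; have := radius_gt0 k; rewrite distrC => r0 dz.
by rewrite /near_indic indicE memNset//= => dz3; lra.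
Qed.

Lemma smooth_corrector K0 N : smooth (corrector K0 N).
Proof.
elim: N => [|N IH] /=; first exact: smooth_mul (smooth_cutoff _) (smooth_mol_height _).
exact: smooth_add IH (smooth_mul (smooth_cutoff _) (smooth_sub (smooth_mol_height _) (smooth_mol_height _))).
Qed.

Lemma pdcomm_corrector K0 N : pdcomm (corrector K0 N).
Proof.
have cchi k : pdcomm (cutoff k) := pdcomm_mol (radius2_gt0 k) (locint_near_indic k).
have chh k : pdcomm (mol_height k) := pdcomm_mol (radius4_gt0 k) locint_height.
elim: N => [|N IH] /=; first exact: pdcomm_mul (smooth_cutoff _) (smooth_mol_height _) (cchi _) (chh _).
apply: (pdcomm_add (smooth_corrector K0 N) (smooth_mul (smooth_cutoff _) (smooth_sub (smooth_mol_height _) (smooth_mol_height _))) IH).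
apply: (pdcomm_mul (smooth_cutoff _) (smooth_sub (smooth_mol_height _) (smooth_mol_height _)) (cchi _)).
exact: (pdcomm_add (smooth_mol_height _) (smooth_opp (smooth_mol_height _)) (chh _) (pdcomm_opp (smooth_mol_height _) (chh _))).
Qed.

(** All cutoffs equal 1 here and the sum telescopes. *)
Lemma corrector_in K0 N x : d x < 5 / 2 * radius (K0 + N) -> corrector K0 N x = mol_height (K0 + N) x.
Proof.
elim: N => [|N IH] /= dx; first by rewrite addn0 in dx *; rewrite cutoff_eq1// mul1r.
rewrite cutoff_eq1// mul1r IH; first by ring.
by move: dx; rewrite addnS radiusS; have := radius_gt0 (K0 + N); lra.
Qed.

Lemma corrector_out K0 N x : 7 / 2 * radius K0 < d x -> corrector K0 N x = 0.
Proof.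
move=> dx; elim: N => [|N IH] /=; first by rewrite cutoff_eq0// mul0r.
rewrite IH cutoff_eq0 ?mul0r ?addr0//; apply: le_lt_trans dx; rewrite ler_pM2l//.
by apply: radius_mono; exact: leq_addr.
Qed.

(** The cutoff following [K0] vanishes beyond [7/2 radius K0.+1 = 7/4 radius K0], and so do all
    finer ones. *)
Lemma corrector_first K0 N x : 7 / 4 * radius K0 < d x -> corrector K0 N x = cutoff K0 x * mol_height K0 x.
Proof.
move=> dx; elim: N => //= N ->; rewrite [cutoff (K0 + N.+1) x]cutoff_eq0 ?mul0r ?addr0//; apply: le_lt_trans dx.
have : radius (K0 + N.+1) <= radius K0.+1 by apply: radius_mono; rewrite addnS ltnS leq_addr.
rewrite radiusS; lra.
Qed.

(** With [k = K0 + j.+1], finer cutoffs vanish beyond [7/2 radius k.+1 = 7/4 radius k], and coarser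
    ones are 1 below [5/2 radius (K0 + j) = 5 radius k]. *)
Lemma corrector_mid K0 N j x : (j < N)%N -> 7 / 4 * radius (K0 + j.+1) < d x -> d x < 5 * radius (K0 + j.+1) ->
  corrector K0 N x = mol_height (K0 + j) x + cutoff (K0 + j.+1) x * (mol_height (K0 + j.+1) x - mol_height (K0 + j) x).
Proof.
move=> + d1 d2; elim: N => // N IH; rewrite ltnS leq_eqVlt => /orP[/eqP jN|jN] /=.
  rewrite -jN corrector_in//; move: d2; rewrite addnS radiusS; lra.
rewrite IH// [cutoff (K0 + N.+1) x]cutoff_eq0 ?mul0r ?addr0//; apply: le_lt_trans d1.
have : radius (K0 + N.+1) <= radius (K0 + j.+1).+1 by apply: radius_mono; rewrite !addnS !ltnS ltn_add2l.
rewrite radiusS; lra.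
Qed.

(** An integral and not a supremum, since L^p bounds for differences control the former. *)
Definition osc (s : R) x : \bar R :=
  (\int[leb2]_(z in box (0 : pt)%R 1%R) (`|psi (x + (- s) *: z)%R - psi x|)%:E)%E.

Lemma osc_ge0 s x : (0 <= osc s x)%E. Proof. exact: integral_ge0. Qed.

Lemma osc_fin s x : osc s x \is a fin_num.
Proof.
rewrite ge0_fin_numE; last exact: osc_ge0.
have cf : continuous (fun z => psi (x + (- s) *: z) - psi x).
  move=> z; apply: cvgB; last exact: cvg_cst.
  apply: (@continuous_comp _ _ _ (fun z => x + (- s) *: z)); last exact: cpsi.
  by apply: cvgD; [exact: cvg_cst|apply: cvgZl_tmp; exact: cvg_id].
have [_ /(_ 1)/integrableP[_]] := locint_continuous cf.
by apply: le_lt_trans; rewrite /osc.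
Qed.

(** As [ht] is 1-Lipschitz, the oscillation of [height] is at most that of [psi]; no derivative of
    [ht] enters. *)
Lemma mol_height_bound k w x : `|pdw w (fun y => mol_height k y - height x) x| <= rhoC R w * (radius k / 4)^-1 ^+ size w * fine (osc (radius k / 4) x).
Proof.
have s0 := radius4_gt0 k.
have h := @mol_bound R height (radius k / 4) w x (height x) s0 locint_height.
have e : pdw w (fun y => mol_height k y - height x) x = pdw w (mol (radius k / 4) height) x - (if w is [::] then height x else 0).
  by rewrite (pdw_sub w (smooth_mol_height k) (smooth_cst (height x))) pdw_cst.
have r0 : 0 <= rhoC R w * (radius k / 4)^-1 ^+ size w.
  by rewrite mulr_ge0 ?rhoC_ge0// exprn_ge0// invr_ge0 ltW.
rewrite e -lee_fin EFinM (fineK (osc_fin _ _)); apply: (le_trans h).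
apply: lee_wpmul2l; first by rewrite lee_fin.
apply: ge0_le_integral => //.
- exact: measurable_box.
- apply: measurable_funTS; apply/measurable_EFinP; apply: measurableT_comp => //.
  apply: measurable_funB => //; apply: measurableT_comp; last exact: measurable_addpt_scale.
  exact: continuous_measurable2 continuous_height.
- apply: measurable_funTS; apply/measurable_EFinP; apply: measurableT_comp => //.
  apply: measurable_funB => //; apply: measurableT_comp; last exact: measurable_addpt_scale.
  exact: continuous_measurable2.
- by move=> z _; rewrite lee_fin; exact: ht_lip.
Qed.

Lemma cutoff_bound k w x : `|pdw w (cutoff k) x| <= rhoC R w * (radius k / 2)^-1 ^+ size w * 4.
Proof.
have s0 := radius2_gt0 k.
have h := @mol_bound R (near_indic k) (radius k / 2) w x 0 s0 (locint_near_indic k).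
have e : pdw w (cutoff k) x = pdw w (mol (radius k / 2) (near_indic k)) x - (if w is [::] then 0 else 0).
  have e0 : (if w is [::] then 0 else 0) = 0 :> R by case: (w).
  by rewrite e0 subr0.
rewrite e -lee_fin EFinM; apply: (le_trans h).
apply: lee_wpmul2l; first by rewrite lee_fin mulr_ge0 ?rhoC_ge0// exprn_ge0// invr_ge0 ltW.
apply: (@le_trans _ _ (\int[leb2]_(z in box (0 : pt)%R 1%R) 1%:E)%E); last first.
  by rewrite (integral_cst_box (0 : pt) 1 ler01) lee_fin; lra.
apply: ge0_le_integral => //.
- exact: measurable_box.
- apply: measurable_funTS; apply/measurable_EFinP; apply: measurableT_comp => //.
  apply: measurable_funB => //; apply: measurableT_comp; last exact: measurable_addpt_scale.
  exact: measurable_near_indic.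
- by move=> z _; rewrite subr0 lee_fin; exact: near_indic_le1.
Qed.

(** In the application [q] is [kernel_const], [a] the power of 2 from the Leibniz rule, and [o1],
    [o2] are the oscillations at two consecutive scales. *)
Lemma mid_shell_arith (q o1 o2 a c : R) : 0 <= q -> 0 <= o1 -> 0 <= o2 -> a <= c ->
  q * o2 + a * (4 * q * (q * (o1 + o2))) <= (q * (1 + c * (4 * q)) + 4 * q) * (o1 + o2).
Proof.
move=> q0 o10 o20 ac; have o12 : 0 <= o1 + o2 by exact: addr_ge0.
have -> : (q * (1 + c * (4 * q)) + 4 * q) * (o1 + o2) =
  q * o2 + c * (4 * q * (q * (o1 + o2))) + (q * o1 + 4 * q * (o1 + o2)) by ring.
have h1 : a * (4 * q * (q * (o1 + o2))) <= c * (4 * q * (q * (o1 + o2))).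
  by apply: ler_wpM2r => //; rewrite !mulr_ge0.
have h2 : 0 <= q * o1 by rewrite mulr_ge0.
have h3 : 0 <= 4 * q * (o1 + o2) by rewrite !mulr_ge0.
lra.
Qed.

Lemma first_shell_arith (q o e a c : R) : 1 <= q -> 0 <= o -> 0 <= e -> 0 <= a -> a <= c ->
  a * (4 * q * (q * o)) + a * (4 * q * e) <= (q * (1 + c * (4 * q)) + 4 * q) * (o + e).
Proof.
move=> q1 o0 e0 a0 ac; have q0 : 0 <= q by exact: le_trans q1.
have c0 : 0 <= c by exact: le_trans ac.
have -> : (q * (1 + c * (4 * q)) + 4 * q) * (o + e) =
  c * (4 * q * (q * o)) + c * (4 * q * (q * e)) + 5 * q * (o + e) by ring.
have h1 : a * (4 * q * (q * o)) <= c * (4 * q * (q * o)) by apply: ler_wpM2r => //; rewrite !mulr_ge0.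
have h2 : a * (4 * q * e) <= c * (4 * q * (q * e)).
  apply: ler_pM => //; first by rewrite !mulr_ge0.
  by apply: ler_wpM2l; rewrite ?mulr_ge0// ler_peMl.
have h3 : 0 <= 5 * q * (o + e) by rewrite !mulr_ge0// addr_ge0.
lra.
Qed.

Section bounds.
Variables (n : nat) (K : R).
Hypotheses (K1 : 1 <= K) (hK : forall w, (size w <= n)%N -> rhoC R w <= K).

(** The power of 4 covers derivatives up to order [n] at the scale [radius k / 4]. *)
Definition kernel_const : R := K * 4 ^+ n.
Definition corrector_const : R := kernel_const * (1 + 2 ^+ n * (4 * kernel_const)) + 4 * kernel_const.

Lemma kernel_const_ge0 : 0 <= kernel_const. Proof. by rewrite mulr_ge0// ?exprn_ge0// (le_trans _ K1). Qed.

Lemma scale_bound k k' (c : R) w : (size w <= n)%N -> 0 < c <= 4 -> (k' <= k)%N ->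
  rhoC R w * (radius k' / c)^-1 ^+ size w <= kernel_const * (radius k)^-1 ^+ size w.
Proof.
move=> wn /andP[c0 c4] kk; have r0 := radius_gt0 k; have r0' := radius_gt0 k'.
have -> : (radius k' / c)^-1 = c * (radius k')^-1 by rewrite invf_div mulrC.
rewrite exprMn mulrA /kernel_const; apply: ler_pM.
- by rewrite mulr_ge0 ?rhoC_ge0// exprn_ge0// ltW.
- by rewrite exprn_ge0// invr_ge0 ltW.
- apply: ler_pM; rewrite ?rhoC_ge0 ?exprn_ge0 ?(ltW c0)//; first exact: hK.
  apply: (@le_trans _ _ (4 ^+ size w)); first by apply: lerXn2r; rewrite ?nnegrE ?(ltW c0).
  by rewrite ler_eXn2l// ltr1n.
- by apply: lerXn2r; [rewrite nnegrE invr_ge0 ltW|rewrite nnegrE invr_ge0 ltW|rewrite lef_pV2 ?posrE//; exact: radius_mono].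
Qed.

Lemma mol_height_bound_radius k k' w x : (size w <= n)%N -> (k' <= k)%N ->
  `|pdw w (fun y => mol_height k' y - height x) x| <= kernel_const * fine (osc (radius k' / 4) x) * (radius k)^-1 ^+ size w.
Proof.
move=> wn kk; apply: (le_trans (mol_height_bound _ _ _)); rewrite [leRHS]mulrAC; apply: ler_wpM2r.
  by rewrite fine_ge0// osc_ge0.
by apply: scale_bound => //; rewrite ltr0n lexx.
Qed.

Lemma cutoff_bound_radius k w x : (size w <= n)%N -> `|pdw w (cutoff k) x| <= 4 * kernel_const * (radius k)^-1 ^+ size w.
Proof.
move=> wn; apply: (le_trans (cutoff_bound _ _ _)); 
rewrite [leRHS](_ : _ = kernel_const * (radius k)^-1 ^+ size w * 4); last by ring.
apply: ler_wpM2r => //.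
by apply: scale_bound => //; rewrite ltr0n ler_nat.
Qed.

Lemma osc0 s x : 0 <= fine (osc s x). Proof. by rewrite fine_ge0// osc_ge0. Qed.

(** The corrector is locally one mollification plus a cutoff times a difference of two. As [w] is
    nonempty, [height x] can be subtracted from both mollifications, after which each is bounded by
    an oscillation. *)
Lemma corrector_mid_bound K0 N j w x : (j < N)%N -> 2 * radius (K0 + j.+1) <= d x -> d x < 4 * radius (K0 + j.+1) ->
  (size w <= n)%N -> w <> [::] ->
  `|pdw w (corrector K0 N) x| <= corrector_const * (radius (K0 + j.+1))^-1 ^+ size w *
     (fine (osc (radius (K0 + j.+1) / 4) x) + fine (osc (radius (K0 + j) / 4) x)).
Proof.
move=> jN d1 d2 wn w0; set k := (K0 + j.+1)%N; set k' := (K0 + j)%N.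
have kk' : (k' <= k)%N by rewrite /k /k' addnS.
have r0 := radius_gt0 k; pose q := (radius k)^-1; have q0 : 0 <= q by rewrite invr_ge0 ltW.
pose V : set pt := [set y | 7 / 4 * radius k < d y] `&` [set y | d y < 5 * radius k].
have oV : open V.
  apply: openI; first exact: (open_comp (fun y _ => dist_continuous A0 (x := y)) (@open_gt R _)).
  exact: (open_comp (fun y _ => dist_continuous A0 (x := y)) (@open_lt R _)).
have Vx : V x by split => /=; lra.
pose c := height x.
pose f1 y := mol_height k y - c; pose f2 y := mol_height k' y - c.
have s1 : smooth f1 := smooth_sub (smooth_mol_height k) (smooth_cst c).
have s2 : smooth f2 := smooth_sub (smooth_mol_height k') (smooth_cst c).
have s12 : smooth (fun y => f1 y - f2 y) := smooth_sub s1 s2.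
have sp := smooth_mul (smooth_cutoff k) s12.
rewrite (@pdw_local R w (corrector K0 N) (fun y => (f2 y + cutoff k y * (f1 y - f2 y)) - - c) V x oV _ Vx); last first.
  by move=> y [y1 y2]; rewrite (corrector_mid jN y1 y2) /f1 /f2; ring.
rewrite (pdw_subc (- c) (smooth_add s2 sp) w0) (pdw_add w s2 sp).
set O1 := fine (osc (radius k / 4) x); set O2 := fine (osc (radius k' / 4) x).
have O10 : 0 <= O1 by exact: osc0.
have O20 : 0 <= O2 by exact: osc0.
have b2 w' : (size w' <= n)%N -> `|pdw w' f2 x| <= kernel_const * O2 * q ^+ size w' by move=> h; exact: mol_height_bound_radius.
have b1 w' : (size w' <= n)%N -> `|pdw w' f1 x| <= kernel_const * O1 * q ^+ size w' by move=> h; exact: mol_height_bound_radius.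
have b12 w' : (size w' <= n)%N -> `|pdw w' (fun y => f1 y - f2 y) x| <= kernel_const * (O1 + O2) * q ^+ size w'.
  move=> h; rewrite (pdw_sub w' s1 s2); apply: (le_trans (ler_normB _ _)).
  by rewrite mulrDr mulrDl; apply: lerD; [exact: b1|exact: b2].
have KC0 := kernel_const_ge0.
have bp := pdw_mul_bound (smooth_cutoff k) s12 (mulr_ge0 (ler0n _ 4) KC0) (mulr_ge0 KC0 (addr_ge0 O10 O20)) q0
  (fun w' => @cutoff_bound_radius k w' x) b12 wn.
apply: (le_trans (ler_normD _ _)); apply: (le_trans (lerD (b2 w wn) bp)).
have qw : 0 <= q ^+ size w by rewrite exprn_ge0.
have -> : corrector_const * q ^+ size w * (O1 + O2) = (corrector_const * (O1 + O2)) * q ^+ size w by ring.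
rewrite -mulrDl; apply: ler_wpM2r => //.
by apply: mid_shell_arith => //; rewrite ler_eXn2l// ltr1n.
Qed.

(** Here the cutoff multiplies the mollification itself, so the constant [height x] does not drop
    out; it is bounded by [eta]. *)
Lemma corrector_first_bound K0 N (eta : R) w x : 2 * radius K0 <= d x -> (forall t, `|ht t| <= eta) ->
  (size w <= n)%N ->
  `|pdw w (corrector K0 N) x| <= corrector_const * (radius K0)^-1 ^+ size w * (fine (osc (radius K0 / 4) x) + eta).
Proof.
move=> d1 hte wn.
have r0 := radius_gt0 K0; pose q := (radius K0)^-1; have q0 : 0 <= q by rewrite invr_ge0 ltW.
pose V : set pt := [set y | 7 / 4 * radius K0 < d y].
have oV : open V by exact: (open_comp (fun y _ => dist_continuous A0 (x := y)) (@open_gt R _)).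
have Vx : V x by rewrite /V/=; lra.
pose c := height x; pose f1 y := mol_height K0 y - c.
have s1 : smooth f1 := smooth_sub (smooth_mol_height K0) (smooth_cst c).
have sp := smooth_mul (smooth_cutoff K0) s1; have sc := smooth_mul (smooth_cutoff K0) (smooth_cst c).
rewrite (@pdw_local R w (corrector K0 N) (fun y => cutoff K0 y * f1 y + cutoff K0 y * c) V x oV _ Vx); last first.
  by move=> y Vy; rewrite (corrector_first N Vy) /f1; ring.
rewrite (pdw_add w sp sc).
set O1 := fine (osc (radius K0 / 4) x).
have O10 : 0 <= O1 by exact: osc0.
have eta0 : 0 <= eta by apply: le_trans (hte 0).
have b1 w' : (size w' <= n)%N -> `|pdw w' f1 x| <= kernel_const * O1 * q ^+ size w' by move=> h; exact: mol_height_bound_radius.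
have bc w' : (size w' <= n)%N -> `|pdw w' (fun=> c) x| <= eta * q ^+ size w'.
  move=> h; rewrite pdw_cst; case: w' h => [|b w'] _; first by rewrite expr0 mulr1; exact: hte.
  by rewrite normr0 mulr_ge0// exprn_ge0.
have KC0 := kernel_const_ge0.
have bp := pdw_mul_bound (smooth_cutoff K0) s1 (mulr_ge0 (ler0n _ 4) KC0) (mulr_ge0 KC0 O10) q0
  (fun w' => @cutoff_bound_radius K0 w' x) b1 wn.
have bq := pdw_mul_bound (smooth_cutoff K0) (smooth_cst c) (mulr_ge0 (ler0n _ 4) KC0) eta0 q0
  (fun w' => @cutoff_bound_radius K0 w' x) bc wn.
apply: (le_trans (ler_normD _ _)); apply: (le_trans (lerD bp bq)).
have qw : 0 <= q ^+ size w by rewrite exprn_ge0.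
have -> : corrector_const * q ^+ size w * (O1 + eta) = (corrector_const * (O1 + eta)) * q ^+ size w by ring.
rewrite -mulrDl; apply: ler_wpM2r => //.
have KCge : 1 <= kernel_const.
  by apply: (le_trans K1); rewrite /kernel_const ler_peMr ?(le_trans ler01 K1)// exprn_ege1// ler1n.
by apply: first_shell_arith => //; rewrite ler_eXn2l// ltr1n.
Qed.

End bounds.

End construction.

(* [G w] is the derivative of the stream function [G [::]] along the word [w]. *)
Definition flow (R : realType) (p : R) (m : nat) (A : set (pt R)) (G : seq bool -> pt R -> R) :=
  [/\ continuous (G [::]),
      forall w, (0 < size w <= m)%N -> continuous (G w) /\ forall x, A x -> G w x = 0,
      forall w, (0 < size w <= m.+1)%N -> measurable_fun setT (G w) /\ (Np p setT (G w) < +oo)%E &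
      forall b w, (size w <= m)%N -> wpd b (G w) (G (b :: w))].

(** * Bounds for the corrector on dyadic shells *)

Section estimates.
Variable R : realType.
Local Notation pt := (pt R).
Local Notation leb2 := (@leb2 R).
Implicit Types (x y z : pt) (b : bool) (w : seq bool) (k j N : nat) (E : set pt).
Variables (p : R) (m : nat) (A : set pt) (G : seq bool -> pt -> R).
Hypotheses (p2 : 2 < p) (A0 : A !=set0) (fG : flow p m A G).

Local Notation d := (dist A).
Local Notation psi := (G [::]).
Let g1 b := G [:: b].
Local Notation gam := (grnorm g1).
Let p0 : 0 < p. Proof. exact: lt_trans p2. Qed.
Let p1 : 1 < p. Proof. by apply: lt_trans p2; rewrite ltr1n. Qed.
Let cpsi : continuous psi. Proof. by case: fG. Qed.
Let mg1 b : measurable_fun setT (g1 b). Proof. by case: fG => _ _ /(_ [:: b] isT)[]. Qed.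
Let g1p b : (Np p setT (g1 b) < +oo)%E. Proof. by case: fG => _ _ /(_ [:: b] isT)[]. Qed.
Let wpsi b : wpd b psi (g1 b). Proof. by case: fG => _ _ _; apply. Qed.
Let mgam : measurable_fun setT gam. Proof. exact: measurable_grnorm. Qed.
Let mpsi : measurable_fun setT psi. Proof. exact: continuous_measurable2. Qed.

(** The oscillations are integrals of the differences [psi (x - s' z) - psi x], which
    [Np_difference] bounds by [s] times the gradient on the larger set [E']. *)
Lemma Np_osc E E' (h : pt -> R) (C s s1 s2 eta : R) : measurable E -> measurable E' -> measurable_fun setT h ->
  0 <= C -> 0 < s1 <= s -> 0 < s2 <= s -> 0 <= eta ->
  (forall x v, E x -> `|v| <= s -> E' (x + v)) ->
  (forall x, E x -> `|h x| <= C * (fine (osc psi s1 x) + fine (osc psi s2 x) + eta)) ->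
  (Np p E h <= ((4 * C) `^ p)%:E * ((2 `^ p)%:E * ((2 `^ p * 2 * s `^ p)%:E * Np p E' gam + (eta `^ p)%:E * leb2 E)))%E.
Proof.
move=> mE mE' mh C0 /andP[s10 s1s] /andP[s20 s2s] eta0 EE' hE.
pose D (s' : R) (q : pt * pt) := psi (q.1 + (- s') *: q.2) - psi q.1.
have mD s' : measurable_fun setT (D s').
  apply: measurable_funB; last exact: measurableT_comp.
  by apply: measurableT_comp => //; exact: measurable_addpair.
(* Integrated over the box of area 4, the constant [eta / 4] gives [eta]. *)
pose F (q : pt * pt) := (`|D s1 q| + `|D s2 q|) + eta / 4.
have mnD s' : measurable_fun setT (fun q => `|D s' q|) by exact: measurableT_comp.
have mF : measurable_fun setT F by apply: measurable_funD => //; exact: measurable_funD.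
have F0 q : 0 <= F q by rewrite !addr_ge0// divr_ge0.
have mb := measurable_box (0 : pt) 1.
have s0 : 0 <= s by rewrite ltW// (lt_le_trans s10).
apply: (@Np_avg R p E h F C) => //.
- move=> x Ex.
  have mDx s' : measurable_fun setT (fun z => `|D s' (x, z)|).
    exact: (measurableT_comp (mnD s') (measurable_pair1 x)).
  apply: (@le_trans _ _ (C * (fine (osc psi s1 x) + fine (osc psi s2 x) + eta))%:E); first by rewrite lee_fin hE.
  rewrite EFinM; apply: lee_wpmul2l; first by rewrite lee_fin.
  rewrite !EFinD !(fineK (osc_fin cpsi _ _)).
  have -> : eta%:E = (\int[leb2]_(z in box (0 : pt)%R 1%R) (eta / 4)%:E)%E.
    by rewrite integral_cst_box//; congr (_%:E); field.
  rewrite /osc -!ge0_integralD//.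
  + rewrite le_eqVlt; apply/orP; left; apply/eqP; apply: eq_integral => z _.
    by rewrite -!EFinD (ger0_norm (F0 _)).
  + by move=> z _; rewrite adde_ge0// lee_fin.
  + apply: emeasurable_funD; apply: measurable_funTS; apply/measurable_EFinP; exact: mDx.
  + by move=> z _; rewrite lee_fin divr_ge0.
  + by apply: measurable_funTS; apply/measurable_EFinP; exact: mDx.
  + by apply: measurable_funTS; apply/measurable_EFinP; exact: mDx.
- move=> z; rewrite /box/= subr0 => z1.
  have mDz s' : measurable_fun setT (fun x => `|D s' (x, z)|).
    exact: (measurableT_comp (mnD s') (measurable_pair2 z)).
  have one s' : 0 < s' <= s -> (Np p E (fun x => `|D s' (x, z)|%R) <= (s `^ p)%:E * Np p E' gam)%E.
    move=> /andP[s'0 s's].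
    rewrite (@eq_Np_norm _ _ _ _ (fun x => psi (x + (- s') *: z) - psi x)); last by move=> x _; rewrite normr_id.
    have zs : `|(- s') *: z| <= s.
      by rewrite normrZ normrN gtr0_norm//; apply: le_trans s's; rewrite -[leRHS]mulr1 ler_pM2l.
    apply: (le_trans (@Np_difference R p E E' psi g1 ((- s') *: z) p1 mE mE' cpsi mg1 g1p wpsi _)).
      move=> x t Ex /andP[t0 t1]; apply: EE' => //; rewrite normrZ gtr0_norm//.
      by apply: le_trans zs; rewrite ler_piMl.
    apply: lee_wpmul2r; first exact: Np_ge0.
    by rewrite lee_fin; apply: ge0_ler_powR; rewrite ?nnegrE// ltW.
  apply: (@Np_add_le R p E (fun x => `|D s1 (x, z)| + `|D s2 (x, z)|) (cst (eta / 4))) => //.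
  + exact: ltW.
  + exact: measurable_funD.
  + apply: (@le_trans _ _ ((2 `^ p)%:E * ((s `^ p)%:E * Np p E' gam + (s `^ p)%:E * Np p E' gam))%E).
      by apply: Np_add_le => //; [exact: ltW|apply: one; rewrite s10|apply: one; rewrite s20].
    rewrite -ge0_muleDl ?lee_fin ?powR_ge0// -EFinD muleA -EFinM.
    rewrite le_eqVlt; apply/orP; left; apply/eqP; congr (_%:E * _)%E; ring.
  + rewrite Np_cst//; apply: lee_wpmul2r; first by [].
    rewrite lee_fin; apply: ge0_ler_powR; rewrite ?nnegrE ?normr_ge0 ?(ltW p0)//.
    by rewrite ger0_norm ?divr_ge0//; lra.
Qed.

Definition shell k : set pt := [set x | 2 * radius R k <= d x < 4 * radius R k].
Definition wide_shell k : set pt := [set x | radius R k <= d x < 8 * radius R k].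

Let md : measurable_fun setT d. Proof. exact: measurable_dist. Qed.

Lemma measurable_band (a c : R) : measurable [set x | a <= d x < c].
Proof.
rewrite (_ : [set x | a <= d x < c] = [set x | a <= d x] `&` [set x | d x < c]).
  apply: measurableI; last by apply: measurable_lt_set => //; exact: measurable_cst.
  by rewrite -[X in measurable X]setTI; apply: measurable_fun_le.
by apply/seteqP; split => x /=; [move=> /andP[]|move=> [-> ->]].
Qed.

Lemma shell_shift k x v : shell k x -> `|v| <= radius R k / 2 -> wide_shell k (x + v).
Proof.
move=> /andP[h1 h2] hv; have := dist_lip x (x + v) A0; have := dist_lip (x + v) x A0.
rewrite opprD addrA subrr sub0r normrN [x + v - x]addrAC subrr add0r => q1 q2.
have := radius_gt0 R k => r0; rewrite /wide_shell/=; apply/andP; split; lra.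
Qed.

(** As [gam] is the size of the gradient of the stream function, this is [|u| / d^m]. *)
Definition hardy_quotient x := gam x * (d x)^-1 ^+ m.

Lemma measurable_hardy_quotient : measurable_fun setT hardy_quotient.
Proof. by apply: measurable_funM => //; exact: measurable_invdist. Qed.

Lemma Np_wide_shell k : (Np p (wide_shell k) gam <= (((8 * radius R k) ^+ m) `^ p)%:E * Np p (wide_shell k) hardy_quotient)%E.
Proof.
have r0 := radius_gt0 R k.
have -> : ((8 * radius R k) ^+ m) `^ p = `|(8 * radius R k) ^+ m| `^ p by rewrite ger0_norm// exprn_ge0// mulr_ge0// ltW.
have mP := measurable_hardy_quotient.
rewrite -Np_scale//; last exact: measurable_band.
apply: le_Np => //; [exact: ltW|exact: measurable_band|exact: measurable_funM|].
move=> x /andP[h1 h2]; have d0 : 0 < d x by exact: lt_le_trans h1.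
rewrite /hardy_quotient mulrCA normrM; apply: ler_peMr => //.
rewrite -exprMn ger0_norm; last by rewrite exprn_ge0// !mulr_ge0// ?invr_ge0 ltW.
by rewrite exprn_ege1// ler_pdivlMr// mul1r ltW.
Qed.

Variables (ht : R -> R) (eta : R).
Hypotheses (ht_lip : forall s t, `|ht s - ht t| <= `|s - t|) (hte : forall t, `|ht t| <= eta).
Variables (K : R).
Hypotheses (K1 : 1 <= K) (hK : forall w, (size w <= m.+1)%N -> rhoC R w <= K).

Local Notation Gff := (corrector A psi ht).
Local Notation GCm := (corrector_const m.+1 K).

Definition shell_const : R := (4 * GCm) `^ p * (2 `^ p * (2 `^ p * 2)) * (8 ^+ m) `^ p.

Lemma corrector_const_ge0 : 0 <= GCm.
Proof.
have h := @kernel_const_ge0 R m.+1 K K1.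
have h2 : 0 <= 2 ^+ m.+1 * (4 * kernel_const m.+1 K) by rewrite mulr_ge0 ?exprn_ge0// mulr_ge0.
by rewrite /corrector_const; apply: addr_ge0; apply: mulr_ge0 => //; exact: addr_ge0.
Qed.

Lemma q_le k w : (size w <= m.+1)%N -> (radius R k)^-1 ^+ size w <= (radius R k)^-1 ^+ m.+1.
Proof.
move=> wm; apply: ler_weXn2l => //; rewrite -[leLHS]invr1 lef_pV2 ?posrE ?radius_gt0//.
exact: radius_le1.
Qed.

Lemma measurable_pdw_corrector w K0 N : measurable_fun setT (pdw w (Gff K0 N)).
Proof. by apply: continuous_measurable2; apply: smooth_continuous; apply: smooth_pdw; exact: smooth_corrector. Qed.

(** The loss [r^(-m-1)] from the derivatives is balanced by [r] from the oscillation and [r^m] from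
    the Hardy quotient, so the constant is the same for all shells. *)
Lemma shell_const_scale k (Y : \bar R) : (0 <= Y)%E ->
  (((4 * (GCm * (radius R k)^-1 ^+ m.+1)) `^ p)%:E * ((2 `^ p)%:E * ((2 `^ p * 2 * (radius R k / 2) `^ p)%:E *
    ((((8 * radius R k) ^+ m) `^ p)%:E * Y))) <= shell_const%:E * Y)%E.
Proof.
move=> Y0; rewrite !muleA -!EFinM; apply: lee_wpmul2r => //; rewrite lee_fin.
have r0 := radius_gt0 R k; have r0' := ltW r0; have G0 := corrector_const_ge0.
set r := radius R k in r0 r0' *.
have q0 : 0 <= r^-1 ^+ m.+1 by rewrite exprn_ge0// invr_ge0.
have -> : 4 * (GCm * r^-1 ^+ m.+1) = (4 * GCm) * r^-1 ^+ m.+1 by ring.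
rewrite (powRM _ (_ : 0 <= 4 * GCm) q0) ?mulr_ge0// exprMn (powRM _ (_ : 0 <= 8 ^+ m)) ?exprn_ge0//.
apply: (@le_trans _ _ (shell_const * ((r^-1 ^+ m.+1) `^ p * r `^ p * (r ^+ m) `^ p))).
  rewrite /shell_const.
  have -> : (4 * GCm) `^ p * (2 `^ p * (2 `^ p * 2)) * (8 ^+ m) `^ p * ((r^-1 ^+ m.+1) `^ p * r `^ p * (r ^+ m) `^ p) =
    ((4 * GCm) `^ p * (r^-1 ^+ m.+1) `^ p * 2 `^ p * (2 `^ p * 2 * r `^ p)) * ((8 ^+ m) `^ p * (r ^+ m) `^ p).
    move: (_ `^ p) ((r^-1 ^+ m.+1) `^ p) (2 `^ p) (r `^ p) ((8 ^+ m) `^ p) ((r ^+ m) `^ p) => *; ring.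
  apply: ler_wpM2r; first by rewrite mulr_ge0 ?powR_ge0.
  apply: ler_wpM2l; first by rewrite !mulr_ge0 ?powR_ge0.
  apply: ler_wpM2l; first by rewrite mulr_ge0 ?powR_ge0.
  by apply: ge0_ler_powR; rewrite ?nnegrE ?divr_ge0 ?(ltW p0)//; lra.
rewrite -!powRM ?mulr_ge0 ?exprn_ge0 ?invr_ge0//.
have -> : r^-1 ^+ m.+1 * r * r ^+ m = 1.
  by rewrite -mulrA -exprS -exprMn mulVf ?gt_eqF// expr1n.
by rewrite powR1 mulr1.
Qed.

Lemma Np_shell_mid K0 N j w : (j < N)%N -> (size w <= m.+1)%N -> w <> [::] ->
  (Np p (shell (K0 + j.+1)) (pdw w (Gff K0 N)) <= shell_const%:E * Np p (wide_shell (K0 + j.+1)) hardy_quotient)%E.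
Proof.
move=> jN wm w0; set k := (K0 + j.+1)%N.
have r0 := radius_gt0 R k; have G0 := corrector_const_ge0.
have q0 : 0 <= (radius R k)^-1 ^+ m.+1 by rewrite exprn_ge0// invr_ge0 ltW.
have rk' : radius R (K0 + j) / 4 = radius R k / 2 by rewrite /k addnS radiusS; field.
have H := @Np_osc (shell k) (wide_shell k) (pdw w (Gff K0 N)) (GCm * (radius R k)^-1 ^+ m.+1) (radius R k / 2) (radius R k / 4) (radius R k / 2) 0
  (measurable_band _ _) (measurable_band _ _) (measurable_pdw_corrector w K0 N) (mulr_ge0 G0 q0).
have s1 : 0 < radius R k / 4 <= radius R k / 2 by apply/andP; split; lra.
have s2 : 0 < radius R k / 2 <= radius R k / 2 by apply/andP; split; lra.
have {}H := H s1 s2 (lexx _) (@shell_shift k).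
have {}H : (Np p (shell k) (pdw w (Gff K0 N)) <= ((4 * (GCm * (radius R k)^-1 ^+ m.+1)) `^ p)%:E *
   ((2 `^ p)%:E * ((2 `^ p * 2 * (radius R k / 2) `^ p)%:E * Np p (wide_shell k) gam + (0 `^ p)%:E * leb2 (shell k))))%E.
  apply: H => x /andP[h1 h2].
  have B := @corrector_mid_bound R A psi ht A0 cpsi ht_lip m.+1 K K1 hK K0 N j w x jN h1 h2 wm w0.
  rewrite -/k rk' in B; apply: (le_trans B); rewrite addr0; apply: ler_wpM2r.
    by rewrite addr_ge0// osc0.
  by apply: ler_wpM2l => //; exact: q_le.
apply: (le_trans H); rewrite powR0 ?gt_eqF// mul0e adde0.
apply: le_trans (shell_const_scale k (Np_ge0 p (wide_shell k) hardy_quotient)).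
apply: lee_wpmul2l; first by rewrite lee_fin powR_ge0.
apply: lee_wpmul2l; first by rewrite lee_fin powR_ge0.
by apply: lee_wpmul2l; [rewrite lee_fin !mulr_ge0 ?powR_ge0|exact: Np_wide_shell].
Qed.

Lemma Np_shell_first K0 N w : (size w <= m.+1)%N ->
  (Np p (shell K0) (pdw w (Gff K0 N)) <= shell_const%:E * Np p (wide_shell K0) hardy_quotient +
    ((4 * (GCm * (radius R K0)^-1 ^+ m.+1)) `^ p * (2 `^ p * eta `^ p))%:E * leb2 (shell K0))%E.
Proof.
move=> wm; set k := K0.
have r0 := radius_gt0 R k; have G0 := corrector_const_ge0.
have eta0 : 0 <= eta by apply: le_trans (hte 0).
have q0 : 0 <= (radius R k)^-1 ^+ m.+1 by rewrite exprn_ge0// invr_ge0 ltW.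
have H := @Np_osc (shell k) (wide_shell k) (pdw w (Gff K0 N)) (GCm * (radius R k)^-1 ^+ m.+1) (radius R k / 2) (radius R k / 4) (radius R k / 2) eta
  (measurable_band _ _) (measurable_band _ _) (measurable_pdw_corrector w K0 N) (mulr_ge0 G0 q0).
have s1 : 0 < radius R k / 4 <= radius R k / 2 by apply/andP; split; lra.
have s2 : 0 < radius R k / 2 <= radius R k / 2 by apply/andP; split; lra.
have {}H := H s1 s2 eta0 (@shell_shift k).
have {}H : (Np p (shell k) (pdw w (Gff K0 N)) <= ((4 * (GCm * (radius R k)^-1 ^+ m.+1)) `^ p)%:E *
   ((2 `^ p)%:E * ((2 `^ p * 2 * (radius R k / 2) `^ p)%:E * Np p (wide_shell k) gam + (eta `^ p)%:E * leb2 (shell k))))%E.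
  apply: H => x /andP[h1 h2].
  have B := @corrector_first_bound R A psi ht A0 cpsi ht_lip m.+1 K K1 hK K0 N eta w x h1 hte wm.
  apply: (le_trans B); apply: (@le_trans _ _ (GCm * (radius R K0)^-1 ^+ m.+1 * (fine (osc psi (radius R K0 / 4) x) + eta))).
    by apply: ler_wpM2r; [rewrite addr_ge0// osc0|apply: ler_wpM2l => //; exact: q_le].
  apply: ler_wpM2l; first by rewrite mulr_ge0.
  by rewrite lerD2r lerDl osc0.
apply: (le_trans H).
rewrite ge0_muleDr ?mule_ge0 ?lee_fin ?mulr_ge0 ?powR_ge0 ?Np_ge0//.
rewrite ge0_muleDr ?mule_ge0 ?lee_fin ?mulr_ge0 ?powR_ge0 ?Np_ge0//.
apply: leeD; last first.
  by rewrite !muleA -!EFinM le_eqVlt; apply/orP; left; apply/eqP; congr (_%:E * _)%E; rewrite -mulrA.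
apply: le_trans (shell_const_scale k (Np_ge0 p (wide_shell k) hardy_quotient)).
apply: lee_wpmul2l; first by rewrite lee_fin powR_ge0.
apply: lee_wpmul2l; first by rewrite lee_fin powR_ge0.
by apply: lee_wpmul2l; [rewrite lee_fin !mulr_ge0 ?powR_ge0|exact: Np_wide_shell].
Qed.

(** A wide shell is covered by the bands [[r, 2r[], [[2r, 4r[] and [[4r, 8r[]; each of these three
    kinds is disjoint over [j]. *)
Lemma sum_wide_shell K0 N : (\sum_(j < N) Np p (wide_shell (K0 + j)) hardy_quotient <= 3%:E * Np p [set x | 0 < d x < 8 * radius R K0]%R hardy_quotient)%E.
Proof.
have mP := measurable_hardy_quotient.
pose W := [set x | 0 < d x < 8 * radius R K0].
have mW : measurable W.
  rewrite (_ : W = [set x | 0 < d x] `&` [set x | d x < 8 * radius R K0]).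
    by apply: measurableI; [exact: (@measurable_lt_set _ (cst 0))|exact: (@measurable_lt_set _ _ (cst _))].
  by apply/seteqP; split => x; rewrite /W/=; [move=> /andP[]|move=> [-> ->]].
pose S (c : R) j : set pt := [set x | c * radius R (K0 + j) <= d x < c * 2 * radius R (K0 + j)].
have mS c j : measurable (S c j) by exact: measurable_band.
have tS c : 0 < c -> trivIset `I_N (S c).
  move=> c0; have aux i j x : (i < j)%N -> S c i x -> S c j x -> False.
    move=> ij /andP[h1 _] /andP[_ h2].
    have : radius R (K0 + j) <= radius R (K0 + i).+1 by apply: radius_mono; rewrite -addnS leq_add2l.
    rewrite radiusS => h3; have : c * 2 * radius R (K0 + j) <= c * radius R (K0 + i).
      by rewrite -mulrA ler_pM2l// mulrC -ler_pdivlMr.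
    by rewrite leNgt => /negP; apply; apply: le_lt_trans h2.
  move=> i j _ _ [x [hi hj]]; case: (ltngtP i j) => // ij; exfalso; [exact: aux ij hi hj|exact: aux ij hj hi].
have one c : 0 < c -> c * 2 <= 8 -> (\sum_(j < N) Np p (S c j) hardy_quotient <= Np p W hardy_quotient)%E.
  move=> c0 c8; rewrite -(@Np_bigU R p (S c))//; last exact: tS.
  apply: subset_Np => //; first exact: bigsetU_measurable.
  rewrite -bigcup_mkord => x [j _ /andP[h1 h2]]; have rj := radius_gt0 R (K0 + j); apply/andP; split.
    by apply: lt_le_trans h1; rewrite mulr_gt0.
  apply: (lt_le_trans h2); apply: ler_pM => //; [by rewrite mulr_ge0 ?ltW|exact: ltW|].
  by apply: radius_mono; exact: leq_addr.
pose S1 := S 1; pose S2 := S 2; pose S4 := S 4.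
have mS1 j : measurable (S1 j) by exact: mS.
have mS2 j : measurable (S2 j) by exact: mS.
have mS4 j : measurable (S4 j) by exact: mS.
have mS12 j : measurable (S1 j `|` S2 j) by exact: measurableU.
apply: (@le_trans _ _ (\sum_(j < N) (Np p (S1 j) hardy_quotient + Np p (S2 j) hardy_quotient + Np p (S4 j) hardy_quotient))%E).
  apply: lee_sum => j _; apply: (@le_trans _ _ (Np p ((S1 j `|` S2 j) `|` S4 j) hardy_quotient)).
    apply: subset_Np => //; [exact: measurable_band|exact: measurableU|].
    move=> x /andP[h1 h2]; have rj := radius_gt0 R (K0 + j); rewrite /S1 /S2 /S4 /S/=.
    have [q1|q1] := ltP (d x) (2 * radius R (K0 + j)); first by left; left; apply/andP; split; lra.
    have [q2|q2] := ltP (d x) (4 * radius R (K0 + j)); first by left; right; apply/andP; split; lra.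
    by right; apply/andP; split; lra.
  apply: (le_trans (Np_setU _ (mS12 j) (mS4 j) mP)).
  by apply: leeD => //; exact: Np_setU.
rewrite !big_split/=.
have -> : (3%:E = 1 + 1 + 1 :> \bar R)%E by rewrite -!EFinD; congr (_%:E); ring.
rewrite !ge0_muleDl ?adde_ge0// !mul1e.
by apply: leeD; [apply: leeD|]; apply: one; lra.
Qed.

End estimates.

(** * Choice of the parameters *)

Section approximation.
Variable R : realType.
Local Notation pt := (pt R).
Local Notation leb2 := (@leb2 R).
Implicit Types (x y z : pt) (b : bool) (w : seq bool) (k j N : nat) (E : set pt).
Variables (p : R) (m : nat) (A : set pt) (G : seq bool -> pt -> R) (M : R).
Hypotheses (p2 : 2 < p) (m0 : (0 < m)%N) (cA : closed A) (A0 : A !=set0) (fG : flow p m A G).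
Hypotheses (M0 : 0 <= M) (AM : forall x, M < `|x| -> A x).

Local Notation d := (dist A).
Local Notation psi := (G [::]).
Let p0 : 0 < p. Proof. exact: lt_trans p2. Qed.
Let p1 : 1 < p. Proof. by apply: lt_trans p2; rewrite ltr1n. Qed.
Let cpsi : continuous psi. Proof. by case: fG. Qed.

(** The gradient vanishes outside the box of radius [M], so mollifications of [psi] are constant
    along the segment. The margin 1 absorbs the mollification scale, and [s] the length of the
    segment. *)
Lemma psi_const_far x z (s : R) : M + 1 + s < `|x| -> `|z - x| <= s -> psi z = psi x.
Proof.
move=> xM zx; have lpsi := locint_continuous cpsi.
have [_ cG LG wG] := fG.
suff h (e : R) : 0 < e -> `|psi z - psi x| <= e + e.
  apply/eqP; rewrite -subr_eq0 -normr_le0; apply/ler_addgt0Pr => e e0; rewrite add0r.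
  by have := h (e / 2); rewrite -splitr; apply; rewrite divr_gt0.
move=> e0; have [d1 d10 h1] := mol_cvg_pt x cpsi e0; have [d2 d20 h2] := mol_cvg_pt z cpsi e0.
pose t := Num.min 1 (Num.min d1 d2).
have t0 : 0 < t by rewrite !lt_min ltr01 d10.
have t1 : t <= 1 by rewrite ge_min lexx.
have {}h1 : `|mol t psi x - psi x| <= e by apply: h1 => //; rewrite !ge_min lexx orbT.
have {}h2 : `|mol t psi z - psi z| <= e by apply: h2 => //; rewrite !ge_min lexx !orbT.
have Gz b y : M + 1 < `|y| -> pdd b (mol t psi) y = 0.
  move=> yM; rewrite (wG b [::] (leq0n _))//.
  have [_ /(_ y)] := @ker_mol R (G [:: b]) M t t0 (locint_continuous (cG [:: b] m0).1) (fun y My => (cG [:: b] m0).2 _ (AM My)).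
  by apply; apply: le_lt_trans yM; rewrite lerD2l.
have := smooth_segavg_le x z (smooth_mol t0 lpsi).
rewrite (_ : segavg _ _ _ = 0%E); last first.
  rewrite /segavg (eq_integral (cst 0%E)) ?integral0// => l; rewrite inE/= in_itv/= => /andP[l0 l1].
  have yM : M + 1 < `|x + l *: (z - x)|.
    have : `|l *: (z - x)| <= s by rewrite normrZ gtr0_norm//; apply: le_trans zx; rewrite ler_piMl.
    have : `|x| <= `|x + l *: (z - x)| + `|l *: (z - x)|.
      by rewrite -{1}(addrK (l *: (z - x)) x); exact: ler_normB.
    lra.
  by rewrite !Gz// normr0 addr0 normr0.
rewrite mule0 lee_fin normr_le0 subr_eq0 => /eqP e12.
have -> : psi z - psi x = - (mol t psi z - psi z) + (mol t psi x - psi x) by rewrite e12; ring.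
by apply: (le_trans (ler_normD _ _)); rewrite normrN lerD.
Qed.

(** By compactness of the box: a point of [A] has a neighbourhood mapped into [U], and a point off
    [A] has one that keeps away from [A]. *)
Lemma near_preimage (U : set R) (r L : R) : open U -> r < L -> (forall x, A x -> `|x| < L -> U (psi x)) ->
  exists2 e : R, 0 < e & forall x, `|x| <= r -> d x < e -> U (psi x).
Proof.
move=> oU rL hU.
have nc := (compact_near_coveringP (box (0 : pt) r)).1 (@compact_box R 0 r).
have cd := dist_continuous A0.
have : \forall e \near (0 : R)^'+, box 0 r `<=` (fun x => d x < e -> U (psi x)).
  apply: nc => x; rewrite /box/= subr0 => xr.
  have [Ax|nAx] := pselect (A x).
    have xL : `|x| < L by exact: le_lt_trans rL.
    have nU : nbhs x (psi @^-1` U) by apply: cpsi; apply: open_nbhs_nbhs; split => //; exact: hU.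
    exists (psi @^-1` U, setT); first by split => //; exact: filterT.
    by move=> [x' e] /= [Ux' _] _.
  have d0 : 0 < d x by exact: dist_gt0.
  have nd : nbhs x [set y | d x / 2 < d y].
    apply: open_nbhs_nbhs; split; last by rewrite /=; lra.
    exact: (open_comp (fun y _ => cd y) (@open_gt R _)).
  exists ([set y | d x / 2 < d y], [set e | e < d x / 2]).
    by split => //=; apply: nbhs_right_lt; rewrite divr_gt0.
  by move=> [x' e] /= [h1 h2] h3; lra.
move=> H; have H' : \forall e \near (0 : R)^'+, (box 0 r `<=` (fun x => d x < e -> U (psi x))) /\ 0 < e.
  by apply: filterI => //; exact: nbhs_right_gt.
have [e [he e0]] := @filter_ex _ _ (at_right_proper_filter (0 : R)) _ H'.
by exists e => // x xr; apply: he; rewrite /box/= subr0.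
Qed.

(** By the intermediate value theorem, every value between [psi x] and [psi z] is taken on the
    segment, hence lies in [U], where [ht] has slope 1. *)
Lemma psi_sub_ht_const (U : set R) (ht : R -> R) x z (s : R) :
  (forall s t, s <= t -> (forall r, s <= r <= t -> U r) -> ht t - ht s = t - s) ->
  (forall y, `|y - x| <= s -> U (psi y)) -> `|z - x| <= s ->
  psi z - ht (psi z) = psi x - ht (psi x).
Proof.
move=> hht hU zx.
pose u (t : R) := psi (x + t *: (z - x)).
have cu : continuous u.
  move=> t; apply: (@continuous_comp _ _ _ (fun t : R => x + t *: (z - x))); last exact: cpsi.
  by apply: cvgD; [exact: cvg_cst|apply: cvgZr_tmp; exact: cvg_id].
have u0 : u 0 = psi x by rewrite /u scale0r addr0.
have u1 : u 1 = psi z by rewrite /u scale1r addrCA subrr addr0.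
have Uv v : Num.min (psi x) (psi z) <= v <= Num.max (psi x) (psi z) -> U v.
  rewrite -u0 -u1 => hv; have [c] := IVT ler01 (continuous_subspaceT cu) hv.
  rewrite in_itv/= => /andP[c0 c1] <-; apply: hU.
  by rewrite addrC addKr normrZ ger0_norm//; apply: le_trans zx; rewrite ler_piMl.
have [le|/ltW le] := leP (psi x) (psi z).
- have := hht _ _ le; rewrite (min_idPl le) (max_idPr le) in Uv => /(_ Uv); lra.
- have := hht _ _ le; rewrite (min_idPr le) (max_idPl le) in Uv => /(_ Uv); lra.
Qed.

(** The corrector is here the mollification of [height] at the very scale at which [psi] is
    mollified; the difference is the mollification of a function constant on the ball involved. *)
Lemma inner_eq (ht : R -> R) K0 N w x : (forall s t, `|ht s - ht t| <= `|s - t|) ->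
  (forall x, d x < 5 / 2 * radius R (K0 + N) -> forall z, `|z - x| <= radius R (K0 + N) / 4 ->
     psi z - ht (psi z) = psi x - ht (psi x)) -> w <> [::] ->
  d x < 5 / 2 * radius R (K0 + N) ->
  pdw w (mol (radius R (K0 + N) / 4) psi) x = pdw w (corrector A psi ht K0 N) x.
Proof.
move=> hl hc w0 dx; set K := (K0 + N)%N in hc dx *.
have s0 := radius4_gt0 R K; have lpsi := locint_continuous cpsi.
have lhp := locint_height cpsi hl.
pose V : set pt := [set y | d y < 5 / 2 * radius R K].
have oV : open V by exact: (open_comp (fun y _ => dist_continuous A0 (x := y)) (@open_lt R _)).
rewrite (@pdw_local R w (corrector A psi ht K0 N) (mol_height psi ht K) V x oV _ dx); last by move=> y Vy; exact: corrector_in.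
apply/eqP; rewrite -subr_eq0; apply/eqP.
have lF : locint (fun y => psi y - height psi ht y) by apply: (locint_add lpsi); exact: locint_opp.
have := @mol_const R (radius R K / 4) _ (psi x - ht (psi x)) x w s0 lF (hc x dx).
have -> : mol (radius R K / 4) (fun y => psi y - height psi ht y) = (fun y => mol (radius R K / 4) psi y - mol_height psi ht K y).
  by apply/funext => y; rewrite /mol (cvl_sub _ lpsi lhp (ker_rhos s0)).
rewrite (pdw_sub w (smooth_mol s0 lpsi) (smooth_mol_height cpsi hl K)) => ->.
by case: w w0.
Qed.

(** Order 1 vanishes pointwise; every higher order is the derivative of one that vanishes on [A],
    and [wpd_vanish] applies. *)
Lemma Np_vanish_set w : (0 < size w <= m.+1)%N -> Np p A (G w) = 0%E.
Proof.
have mA := closed_measurable2 cA.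
have [_ cG LG wG] := fG.
case: w => // b [|b' w'] /= wm.
  have [_ h] := cG [:: b] m0; rewrite (@eq_Np _ _ _ _ (cst 0)); last by move=> x Ax; exact: h.
  by rewrite Np_cst// normr0 powR0 ?gt_eqF// mul0e.
have wm' : (0 < size (b' :: w') <= m)%N by [].
have [cf fA] := cG (b' :: w') wm'.
have wm2 : (0 < size (b' :: w') <= m.+1)%N by rewrite /= leqW.
have [_ fp] := LG _ wm2; have [mg gp] := LG (b :: b' :: w') wm.
by apply: (@wpd_vanish R p b (G (b' :: w')) (G (b :: b' :: w')) A) => //; exact: wG.
Qed.

Lemma Np_bigU_le (F : nat -> set pt) N f : (forall i, measurable (F i)) -> measurable_fun setT f ->
  (Np p (\big[setU/set0]_(i < N) F i) f <= \sum_(i < N) Np p (F i) f)%E.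
Proof.
move=> mF mf; elim: N => [|N IH].
  by rewrite !big_ord0 NpE integral_set0.
rewrite !big_ord_recr/=; apply: (le_trans (Np_setU _ _ _ _)) => //; first exact: bigsetU_measurable.
exact: leeD.
Qed.

Lemma shell_cover K0 N x : 2 * radius R (K0 + N) <= d x -> d x < 4 * radius R K0 ->
  exists2 j, (j <= N)%N & shell A (K0 + j) x.
Proof.
elim: N => [|N IH] h1 h2; first by exists 0%N => //; rewrite /shell/= h1 addn0.
have [h3|h3] := leP (2 * radius R (K0 + N)) (d x).
  by have [j jN hj] := IH h3 h2; exists j => //; exact: leqW.
exists N.+1 => //; rewrite /shell/= h1/=; move: h3; rewrite addnS radiusS => h3; lra.
Qed.

(** [hardy_global] is applied to the first derivatives of [psi]; the words are extended on the right
    because the last letter is differentiated first. *)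
Lemma hardy_quotient_finite : (Np p [set x | 0 < d x]%R (hardy_quotient m A G) < +oo)%E.
Proof.
have [_ cG LG wG] := fG.
pose g' b x := G [:: b] x * (d x)^-1 ^+ m.
have mD : measurable [set x | 0 < d x].
  by apply: (@measurable_lt_set _ (cst 0)) => //; exact: measurable_dist.
have fin b : (Np p [set x | 0 < d x]%R (g' b) < +oo)%E.
  apply: (@hardy_global R p m A (fun w => G (rcons w b)) p2 A0).
  - by move=> w wm; apply: cG; rewrite size_rcons.
  - by move=> w wm; apply: LG; rewrite size_rcons.
  - by move=> b' w wm; rewrite rcons_cons; apply: wG; rewrite size_rcons.
have mg' b : measurable_fun setT (g' b).
  apply: measurable_funM; last exact: measurable_invdist.
  by have [] := LG [:: b] isT.
rewrite (@eq_Np _ _ _ _ (grnorm g')); last first.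
  move=> x _; rewrite /hardy_quotient /grnorm /g' !normrM mulrDl.
  by rewrite [`|_ ^+ m|]ger0_norm// exprn_ge0// invr_ge0 dist_ge0.
apply: (le_lt_trans (Np_grnorm (ltW p0) mD mg')).
by rewrite lte_mul_pinfty ?lee_fin ?powR_ge0// lte_add_pinfty.
Qed.

Lemma hardy_quotient_small (e : R) : 0 < e -> exists K0, (Np p [set x | 0 < d x < 8 * radius R K0]%R (hardy_quotient m A G) <= e%:E)%E.
Proof.
move=> e0; have md := measurable_dist A0.
have mD : measurable [set x | 0 < d x] by exact: (@measurable_lt_set _ (cst 0)).
pose E_ n : set pt := [set x | d x < 8 * radius R n].
have mE n : measurable (E_ n) by exact: (@measurable_lt_set _ _ (cst _)).
have [|N hN] := Np_vanish p0 mD mE (measurable_hardy_quotient A0 fG) _ hardy_quotient_finite e0.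
  move=> x /= d0; have d8 : 0 < d x / 8 by rewrite divr_gt0.
  have [N hN] := radius_small d8; exists N => n Nn; rewrite /E_/=; have := hN n Nn; lra.
exists N; rewrite (_ : [set x | 0 < d x < 8 * radius R N] = [set x | 0 < d x] `&` E_ N); first exact: hN.
by apply/seteqP; split => x; rewrite /E_/=; [move=> /andP[]|move=> [-> ->]].
Qed.

Lemma G_near_small (e : R) : 0 < e -> exists2 r : R, 0 < r &
  forall w, (0 < size w <= m.+1)%N -> (Np p [set x | d x < r]%R (G w) <= e%:E)%E.
Proof.
move=> e0; have [_ _ LG _] := fG; have md := measurable_dist A0.
have ex w : exists N, (0 < size w <= m.+1)%N -> (Np p [set x | d x < 4 * 1 / N.+1%:R]%R (G w) <= e%:E)%E.
  have [wm|wm] := boolP (0 < size w <= m.+1)%N; last by exists 0%N.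
  have [mg gp] := LG w wm.
  have [N hN] := @near_small R p A 1 (G w) p0 cA A0 ltr01 mg gp (Np_vanish_set wm) e e0.
  by exists N => _; exact: hN.
have [B B1 hB] := @words_bound R (fun w => (sval (cid (ex w)))%:R) m.+1.
have B0 : 0 < B by exact: lt_le_trans B1.
exists (4 / (B + 1)); first by rewrite divr_gt0// addr_gt0.
move=> w wm; have := hB w; case: cid => N /= hN /(_ (andP wm).2) NB.
have [mg _] := LG w wm.
apply: le_trans (hN wm); apply: subset_Np => //; try exact: (@measurable_lt_set _ _ (cst _)).
move=> x /= /lt_le_trans; apply; rewrite mulr1 ler_pM2l// lef_pV2 ?posrE ?addr_gt0// -natr1.
by rewrite lerD2r.
Qed.

(** [F] is to be subtracted from [mol s psi]: near [A] it has the same derivatives, and everywhere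
    its derivatives are small in L^p. The three thirds of [e] go to the innermost region, to the
    Hardy quotient on the shells, and to the outermost cutoff. *)
Lemma cutoff_stream (e : R) : 0 < e -> exists (F : pt -> R) (s r : R), [/\ 0 < s <= e, 0 < r,
  smooth F, pdcomm F & (forall w x, w <> [::] -> d x < r -> pdw w (mol s psi) x = pdw w F x) /\
  forall w, (0 < size w <= m.+1)%N -> (Np p setT (pdw w F) <= e%:E)%E].
Proof.
move=> e0; have [_ cG LG wG] := fG; have md := measurable_dist A0.
have [K K1 hK] := @words_bound R (@rhoC R) m.+1.
pose C := shell_const p m K; have C0 : 0 <= C.
  by rewrite /C /shell_const !mulr_ge0 ?powR_ge0.
have e3 : 0 < e / 3 by rewrite divr_gt0.
(* The shells contribute at most [3 C] times this amount, whatever their number; this fixes the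
   outer scale [K0]. *)
have eC : 0 < e / 3 / (3 * (C + 1)) by rewrite divr_gt0// mulr_gt0// ltr_wpDl.
have [K0 hK0] := hardy_quotient_small eC.
(* The outermost cutoff costs [B eta^p], where [(2 M)^2] bounds the area of its shell. As [B]
   depends on [K0], [eta] is chosen afterwards. *)
pose B := (4 * (corrector_const m.+1 K * (radius R K0)^-1 ^+ m.+1)) `^ p * 2 `^ p * (2 * M) ^+ 2.
have B0 : 0 <= B by rewrite !mulr_ge0 ?powR_ge0// sqr_ge0.
pose eta := (e / 3 / (B + 1)) `^ p^-1.
have eB : 0 < e / 3 / (B + 1) by rewrite divr_gt0// ltr_wpDl.
have eta0 : 0 < eta by rewrite powR_gt0.
have etap : eta `^ p = e / 3 / (B + 1) by rewrite /eta -powRrM mulVf ?gt_eqF// powRr1// ltW.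
(* The bounds [M + 5], [M + 4] and [M + 3] used in turn leave room for neighbourhoods and for the
   mollification; farther out [psi] is locally constant. *)
have [U [oU UA Ue]] : exists U : set R, [/\ open U, (forall x, A x -> `|x| < M + 5 -> U (psi x)) & (@lebesgue_measure R U <= eta%:E)%E].
  apply: (@sard R p A (M + 5) psi G p2 cA A0 _ cpsi) => //.
  - by rewrite ltr_wpDl.
  - by move=> i; have [] := cG [:: i] m0.
  - by move=> w /andP[w1 w2]; apply: LG; rewrite w1 (leq_trans w2).
  - by move=> i; apply: wG.
  - by move=> i j; apply: wG.
  - by move=> i x Ax; have [_ h] := cG [:: i] m0; exact: h.
  - by move=> i j; apply: Np_vanish_set.
have [ht [ht0 hl hc]] := height_function oU Ue.
have hte t : `|ht t| <= eta by have /andP[h1 h2] := ht0 t; rewrite ger0_norm.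
have [rho rho0 hrho] := @near_preimage U (M + 4) (M + 5) oU (ltac:(lra)) UA.
pose Cm : R := (4 * rhoC R [::]) `^ p + 1.
have Cm0 : 0 < Cm by rewrite ltr_wpDl// powR_ge0.
have eCm : 0 < e / 3 / Cm by rewrite divr_gt0.
have [r1 r10 hr1] := G_near_small eCm.
(* For the inner scale, [rho / 3] keeps [psi] in [U] around the innermost region, [r1 / 3] keeps the
   mollified derivatives where [G] is small, and [e] bounds [s]. *)
pose r2 := Num.min (Num.min (rho / 3) (r1 / 3)) e.
have r20 : 0 < r2 by rewrite !lt_min e0 !divr_gt0.
have [N0 hN0] := radius_small r20.
have := hN0 (K0 + N0)%N (leq_addl _ _); rewrite !le_min => /andP[/andP[ra rb] rc].
pose N := N0; pose KK := (K0 + N)%N; rewrite -/KK in ra rb rc.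
have rK0 := radius_gt0 R KK; have rK1 := radius_le1 R KK.
pose s := radius R KK / 4; have s0 : 0 < s by rewrite divr_gt0.
have lpsi := locint_continuous cpsi.
have Hc x : d x < 5 / 2 * radius R KK -> forall z, `|z - x| <= radius R KK / 4 -> psi z - ht (psi z) = psi x - ht (psi x).
  move=> dx z zx; have [xM|xM] := leP `|x| (M + 3); last first.
    by rewrite (@psi_const_far x z 1)//; lra.
  apply: (psi_sub_ht_const hc _ zx) => y yx; apply: hrho.
    have : `|y| <= `|y - x| + `|x| by rewrite -{1}(subrK x y) ler_normD.
    lra.
  have := dist_lip y x A0; lra.
pose F := corrector A psi ht K0 N.
have sF : smooth F by exact: smooth_corrector.
exists F, s, (5 / 2 * radius R KK); split.
- by apply/andP; split => //; rewrite /s; lra.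
- by rewrite mulr_gt0.
- exact: sF.
- exact: pdcomm_corrector.
split; first by move=> w x w0 dx; apply: inner_eq.
move=> w wm; have w0 : w <> [::] by move=> w0; move: wm; rewrite w0.
have mw : measurable_fun setT (pdw w F) by exact: (measurable_pdw_corrector A0 fG hl).
pose D1 : set pt := [set x | d x < 2 * radius R KK].
pose D3 : set pt := [set x | 4 * radius R K0 <= d x].
pose D2 := \big[setU/set0]_(j < N.+1) shell A (K0 + j).
have mD1 : measurable D1 by exact: (@measurable_lt_set _ _ (cst _)).
have mD3 : measurable D3 by rewrite -[X in measurable X]setTI; apply: measurable_fun_le.
have msh j : measurable (shell A (K0 + j)) by apply: measurable_band.
have mD2 : measurable D2 by exact: bigsetU_measurable.
have mD12 : measurable (D1 `|` D2) by exact: measurableU.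
apply: (@le_trans _ _ (Np p ((D1 `|` D2) `|` D3) (pdw w F))).
  apply: subset_Np => //; first exact: measurableU.
  move=> x _; have [h1|h1] := ltP (d x) (2 * radius R KK); first by left; left.
  have [h2|h2] := leP (4 * radius R K0) (d x); first by right.
  left; right; have [j jN hj] := shell_cover h1 h2.
  by rewrite /D2 -(bigcup_mkord N.+1 (fun j => shell A (K0 + j))); exists j.
apply: (le_trans (Np_setU _ mD12 mD3 mw)).
have -> : e = e / 3 + (e / 3 + e / 3) by field.
(* Beyond [4 radius K0] even the outermost cutoff vanishes. *)
have E3 : Np p D3 (pdw w F) = 0%E.
  pose V : set pt := [set y | 7 / 2 * radius R K0 < d y].
  have oV : open V by exact: (open_comp (fun y _ => dist_continuous A0 (x := y)) (@open_gt R _)).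
  rewrite (@eq_Np _ _ _ _ (cst 0)); first by rewrite Np_cst// normr0 powR0 ?gt_eqF// mul0e.
  move=> x Dx; have rk := radius_gt0 R K0.
  rewrite (@pdw_local R w F (cst 0) V x oV); first by rewrite pdw_cst; case: (w).
    by move=> y Vy; exact: corrector_out.
  by move: Dx; rewrite /D3 /V/=; lra.
rewrite E3 adde0; apply: (le_trans (Np_setU _ mD1 mD2 mw)).
rewrite [(e / 3 + _)%:E]EFinD; apply: leeD.
(* In the innermost region the derivatives of [F] are mollifications of [G w], small because [G w]
   vanishes a.e. on [A]. *)
- rewrite (@eq_Np _ _ _ _ (mol s (G w))); last first.
    move=> x Dx; rewrite -(@inner_eq ht K0 N w x hl Hc w0); last by move: Dx; rewrite /D1/= -/KK; lra.
    by rewrite (@wpd_pdw R m.+1 G (radius R KK / 4) s0)//; case/andP: wm.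
  have [mgw gwp] := LG w wm; have lgw := locint_Lp p1 mgw gwp.
  have mr1 : measurable [set x | d x < r1] by exact: (@measurable_lt_set _ _ (cst _)).
  apply: (@le_trans _ _ (((4 * rhoC R [::]) `^ p)%:E * Np p [set x | d x < r1]%R (G w))%E).
    apply: Np_mol => //; move=> x z; rewrite /D1/= => Dx zs.
    have := dist_lip (x + z) x A0; rewrite [x + z]addrC addrK => h.
    move: rb zs; rewrite /s -/KK; lra.
  apply: (@le_trans _ _ (((4 * rhoC R [::]) `^ p)%:E * (e / 3 / Cm)%:E)%E).
    by apply: lee_wpmul2l; [rewrite lee_fin powR_ge0|exact: hr1].
  by rewrite -EFinM lee_fin mulrA ler_pdivrMr// mulrC ler_pM2l// /Cm lerDl.
apply: (le_trans (Np_bigU_le _ msh mw)).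
have wm1 : (size w <= m.+1)%N by case/andP: wm.
pose X := (((4 * (corrector_const m.+1 K * (radius R K0)^-1 ^+ m.+1)) `^ p * (2 `^ p * eta `^ p))%:E * leb2 (shell A K0))%E.
apply: (@le_trans _ _ (C%:E * (\sum_(j < N.+1) Np p (wide_shell A (K0 + j)) (hardy_quotient m A G)) + X)%E).
  rewrite !big_ord_recl/= addn0 ge0_muleDr ?Np_ge0//; last by apply: sume_ge0 => j _; exact: Np_ge0.
  rewrite -addeA [X in (_ <= _ + X)%E]addeC addeA; apply: leeD.
    exact: (Np_shell_first p2 A0 fG hl hte K1 hK K0 N wm1).
  rewrite ge0_sume_distrr; last by move=> j _; exact: Np_ge0.
  apply: lee_sum => j _; rewrite /bump/= add1n.
  exact: (Np_shell_mid p2 A0 fG hl K1 hK K0 (ltn_ord j) wm1 w0).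
rewrite EFinD; apply: leeD.
  apply: (@le_trans _ _ (C%:E * (3%:E * (e / 3 / (3 * (C + 1)))%:E))%E).
    apply: lee_wpmul2l; first by rewrite lee_fin.
    apply: (le_trans (sum_wide_shell A0 fG K0 N.+1)).
    by apply: lee_wpmul2l => //; rewrite lee_fin.
  rewrite -!EFinM lee_fin.
  have -> : C * (3 * (e / 3 / (3 * (C + 1)))) = e / 3 * (C / (C + 1)).
    by field; rewrite gt_eqF// ltr_wpDl.
  by rewrite ler_piMr ?(ltW e3)// ler_pdivrMr ?ltr_wpDl// mul1r lerDl.
have shB : shell A K0 `<=` box 0 M.
  move=> x /andP[h1 _]; rewrite /box/= subr0 leNgt; apply/negP => /AM Ax.
  by have := radius_gt0 R K0; rewrite (dist_eq0 Ax) in h1; lra.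
have lsh : (leb2 (shell A K0) <= ((2 * M) ^+ 2)%:E)%E.
  rewrite -(leb2_box 0 M0); apply: le_measure; [apply: mem_set|apply: mem_set|exact: shB].
    by have := msh 0%N; rewrite addn0.
  exact: measurable_box.
apply: (@le_trans _ _ (((4 * (corrector_const m.+1 K * (radius R K0)^-1 ^+ m.+1)) `^ p * (2 `^ p * eta `^ p))%:E * ((2 * M) ^+ 2)%:E)%E).
  by apply: lee_wpmul2l => //; rewrite lee_fin !mulr_ge0 ?powR_ge0.
rewrite -EFinM lee_fin etap.
set a1 := _ `^ p; set a2 := 2 `^ p.
have -> : a1 * (a2 * (e / 3 / (B + 1))) * (2 * M) ^+ 2 = e / 3 * (B / (B + 1)) by rewrite /B -/a1 -/a2; ring.
by rewrite ler_piMr ?(ltW e3)// ler_pdivrMr ?ltr_wpDl// mul1r lerDl.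
Qed.

End approximation.

(** * The approximating fields *)

Section assembly.
Variable R : realType.
Local Notation pt := (pt R).
Local Notation leb2 := (@leb2 R).
Implicit Types (x y z : pt) (b : bool) (w : seq bool) (al : nat * nat).

Local Opaque smooth pdw.

Lemma wpd_opp b (f g : pt -> R) : locint f -> locint g -> wpd b f g -> wpd b (fun x => - f x) (fun x => - g x).
Proof.
move=> lf lg wf s s0; rewrite (mol_opp s0 lf) (mol_opp s0 lg) (pdd_opp b (smooth_mol s0 lf)).
by apply/funext => x; rewrite (wf s s0).
Qed.

Lemma cnt_nseq al : cnt (nseq al.1 true ++ nseq al.2 false) = al.
Proof.
by case: al => i j; rewrite /cnt/= !count_cat !count_nseq /= !mul1n !mul0n addn0 add0n.
Qed.

(** The last letter is differentiated first and selects the component: the derivative of [psi] along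
    [false] is the first component of the field, along [true] minus the second. The other letters
    are read as a multi-index. *)
Definition stream_family (psi : pt -> R) (G1 G2 : nat * nat -> pt -> R) w : pt -> R :=
  if w is b :: w' then
    if last b w' then (fun x => - G2 (cnt (belast b w')) x) else G1 (cnt (belast b w'))
  else psi.

Lemma stream_family_rcons psi G1 G2 w b :
  stream_family psi G1 G2 (rcons w b) = if b then (fun x => - G2 (cnt w) x) else G1 (cnt w).
Proof. by case: w => [|b0 w] //; rewrite rcons_cons /= last_rcons belast_rcons. Qed.

(** Needed because [sobolev_cvg] quantifies over all representatives of a weak derivative. *)
Lemma weak_mol_unique (p : R) al (u g h : pt -> R) : 1 < p -> locint u ->
  measurable_fun setT g -> (Np p setT g < +oo)%E -> weak_deriv al u g ->
  measurable_fun setT h -> (Np p setT h < +oo)%E -> weak_deriv al u h ->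
  Np p setT (fun x => g x - h x) = 0%E.
Proof.
move=> p1 lu mg gp wg mh height wh; have lg := locint_Lp p1 mg gp; have lh := locint_Lp p1 mh height.
apply: (@Np_mol_sub_cvg R p g h (fun n => n.+1%:R^-1)) => //.
- exact: cvg_harmonic.
- move=> n; have n0 : 0 < n.+1%:R^-1 :> R by rewrite invr_gt0.
  by apply/funext => x; rewrite /mol (weak_cvl x lu lg wg (ker_rhos n0)) (weak_cvl x lu lh wh (ker_rhos n0)).
Qed.

Lemma Lnorm_mol_cvg (p : R) (G g : pt -> R) (f h : nat -> pt -> R) (s : nat -> R) : 1 < p ->
  measurable_fun setT G -> (Np p setT G < +oo)%E -> measurable_fun setT g ->
  Np p setT (fun x => G x - g x) = 0%E ->
  (forall n, 0 < s n <= n.+1%:R^-1) ->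
  (forall n, measurable_fun setT (h n)) -> (forall n, Np p setT (h n) <= (n.+1%:R^-1)%:E)%E ->
  (forall n x, f n x = mol (s n) G x + h n x) ->
  (fun n => Lnorm leb2 p%:E (fun x => (f n x - g x)%:E)) @ \oo --> 0%E.
Proof.
move=> p1 mG Gp mg Gg hs mh mol_height fE; have p0 : 0 < p by exact: lt_trans p1.
have lG := locint_Lp p1 mG Gp.
apply: small_cvge0 => [n|e e0]; first exact: Lnorm_ge0.
pose K : R := 2 `^ p; have K0 : 0 < K by rewrite powR_gt0.
pose c := e `^ p / (K * (K + 1)).
have c0 : 0 < c by rewrite divr_gt0 ?powR_gt0// mulr_gt0// addr_gt0.
have [d d0 hd] := mol_cvg p1 mG Gp c0.
pose m := Num.min d c; have m0 : 0 < m by rewrite lt_min d0.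
exists (Num.bound m^-1) => n Nn.
have nm : n.+1%:R^-1 <= m.
  rewrite -[leRHS]invrK lef_pV2 ?posrE ?invr_gt0//.
  apply: (@le_trans _ _ (Num.bound m^-1)%:R); last by rewrite ler_nat ltnW.
  by rewrite ltW// archi_boundP// invr_ge0 ltW.
have /andP[sn0 sn1] := hs n.
have mm := measurable_mol sn0 lG.
have bd : (Np p setT (fun x => f n x - g x)%R <= (e `^ p)%:E)%E.
  rewrite (@eq_Np _ _ _ _ (fun x => ((mol (s n) G x - G x) + (G x - g x)) + h n x)); last first.
    by move=> x _; rewrite fE; ring.
  have m1 : measurable_fun setT (fun x => mol (s n) G x - G x) by exact: measurable_funB.
  have m2 : measurable_fun setT (fun x => G x - g x) by exact: measurable_funB.
  have a1 : (Np p setT (fun x => mol (s n) G x - G x)%R <= c%:E)%E.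
    by apply: hd => //; apply: (le_trans sn1); apply: (le_trans nm); rewrite ge_min lexx.
  have a2 : (Np p setT (h n) <= c%:E)%E.
    by apply: (le_trans (mol_height n)); rewrite lee_fin; apply: (le_trans nm); rewrite ge_min lexx orbT.
  have b1 := Np_add_le (ltW p0) measurableT m1 m2 a1 (le_refl _).
  rewrite Gg adde0 in b1.
  have m12 : measurable_fun setT (fun x => (mol (s n) G x - G x) + (G x - g x)) by exact: measurable_funD.
  apply: (le_trans (Np_add_le (ltW p0) measurableT m12 (mh n) b1 a2)).
  have -> : ((2 `^ p)%:E * ((2 `^ p)%:E * c%:E + c%:E) = (K * (K * c + c))%:E)%E by [].
  rewrite lee_fin le_eqVlt; apply/orP; left; apply/eqP.
  by rewrite /c; field; rewrite !gt_eqF// addr_gt0.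
rewrite -[X in Lnorm _ _ X]/(EFin \o (fun x => f n x - g x)) Lnorm_Np//.
have -> : e%:E = ((e `^ p)%:E `^ p^-1)%E.
  by rewrite poweR_EFin -powRrM mulfV ?gt_eqF// powRr1// ltW.
apply: gt0_ler_poweR; rewrite ?invr_ge0 ?(ltW p0)// in_itv/= leey andbT; first exact: Np_ge0.
by rewrite lee_fin powR_ge0.
Qed.

End assembly.

Theorem theorem1p1 (R : realType) (m : nat) (p : R) (Omega : set (pt R))
  (u1 u2 : pt R -> R) :
  (0 < m)%N -> 2 < p ->
  open Omega -> bounded_set2 Omega ->
  (@leb2 R).-negligible (Sing Omega) ->
  sobolev m p u1 -> sobolev m p u2 ->
  div_free u1 u2 ->
  (forall j : nat * nat, (j.1 + j.2 <= m.-1)%N ->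
     vanish_on (~` Omega) j u1 /\ vanish_on (~` Omega) j u2) ->
  exists uk1 uk2 : nat -> pt R -> R,
    (forall k, test_fun (uk1 k) /\ test_fun (uk2 k) /\
       (forall x, pd1 (uk1 k) x + pd2 (uk2 k) x = 0) /\
       supp (uk1 k) `|` supp (uk2 k) `<=` Omega) /\
    sobolev_cvg m p uk1 u1 /\ sobolev_cvg m p uk2 u2.
Proof.
move=> m0 p2 oO [M' hM'] _ su1 su2 dv hv.
have p0 : 0 < p by exact: lt_trans p2.
have p1 : 1 < p by apply: lt_trans p2; rewrite ltr1n.
(* The given bound may be negative when [Omega] is empty. *)
pose M := Num.max 0 M'; have M0 : 0 <= M by rewrite le_max lexx.
pose A := ~` Omega; have cA : closed A by exact: open_closedC.
have AM x : M < `|x| -> A x.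
  move=> xM Ox; have [h1 h2] := hM' x Ox; move: xM; apply/negP; rewrite -leNgt.
  by rewrite pt_lenorm !le_max h1 h2 !orbT.
have A0 : A !=set0.
  exists (M + 1, 0); apply: AM; apply: lt_le_trans (pt_norm1 _).
  by rewrite /= ger0_norm ?addr_ge0// ltrDl.
have [G1 [L1 C1]] := sobolev_family p1 m0 su1 AM (fun j hj => (hv j hj).1).
have [G2 [L2 C2]] := sobolev_family p1 m0 su2 AM (fun j hj => (hv j hj).2).
have [mu1 up1] := LpP p0 su1.1; have lu1 := locint_Lp p1 mu1 up1.
have [mu2 up2] := LpP p0 su2.1; have lu2 := locint_Lp p1 mu2 up2.
have l1 al : (al.1 + al.2 <= m)%N -> locint (G1 al) by move=> /L1[mg gp _]; exact: locint_Lp gp.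
have l2 al : (al.1 + al.2 <= m)%N -> locint (G2 al) by move=> /L2[mg gp _]; exact: locint_Lp gp.
have W1 := @weak_wpd R m u1 G1 lu1 (fun al h => conj (l1 al h) (let: And3 _ _ w := L1 al h in w)).
have W2 := @weak_wpd R m u2 G2 lu2 (fun al h => conj (l2 al h) (let: And3 _ _ w := L2 al h in w)).
have [cU1 U1A] := C1 (0%N, 0%N) m0; have [cU2 U2A] := C2 (0%N, 0%N) m0.
have [psi [cpsi wpf wpt]] : exists psi, [/\ continuous psi, wpd false psi (G1 (0%N, 0%N)) &
    wpd true psi (fun x => - G2 (0%N, 0%N) x)].
  apply: (stream_function cU1 cU2 M0).
  - by move=> x /AM /U1A.
  - by move=> x /AM /U2A.
  move=> s x s0; have kk := @ker_rhos R s s0.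
  have [_ _ w1] := L1 (0%N, 0%N) (leq0n m); have [_ _ w2] := L2 (0%N, 0%N) (leq0n m).
  rewrite (weak_cvl x lu1 (l1 (0%N, 0%N) (leq0n m)) w1 (ker_pdd true kk)).
  rewrite (weak_cvl x lu2 (l2 (0%N, 0%N) (leq0n m)) w2 (ker_pdd false kk)).
  exact: div_mol.
pose G := stream_family psi G1 G2.
have fG : flow p m A G.
  split => //.
  - case=> // b w /= wm; have hc : ((cnt (belast b w)).1 + (cnt (belast b w)).2 < m)%N by rewrite cnt_size size_belast.
    have [c1 z1] := C1 _ hc; have [c2 z2] := C2 _ hc.
    rewrite /G /stream_family; case: last; split => //.
    + by move=> x; apply: cvgN; exact: c2.
    + by move=> x Ax; rewrite z2// oppr0.
  - case=> // b w /= wm; have hc : ((cnt (belast b w)).1 + (cnt (belast b w)).2 <= m)%N by rewrite cnt_size size_belast.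
    have [m1 f1 _] := L1 _ hc; have [m2 f2 _] := L2 _ hc.
    rewrite /G /stream_family; case: last; split => //; first exact: measurableT_comp.
    by rewrite Np_opp.
  - move=> b [_|b0 w /= wm]; first by case: b; rewrite /G /stream_family /=.
    have hc : (size (belast b0 w) < m)%N by rewrite size_belast.
    have hc1 : ((cnt (belast b0 w)).1 + (cnt (belast b0 w)).2 <= m)%N by rewrite cnt_size ltnW.
    have hc2 : ((cnt (b :: belast b0 w)).1 + (cnt (b :: belast b0 w)).2 <= m)%N by rewrite cnt_size.
    have h1 := W1 b _ hc; have h2 := W2 b _ hc.
    rewrite /G /stream_family -/(last b0 w) /=; case: (last b0 w) => //.
    exact: wpd_opp (l2 _ hc1) (l2 _ hc2) h2.
have n0 k : 0 < k.+1%:R^-1 :> R by rewrite invr_gt0.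
have ap k := cutoff_stream p2 m0 cA A0 fG M0 AM (n0 k).
pose F k := sval (cid (ap k)).
have apF k : exists s r : R, [/\ 0 < s <= k.+1%:R^-1, 0 < r,
    smooth (F k), pdcomm (F k) & (forall w x, w <> [::] -> dist A x < r -> pdw w (mol s (G [::])) x = pdw w (F k) x) /\
  forall w, (0 < size w <= m.+1)%N -> (Np p setT (pdw w (F k)) <= (k.+1%:R^-1)%:E)%E].
  by rewrite /F; case: cid.
pose s k := sval (cid (apF k)).
have aps k : exists r : R, [/\ 0 < s k <= k.+1%:R^-1, 0 < r,
    smooth (F k), pdcomm (F k) & (forall w x, w <> [::] -> dist A x < r -> pdw w (mol (s k) (G [::])) x = pdw w (F k) x) /\
  forall w, (0 < size w <= m.+1)%N -> (Np p setT (pdw w (F k)) <= (k.+1%:R^-1)%:E)%E].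
  by rewrite /s; case: cid.
have s0 k : 0 < s k by have [r [/andP[]]] := aps k.
have hs k : 0 < s k <= k.+1%:R^-1 by have [r []] := aps k.
have sF k : smooth (F k) by have [r []] := aps k.
have cF k : pdcomm (F k) by have [r []] := aps k.
have NF k w : (0 < size w <= m.+1)%N -> (Np p setT (pdw w (F k)) <= (k.+1%:R^-1)%:E)%E.
  by have [r [_ _ _ _ [_]]] := aps k; apply.
have lpsi := locint_continuous cpsi.
have sm k : smooth (mol (s k) psi) := smooth_mol (s0 k) lpsi.
(* The corrected stream function, whose rotated gradient is the approximating field. *)
pose Psi k x := mol (s k) psi x - F k x.
have sPsi k : smooth (Psi k) := smooth_sub (sm k) (sF k).
have cPsi k : pdcomm (Psi k) := pdcomm_add (sm k) (smooth_opp (sF k)) (pdcomm_mol (s0 k) lpsi) (pdcomm_opp (sF k) (cF k)).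
(* A vanishing gradient on a whole neighbourhood of [A] keeps the supports at a positive distance
   from it. *)
have Psi0 k : exists2 r : R, 0 < r & forall b x, dist A x < r -> pdd b (Psi k) x = 0.
  have [r [_ r0 _ _ [h _]]] := aps k; exists r => // b x dx.
  have -> : pdd b (Psi k) = pdw [:: b] (Psi k) by rewrite pdw_cons.
  by rewrite (pdw_sub [:: b] (sm k) (sF k)) -(h [:: b] x _ dx)// subrr.
pose uk1 k := pdd false (Psi k); pose uk2 k x := - pdd true (Psi k) x.
have supp_in k (f : pt R -> R) : (forall x, pdd false (Psi k) x = 0 -> pdd true (Psi k) x = 0 -> f x = 0) ->
    compact (supp f) /\ supp f `<=` Omega.
  move=> hf; have [r r0 hr] := Psi0 k.
  have f0 x : dist A x < r -> f x = 0 by move=> dx; apply: hf; exact: hr.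
  have [cf _] := @compact_supp R f 0 M (fun x xM => f0 x (ltac:(rewrite (dist_eq0 (AM x _)) // -(subr0 x); exact: xM))).
  split => //.
  have cl : closed [set x | r <= dist A x].
    exact: (closed_comp (fun x _ => dist_continuous A0 (x := x)) (@closed_ge R r)).
  have sub : supp f `<=` [set x | r <= dist A x].
    rewrite ((closure_id _).1 cl); apply: closure_subset => x /= fx; rewrite leNgt; apply/negP => dx.
    by move: fx; rewrite f0// eqxx.
  move=> x /sub /= rx; apply: contrapT => nO.
  by move: rx; rewrite (dist_eq0 (nO : A x)) leNgt r0.
have msc k w : measurable_fun setT (pdw w (F k)).
  by apply: continuous_measurable2; apply: smooth_continuous; exact: smooth_pdw.
have pdwPsi k w b : (size w <= m)%N -> pdw w (pdd b (Psi k)) = fun x => mol (s k) (G (rcons w b)) x - pdw (rcons w b) (F k) x.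
  move=> wm; rewrite -pdw_rcons (pdw_sub _ (sm k) (sF k)).
  have [_ _ _ wG] := fG.
  have e1 := @wpd_pdw R m.+1 G (s k) (s0 k) (fun b' w' h => wG b' w' h) (rcons w b).
  by rewrite -e1// size_rcons.
exists uk1, uk2; split; [|split].
- move=> k; have [c1 o1] := supp_in k (uk1 k) (fun x h _ => h).
  have [c2 o2] : compact (supp (uk2 k)) /\ supp (uk2 k) `<=` Omega.
    by apply: (supp_in k) => x _ h; rewrite /uk2 h oppr0.
  split; [split => //; exact: smooth_pdd|split; [split => //; apply: smooth_opp; exact: smooth_pdd|split]].
  + move=> x; rewrite -[pd1 _ x]/(pdd true (uk1 k) x) -[pd2 _ x]/(pdd false (uk2 k) x).
    by rewrite /uk1 /uk2 (pdd_opp false (smooth_pdd true (sPsi k))) cPsi subrr.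
  + by move=> x [/o1|/o2].
- move=> al hal g Lg wg; have [mg gp] := LpP p0 Lg; have [mG Gp wG] := L1 al hal.
  pose w := nseq al.1 true ++ nseq al.2 false.
  have sw : size w = (al.1 + al.2)%N by rewrite size_cat !size_nseq.
  apply: (@Lnorm_mol_cvg R p (G1 al) g _ (fun k x => - pdw (rcons w false) (F k) x) s) => //.
  + exact: (weak_mol_unique p1 lu1 mG Gp wG mg gp wg).
  + by move=> k; exact: measurableT_comp.
  + by move=> k; rewrite Np_opp; apply: NF; rewrite size_rcons sw.
  + move=> k x; rewrite /Dmi -/w (pdwPsi k w false) ?sw// /G stream_family_rcons.
    by rewrite /w cnt_nseq.
- move=> al hal g Lg wg; have [mg gp] := LpP p0 Lg; have [mG Gp wG] := L2 al hal.
  pose w := nseq al.1 true ++ nseq al.2 false.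
  have sw : size w = (al.1 + al.2)%N by rewrite size_cat !size_nseq.
  apply: (@Lnorm_mol_cvg R p (G2 al) g _ (fun k x => pdw (rcons w true) (F k) x) s) => //.
  + exact: (weak_mol_unique p1 lu2 mG Gp wG mg gp wg).
  + by move=> k; apply: NF; rewrite size_rcons sw.
  + move=> k x; rewrite /Dmi -/w /uk2 (pdw_opp w (smooth_pdd true (sPsi k))) (pdwPsi k w true) ?sw// /G stream_family_rcons.
    by rewrite /w cnt_nseq (mol_opp (s0 k) (l2 al hal)) opprB opprK addrC.
Qed.
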